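(* The mean zero Gaussian white noise $Q_0$ is invariant under the Korteweg--de Vries flow; that is, for every $t\in\mathbb{R}$, $\bar{\mathcal S}_t^{*}Q_0=Q_0$, where $\bar{\mathcal S}_t^*Q_0$ denotes the pushforward of $Q_0$ under the map $\bar{\mathcal S}_t$.
   Context: $\mathbb{T}=\mathbb{R}/\mathbb{Z}$. $H^s_0(\mathbb{T})$ is the space of real-valued distributions $u=\sum_{n\neq 0}\hat u_n e^{2\pi i n x}$ on $\mathbb{T}$ (so $\hat u_{-n}=\overline{\hat u_n}$) with $\|u\|_{H^s_0}^2=\sum_{n\ne 0}|n|^{2s}|\hat u_n|^2<\infty$. $Q_0$ is the mean zero Gaussian white noise on $\mathbb{T}$: the probability measure on real-valued distributions $u$ with $\int_{\mathbb{T}}u=0$ satisfying $\int e^{i\langle f,u\rangle}\,dQ_0(u)=e^{-\frac12\|f\|_{L^2}^2}$ for every mean zero smooth real-valued $f$ on $\mathbb{T}$. It is supported on $H^s_0(\mathbb{T})$ for $s<-\frac12$. The KdV equation on $\mathbb{T}$ is $u_t+u_{xxx}-6uu_x=0$, $u(0)=u_0$. For smooth $u_0$ it has a global solution $u(t)=\mathcal S_tu_0$, $-\infty<t<\infty$. It is known (Kappeler--Topalov) that the solution map $\mathcal S_t$ extends to a continuous group of nonlinear evolution operators $\bar{\mathcal S}_t:H^s_0(\mathbb{T})\to H^s_0(\mathbb{T})$, $-\infty<t<\infty$, for $s\ge-1$; $\bar{\mathcal S}_t$ denotes this extension. *)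

(* Defs.v *)
From HB Require Import structures.
From mathcomp Require Import all_boot all_order all_algebra.
From mathcomp Require Import all_classical all_reals all_analysis.
From mathcomp Require Import ring lra.

Set Implicit Arguments.
Unset Strict Implicit.
Unset Printing Implicit Defensive.

Import Order.TTheory GRing.Theory Num.Theory.
Import numFieldNormedType.Exports.

Local Open Scope classical_set_scope.
Local Open Scope ring_scope.

(* Functions on T = R/Z are 1-periodic functions on R. *)
Definition smooth (R : realType) (f : R -> R) : Prop :=
  forall n x, derivable (derive1n n f) x 1.

Definition periodic1 (R : realType) (f : R -> R) : Prop :=
  forall x, f (x + 1) = f x.

Definition integralT (R : realType) (f : R -> R) : R :=
  Rintegral lebesgue_measure `[0, 1] f.

Record test_function (R : realType) := TestFunction {
  test_fun :> R -> R ;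
  test_smooth : smooth test_fun ;
  test_periodic : periodic1 test_fun }.

(* Continuity is with respect to the seminorms sup |f^(k)|, k <= N; the
   quantifier over M avoids naming the suprema. *)
Record distribution (R : realType) := Distribution {
  pairing :> test_function R -> R ;
  pairing_linear : forall (a : R) (f g h : test_function R),
    (forall x, h x = a * f x + g x) -> pairing h = a * pairing f + pairing g ;
  pairing_continuous : exists (N : nat) (C : R),
    forall (f : test_function R) (M : R),
      (forall k x, (k <= N)%N -> `|derive1n k f x| <= M) -> `|pairing f| <= C * M }.

Section trig.
Variable R : realType.

Definition trig (a b c : R) (x : R) : R := a * cos (c * x) + b * sin (c * x).

Lemma is_derive_trig (a b c x : R) :
  is_derive x 1 (trig a b c) (trig (b * c) (- (a * c)) c x).
Proof.
have h : is_derive x 1 (fun y : R => c * y) c.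
  by have := @is_deriveZ _ _ _ id c x 1 1 (is_derive_id _ _); rewrite /GRing.scale /= mulr1.
have hc := @is_derive1_comp _ _ _ _ _ _ (is_derive_cos (c * x)) h.
have hs := @is_derive1_comp _ _ _ _ _ _ (is_derive_sin (c * x)) h.
have := is_deriveD (is_deriveZ a hc) (is_deriveZ b hs).
rewrite /GRing.scale /= => /is_derive_eq; apply; rewrite /trig; ring.
Qed.

Lemma derive1_trig (a b c : R) :
  derive1 (trig a b c) = trig (b * c) (- (a * c)) c.
Proof.
apply/funext => x; rewrite derive1E.
by have [_ ->] := is_derive_trig a b c x.
Qed.

Lemma smooth_trig (a b c : R) : smooth (trig a b c).
Proof.
move=> n x.
have [a' [b' ->]] : exists a' b', derive1n n (trig a b c) = trig a' b' c.
  elim: n => [|n [a' [b' IH]]]; first by exists a, b.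
  by exists (b' * c), (- (a' * c)); rewrite derive1nS IH derive1_trig.
by have [] := is_derive_trig a' b' c x.
Qed.

Lemma periodic_trig (a b : R) (n : int) :
  periodic1 (trig a b (2 * pi * n%:~R)).
Proof.
have shift (h : R -> R) : (forall y, h (y + pi *+ 2) = h y) ->
    forall y, h (y + 2 * pi * n%:~R) = h y.
  move=> hp.
  have hn (k : nat) y : h (y + 2 * pi * k%:R) = h y.
    elim: k y => [|k IH] y; first by rewrite mulr0 addr0.
    have -> : y + 2 * pi * k.+1%:R = y + 2 * pi * k%:R + pi *+ 2.
      by rewrite -natr1; ring.
    by rewrite hp IH.
  case: n => k y; first exact: hn.
  by rewrite NegzE mulrNz mulrN -[LHS](hn k.+1) subrK.
move=> x; rewrite /trig.
have -> : 2 * pi * n%:~R * (x + 1) = 2 * pi * n%:~R * x + 2 * pi * n%:~R by ring.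
by rewrite (shift _ (@cosD2pi R)) (shift _ (@sinD2pi R)).
Qed.

End trig.

(* Real and (minus the) imaginary part of e^{-2 i pi n x}. *)
Definition cos_mode (R : realType) (n : int) : test_function R :=
  TestFunction (@smooth_trig R 1 0 (2 * pi * n%:~R)) (@periodic_trig R 1 0 n).
Definition sin_mode (R : realType) (n : int) : test_function R :=
  TestFunction (@smooth_trig R 0 1 (2 * pi * n%:~R)) (@periodic_trig R 0 1 n).

Section sobolev_norm.
Variables (R : realType) (s : R).
Implicit Types u v : test_function R -> R.

(* |hat u_n|^2, where hat u_n = <e^{-2 i pi n x}, u>; as u is real valued, the
   relation between hat u_{-n} and hat u_n holds automatically. *)
Definition fourier_sqmod u (n : int) : R :=
  u (cos_mode R n) ^+ 2 + u (sin_mode R n) ^+ 2.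

Definition sobolev_sqnorm u : \bar R :=
  \esum_(n in [set n : int | n != 0])
    (`|n%:~R| `^ (2 * s) * fourier_sqmod u n)%:E.

Definition sobolev_norm u : R := Num.sqrt (fine (sobolev_sqnorm u)).

Let term_ge0 u n : (0 <= (`|n%:~R| `^ (2 * s) * fourier_sqmod u n)%:E)%E.
Proof. by rewrite lee_fin mulr_ge0 ?powR_ge0 // addr_ge0 // sqr_ge0. Qed.

Lemma sobolev_sqnorm_ge0 u : (0 <= sobolev_sqnorm u)%E.
Proof. by apply: esum_ge0 => n _. Qed.

Let esum_scale (c : R) (a : int -> \bar R) (A : set int) : 0 <= c ->
  (forall n, 0 <= a n)%E ->
  (\esum_(n in A) (c%:E * a n) <= c%:E * \esum_(n in A) a n)%E.
Proof.
move=> c0 a0; apply: ge_ereal_sup => _ [F [finF FA] <-].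
rewrite -ge0_mule_fsumr // lee_wpmul2l ?lee_fin //.
by apply: ereal_sup_ubound; exists F.
Qed.

Lemma sobolev_sqnormD u v (l : R) : 0 < l ->
  (sobolev_sqnorm (u \+ v)%R <=
   (1 + l)%:E * sobolev_sqnorm u + (1 + l^-1)%:E * sobolev_sqnorm v)%E.
Proof.
move=> l0; have li0 : 0 < l^-1 by rewrite invr_gt0.
have l1 : 0 <= 1 + l by rewrite addr_ge0 // ltW.
have li1 : 0 <= 1 + l^-1 by rewrite addr_ge0 // ltW.
pose a u n := (`|n%:~R| `^ (2 * s) * fourier_sqmod u n)%:E.
apply: (@le_trans _ _ (\esum_(n in [set n : int | n != 0%R])
   ((1 + l)%:E * a u n + (1 + l^-1)%:E * a v n))%E).
  apply: le_esum => n _; rewrite /a -!EFinM -EFinD lee_fin.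
  rewrite (mulrCA (1 + l)) (mulrCA (1 + l^-1)) -mulrDr ler_wpM2l ?powR_ge0 //.
  have young (y z : R) :
      (y + z) ^+ 2 <= (1 + l) * y ^+ 2 + (1 + l^-1) * z ^+ 2.
    have : 0 <= l * (y - l^-1 * z) ^+ 2 by rewrite mulr_ge0 ?sqr_ge0 // ltW.
    have -> : l * (y - l^-1 * z) ^+ 2 =
        (1 + l) * y ^+ 2 + (1 + l^-1) * z ^+ 2 - (y + z) ^+ 2.
      by field; rewrite gt_eqF.
    by rewrite subr_ge0.
  rewrite /fourier_sqmod /= !mulrDr addrACA.
  by apply: lerD; exact: young.
rewrite esumD; first by apply: leeD; apply: esum_scale => // n; exact: term_ge0.
- by move=> n _; rewrite mule_ge0 ?lee_fin ?term_ge0 // -lee_fin term_ge0.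
- by move=> n _; rewrite mule_ge0 ?lee_fin ?term_ge0 // -lee_fin term_ge0.
Qed.

Lemma sobolev_sqnormN u : sobolev_sqnorm (fun f => - u f) = sobolev_sqnorm u.
Proof. by apply: eq_esum => n _; rewrite /fourier_sqmod !sqrrN. Qed.

Lemma sobolev_sqnorm0 : sobolev_sqnorm (fun=> 0) = 0%E.
Proof.
by apply: esum1 => n _; rewrite /fourier_sqmod expr0n /= addr0 mulr0.
Qed.

Lemma sobolev_norm_triangle u v (e1 e2 : R) :
  (sobolev_sqnorm u < +oo)%E -> (sobolev_sqnorm v < +oo)%E ->
  sobolev_norm u < e1 -> sobolev_norm v < e2 ->
  sobolev_norm (u \+ v) < e1 + e2.
Proof.
move=> uoo voo ue1 ve2.
have e10 : 0 < e1 by apply: le_lt_trans ue1; exact: sqrtr_ge0.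
have e20 : 0 < e2 by apply: le_lt_trans ve2; exact: sqrtr_ge0.
have fu : sobolev_sqnorm u \is a fin_num by rewrite ge0_fin_numE ?sobolev_sqnorm_ge0.
have fv : sobolev_sqnorm v \is a fin_num by rewrite ge0_fin_numE ?sobolev_sqnorm_ge0.
have sq w e : sobolev_norm w < e -> fine (sobolev_sqnorm w) < e ^+ 2.
  move=> we; rewrite -[fine _]sqr_sqrtr ?fine_ge0 ?sobolev_sqnorm_ge0 //.
  by rewrite ltr_pXn2r ?nnegrE ?sqrtr_ge0 // (le_trans _ (ltW we)) ?sqrtr_ge0.
have l0 : 0 < e2 / e1 by rewrite divr_gt0.
have := sobolev_sqnormD u v l0.
rewrite -(fineK fu) -(fineK fv) -!EFinM -EFinD => le.
have fuv : sobolev_sqnorm (u \+ v) \is a fin_num.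
  by rewrite ge0_fin_numE ?sobolev_sqnorm_ge0 // (le_lt_trans le) ?ltry.
rewrite -(fineK fuv) lee_fin in le.
have e12 : 0 < e1 + e2 by rewrite addr_gt0.
rewrite -(ger0_norm (ltW e12)) -sqrtr_sqr ltr_sqrt ?exprn_gt0 //.
apply: (le_lt_trans le).
have -> : (e1 + e2) ^+ 2 =
    (1 + e2 / e1) * e1 ^+ 2 + (1 + (e2 / e1)^-1) * e2 ^+ 2.
  by field; rewrite !gt_eqF.
by apply: ltrD; rewrite ltr_pM2l ?addr_gt0 ?invr_gt0 // sq.
Qed.

End sobolev_norm.

(* H^s_0(T): the distributions with hat u_0 = 0 (cos_mode 0 is the constant 1)
   and finite H^s norm. *)
Record sobolev0 (R : realType) (s : R) := Sobolev0 {
  sobolev0_distribution :> distribution R ;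
  sobolev0_mean0 : sobolev0_distribution (cos_mode R 0) = 0 ;
  sobolev0_finite : (sobolev_sqnorm s sobolev0_distribution < +oo)%E }.

Section sobolev0_structure.
Variables (R : realType) (s : R).

Let zero_linear (a : R) (f g h : test_function R) :
  (forall x, h x = a * f x + g x) -> (0 : R) = a * 0 + 0.
Proof. by rewrite mulr0 addr0. Qed.

Let zero_continuous : exists (N : nat) (C : R),
  forall (f : test_function R) (M : R),
    (forall k x, (k <= N)%N -> `|derive1n k f x| <= M) -> `|0 : R| <= C * M.
Proof. by exists 0%N, 0 => f M _; rewrite normr0 mul0r. Qed.

Let zero_distribution : distribution R :=
  Distribution zero_linear zero_continuous.

Let zero_finite : (sobolev_sqnorm s zero_distribution < +oo)%E.
Proof. by rewrite [sobolev_sqnorm _ _]sobolev_sqnorm0 ltry. Qed.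

HB.instance Definition _ := gen_eqMixin (sobolev0 s).
HB.instance Definition _ := gen_choiceMixin (sobolev0 s).
HB.instance Definition _ := isPointed.Build (sobolev0 s)
  (@Sobolev0 R s zero_distribution erefl zero_finite).

Definition sobolev0_ball (u : sobolev0 s) (e : R) : set (sobolev0 s) :=
  [set v | sobolev_norm s (u \- v) < e].

Let ent := entourage_ sobolev0_ball.

Let diff_finite (u v : sobolev0 s) : (sobolev_sqnorm s (u \- v)%R < +oo)%E.
Proof.
apply: le_lt_trans (sobolev_sqnormD s u (fun f => - v f) ltr01) _.
rewrite sobolev_sqnormN invr1.
by rewrite lte_add_pinfty // lte_mul_pinfty ?lee_fin ?addr_ge0 ?sobolev0_finite.
Qed.

Let ball_center (u : sobolev0 s) (e : R) : 0 < e -> sobolev0_ball u e u.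
Proof.
move=> e0; rewrite /sobolev0_ball /= (_ : _ \- _ = fun=> 0).
  by rewrite /sobolev_norm sobolev_sqnorm0 /= sqrtr0.
by apply/funext => f /=; rewrite subrr.
Qed.

Let ball_sym (u v : sobolev0 s) (e : R) :
  sobolev0_ball u e v -> sobolev0_ball v e u.
Proof.
rewrite /sobolev0_ball /sobolev_norm /= -[in X in X -> _]sobolev_sqnormN.
by congr (Num.sqrt (fine (sobolev_sqnorm s _)) < e); apply/funext => f /=;
  rewrite opprB.
Qed.

Let ball_triangle (u v w : sobolev0 s) (e1 e2 : R) :
  sobolev0_ball u e1 v -> sobolev0_ball v e2 w -> sobolev0_ball u (e1 + e2) w.
Proof.
move=> uv vw; rewrite /sobolev0_ball /=.
rewrite (_ : _ \- _ = (u \- v) \+ (v \- w)); first exact: sobolev_norm_triangle.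
by apply/funext => f /=; rewrite addrA subrK.
Qed.

HB.instance Definition _ := hasNbhs.Build (sobolev0 s) (nbhs_ ent).
HB.instance Definition _ := @Nbhs_isPseudoMetric.Build R (sobolev0 s)
  ent erefl sobolev0_ball ball_center ball_sym ball_triangle erefl.

End sobolev0_structure.

Definition borel_sobolev0 (R : realType) (s : R) :=
  g_sigma_algebraType (@open (sobolev0 s)).

(* The characteristic functional int e^{i<f,u>} dQ(u) = e^{-|f|^2/2}, separated
   into its real and imaginary parts. *)
Definition is_white_noise (R : realType) (s : R)
    (Q : probability (borel_sobolev0 s) R) : Prop :=
  forall f : test_function R, integralT f = 0 ->
    (\int[Q]_u (cos ((u : sobolev0 s) f))%:E =
       (expR (- (2^-1 * integralT (fun x => f x ^+ 2))))%:E)%E /\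
    (\int[Q]_u (sin ((u : sobolev0 s) f))%:E = 0)%E.

Definition partial_t (R : realType) (u : R -> R -> R) : R -> R -> R :=
  fun t x => derive1 (u^~ x) t.

Definition partial_x (R : realType) (u : R -> R -> R) : R -> R -> R :=
  fun t x => derive1 (u t) x.

Fixpoint class_C (R : realType) (k : nat) (u : R -> R -> R) : Prop :=
  continuous (fun p : R * R => u p.1 p.2) /\
  if k is k'.+1 then
    [/\ forall t x, derivable (u^~ x) t 1,
        forall t x, derivable (u t) x 1,
        class_C k' (partial_t u) &
        class_C k' (partial_x u)]
  else True.

Definition smooth2 (R : realType) (u : R -> R -> R) : Prop :=
  forall k, class_C k u.

Definition kdv_solution (R : realType) (u : R -> R -> R) : Prop :=
  [/\ smooth2 u,
      forall t, periodic1 (u t) &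
      forall t x, partial_t u t x + partial_x (partial_x (partial_x u)) t x
                  - 6 * u t x * partial_x u t x = 0].

Definition represents (R : realType) (v : R -> R) (u : distribution R) : Prop :=
  forall f : test_function R, u f = integralT (fun x => v x * f x).

(* The extension to H^s_0(T), as a continuous group, of the solution map of KdV
   with smooth data. Smooth functions being dense, there is at most one. *)
Definition is_kdv_flow (R : realType) (s : R)
    (S : R -> sobolev0 s -> sobolev0 s) : Prop :=
  [/\ forall u, S 0 u = u,
      forall t r u, S (t + r) u = S t (S r u),
      forall t, continuous (S t),
      forall u, continuous (S^~ u) &
      forall (v : test_function R) (w : sobolev0 s), represents v w ->
        exists u : R -> R -> R,
          [/\ kdv_solution u, u 0 = v & forall t, represents (u t) (S t w)]].

(* Main.v *)
From mathcomp Require Import all_boot all_order all_algebra.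
From mathcomp Require Import all_classical all_reals all_analysis.
From mathcomp Require Import measurable_realfun ring lra zify.
Require Import Defs.

Set Implicit Arguments.
Unset Strict Implicit.
Unset Printing Implicit Defensive.

Import Order.TTheory GRing.Theory Num.Theory.
Import numFieldNormedType.Exports.

Local Open Scope classical_set_scope.
Local Open Scope ring_scope.

(** Why KdV preserves white noise.

In the orthonormal basis of mean zero trigonometric functions, white noise is a
sequence of independent standard normal coordinates, and its formal density is
exp(- 1/2 int v^2), a function of a conserved quantity.  The truncation of KdV
to finitely many frequencies is a Hamiltonian system: its vector field is
divergence free and conserves the momentum int v^2 and the energy
int (v_x^2 / 2 + v^3), so that it preserves every density that is a function of
these two.  White noise itself is too rough to compare the truncated equation
with the full one.  The comparison is made instead for the measure proportional
to exp(- 1/2 int v^2 - eps * energy), cut off smoothly at int v^2 = K.  It has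
the density gibbs with respect to the Gaussian vector of covariance
1 / (1 + eps freq^2), and this vector is white noise with its k-th coordinate
multiplied by lam eps k.

Invariance for the truncated system.  The hypothesis on white noise gives its
characteristic functional only.  Differentiating the invariance of the law
under a rotation in two coordinates gives Gaussian integration by parts
(gaussian_ibp).  It implies that the derivative of a polynomial along the
truncated field has mean zero for the Gibbs density (gibbs_lie).  The field is
quadratic, so that polynomials are the sum of their Taylor series along it over
a short time step, uniformly on the ball that carries the density.  Hence polynomial moments, and with
them characteristic functions, are constant along the discretized truncated
flow (chain_moment, chain_trig).

Comparison with KdV.  Let w be the difference between the smooth solution u of
KdV and the solution v of the truncated system with the same initial value.
The derivative of int w^2 contains int w^2 v_x, and v_x is not controlled
uniformly in the number of modes.  With W and V the antiderivatives of w and v,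
and q the part of u above the truncation, the energy
  int w^2 + 2 int W^2 v - 2 int q V^2 + 4 K int W^2
is comparable to int w^2, and all terms with derivatives cancel in its
derivative (energy_identity, dr_energy_good).  What remains is at most
rate * int w^2 + defect (good_bound), where rate and defect are functions of v
alone.  By invariance their means are the same at all times.  The mean of the
rate is bounded uniformly in the truncation, although it contains the sup norm
of v (weighted_supPoly), and the mean of the defect tends to 0 (defect_mean).
A Gronwall argument and Markov's inequality give flow_vs_chain: KdV almost
preserves the Gibbs measure.

Removing the regularization.  For eps = n^-8 and K = n^6 the density tends to 1
in mean as n grows (density_near_one), and the smoothed data converge to the
original white noise sample in H^s (cutoff_cvg).  As the flow is continuous on
H^s, the characteristic functionals of white noise and of its image agree
(trig_invariant).  They determine a Borel probability on H^s, because Borel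
sets are measurable conditions on the coordinates (borel_coord, law_event). *)

(** * Integrals of real functions over a set of measure one *)

Section mass_one_integral.
Context d (T : measurableType d) (R : realType).
Variables (mu : {measure set T -> \bar R}) (D : set T).
Hypotheses (mD : measurable D) (muD : mu D = 1%E).
Implicit Types f g : T -> R.
Local Notation Int f := (\int[mu]_(x in D) f x).
Local Notation ig f := (mu.-integrable D (EFin \o f)).

Lemma ig_meas f : ig f -> measurable_fun D f.
Proof. by move=> /integrableP[/measurable_EFinP]. Qed.

Lemma ig_dom f g : measurable_fun D f -> ig g ->
  (forall x, D x -> `|f x| <= g x) -> ig f.
Proof.
move=> mf ig_g fg; apply: le_integrable ig_g => //.
  exact/measurable_EFinP.
move=> x Dx /=; rewrite lee_fin; apply: le_trans (fg x Dx) _; exact: ler_norm.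
Qed.

Lemma ig_cst (c : R) : ig (fun=> c).
Proof.
apply: measurable_bounded_integrable => //; first by rewrite muD ltry.
exact: bounded_cst.
Qed.

Lemma ig_bdd f (C : R) : measurable_fun D f ->
  (forall x, D x -> `|f x| <= C) -> ig f.
Proof. by move=> mf; apply: ig_dom => //; exact: ig_cst. Qed.

Lemma igD f g : ig f -> ig g -> ig (fun x => f x + g x).
Proof. by move=> i1 i2; have := integrableD mD i1 i2. Qed.

Lemma igZ (c : R) f : ig f -> ig (fun x => c * f x).
Proof. by move=> i1; have := integrableZl mD c i1. Qed.

Lemma igN f : ig f -> ig (fun x => - f x).
Proof. by move=> i1; have := integrableN i1. Qed.

Lemma igB f g : ig f -> ig g -> ig (fun x => f x - g x).
Proof. by move=> i1 i2; apply: igD => //; exact: igN. Qed.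

Lemma ig_abs f : ig f -> ig (fun x => `|f x|).
Proof. by move=> i1; apply: integrable_norm. Qed.

Lemma ig_sum (I : Type) (s : seq I) (P : pred I) (F : I -> T -> R) :
  (forall i, P i -> ig (F i)) -> ig (fun x => \sum_(i <- s | P i) F i x).
Proof.
move=> h; elim: s => [|i s IH].
  by under [X in _.-integrable _ X]eq_fun do rewrite /= big_nil; exact: ig_cst.
under [X in _.-integrable _ X]eq_fun do rewrite /= big_cons.
by case Pi: (P i) => //; apply: igD => //; exact: h.
Qed.

Lemma IntD f g : ig f -> ig g -> Int (fun x => f x + g x) = Int f + Int g.
Proof. by move=> *; rewrite RintegralD. Qed.

Lemma IntB f g : ig f -> ig g -> Int (fun x => f x - g x) = Int f - Int g.
Proof. by move=> *; rewrite RintegralB. Qed.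

Lemma IntZ (c : R) f : ig f -> Int (fun x => c * f x) = c * Int f.
Proof. by move=> *; rewrite RintegralZl. Qed.

Lemma IntN f : ig f -> Int (fun x => - f x) = - Int f.
Proof.
move=> i; rewrite -[RHS]mulN1r -IntZ//; apply: eq_Rintegral => x _.
by rewrite mulN1r.
Qed.

Lemma Int_cst (c : R) : Int (fun=> c) = c.
Proof. by rewrite Rintegral_cst// muD /= mulr1. Qed.

Lemma Int_sum (I : Type) (s : seq I) (P : pred I) (F : I -> T -> R) :
  (forall i, P i -> ig (F i)) ->
  Int (fun x => \sum_(i <- s | P i) F i x) = \sum_(i <- s | P i) Int (F i).
Proof.
move=> h; elim: s => [|i s IH].
  rewrite big_nil -[RHS](Int_cst 0); apply: eq_Rintegral => x _.
  by rewrite big_nil.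
rewrite big_cons; under eq_Rintegral do rewrite big_cons.
case: ifPn => Pi //; rewrite IntD ?IH//; first exact: h.
by apply: ig_sum.
Qed.

Lemma Int_le f g : ig f -> ig g -> (forall x, D x -> f x <= g x) ->
  Int f <= Int g.
Proof. by move=> *; apply: le_Rintegral. Qed.

Lemma Int_ge0 f : (forall x, D x -> 0 <= f x) -> 0 <= Int f.
Proof. by move=> ?; apply: Rintegral_ge0. Qed.

Lemma Int_abs_le f g : measurable_fun D f -> ig g ->
  (forall x, D x -> `|f x| <= g x) -> `|Int f| <= Int g.
Proof.
move=> mf i2 fg; have i1 := ig_dom mf i2 fg.
apply: le_trans (le_normr_Rintegral mD i1) _.
by apply: Int_le => //; exact: ig_abs.
Qed.

Lemma Int_abs_bdd f (C : R) : measurable_fun D f ->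
  (forall x, D x -> `|f x| <= C) -> `|Int f| <= C.
Proof.
move=> mf h; rewrite -[leRHS](Int_cst C).
by apply: Int_abs_le => //; exact: ig_cst.
Qed.

Lemma Int_EFin f : ig f -> (\int[mu]_(x in D) (f x)%:E = (Int f)%:E)%E.
Proof.
by move=> i; rewrite /Rintegral fineK//; exact: integrable_fin_num.
Qed.

Lemma Int_sqr_le f : ig f -> ig (fun x => f x ^+ 2) ->
  (Int f) ^+ 2 <= Int (fun x => f x ^+ 2).
Proof.
move=> i1 i2; set m := Int f.
have : 0 <= Int (fun x => (f x ^+ 2 - (2 * m) * f x) + m ^+ 2).
  apply: Int_ge0 => x _; have -> : f x ^+ 2 - 2 * m * f x + m ^+ 2 = (f x - m) ^+ 2.
    ring.
  exact: sqr_ge0.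
rewrite IntD; [|apply: igB => //; exact: igZ|exact: ig_cst].
rewrite IntB//; last exact: igZ.
rewrite IntZ// Int_cst -/m; nra.
Qed.

Lemma Int_dct (F : nat -> T -> R) f g : (forall n, measurable_fun D (F n)) ->
  ig g -> (forall x, D x -> F ^~ x @ \oo --> f x) ->
  (forall n x, D x -> `|F n x| <= g x) ->
  ig f /\ Int (F n) @[n --> \oo] --> Int f.
Proof.
move=> mF i_g Ff Fg.
have mf : measurable_fun D f by apply: measurable_fun_cvg Ff.
have [|||||if_ _ h] := @dominated_convergence _ _ _ mu D mD (fun n x => (F n x)%:E)
    (EFin \o f) (EFin \o g).
- by move=> n; apply/measurable_EFinP.
- exact/measurable_EFinP.
- by apply: aeW => x Dx; apply: cvg_EFin; [exact: nearW|exact: Ff].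
- exact: i_g.
- by apply: aeW => x n Dx; rewrite /= lee_fin; exact: Fg.
split => //.
apply: fine_cvg; rewrite fineK; first exact: h.
exact: integrable_fin_num.
Qed.

Lemma ig_fatou (F : nat -> T -> R) f (C : R) :
  (forall n, measurable_fun D (F n)) ->
  (forall n x, D x -> 0 <= F n x) ->
  (forall x, D x -> F ^~ x @ \oo --> f x) ->
  (forall n, ig (F n)) -> (forall n, Int (F n) <= C) ->
  ig f /\ Int f <= C.
Proof.
move=> mF F0 Ff iF FC.
have mf : measurable_fun D f by apply: measurable_fun_cvg Ff.
have f0 x : D x -> 0 <= f x.
  move=> Dx; have := Ff x Dx => /cvg_lim <- //; apply: limr_ge.
    by apply/cvg_ex; exists (f x); exact: Ff.
  by apply: nearW => n; exact: F0.
have H : (\int[mu]_(x in D) (f x)%:E <= C%:E)%E.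
  have mF' n : measurable_fun D (fun x => (F n x)%:E).
    by apply/measurable_EFinP; exact: mF.
  have F0' n x : D x -> (0 <= (F n x)%:E)%E by move=> Dx; rewrite lee_fin F0.
  apply: le_trans (le_trans (fatou mu mD mF' F0') _).
    rewrite (@eq_integral _ _ _ mu D (EFin \o f) (fun x => limn_einf (fun n => (F n x)%:E)))//.
    move=> x /set_mem Dx; have h : (F n x)%:E @[n --> \oo] --> (f x)%:E.
      by apply: cvg_EFin; [exact: nearW|exact: Ff].
    by have [-> _] := cvg_limn_einf_sup h.
  rewrite limn_einf_lim; apply: lime_le; first exact: is_cvg_einfs.
  apply: nearW => n; apply: (@le_trans _ _ (\int[mu]_(x in D) (F n x)%:E)%E).
    by apply: ereal_inf_lbound; exists n => /=.
  by rewrite Int_EFin// lee_fin.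
have ig_f : ig f.
  apply/integrableP; split; first exact/measurable_EFinP.
  under eq_integral => x /set_mem Dx do rewrite /= ger0_norm ?f0//.
  exact: le_lt_trans H (ltry _).
by split => //; rewrite -lee_fin -Int_EFin.
Qed.

End mass_one_integral.

(** * Derivatives of real functions *)

Section real_calculus.
Variable R : realType.
Implicit Types f g : R -> R.

Local Notation dr f x l := (is_derive (x : R) (1 : R) (f : R -> R) (l : R)).

Lemma drD f g x a b : dr f x a -> dr g x b -> dr (fun y => f y + g y) x (a + b).
Proof. by move=> df dg; exact: is_deriveD. Qed.

Lemma drN f x a : dr f x a -> dr (fun y => - f y) x (- a).
Proof. by move=> df; exact: is_deriveN. Qed.

Lemma drB f g x a b : dr f x a -> dr g x b -> dr (fun y => f y - g y) x (a - b).
Proof. by move=> df dg; exact: is_deriveB. Qed.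

Lemma drM f g x a b : dr f x a -> dr g x b ->
  dr (fun y => f y * g y) x (a * g x + f x * b).
Proof.
move=> df dg; have h := is_deriveM df dg.
by apply: is_derive_eq h _; rewrite /GRing.scale /= addrC (mulrC a).
Qed.

Lemma dr_cst (c : R) x : dr (fun=> c) x 0.
Proof. exact: is_derive_cst. Qed.

Lemma dr_id x : dr id x 1. Proof. exact: is_derive_id. Qed.

Lemma drZ (c : R) f x a : dr f x a -> dr (fun y => c * f y) x (c * a).
Proof. by move=> df; exact: is_deriveZ. Qed.

Lemma dr_sum (I : Type) (s : seq I) (P : pred I) (F : I -> R -> R) (F' : I -> R) x :
  (forall i, P i -> dr (F i) x (F' i)) ->
  dr (fun y => \sum_(i <- s | P i) F i y) x (\sum_(i <- s | P i) F' i).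
Proof.
move=> h; elim: s => [|i s IH].
  rewrite big_nil; have -> : (fun y => \sum_(i <- [::] | P i) F i y) = fun=> 0.
    by apply/funext => y; rewrite big_nil.
  exact: dr_cst.
have -> : (fun y => \sum_(j <- i :: s | P j) F j y) =
   (fun y => (if P i then F i y else 0) + \sum_(j <- s | P j) F j y).
  by apply/funext => y; rewrite big_cons; case: ifPn; rewrite ?add0r.
rewrite big_cons -[X in is_derive _ _ _ X]add0r.
have -> : 0 + (if P i then F' i + \sum_(j <- s | P j) F' j else \sum_(j <- s | P j) F' j)
  = (if P i then F' i else 0) + \sum_(j <- s | P j) F' j.
  by case: ifPn; rewrite ?add0r.
apply: drD => //; case: (boolP (P i)) => Pi; first exact: h.
exact: dr_cst.
Qed.

Lemma dr_eq f x a b : dr f x a -> a = b -> dr f x b.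
Proof. by move=> ? <-. Qed.

Lemma drX n x : dr (fun y => y ^+ n) x (n%:R * x ^+ n.-1).
Proof.
elim: n => [|n IH]; first by rewrite mul0r; under eq_fun do rewrite expr0; exact: dr_cst.
under eq_fun do rewrite exprS.
apply: dr_eq (drM (dr_id x) IH) _; rewrite -natr1 mulrDl !mul1r addrC; congr (_ + _).
by case: n {IH} => [|n]; rewrite ?mul0r ?mulr0 //= exprS; ring.
Qed.

Lemma eq_ler (a b : R) : a = b -> a <= b.
Proof. by move=> ->. Qed.

Lemma dr_comp f g x a b : dr g x b -> dr f (g x) a -> dr (fun y => f (g y)) x (a * b).
Proof. by move=> dg df; exact: is_derive1_comp df dg. Qed.

Lemma dr_uniq f x a b : dr f x a -> dr f x b -> a = b.
Proof. by move=> [_ <-] [_ <-]. Qed.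

Lemma dr_cont f x a : dr f x a -> {for x, continuous f}.
Proof. by move=> [/derivable1_diffP/differentiable_continuous]. Qed.

Lemma dr_continuous f f' : (forall x, dr f x (f' x)) -> continuous f.
Proof. by move=> h x; exact: dr_cont (h x). Qed.

Lemma cont_within f (A : set R) : continuous f -> {within A, continuous f}.
Proof. by move=> cf; apply: continuous_subspaceT. Qed.

Lemma dr_zero_cst f : (forall x, dr f x 0) -> forall x y, f x = f y.
Proof. by move=> h x y; exact: is_derive_0_is_cst. Qed.

Lemma dr_nondecreasing f f' (a b : R) :
  (forall x, a <= x <= b -> dr f x (f' x)) ->
  (forall x, a <= x <= b -> 0 <= f' x) -> a <= b -> f a <= f b.
Proof.
move=> df f0 ab; have [||c + e] := @MVT_segment R f f' a b ab.
- by move=> x /andP[]; rewrite !bnd_simp => ax xb; apply: df; rewrite !ltW.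
- apply: derivable_within_continuous => x; rewrite in_itv /= => xab.
  by have [] := df x xab.
by rewrite in_itv /= => cab; rewrite -subr_ge0 e mulr_ge0 ?f0 ?subr_ge0.
Qed.

Lemma dr_lip f f' (a b C : R) :
  (forall x, a <= x <= b -> dr f x (f' x)) ->
  (forall x, a <= x <= b -> `|f' x| <= C) -> a <= b -> `|f b - f a| <= C * (b - a).
Proof.
move=> df f0 ab; have [||c + e] := @MVT_segment R f f' a b ab.
- by move=> x /andP[]; rewrite !bnd_simp => ax xb; apply: df; rewrite !ltW.
- apply: derivable_within_continuous => x; rewrite in_itv /= => xab.
  by have [] := df x xab.
rewrite in_itv /= => cab; rewrite e normrM (@ger0_norm _ (b - a)) ?subr_ge0//.
by rewrite ler_wpM2r ?subr_ge0 ?f0.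
Qed.

(** * Integrals of continuous functions over one period *)

Lemma mu01 : lebesgue_measure (`[0, 1]%classic : set R) = 1%E.
Proof. by rewrite lebesgue_measure_itv /= lte_fin ltr01 -EFinB subr0. Qed.

Let m01 : measurable (`[0, 1]%classic : set R).
Proof. exact: measurable_itv. Qed.

Local Notation ig01 f := ((@lebesgue_measure R).-integrable `[0, 1]%classic (EFin \o f)).

Lemma cont_meas f (D : set R) : continuous f -> measurable_fun D f.
Proof. by move=> cf; apply: measurable_funTS; exact: continuous_measurable_fun. Qed.

Lemma cont_ig f : continuous f -> ig01 f.
Proof.
move=> cf; apply: continuous_compact_integrable; first exact: segment_compact.
exact: cont_within.
Qed.

Lemma contD f g : continuous f -> continuous g -> continuous (fun x => f x + g x).
Proof. by move=> cf cg x; apply: cvgD; [exact: cf|exact: cg]. Qed.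
Lemma contB f g : continuous f -> continuous g -> continuous (fun x => f x - g x).
Proof. by move=> cf cg x; apply: cvgB; [exact: cf|exact: cg]. Qed.
Lemma contM f g : continuous f -> continuous g -> continuous (fun x => f x * g x).
Proof. by move=> cf cg x; apply: cvgM; [exact: cf|exact: cg]. Qed.
Lemma contN f : continuous f -> continuous (fun x => - f x).
Proof. by move=> cf x; apply: cvgN; exact: cf. Qed.
Lemma cont_cst (c : R) : continuous (fun _ : R => c).
Proof. by move=> x; exact: cvg_cst. Qed.
Lemma contZ (c : R) f : continuous f -> continuous (fun x => c * f x).
Proof. by move=> cf; apply: contM => //; exact: cont_cst. Qed.
Lemma contX f n : continuous f -> continuous (fun x => f x ^+ n).
Proof.
move=> cf; elim: n => [|n IH]; first by under eq_fun do rewrite expr0; exact: cont_cst.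
by under eq_fun do rewrite exprS; exact: contM.
Qed.
Lemma cont_abs f : continuous f -> continuous (fun x => `|f x|).
Proof. by move=> cf x; apply: cvg_norm; exact: cf. Qed.
Lemma cont_sum (I : Type) (s : seq I) (P : pred I) (F : I -> R -> R) :
  (forall i, P i -> continuous (F i)) ->
  continuous (fun y => \sum_(i <- s | P i) F i y).
Proof.
move=> h; elim: s => [|i s IH].
  by under eq_fun do rewrite big_nil; exact: cont_cst.
under eq_fun do rewrite big_cons.
by case Pi: (P i) => //; apply: contD => //; exact: h.
Qed.

Lemma iTD f g : continuous f -> continuous g ->
  integralT (fun x => f x + g x) = integralT f + integralT g.
Proof. by move=> cf cg; apply: IntD => //; exact: cont_ig. Qed.
Lemma iTB f g : continuous f -> continuous g ->
  integralT (fun x => f x - g x) = integralT f - integralT g.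
Proof. by move=> cf cg; apply: IntB => //; exact: cont_ig. Qed.
Lemma iTZ (c : R) f : continuous f ->
  integralT (fun x => c * f x) = c * integralT f.
Proof. by move=> cf; apply: IntZ => //; exact: cont_ig. Qed.
Lemma iTN f : continuous f -> integralT (fun x => - f x) = - integralT f.
Proof. by move=> cf; apply: IntN => //; exact: cont_ig. Qed.
Lemma iT_cst (c : R) : integralT (fun=> c) = c.
Proof. by apply: Int_cst => //; exact: mu01. Qed.
Lemma iT_sum (I : Type) (s : seq I) (P : pred I) (F : I -> R -> R) :
  (forall i, P i -> continuous (F i)) ->
  integralT (fun x => \sum_(i <- s | P i) F i x) = \sum_(i <- s | P i) integralT (F i).
Proof.
move=> h; apply: Int_sum => //; first exact: mu01.
by move=> i Pi; apply: cont_ig; exact: h.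
Qed.
Lemma iT_ge0 f : (forall x, 0 <= f x) -> 0 <= integralT f.
Proof. by move=> h; apply: Int_ge0 => x _; exact: h. Qed.
Lemma iT_le f g : continuous f -> continuous g -> (forall x, f x <= g x) ->
  integralT f <= integralT g.
Proof. by move=> cf cg h; apply: Int_le => //; exact: cont_ig. Qed.
Lemma iT_eq f g : f =1 g -> integralT f = integralT g.
Proof. by move=> /funext ->. Qed.

Lemma iT_abs_le f g : continuous f -> continuous g -> (forall x, `|f x| <= g x) ->
  `|integralT f| <= integralT g.
Proof.
move=> cf cg h; apply: Int_abs_le => //; [exact: cont_meas|exact: cont_ig].
Qed.

(** The discriminant of the nonnegative quadratic polynomial l |-> int (f + l g)^2. *)
Lemma iT_CS f g : continuous f -> continuous g ->
  (integralT (fun x => f x * g x)) ^+ 2 <=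
  integralT (fun x => f x ^+ 2) * integralT (fun x => g x ^+ 2).
Proof.
move=> cf cg; set b := integralT (fun x => f x * g x).
set a := integralT (fun x => f x ^+ 2); set c := integralT (fun x => g x ^+ 2).
have h (l m : R) : 0 <= l ^+ 2 * a + 2 * l * m * b + m ^+ 2 * c.
  have <- : integralT (fun x => (l * f x + m * g x) ^+ 2) =
     l ^+ 2 * a + 2 * l * m * b + m ^+ 2 * c.
    rewrite /a /b /c -!iTZ; do ?[exact: contX|exact: contM].
    rewrite -!iTD; do ?[exact: contX|exact: contM|apply: contD|apply: contZ].
    by apply: iT_eq => x; ring.
  by apply: iT_ge0 => x; exact: sqr_ge0.
have a0 : 0 <= a by apply: iT_ge0 => x; exact: sqr_ge0.
have c0 : 0 <= c by apply: iT_ge0 => x; exact: sqr_ge0.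
have [c_0|cn0] := eqVneq c 0.
  rewrite c_0 mulr0; suff -> : b = 0 by rewrite expr0n.
  (* If g vanishes in L^2, this choice of l and m gives the value - b^2. *)
  have := h b (- (a + 1) / 2); rewrite c_0 mulr0 addr0.
  have -> : b ^+ 2 * a + 2 * b * (- (a + 1) / 2) * b = - b ^+ 2 by field.
  by rewrite oppr_ge0 => h'; apply/eqP; rewrite -sqrf_eq0 eq_le h' sqr_ge0.
have := h c (- b).
have -> : c ^+ 2 * a + 2 * c * - b * b + (- b) ^+ 2 * c = c * (a * c - b ^+ 2) by ring.
by rewrite pmulr_rge0 ?subr_ge0// lt0r cn0.
Qed.

Lemma iT_FTC f f' : (forall x, dr f x (f' x)) -> continuous f' ->
  integralT f' = f 1 - f 0.
Proof.
move=> df cf'; rewrite /integralT /Rintegral.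
rewrite (@continuous_FTC2 R f' f 0 1) ?ltr01 //.
- exact: cont_within.
- split; first by move=> x _; have [] := df x.
    by apply: cvg_at_right_filter; exact: (dr_continuous df).
  by apply: cvg_at_left_filter; exact: (dr_continuous df).
- by move=> x _; rewrite derive1E; have [_ ->] := df x.
Qed.

Lemma iT_derive_periodic f f' : (forall x, dr f x (f' x)) -> continuous f' ->
  periodic1 f -> integralT f' = 0.
Proof. by move=> df cf' pf; rewrite (iT_FTC df cf') -[1]add0r pf subrr. Qed.

End real_calculus.

Ltac ct := lazymatch goal with
 | H : continuous ?f |- continuous ?f => exact H
 | H : continuous ?f |- continuous (fun x => ?f x) => exact H
 | |- continuous (fun x => (@?f x - @?g x)%R) => apply (@contB _ f g); ct
 | |- continuous (fun x => (@?f x + @?g x)%R) => apply (@contD _ f g); ct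
 | |- continuous (fun x => (- @?f x)%R) => apply (@contN _ f); ct
 | |- continuous (fun x => (@?f x * @?g x)%R) => apply (@contM _ f g); ct
 | |- continuous (fun x => (@?f x ^+ ?n)%R) => apply (@contX _ f n); ct
 | |- continuous (fun x => `|@?f x|%R) => apply (@cont_abs _ f); ct
 | |- continuous (fun _ => ?c) => exact (@cont_cst _ c)
 | |- _ => try assumption
 end.

(** * Integrals depending on a parameter *)

Section parametric_integral.
Variable R : realType.
Local Notation dr f x l := (is_derive (x : R) (1 : R) (f : R -> R) (l : R)).

(** The tube lemma for the compact segment [0, 1]. *)
Lemma near_unif_segment (X : topologicalType) (H : X -> R -> R) (p : X) :
  (forall y : R, {for (p, y), continuous (fun q : X * R => H q.1 q.2)}) ->
  forall e : R, 0 < e -> \forall q \near p, forall y : R, 0 <= y <= 1 -> `|H q y - H p y| < e.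
Proof.
move=> cH e e0.
have cc := @segment_compact R 0 1.
have := (iffLR (compact_near_coveringP _) cc) X (nbhs p)
  (fun q y => `|H q y - H p y| < e) _.
have step : forall y : R, `[0, 1]%classic y ->
   \forall y' \near y & q \near p, `|H q y' - H p y'| < e.
  move=> y _; have e2 : 0 < e / 2 by rewrite divr_gt0.
  have h1 : \forall q \near (p, y), `|H p y - H q.1 q.2| < e / 2.
    have /cvgrPdist_lt := cH y; exact.
  have [[A B] /= [nA nB] AB] := h1.
  exists (B, A); first by split.
  move=> [y' q] /= [By' Aq].
  have /= hq := AB (q, y') (conj Aq By').
  have /= hp := AB (p, y') (conj (nbhs_singleton nA) By').
  rewrite (splitr e) (_ : H q y' - H p y' = (H p y - H p y') - (H p y - H q y')); last by ring.
  by apply: le_lt_trans (ler_normB _ _) _; rewrite ltrD.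
move=> /(_ (nbhs_filter p) step); apply: filterS => q h y y01; apply: h; by rewrite /= in_itv.
Qed.

Lemma iT_cont_param (X : topologicalType) (H : X -> R -> R) (p : X) :
  (forall y : R, {for (p, y), continuous (fun q : X * R => H q.1 q.2)}) ->
  (\forall q \near p, continuous (H q)) ->
  {for p, continuous (fun q => integralT (H q))}.
Proof.
move=> cH cHq; apply/cvgrPdist_le => e e0.
have cHp : continuous (H p) := nbhs_singleton cHq.
near=> q.
have cq : continuous (H q) by near: q.
have hq : forall y : R, 0 <= y <= 1 -> `|H q y - H p y| < e.
  by near: q; exact: near_unif_segment.
rewrite -iTB//; apply: Int_abs_bdd => //; first exact: mu01.
  by apply: cont_meas; exact: contB.
move=> y /=; rewrite in_itv /= => y01.
by rewrite distrC ltW // hq.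
Unshelve. all: end_near. Qed.

(** Dominated differentiation; near a, the derivative Gt is within 1 of Gt a,
   uniformly on [0, 1], which provides the dominating constant. *)
Lemma iT_dr_under (u v : R) (G Gt : R -> R -> R) (a : R) : u < a < v ->
  (forall t x, u < t < v -> dr (G ^~ x) t (Gt t x)) ->
  (forall t, u < t < v -> continuous (G t)) ->
  continuous (Gt a) ->
  (forall x : R, {for (a, x), continuous (fun p : R * R => Gt p.1 p.2)}) ->
  dr (fun t => integralT (G t)) a (integralT (Gt a)).
Proof.
move=> /andP[ua av] dG cG cGa cGt.
have [C hC] : exists C : R, forall y : R, 0 <= y <= 1 -> `|Gt a y| <= C.
  have /compact_bounded := continuous_compact (cont_within (A := `[0, 1]%classic) cGa)
     (segment_compact (a:=0) (b:=1)).
  move=> [C [_ hC]]; exists (C + 1) => y y01; apply: (hC (C + 1)); first by rewrite ltrDl.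
  by exists y => //=; rewrite in_itv.
have hb := near_unif_segment cGt (ltr01 : 0 < 1 :> R).
have h1 : \forall t \near a, u < t < v.
  have /near_in_itvoo : a \in `]u, v[ by rewrite in_itv /= ua av.
  by apply: filterS => t; rewrite in_itv.
have [d /= d0 hd] : exists2 d : R, 0 < d & forall t, `|a - t| < d ->
    (u < t < v) /\ (forall y : R, 0 <= y <= 1 -> `|Gt t y - Gt a y| < 1).
  have : \forall t \near a, (u < t < v) /\ (forall y : R, 0 <= y <= 1 -> `|Gt t y - Gt a y| < 1).
    by near=> t; split; near: t.
  by move=> [d d0 hd]; exists d.
pose I : set R := `](a - d), (a + d)[%classic.
have Id t : I t -> `|a - t| < d.
  by rewrite /I /= in_itv /= ltr_distlC; lra.
have Ia : I a by rewrite /I /= in_itv /=; lra.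
have D1 x y : I x -> `[0, 1]%classic y -> partial1of2 G x y = Gt x y.
  move=> Ix _; rewrite /partial1of2 derive1E.
  by have [_ ->] := dG x y (hd x (Id _ Ix)).1.
have m01 : measurable (`[0, 1]%classic : set R) by [].
have A1 x : I x -> (@lebesgue_measure R).-integrable `[0, 1]%classic (EFin \o G x).
  by move=> Ix; apply: cont_ig; apply: cG; have [] := hd x (Id _ Ix).
have A2 x y : I x -> `[0, 1]%classic y -> derivable (G ^~ y) x 1.
  by move=> Ix _; have [] := dG x y (hd x (Id _ Ix)).1.
have A3 : (@lebesgue_measure R).-integrable `[0, 1]%classic (EFin \o (fun _ : R => `|C| + 1)).
  by apply: cont_ig; exact: cont_cst.
have A4 x y : I x -> `[0, 1]%classic y -> `|partial1of2 G x y| <= `|C| + 1.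
  move=> Ix y01; rewrite D1//; move: y01; rewrite /= in_itv /= => y01.
  have := (hd x (Id _ Ix)).2 y y01; have := hC y y01.
  rewrite (_ : Gt x y = Gt a y + (Gt x y - Gt a y)); last by ring.
  move=> h h'; apply: le_trans (ler_normD _ _) _; rewrite lerD//; last first.
    by apply: le_trans (ltW h'); rewrite [X in _ <= `|X|](_ : _ = Gt x y - Gt a y)//; ring.
  exact: le_trans h (ler_norm _).
have A5 (y : R) : 0 <= `|C| + 1 by rewrite addr_ge0.
split.
  have := @derivable_under_integral R _ _ (@lebesgue_measure R) G _ m01 a _ _ Ia A1 A2 (fun=> `|C| + 1) A5 A3 A4; exact.
rewrite -derive1E.
have := @differentiation_under_integral R _ _ (@lebesgue_measure R) G _ m01 a _ _ Ia A1 A2 (fun=> `|C| + 1) A5 A3 A4.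
by move=> e0; apply: (etrans e0); apply: eq_Rintegral => y /set_mem y01; exact: D1.
Unshelve. all: end_near. Qed.

(** * Space-time functions that are C^1 in time *)
Variables u v : R.

Definition jc (G : R -> R -> R) := forall t x, u < t < v ->
  {for (t, x), continuous (fun p : R * R => G p.1 p.2)}.

Lemma jcD G H : jc G -> jc H -> jc (fun t x => G t x + H t x).
Proof. by move=> cG cH t x tI; apply: (cvgD (cG t x tI) (cH t x tI)). Qed.
Lemma jcB G H : jc G -> jc H -> jc (fun t x => G t x - H t x).
Proof. by move=> cG cH t x tI; apply: (cvgB (cG t x tI) (cH t x tI)). Qed.
Lemma jcN G : jc G -> jc (fun t x => - G t x).
Proof. by move=> cG t x tI; apply: (cvgN (cG t x tI)). Qed.
Lemma jcM G H : jc G -> jc H -> jc (fun t x => G t x * H t x).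
Proof. by move=> cG cH t x tI; apply: (cvgM (cG t x tI) (cH t x tI)). Qed.
Lemma jc_cst (c : R) : jc (fun _ _ => c).
Proof. by move=> t x _; exact: cvg_cst. Qed.
Lemma jcZ (c : R) G : jc G -> jc (fun t x => c * G t x).
Proof. by move=> cG; apply: jcM => //; exact: jc_cst. Qed.
Lemma jc_t (f : R -> R) : (forall t, u < t < v -> {for t, continuous f}) -> jc (fun t _ => f t).
Proof.
by move=> cf t x tI; apply: (@cvg_comp _ _ _ fst f _ (nbhs t)); [exact: cvg_fst|exact: cf].
Qed.
Lemma jc_x (f : R -> R) : continuous f -> jc (fun _ x => f x).
Proof.
by move=> cf t x tI; apply: (@cvg_comp _ _ _ snd f _ (nbhs x)); [exact: cvg_snd|exact: cf].
Qed.
Lemma jc_sum (I : Type) (s : seq I) (P : pred I) (F : I -> R -> R -> R) :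
  (forall i, P i -> jc (F i)) -> jc (fun t x => \sum_(i <- s | P i) F i t x).
Proof.
move=> h; elim: s => [|i s IH].
  by under eq_fun do under eq_fun do rewrite big_nil; exact: jc_cst.
have -> : (fun t x => \sum_(j <- i :: s | P j) F j t x) =
    if P i then fun t x => F i t x + \sum_(j <- s | P j) F j t x
    else fun t x => \sum_(j <- s | P j) F j t x.
  by apply/funext => t; apply/funext => x; rewrite big_cons; case: (P i).
by case Pi: (P i) => //; apply: jcD => //; exact: h.
Qed.
Lemma jc_cont G t : jc G -> u < t < v -> continuous (G t).
Proof.
move=> cG tI x; apply: (@cvg_comp _ _ _ (fun x : R => (t, x)) (fun p : R * R => G p.1 p.2) _ (nbhs (t, x))).
  apply: (cvg_pair (F := nbhs x) (G := nbhs t) (H := nbhs x) (cvg_cst t) cvg_id).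
exact: cG.
Qed.

(** What differentiation under the integral over a period asks for, in a form
   that is stable under sums and products. *)
Definition C1t (G Gt : R -> R -> R) :=
  [/\ forall t x, u < t < v -> dr (G ^~ x) t (Gt t x), jc G & jc Gt].

Lemma C1tD G Gt H Ht : C1t G Gt -> C1t H Ht ->
  C1t (fun t x => G t x + H t x) (fun t x => Gt t x + Ht t x).
Proof.
move=> [d1 a1 b1] [d2 a2 b2]; split; [|exact: jcD|exact: jcD].
by move=> t x tI; apply: drD; [exact: d1|exact: d2].
Qed.
Lemma C1tB G Gt H Ht : C1t G Gt -> C1t H Ht ->
  C1t (fun t x => G t x - H t x) (fun t x => Gt t x - Ht t x).
Proof.
move=> [d1 a1 b1] [d2 a2 b2]; split; [|exact: jcB|exact: jcB].
by move=> t x tI; apply: drB; [exact: d1|exact: d2].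
Qed.
Lemma C1tM G Gt H Ht : C1t G Gt -> C1t H Ht ->
  C1t (fun t x => G t x * H t x) (fun t x => Gt t x * H t x + G t x * Ht t x).
Proof.
move=> [d1 a1 b1] [d2 a2 b2]; split; [|exact: jcM|by apply: jcD; apply: jcM].
by move=> t x tI; apply: (@drM _ (G^~ x) (H^~ x)); [exact: d1|exact: d2].
Qed.
Lemma C1tZ (c : R) G Gt : C1t G Gt ->
  C1t (fun t x => c * G t x) (fun t x => c * Gt t x).
Proof.
move=> [d1 a1 b1]; split; [|exact: jcZ|exact: jcZ].
by move=> t x tI; apply: drZ; exact: d1.
Qed.
Lemma C1t_tx (f f' e : R -> R) :
  (forall t, u < t < v -> dr f t (f' t)) ->
  (forall t, u < t < v -> {for t, continuous f'}) -> continuous e ->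
  C1t (fun t x => f t * e x) (fun t x => f' t * e x).
Proof.
move=> df cf' ce; split.
- by move=> t x tI; apply: dr_eq (drM (df t tI) (dr_cst (e x) t)) _; rewrite mulr0 addr0.
- by apply: jcM; [apply: jc_t => t tI; exact: dr_cont (df t tI)|exact: jc_x].
- by apply: jcM; [exact: jc_t|exact: jc_x].
Qed.
Lemma C1t_sum (I : Type) (s : seq I) (P : pred I) (F F' : I -> R -> R -> R) :
  (forall i, P i -> C1t (F i) (F' i)) ->
  C1t (fun t x => \sum_(i <- s | P i) F i t x) (fun t x => \sum_(i <- s | P i) F' i t x).
Proof.
move=> h; split.
- by move=> t x tI; apply: dr_sum => i Pi; have [+ _ _] := h i Pi; exact.
- by apply: jc_sum => i /h[].
- by apply: jc_sum => i /h[].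
Qed.
Lemma C1t_int G Gt t : C1t G Gt -> u < t < v ->
  dr (fun t => integralT (G t)) t (integralT (Gt t)).
Proof.
move=> [dG cG cGt] tI; apply: (iT_dr_under tI) => //.
- by move=> s sI; exact: jc_cont.
- exact: jc_cont.
- by move=> x; exact: cGt.
Qed.

End parametric_integral.

(** * The trigonometric basis *)

Section trig_basis.
Variable R : realType.
Local Notation dr f x l := (is_derive (x : R) (1 : R) (f : R -> R) (l : R)).
Local Notation sq2 := (Num.sqrt 2 : R).
Implicit Types f g h : R -> R.

Definition freq (k : nat) : R := 2 * pi * (k./2.+1)%:~R.
Definition partner (k : nat) : nat := if odd k then k.-1 else k.+1.
Definition dsign (k : nat) : R := if odd k then 1 else -1.
Definition cos_amp (k : nat) : R := if odd k then 0 else sq2.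
Definition sin_amp (k : nat) : R := if odd k then sq2 else 0.

(** The L^2-orthonormal basis of mean zero functions: sqrt 2 cos (2 pi x),
   sqrt 2 sin (2 pi x), sqrt 2 cos (4 pi x), ... *)
Definition emode (k : nat) : test_function R :=
  TestFunction (@smooth_trig R (cos_amp k) (sin_amp k) (2 * pi * (k./2.+1)%:~R))
    (@periodic_trig R (cos_amp k) (sin_amp k) (k./2.+1)).

Lemma emodeE k x : emode k x = cos_amp k * cos (freq k * x) + sin_amp k * sin (freq k * x).
Proof. by []. Qed.

Lemma sq2_sqr : sq2 * sq2 = 2.
Proof. by rewrite -expr2 sqr_sqrtr. Qed.

Lemma partnerK : involutive partner.
Proof.
move=> k; rewrite /partner; case: (boolP (odd k)) => ok; last by rewrite /= (negPf ok).
by case: k ok => //= k ok; rewrite (negPf ok).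
Qed.

Lemma partner_half k : (partner k)./2 = k./2.
Proof.
rewrite /partner; case: (boolP (odd k)) => ok; last by rewrite /= uphalf_half (negPf ok).
by case: k ok => //= k ok; rewrite uphalf_half (negPf ok).
Qed.

Lemma odd_partner k : odd (partner k) = ~~ odd k.
Proof. by rewrite /partner; case: (boolP (odd k)) => [|/= ->] //; case: k => //= k /negPf ->. Qed.

Lemma freq_partner k : freq (partner k) = freq k.
Proof. by rewrite /freq partner_half. Qed.

Lemma dsign_partner k : dsign (partner k) = - dsign k.
Proof. by rewrite /dsign odd_partner; case: (odd k) => //=; rewrite opprK. Qed.

Lemma dsign_sqr k : dsign k * dsign k = 1.
Proof. by rewrite /dsign; case: ifP => _; rewrite ?mulr1 // mulrNN mulr1. Qed.

Lemma freq_gt0 k : 0 < freq k.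
Proof. by rewrite /freq !mulr_gt0 ?pi_gt0 // ltr0n. Qed.

Lemma ltn_half2 k M : (k < M.*2)%N = (k./2 < M)%N.
Proof. lia. Qed.

Lemma partner_ltn k M : (partner k < M.*2)%N = (k < M.*2)%N.
Proof. by rewrite !ltn_half2 partner_half. Qed.

Lemma dr_emode k x : dr (emode k) x (dsign k * freq k * emode (partner k) x).
Proof.
apply: dr_eq (is_derive_trig _ _ _ _) _; rewrite emodeE freq_partner /trig.
rewrite /cos_amp /sin_amp /dsign odd_partner -/(freq k); case: (odd k) => /=; ring.
Qed.

Lemma cont_emode k : continuous (emode k).
Proof. exact: dr_continuous (dr_emode k). Qed.

Lemma emode_periodic k : periodic1 (emode k).
Proof. exact: test_periodic. Qed.

Lemma emode_pair k x : emode k x ^+ 2 + emode (partner k) x ^+ 2 = 2.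
Proof.
rewrite !emodeE freq_partner /cos_amp /sin_amp odd_partner.
have h := cos2Dsin2 (freq k * x); have s2 := sq2_sqr.
by case: (odd k); rewrite /= !(mul0r, add0r, addr0) !exprMn -mulrDr ?(addrC (sin _ ^+ 2)) h mulr1 expr2.
Qed.

Lemma emode_bound k x : `|emode k x| <= sq2.
Proof.
rewrite -(ler_pXn2r (ltn0Sn 1)) ?nnegrE ?sqrtr_ge0//.
rewrite real_normK ?num_real// sqr_sqrtr// -(emode_pair k x) lerDl; exact: sqr_ge0.
Qed.

Lemma trigM (a b c a' b' c' x : R) : trig a b c x * trig a' b' c' x =
  2^-1 * (trig (a * a' + b * b') (b * a' - a * b') (c - c') x +
          trig (a * a' - b * b') (a * b' + b * a') (c + c') x).
Proof.
by rewrite /trig (mulrBl x c) (mulrDl c c' x) cosB cosD sinB sinD; field.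
Qed.

Lemma iT_trig (a b : R) (n : int) :
  integralT (trig a b (2 * pi * n%:~R)) = if n == 0 then a else 0.
Proof.
case: eqVneq => [->|n0].
  rewrite -[RHS]iT_cst; apply: iT_eq => x.
  by rewrite /trig mulr0 mul0r cos0 sin0 mulr0 mulr1 addr0.
have c0 : 2 * pi * n%:~R != 0 :> R.
  by rewrite mulf_neq0 ?intr_eq0// mulf_neq0 ?pnatr_eq0// gt_eqF ?pi_gt0.
set c := 2 * pi * n%:~R in c0 *.
apply: (@iT_derive_periodic _ (trig (- (b / c)) (a / c) c)).
- by move=> x; apply: dr_eq (is_derive_trig _ _ _ _) _; rewrite /trig; field.
- exact: (dr_continuous (fun x => is_derive_trig a b c x)).
- exact: periodic_trig.
Qed.

Lemma iT_emode k : integralT (emode k) = 0.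
Proof. by rewrite /emode iT_trig. Qed.

Lemma cont_trig (a b c : R) : continuous (trig a b c).
Proof. exact: (dr_continuous (fun x => is_derive_trig a b c x)). Qed.

Lemma iT_emodeM j k : integralT (fun x => emode j x * emode k x) = (j == k)%:R.
Proof.
rewrite (@iT_eq _ _ (fun x => 2^-1 * (trig (cos_amp j * cos_amp k + sin_amp j * sin_amp k)
   (sin_amp j * cos_amp k - cos_amp j * sin_amp k) (2 * pi * ((j./2.+1)%:Z - (k./2.+1)%:Z)%:~R) x
   + trig (cos_amp j * cos_amp k - sin_amp j * sin_amp k)
   (cos_amp j * sin_amp k + sin_amp j * cos_amp k) (2 * pi * ((j./2.+1)%:Z + (k./2.+1)%:Z)%:~R) x))); last first.
  by move=> x; rewrite /emode /= trigM; congr (_ * (trig _ _ _ _ + trig _ _ _ _)); rewrite ?rmorphB ?rmorphD /=; ring.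
rewrite iTZ; last by apply: contD; exact: cont_trig.
rewrite (iTD (@cont_trig _ _ _) (@cont_trig _ _ _)) !iT_trig.
have -> : ((j./2.+1)%:Z + (k./2.+1)%:Z == 0) = false by lia.
rewrite addr0 subr_eq0 eqz_nat eqSS /cos_amp /sin_amp.
have s2 := sq2_sqr.
have e1 : (j == k) = (j./2 == k./2) && (odd j == odd k).
  by apply/eqP/andP => [->|[/eqP h /eqP h2]]; [split|lia].
rewrite e1; case: (j./2 == k./2) => /=; last by rewrite mulr0.
by case: (odd j); case: (odd k); rewrite /= ?mul0r ?mulr0 ?add0r ?addr0 ?sq2_sqr ?mulVf ?mulr0 ?pnatr_eq0.
Qed.

(** * Trigonometric polynomials and the Galerkin projection *)

(** Frequencies at most m.  Under products the degrees add up, and coproj M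
   vanishes on degree at most M: these two facts are how products of low
   frequency functions disappear from the estimates. *)
Inductive tpoly (m : nat) : (R -> R) -> Prop :=
| tpoly_trig a b n : (`|n| <= m)%N -> tpoly m (trig a b (2 * pi * n%:~R))
| tpoly_add f g : tpoly m f -> tpoly m g -> tpoly m (fun x => f x + g x).

Lemma tpoly_cont m f : tpoly m f -> continuous f.
Proof.
by elim=> [a b n _|f1 f2 _ c1 _ c2]; [exact: cont_trig|exact: contD].
Qed.

Lemma tpoly_cst m (c : R) : tpoly m (fun=> c).
Proof.
have -> : (fun=> c) = trig c 0 (2 * pi * (0 : int)%:~R) :> (R -> R).
  by apply/funext => x; rewrite /trig mulr0 mul0r cos0 mulr1 mul0r addr0.
exact: tpoly_trig.
Qed.

Lemma tpolyZ m (c : R) f : tpoly m f -> tpoly m (fun x => c * f x).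
Proof.
elim=> [a b n nm|f1 f2 _ c1 _ c2]; last first.
  by under eq_fun do rewrite mulrDr; exact: tpoly_add.
have -> : (fun x => c * trig a b (2 * pi * n%:~R) x) = trig (c * a) (c * b) (2 * pi * n%:~R).
  by apply/funext => x; rewrite /trig; ring.
exact: tpoly_trig.
Qed.

Lemma tpoly_le m n f : (m <= n)%N -> tpoly m f -> tpoly n f.
Proof.
move=> mn; elim=> [a b i im|f1 f2 _ c1 _ c2]; last exact: tpoly_add.
by apply: tpoly_trig; exact: leq_trans im mn.
Qed.

Lemma tpolyM m n f g : tpoly m f -> tpoly n g -> tpoly (m + n) (fun x => f x * g x).
Proof.
move=> tf tg; elim: tf => [a b i im|f1 f2 _ c1 _ c2]; last first.
  by under eq_fun do rewrite mulrDl; exact: tpoly_add.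
elim: tg => [a' b' j jn|f1 f2 _ c1 _ c2]; last first.
  by under eq_fun do rewrite mulrDr; exact: tpoly_add.
have -> : (fun x => trig a b (2 * pi * i%:~R) x * trig a' b' (2 * pi * j%:~R) x) =
  (fun x => 2^-1 * (trig (a * a' + b * b') (b * a' - a * b') (2 * pi * (i - j)%:~R) x +
          trig (a * a' - b * b') (a * b' + b * a') (2 * pi * (i + j)%:~R) x)).
  by apply/funext => x; rewrite trigM -mulrBr -mulrDr intrB intrD.
by apply: tpolyZ; apply: tpoly_add; apply: tpoly_trig; lia.
Qed.

Lemma tpoly_emode m k : (k < m.*2)%N -> tpoly m (emode k).
Proof. by move=> km; apply: tpoly_trig; lia. Qed.

Lemma tpoly_sum m (I : Type) (s : seq I) (P : pred I) (F : I -> R -> R) :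
  (forall i, P i -> tpoly m (F i)) -> tpoly m (fun x => \sum_(i <- s | P i) F i x).
Proof.
move=> h; elim: s => [|i s IH].
  by under eq_fun do rewrite big_nil; exact: tpoly_cst.
under eq_fun do rewrite big_cons.
by case Pi: (P i) => //; apply: tpoly_add => //; exact: h.
Qed.

Variable M : nat.
Definition coef (f : R -> R) (k : nat) : R := integralT (fun x => f x * emode k x).
Definition proj (f : R -> R) (x : R) : R := \sum_(k < M.*2) coef f k * emode k x.
(** The part of f above the truncation: the mean is removed as well. *)
Definition coproj (f : R -> R) (x : R) : R := f x - integralT f - proj f x.

Lemma coefD f g k : continuous f -> continuous g ->
  coef (fun x => f x + g x) k = coef f k + coef g k.
Proof.
move=> cf cg; rewrite /coef -iTD; try by apply: contM => //; exact: cont_emode.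
by apply: iT_eq => x; rewrite mulrDl.
Qed.

Lemma cont_proj f : continuous (proj f).
Proof. by apply: cont_sum => i _; apply: contZ; exact: cont_emode. Qed.

Lemma tpoly_proj f : tpoly M (proj f).
Proof. by apply: tpoly_sum => i _; apply: tpolyZ; exact: tpoly_emode. Qed.

Lemma cont_coproj f : continuous f -> continuous (coproj f).
Proof.
by move=> cf; apply: contB; [apply: contB => //; exact: cont_cst|exact: cont_proj].
Qed.

Lemma coprojD f g : continuous f -> continuous g -> forall x,
  coproj (fun x => f x + g x) x = coproj f x + coproj g x.
Proof.
move=> cf cg x; rewrite /coproj /proj iTD//.
under eq_bigr do rewrite coefD// mulrDl.
by rewrite big_split /=; ring.
Qed.

Lemma coprojZ (c : R) f : continuous f -> forall x,
  coproj (fun x => c * f x) x = c * coproj f x.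
Proof.
move=> cf x; rewrite /coproj /proj iTZ//.
have e k : coef (fun x => c * f x) k = c * coef f k.
  rewrite /coef -iTZ; last by apply: contM => //; exact: cont_emode.
  by apply: iT_eq => y; rewrite mulrA.
under eq_bigr do rewrite e -mulrA.
by rewrite -mulr_sumr; ring.
Qed.

Lemma coproj_tpoly f : tpoly M f -> forall x, coproj f x = 0.
Proof.
elim=> [a b n nM|f1 f2 t1 c1 t2 c2] x; last first.
  by rewrite coprojD ?c1 ?c2 ?addr0//; [exact: tpoly_cont t1|exact: tpoly_cont t2].
have key k : (k < M.*2)%N -> coproj (emode k) x = 0.
  move=> kM; rewrite /coproj /proj iT_emode subr0.
  rewrite (bigD1 (Ordinal kM))//= /coef iT_emodeM eqxx mul1r big1 ?addr0 ?subrr//.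
  move=> i ik; rewrite iT_emodeM; have -> : (k == i) = false; last by rewrite mul0r.
  by apply/negbTE; apply: contra ik => /eqP h; apply/eqP/val_inj.
have csq2 : sq2 != 0 by rewrite gt_eqF // sqrtr_gt0.
have pos (b' : R) (j : nat) : (j < M)%N -> coproj (trig a b' (2 * pi * (j.+1)%:~R)) x = 0.
  move=> jM; have -> : trig a b' (2 * pi * (j.+1)%:~R) = (fun y =>
     (a / sq2) * emode j.*2 y + (b' / sq2) * emode j.*2.+1 y).
    apply/funext => y; rewrite !emodeE /cos_amp /sin_amp /= odd_double /= /freq.
    have -> : (j.*2)./2 = j by lia.
    have -> : (j.*2.+1)./2 = j by lia.
    by rewrite /trig; field.
  rewrite coprojD; try by apply: contZ; exact: cont_emode.
  by rewrite !coprojZ ?key ?mulr0 ?addr0//; try exact: cont_emode; lia.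
case: n nM => [[|j]|j] nM.
- have -> : trig a b (2 * pi * (0%N : int)%:~R) = (fun=> a) :> (R -> R).
    by apply/funext => y; rewrite /trig mulr0 mul0r cos0 sin0 mulr0 mulr1 addr0.
  rewrite /coproj /proj iT_cst subrr sub0r big1 ?oppr0// => k _.
  rewrite /coef iTZ ?iT_emode ?mulr0 ?mul0r//; exact: cont_emode.
- by apply: pos; lia.
- have -> : trig a b (2 * pi * (Negz j)%:~R) = trig a (- b) (2 * pi * (j.+1)%:~R).
    apply/funext => y; rewrite /trig NegzE mulrNz mulrN mulNr cosN sinN; ring.
  by apply: pos; lia.
Qed.

Lemma iT_projr f g : continuous f -> continuous g ->
  integralT (fun x => f x * proj g x) = \sum_(k < M.*2) coef f k * coef g k.
Proof.
move=> cf cg; rewrite (@iT_eq _ _ (fun x => \sum_(k < M.*2) coef g k * (f x * emode k x))).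
  rewrite iT_sum; last by move=> i _; apply: contZ; apply: contM => //; exact: cont_emode.
  apply: eq_bigr => k _; rewrite iTZ 1?mulrC//.
  by apply: contM => //; exact: cont_emode.
by move=> x; rewrite mulr_sumr; apply: eq_bigr => i _; ring.
Qed.

Lemma iT_proj_sym f g : continuous f -> continuous g ->
  integralT (fun x => f x * proj g x) = integralT (fun x => proj f x * g x).
Proof.
move=> cf cg; rewrite iT_projr//.
under [RHS]iT_eq do rewrite mulrC.
by rewrite iT_projr//; apply: eq_bigr => k _; rewrite mulrC.
Qed.

Lemma iT_coproj_sym f g : continuous f -> continuous g ->
  integralT (fun x => f x * coproj g x) = integralT (fun x => coproj f x * g x).
Proof.
move=> cf cg; rewrite /coproj.
rewrite (@iT_eq _ _ (fun x => f x * g x - integralT g * f x - f x * proj g x)); last by move=> x; ring.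
rewrite [RHS](@iT_eq _ _ (fun x => f x * g x - integralT f * g x - proj f x * g x)); last by move=> x; ring.
rewrite !iTB; ct; try exact: cont_proj.
by rewrite iT_proj_sym// !iTZ// (mulrC (integralT f)).
Qed.

Lemma iT_coproj_sqr f : continuous f ->
  integralT (fun x => coproj f x ^+ 2) =
  integralT (fun x => f x ^+ 2) - integralT f ^+ 2 - \sum_(k < M.*2) coef f k ^+ 2.
Proof.
move=> cf; rewrite (@iT_eq _ _ (fun x => coproj f x * coproj f x)); last by move=> x; rewrite expr2.
rewrite -iT_coproj_sym; [|by []|exact: cont_coproj].
have z : forall x, coproj (coproj f) x = coproj f x.
  move=> x; rewrite {1}/coproj.
  have -> : proj (coproj f) x = 0.
    rewrite /proj big1// => k _; have -> : coef (coproj f) k = 0; last by rewrite mul0r.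
    rewrite /coef; under iT_eq do rewrite mulrC.
    rewrite iT_coproj_sym//; last exact: cont_emode.
    rewrite -[RHS](iT_cst 0); apply: iT_eq => y; rewrite coproj_tpoly ?mul0r//.
    exact: tpoly_emode.
  have -> : integralT (coproj f) = 0; last by rewrite !subr0.
  rewrite /coproj iTB ?iTB ?iT_cst//; do ?[exact: cont_proj|exact: cont_cst|apply: contB => //].
  rewrite subrr sub0r /proj iT_sum; last by move=> i _; apply: contZ; exact: cont_emode.
  rewrite big1 ?oppr0// => i _; rewrite iTZ ?iT_emode ?mulr0//; exact: cont_emode.
rewrite (@iT_eq _ _ (fun x => f x * coproj f x)); last by move=> x; rewrite z.
rewrite /coproj (@iT_eq _ _ (fun x => f x ^+ 2 - integralT f * f x - f x * proj f x)); last by move=> x; ring.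
rewrite !iTB; ct; try exact: cont_proj.
rewrite iT_projr// iTZ// -expr2; congr (_ - _); apply: eq_bigr => k _; by rewrite expr2.
Qed.

Lemma iT_coproj_le f : continuous f ->
  integralT (fun x => coproj f x ^+ 2) <= integralT (fun x => f x ^+ 2).
Proof.
move=> cf; rewrite iT_coproj_sqr// -addrA gerDl -opprD oppr_le0 addr_ge0 ?sqr_ge0//.
by apply: sumr_ge0 => k _; exact: sqr_ge0.
Qed.

End trig_basis.

(** * The Galerkin truncation of KdV *)

Section galerkin_field.
Variables (R : realType) (M : nat).
Local Notation dr f x l := (is_derive (x : R) (1 : R) (f : R -> R) (l : R)).
Local Notation d := (M.*2).
Local Notation e := (@emode R).
Local Notation w := (freq R).
Local Notation sg := (dsign R).
Implicit Types (x z : nat -> R) (f g : R -> R).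

(** The function with coordinates x, its derivative and its mean zero
   antiderivative in coordinates. *)
Definition vf x (y : R) : R := \sum_(k < d) x k * e k y.
Definition Dx x (k : nat) : R := - (sg k * w k) * x (partner k).
Definition Ix x (k : nat) : R := sg k / w k * x (partner k).

Lemma sum_partner (F : nat -> R) : \sum_(k < d) F (partner k) = \sum_(k < d) F k.
Proof.
have h (k : 'I_d) : (partner k < d)%N by rewrite partner_ltn.
rewrite [RHS](reindex_inj (h := fun k : 'I_d => Ordinal (h k)))//.
by move=> i j [] /(congr1 partner); rewrite !partnerK => /val_inj.
Qed.

Lemma vfD x z y : vf (fun k => x k + z k) y = vf x y + vf z y.
Proof. by rewrite /vf -big_split /=; apply: eq_bigr => k _; rewrite mulrDl. Qed.
Lemma vfB x z y : vf (fun k => x k - z k) y = vf x y - vf z y.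
Proof. by rewrite /vf -sumrB; apply: eq_bigr => k _; rewrite mulrBl. Qed.
Lemma vfZ (c : R) x y : vf (fun k => c * x k) y = c * vf x y.
Proof. by rewrite /vf mulr_sumr; apply: eq_bigr => k _; rewrite mulrA. Qed.

Lemma eq_vf x z : (forall k, (k < d)%N -> x k = z k) -> vf x =1 vf z.
Proof. by move=> h y; apply: eq_bigr => k _; rewrite h. Qed.

Lemma dr_vf x y : dr (vf x) y (vf (Dx x) y).
Proof.
apply: dr_eq (@dr_sum R _ _ _ (fun (k : 'I_d) y => x k * e k y) _ y (fun k _ => drZ (x k) (dr_emode k y))) _.
rewrite /vf -(sum_partner (fun k => Dx x k * e k y)); apply: eq_bigr => k _.
by rewrite /Dx partnerK dsign_partner freq_partner; ring.
Qed.

Lemma DxIx x k : Dx (Ix x) k = x k.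
Proof.
rewrite /Dx /Ix partnerK dsign_partner freq_partner.
have h := dsign_sqr R k; have w0 : w k != 0 by rewrite gt_eqF ?freq_gt0.
transitivity ((sg k * sg k) * x k); last by rewrite h mul1r.
by field.
Qed.

Lemma DxDx x k : Dx (Dx x) k = - (w k ^+ 2 * x k).
Proof.
rewrite /Dx partnerK dsign_partner freq_partner; have h := dsign_sqr R k.
transitivity (- ((sg k * sg k) * (w k ^+ 2 * x k))); [ring|by rewrite h mul1r].
Qed.

Lemma dr_vfI x y : dr (vf (Ix x)) y (vf x y).
Proof. by apply: dr_eq (dr_vf _ _) _; apply: eq_vf => k _; exact: DxIx. Qed.

Lemma cont_vf x : continuous (vf x).
Proof. exact: dr_continuous (dr_vf x). Qed.

Lemma vf_periodic x : periodic1 (vf x).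
Proof. by move=> y; apply: eq_bigr => k _; rewrite emode_periodic. Qed.

Lemma tpoly_vf x : tpoly M (vf x).
Proof. by apply: tpoly_sum => k _; apply: tpolyZ; exact: tpoly_emode. Qed.

Lemma iT_vf x : integralT (vf x) = 0.
Proof.
rewrite /vf iT_sum; last by move=> k _; apply: contZ; exact: cont_emode.
by rewrite big1// => k _; rewrite iTZ ?iT_emode ?mulr0//; exact: cont_emode.
Qed.

Lemma iT_vfM f x : continuous f ->
  integralT (fun y => f y * vf x y) = \sum_(k < d) coef f k * x k.
Proof.
move=> cf; rewrite (@iT_eq _ _ (fun y => \sum_(k < d) x k * (f y * e k y))); last first.
  by move=> y; rewrite /vf mulr_sumr; apply: eq_bigr => k _; ring.
rewrite iT_sum; last by move=> k _; ct; exact: cont_emode.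
by apply: eq_bigr => k _; rewrite iTZ 1?mulrC//; ct; exact: cont_emode.
Qed.

Lemma coef_vf x k : (k < d)%N -> coef (vf x) k = x k.
Proof.
move=> kd; rewrite /coef; under iT_eq do rewrite mulrC.
rewrite iT_vfM; last exact: cont_emode.
rewrite (bigD1 (Ordinal kd))//= {1}/coef iT_emodeM eqxx mul1r big1 ?addr0//.
move=> i ik; rewrite {1}/coef iT_emodeM; have -> : (k == i) = false; last by rewrite mul0r.
by apply/negbTE; apply: contra ik => /eqP h; apply/eqP/val_inj.
Qed.

Lemma projE f : proj M f = vf (coef f). Proof. by []. Qed.

Lemma proj_vf x : proj M (vf x) =1 vf x.
Proof. by move=> y; rewrite projE; apply: eq_vf => k kd; exact: coef_vf. Qed.

Lemma iT_vf_vf x z : integralT (fun y => vf x y * vf z y) = \sum_(k < d) x k * z k.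
Proof.
rewrite iT_vfM; last exact: cont_vf.
by apply: eq_bigr => k _; rewrite coef_vf.
Qed.

Lemma iT_vf_sqr x : integralT (fun y => vf x y ^+ 2) = \sum_(k < d) x k ^+ 2.
Proof.
under iT_eq do rewrite expr2.
by rewrite iT_vf_vf; apply: eq_bigr => k _; rewrite expr2.
Qed.

(** Integration by parts in coordinates: Dx is antisymmetric. *)
Lemma Dx_antisym x z : \sum_(k < d) x k * Dx z k = - \sum_(k < d) Dx x k * z k.
Proof.
rewrite -(sum_partner (fun k => x k * Dx z k)) -sumrN; apply: eq_bigr => k _.
by rewrite /Dx partnerK dsign_partner freq_partner; ring.
Qed.

Lemma sum_Dx_self x : \sum_(k < d) x k * Dx x k = 0.
Proof.
have := Dx_antisym x x.
have -> : \sum_(k < d) Dx x k * x k = \sum_(k < d) x k * Dx x k.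
  by apply: eq_bigr => k _; rewrite mulrC.
by lra.
Qed.

Definition gam x (k : nat) : R := coef (fun y => vf x y ^+ 2) k.
Definition gradH x (k : nat) : R := w k ^+ 2 * x k + 3 * gam x k.
(** Galerkin truncation of KdV, as the Hamiltonian vector field d/dx (grad H) of
   H = int v_x^2 / 2 + v^3. *)
Definition kdvX x (k : nat) : R := Dx (gradH x) k.

Lemma vf_gradH x y : vf (gradH x) y = - vf (Dx (Dx x)) y + 3 * vf (gam x) y.
Proof.
rewrite -mulN1r -!vfZ -vfD; apply: eq_vf => k _; rewrite DxDx /gradH; ring.
Qed.

Lemma vf_kdvX x y :
  vf (kdvX x) y = - vf (Dx (Dx (Dx x))) y + 3 * vf (Dx (gam x)) y.
Proof.
rewrite -mulN1r -!vfZ -vfD; apply: eq_vf => k _.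
by rewrite /kdvX [in LHS]/Dx [Dx (Dx (Dx x)) k]/Dx DxDx [Dx (gam x) k]/Dx /gradH freq_partner; ring.
Qed.

Lemma vf_Ix_kdvX x y : vf (Ix (kdvX x)) y = - vf (Dx (Dx x)) y + 3 * vf (gam x) y.
Proof.
rewrite -vf_gradH; apply: eq_vf => k _.
rewrite /kdvX /Ix /Dx partnerK dsign_partner freq_partner.
have h := dsign_sqr R k; have w0 : w k != 0 by rewrite gt_eqF ?freq_gt0.
transitivity ((sg k * sg k) * gradH x k); last by rewrite h mul1r.
by field.
Qed.

Lemma kdvX_momentum x : \sum_(k < d) x k * kdvX x k = 0.
Proof.
rewrite Dx_antisym; apply/eqP; rewrite oppr_eq0; apply/eqP.
have cv := @cont_vf.
rewrite -iT_vf_vf (@iT_eq _ _ (fun y => - (vf (Dx x) y * vf (Dx (Dx x)) y) +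
   3 * (vf (Dx x) y * proj M (fun y => vf x y ^+ 2) y))); last first.
  by move=> y; rewrite vf_gradH -projE; ring.
have cx2 : continuous (fun y => vf x y ^+ 2) by apply: contX.
have cP := cont_proj (M := M) (f := fun y => vf x y ^+ 2).
rewrite iTD ?iTZ ?iT_proj_sym//; try by ct.
under [X in _ + 3 * X]iT_eq do rewrite proj_vf.
rewrite -iTZ -?iTD; try by ct.
apply: (@iT_derive_periodic _ (fun y => - (2^-1 * vf (Dx x) y ^+ 2) + vf x y ^+ 3)
  (fun y => - (vf (Dx x) y * vf (Dx (Dx x)) y) + 3 * (vf (Dx x) y * vf x y ^+ 2))).
- move=> y; have h1 := dr_vf x y; have h2 := dr_vf (Dx x) y.
  have h := drD (drN (drZ (2^-1) (drM h2 h2))) (drM h1 (drM h1 h1)).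
  under eq_fun do rewrite expr2 exprS expr2.
  by apply: dr_eq h _; field.
- by ct.
- by move=> y; rewrite !vf_periodic.
Qed.

Lemma kdvX_energy x : \sum_(k < d) gradH x k * kdvX x k = 0.
Proof. exact: sum_Dx_self. Qed.

Definition b3 (i j k : nat) : R := integralT (fun y => e i y * e j y * e k y).

Lemma gamE x k : gam x k = \sum_(i < d) \sum_(j < d) b3 i j k * (x i * x j).
Proof.
rewrite /gam /coef (@iT_eq _ _ (fun y => \sum_(i < d) \sum_(j < d) (x i * x j) * (e i y * e j y * e k y))).
  rewrite iT_sum; last by move=> i _; apply: cont_sum => j _; ct; exact: cont_emode.
  apply: eq_bigr => i _; rewrite iT_sum; last by move=> j _; ct; exact: cont_emode.
  by apply: eq_bigr => j _; rewrite iTZ 1?mulrC//; ct; exact: cont_emode.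
move=> y; rewrite /vf expr2 mulr_suml mulr_suml; apply: eq_bigr => i _.
rewrite mulr_sumr mulr_suml; apply: eq_bigr => j _; ring.
Qed.

End galerkin_field.

(** * Taylor expansion of polynomials along the Galerkin field *)

Section taylor.
Variable R : realType.
Local Notation dr f x l := (is_derive (x : R) (1 : R) (f : R -> R) (l : R)).

(** Lagrange's bound for a sequence of functions each of which is the derivative
   of the previous one. *)
Lemma taylor_tower (phi : nat -> R -> R) (h B : R) (n : nat) : 0 <= h ->
  (forall k t, 0 <= t <= h -> dr (phi k) t (phi k.+1 t)) ->
  (forall t, 0 <= t <= h -> `|phi n t| <= B) ->
  forall t, 0 <= t <= h ->
  `|phi 0%N t - \sum_(k < n) t ^+ k / k`!%:R * phi k 0| <= B * t ^+ n / n`!%:R.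
Proof.
move=> h0; elim: n phi => [|n IH] phi dphi bphi t th.
  by rewrite big_ord0 subr0 expr0 fact0 divr1 mulr1 bphi.
pose psi s := phi 0%N s - \sum_(k < n.+1) s ^+ k / k`!%:R * phi k 0.
pose psi' s := phi 1%N s - \sum_(k < n) s ^+ k / k`!%:R * phi k.+1 0.
have dX (k : nat) (s : R) : dr (fun s => s ^+ k.+1 / k.+1`!%:R) s (s ^+ k / k`!%:R).
  have h1 := drZ (k.+1`!%:R^-1) (drX k.+1 s).
  under eq_fun do rewrite mulrC.
  apply: dr_eq h1 _; rewrite /= factS natrM invfM.
  have n0 : k.+1%:R != 0 :> R by rewrite pnatr_eq0.
  have f0 : k`!%:R != 0 :> R by rewrite pnatr_eq0 -lt0n fact_gt0.
  set A : R := k.+1%:R in n0 *; set B' : R := k`!%:R in f0 *.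
  by field; apply/andP; split.
have dpsi s : 0 <= s <= h -> dr psi s (psi' s).
  move=> sh; apply: drB; first exact: dphi.
  rewrite [X in is_derive _ _ X](_ : _ = fun s => phi 0%N 0 +
      \sum_(k < n) (s ^+ k.+1 / k.+1`!%:R) * phi k.+1 0); last first.
    apply/funext => r; rewrite big_ord_recl expr0 fact0 divr1 mul1r.
    by congr (_ + _); apply: eq_bigr => k _.
  rewrite -[X in is_derive _ _ _ X]add0r; apply: (drD (dr_cst _ s)).
  apply: (@dr_sum R _ _ _ (fun (k : 'I_n) s => (s ^+ k.+1 / k.+1`!%:R) * phi k.+1 0)
     (fun k : 'I_n => s ^+ k / k`!%:R * phi k.+1 0)) => k _.
  by apply: dr_eq (drM (dX k s) (dr_cst _ _)) _; rewrite mulr0 addr0.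
have bpsi s : 0 <= s <= h -> `|psi' s| <= B * s ^+ n / n`!%:R.
  exact: (IH (fun k => phi k.+1) (fun k r rh => dphi k.+1 r rh) bphi s).
have psi0 : psi 0 = 0.
  rewrite /psi big_ord_recl expr0 fact0 divr1 mul1r big1 ?addr0 ?subrr// => k _.
  by rewrite expr0n /= !mul0r.
have B' s : dr (fun s => B * (s ^+ n.+1 / n.+1`!%:R)) s (B * s ^+ n / n`!%:R).
  by apply: dr_eq (drZ B (dX n s)) _; rewrite mulrA.
have th' s : 0 <= s <= t -> 0 <= s <= h by lra.
have t0 : 0 <= t by lra.
have z : B * (0 ^+ n.+1 / n.+1`!%:R) = 0 by rewrite expr0n /= mul0r mulr0.
rewrite -/(psi t) ler_norml -mulrA.
have H1 : 0 <= B * (t ^+ n.+1 / n.+1`!%:R) + psi t.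
  have <- : B * (0 ^+ n.+1 / n.+1`!%:R) + psi 0 = 0 by rewrite z psi0 addr0.
  apply: (@dr_nondecreasing R (fun s => B * (s ^+ n.+1 / n.+1`!%:R) + psi s)
    (fun s => B * s ^+ n / n`!%:R + psi' s) 0 t) => [s st|s st|//].
    exact: (drD (B' s) (dpsi s (th' s st))).
  by have := bpsi s (th' s st); rewrite ler_norml; lra.
have H2 : 0 <= B * (t ^+ n.+1 / n.+1`!%:R) - psi t.
  have <- : B * (0 ^+ n.+1 / n.+1`!%:R) - psi 0 = 0 by rewrite z psi0 subr0.
  apply: (@dr_nondecreasing R (fun s => B * (s ^+ n.+1 / n.+1`!%:R) - psi s)
    (fun s => B * s ^+ n / n`!%:R - psi' s) 0 t) => [s st|s st|//].
    exact: (drB (B' s) (dpsi s (th' s st))).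
  by have := bpsi s (th' s st); rewrite ler_norml; lra.
by lra.
Qed.

End taylor.

Section polynomials.
Variables (R : realType) (M : nat).
Local Notation dr f x l := (is_derive (x : R) (1 : R) (f : R -> R) (l : R)).
Local Notation d := (M.*2).
Implicit Types (F G : (nat -> R) -> R) (x : nat -> R).

(** Polynomials in x_0, ..., x_(d-1) of degree at most m whose coefficients have
   absolute values of sum at most c.  Tracking c is what makes the repeated Lie
   derivatives summable. *)
Inductive polyb : nat -> R -> ((nat -> R) -> R) -> Prop :=
| polyb_cst c : polyb 0 `|c| (fun=> c)
| polyb_x i : (i < d)%N -> polyb 1 1 (fun x => x i)
| polyb_add m c c' F G : polyb m c F -> polyb m c' G -> polyb m (c + c') (fun x => F x + G x)
| polyb_mul m m' c c' F G : polyb m c F -> polyb m' c' G ->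
    polyb (m + m') (c * c') (fun x => F x * G x)
| polyb_le m m' c c' F : (m <= m')%N -> c <= c' -> polyb m c F -> polyb m' c' F.

Lemma polyb_ge0 m c F : polyb m c F -> 0 <= c.
Proof.
elim=> // {m c F}; first by move=> *; exact: addr_ge0.
  by move=> *; exact: mulr_ge0.
by move=> m m' c c' F _ cc' _ c0; exact: le_trans c0 cc'.
Qed.

Lemma polybC m (c : R) : polyb m `|c| (fun=> c).
Proof. by apply: (@polyb_le 0 _ _ _ _ (leq0n m) (lexx _)); exact: polyb_cst. Qed.

Lemma polyb0 m : polyb m 0 (fun=> 0).
Proof. by have := polybC m 0; rewrite normr0. Qed.

Lemma polybZ m c (a : R) F : polyb m c F -> polyb m (`|a| * c) (fun x => a * F x).
Proof. by move=> pF; have := polyb_mul (polyb_cst a) pF; rewrite add0n. Qed.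

Lemma polyb_sum m (I : Type) (s : seq I) (c : I -> R) (F : I -> (nat -> R) -> R) :
  (forall i, polyb m (c i) (F i)) ->
  polyb m (\sum_(i <- s) c i) (fun x => \sum_(i <- s) F i x).
Proof.
move=> h; elim: s => [|i s IH].
  by rewrite big_nil; under eq_fun do rewrite big_nil; exact: polyb0.
rewrite big_cons (_ : (fun x => _) = fun x => F i x + \sum_(j <- s) F j x).
  exact: polyb_add.
by apply/funext => x; rewrite big_cons.
Qed.

Lemma polyb_bound m c F (r : R) x : 1 <= r -> polyb m c F ->
  (forall i, (i < d)%N -> `|x i| <= r) -> `|F x| <= c * r ^+ m.
Proof.
move=> r1 + xr; have r0 : 0 <= r by apply: le_trans r1; exact: ler01.
elim=> {m c F}.
- by move=> c; rewrite expr0 mulr1.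
- by move=> i /xr; rewrite mul1r.
- move=> m c c' F G _ h1 _ h2; rewrite mulrDl.
  by apply: le_trans (ler_normD _ _) _; exact: lerD.
- move=> m m' c c' F G _ h1 _ h2; rewrite normrM exprD mulrACA.
  by apply: ler_pM.
- move=> m m' c c' F mm' cc' pF h; apply: le_trans h _.
  have c0 := polyb_ge0 pF.
  apply: ler_pM => //; first exact: exprn_ge0.
  by rewrite ler_weXn2l.
Qed.

Lemma polyb_dep m c F x z : polyb m c F -> (forall i, (i < d)%N -> x i = z i) -> F x = F z.
Proof.
move=> + xz; elim=> {m c F} //.
  by move=> m c c' F G _ -> _ ->.
by move=> m m' c c' F G _ -> _ ->.
Qed.

Definition is_grad F (dF : nat -> (nat -> R) -> R) :=
  forall (y : R -> nat -> R) (y' : nat -> R) (t : R),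
  (forall i, (i < d)%N -> dr (y ^~ i) t (y' i)) ->
  dr (fun s => F (y s)) t (\sum_(i < d) y' i * dF i (y t)).

Lemma polyb_grad m c F : polyb m c F ->
  exists2 dF, (forall i, polyb m (m%:R * c) (dF i)) & is_grad F dF.
Proof.
elim=> {m c F}.
- move=> c; exists (fun _ _ => 0).
    by move=> i; rewrite mul0r; exact: polyb0.
  by move=> y y' t _; rewrite big1; [exact: dr_cst|by move=> i _; rewrite mulr0].
- move=> i id; exists (fun j _ => (j == i)%:R).
    move=> j; rewrite mul1r; apply: (polyb_le (leqnn _)) (polybC 1 (j == i)%:R).
    by case: (j == i); rewrite ?normr1 ?normr0 ?ler01.
  move=> y y' t hy; rewrite (bigD1 (Ordinal id))//= eqxx mulr1 big1 ?addr0; first exact: hy.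
  move=> j ji; have -> : (val j == i) = false; last by rewrite mulr0.
  by apply/negbTE; apply: contra ji => /eqP h; apply/eqP/val_inj.
- move=> m c c' F G _ [dF pF gF] _ [dG pG gG].
  exists (fun i x => dF i x + dG i x); first by move=> i; rewrite mulrDr; exact: polyb_add.
  move=> y y' t hy; apply: dr_eq (drD (gF _ _ _ hy) (gG _ _ _ hy)) _.
  by rewrite -big_split; apply: eq_bigr => i _; rewrite mulrDr.
- move=> m m' c c' F G pF0 [dF pF gF] pG0 [dG pG gG].
  exists (fun i x => dF i x * G x + F x * dG i x).
    move=> i; have h1 := polyb_mul (pF i) pG0; have h2 := polyb_mul pF0 (pG i).
    apply: polyb_le (polyb_add h1 h2) => //.
    by rewrite natrD; apply: eq_ler; ring.
  move=> y y' t hy; apply: dr_eq (drM (gF _ _ _ hy) (gG _ _ _ hy)) _.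
  by rewrite mulr_suml mulr_sumr -big_split; apply: eq_bigr => i _ /=; ring.
- move=> m m' c c' F mm' cc' pF0 [dF pF gF]; exists dF => // i.
  apply: polyb_le (pF i) => //; apply: ler_pM => //; first exact: polyb_ge0 pF0.
  by rewrite ler_nat.
Qed.

Definition normX (k : nat) : R :=
  freq R k * (freq R k ^+ 2 + 3 * \sum_(i < d) \sum_(j < d) `|b3 R i j (partner k)|).
(** The field is at most aX r^2 where no coordinate exceeds r >= 1, and aX times the degree
   bounds the growth of coefficients under one Lie derivative. *)
Definition aX : R := 1 + \sum_(k < d) normX k.

Lemma normX_ge0 k : 0 <= normX k.
Proof.
apply: mulr_ge0; first exact: ltW (freq_gt0 _ _).
apply: addr_ge0; first exact: sqr_ge0.
apply: mulr_ge0 => //.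
by apply: sumr_ge0 => i _; apply: sumr_ge0.
Qed.

Lemma aX_ge1 : 1 <= aX.
Proof. by rewrite lerDl; apply: sumr_ge0 => k _; exact: normX_ge0. Qed.

Lemma polyb_kdvX k : (k < d)%N -> polyb 2 (normX k) (fun x => kdvX M x k).
Proof.
move=> kd.
have h1 : polyb 1 1 (fun x => x (partner k)) by apply: polyb_x; rewrite partner_ltn.
have h2 : polyb 2 (\sum_(i < d) \sum_(j < d) `|b3 R i j (partner k)|)
    (fun x => gam M x (partner k)).
  have -> : (fun x => gam M x (partner k)) =
      fun x => \sum_(i < d) \sum_(j < d) b3 R i j (partner k) * (x i * x j).
    by apply/funext => x; exact: gamE.
  apply: polyb_sum => i; apply: polyb_sum => j.
  rewrite -[X in polyb _ X]mulr1; apply: polybZ.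
  by rewrite -[X in polyb _ X]mulr1; apply: (polyb_mul (polyb_x (ltn_ord i)) (polyb_x (ltn_ord j))).
have h3 := polybZ (- (dsign R k * freq R k)) (polyb_add (polybZ (freq R k ^+ 2)
    (polyb_le (isT : (1 <= 2)%N) (lexx _) h1)) (polybZ 3 h2)).
have -> : (fun x => kdvX M x k) = (fun x => - (dsign R k * freq R k) *
   (freq R k ^+ 2 * x (partner k) + 3 * gam M x (partner k))).
  by apply/funext => x; rewrite /kdvX /Dx /gradH freq_partner.
apply: polyb_le h3 => //; rewrite /normX normrN normrM (ger0_norm (ltW (freq_gt0 _ _))).
rewrite (ger0_norm (sqr_ge0 _)) mulr1 (ger0_norm (ler0n _ 3)).
have -> : `|dsign R k| = 1 by rewrite /dsign; case: ifP; rewrite ?normrN1 ?normr1.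
by rewrite mul1r.
Qed.

(** The components of the gradient are asked to be polynomials so that they can
   be integrated against the Gibbs density. *)
Definition is_lie F G := exists dF, [/\ forall i, exists m c, polyb m c (dF i),
  is_grad F dF & G = fun x => \sum_(i < d) kdvX M x i * dF i x].

Lemma polyb_lie m c F : polyb m c F ->
  exists2 G, is_lie F G & polyb m.+2 (aX * (m%:R * c)) G.
Proof.
move=> pF; have c0 := polyb_ge0 pF; have [dF pdF gF] := polyb_grad pF.
exists (fun x => \sum_(i < d) kdvX M x i * dF i x).
  by exists dF; split => // i; exists m, (m%:R * c).
have h : polyb m.+2 (\sum_(i < d) normX i * (m%:R * c)) (fun x => \sum_(i < d) kdvX M x i * dF i x).
  apply: polyb_sum => i; exact: (polyb_mul (polyb_kdvX (ltn_ord i)) (pdF i)).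
apply: polyb_le h => //; rewrite -mulr_suml ler_wpM2r ?mulr_ge0//.
by rewrite /aX lerDr ler01.
Qed.

(** Each Lie derivative raises the degree by 2 and multiplies the coefficient
   bound by aX times the degree; the product m (m + 2) (m + 4) ... is at most
   2^(m + 2 k) k!, and Taylor's formula divides by k!. *)
Lemma polyb_lie_tower m c F : polyb m c F -> exists Fs : nat -> (nat -> R) -> R,
  [/\ Fs 0%N = F, forall k, is_lie (Fs k) (Fs k.+1) &
   forall k, polyb (m + k.*2) (c * aX ^+ k * (2 ^+ (m + k.*2) * k`!%:R)) (Fs k)].
Proof.
move=> pF; have c0 := polyb_ge0 pF.
have a0 : 0 <= aX by apply: le_trans aX_ge1; exact: ler01.
have /choice[next hn] : forall p : nat * R * ((nat -> R) -> R), exists G,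
     polyb p.1.1 p.1.2 p.2 ->
     is_lie p.2 G /\ polyb p.1.1.+2 (aX * (p.1.1%:R * p.1.2)) G.
  move=> [[m' c'] F'] /=.
  have [p|np] := pselect (polyb m' c' F'); last by exists (fun=> 0) => /np.
  by have [G l pG] := polyb_lie p; exists G.
pose st (p : nat * R * ((nat -> R) -> R)) := (p.1.1.+2, aX * (p.1.1%:R * p.1.2), next p).
pose P k := iter k st (m, c, F).
have hP k : polyb (P k).1.1 (P k).1.2 (P k).2.
  by elim: k => [//|k IH] /=; have [] := hn (P k) IH.
have hm k : (P k).1.1 = (m + k.*2)%N.
  by elim: k => [|k IH] /=; rewrite ?addn0 // IH; lia.
have hc k : (P k).1.2 <= c * aX ^+ k * (2 ^+ k * ((m + k) ^_ k)%:R).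
  elim: k => [|k IH] /=; first by rewrite !expr0 ffactn0 !mulr1.
  rewrite hm addnS ffactSS exprS exprS natrM.
  apply: (@le_trans _ _ (aX * ((m + k.*2)%:R * (c * aX ^+ k * (2 ^+ k * ((m + k) ^_ k)%:R))))).
    by rewrite !ler_wpM2l.
  set A := aX ^+ k; set B := 2 ^+ k; set C : R := ((m + k) ^_ k)%:R.
  have A0 : 0 <= A by exact: exprn_ge0.
  have B0 : 0 <= B by exact: exprn_ge0.
  rewrite (_ : c * (aX * A) * (2 * B * ((m + k).+1%:R * C)) =
     aX * ((2 * (m + k).+1%:R) * (c * A * (B * C)))); last by ring.
  rewrite ler_wpM2l// ler_wpM2r ?mulr_ge0//.
  by rewrite -[2]/(2%:R) -natrM ler_nat; lia.
exists (fun k => (P k).2); split => // k; first by have [] := hn (P k) (hP k).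
apply: (@polyb_le (P k).1.1 _ (P k).1.2); [by rewrite hm| |exact: hP].
apply: le_trans (hc k) _; rewrite ler_wpM2l ?mulr_ge0 ?exprn_ge0//.
rewrite -bin_ffact natrM mulrA ler_wpM2r// -addnn addnA exprD mulrC ler_wpM2r ?exprn_ge0//.
rewrite -natrX ler_nat.
have := expnDn 1 1 (m + k); rewrite addn1 => ->.
have kk : (k < (m + k).+1)%N by lia.
by rewrite (bigD1 (Ordinal kk))//= !exp1n !muln1 leq_addr.
Qed.

Lemma taylor_along m c F (Fs : nat -> (nat -> R) -> R) (y : R -> nat -> R) (h r : R) :
  1 <= r -> 0 <= h -> polyb m c F -> Fs 0%N = F ->
  (forall k, is_lie (Fs k) (Fs k.+1)) ->
  (forall k, polyb (m + k.*2) (c * aX ^+ k * (2 ^+ (m + k.*2) * k`!%:R)) (Fs k)) ->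
  (forall t i, 0 <= t <= h -> (i < d)%N -> `|y t i| <= r) ->
  (forall t i, 0 <= t <= h -> (i < d)%N -> dr (y ^~ i) t (kdvX M (y t) i)) ->
  forall n, `|F (y h) - \sum_(k < n) h ^+ k / k`!%:R * Fs k (y 0)| <=
     c * (2 * r) ^+ m * (4 * aX * r ^+ 2 * h) ^+ n.
Proof.
move=> r1 h0 pF F0 lF pFs yr dy n.
have dphi k t : 0 <= t <= h -> dr (fun t => Fs k (y t)) t (Fs k.+1 (y t)).
  move=> th; have [dF [_ gF ->]] := lF k.
  by apply: gF => i id; exact: dy.
have hh : 0 <= h <= h by rewrite h0 lexx.
have := taylor_tower h0 dphi (B := c * aX ^+ n * (2 ^+ (m + n.*2) * n`!%:R) * r ^+ (m + n.*2))
  (n := n) _ hh.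
rewrite F0 => /(_ _)/le_trans; apply.
  move=> t th; apply: polyb_bound (pFs n) _ => // i id; exact: yr.
have f0 : n`!%:R != 0 :> R by rewrite pnatr_eq0 -lt0n fact_gt0.
have e2 : (2 : R) ^+ n.*2 = 4 ^+ n by rewrite -muln2 mulnC exprM; congr (_ ^+ _); ring.
rewrite !exprMn !exprD e2 -[r ^+ n.*2](_ : (r ^+ 2) ^+ n = _); last by rewrite -exprM mul2n.
rewrite !expr2 !exprMn; by apply: eq_ler; field.
Qed.

End polynomials.

(** * Short time solutions of the Galerkin system *)

Section limits.
Variable R : realType.
Local Notation dr f x l := (is_derive (x : R) (1 : R) (f : R -> R) (l : R)).

(** u_n - 2 C 2^-n increases and u_n + 2 C 2^-n decreases. *)
Lemma geometric_cvg (u : nat -> R) (C : R) : 0 <= C ->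
  (forall n, `|u n.+1 - u n| <= C * 2^-1 ^+ n) ->
  exists2 l, u @ \oo --> l & forall n, `|l - u n| <= 2 * C * 2^-1 ^+ n.
Proof.
move=> C0 hu; pose q n : R := 2 * C * 2^-1 ^+ n.
have qS n : q n.+1 = q n - C * 2^-1 ^+ n by rewrite /q exprS; field.
have q0 n : 0 <= q n by rewrite /q !mulr_ge0// exprn_ge0// invr_ge0.
have inc : nondecreasing_seq (fun n => u n - q n).
  apply/nondecreasing_seqP => n; rewrite qS.
  by have := hu n; rewrite ler_norml; lra.
have dec : nonincreasing_seq (fun n => u n + q n).
  apply/nonincreasing_seqP => n; rewrite qS.
  by have := hu n; rewrite ler_norml; lra.
have ub : has_ubound (range (fun n => u n - q n)).
  exists (u 0%N + q 0%N) => _ [n _ <-].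
  apply: le_trans (dec 0%N n (leq0n n)); have := q0 n; lra.
have cq : q @ \oo --> 0.
  rewrite /q -[X in _ --> X](mulr0 (2 * C)); apply: cvgMr.
  by apply: cvg_expr; rewrite ger0_norm; lra.
have cl := nondecreasing_is_cvgn inc ub.
set l := limn (fun n => u n - q n) in cl.
have ul : u @ \oo --> l.
  have -> : u = (fun n => (u n - q n) + q n) by apply/funext => n; rewrite subrK.
  by rewrite -[l]addr0; apply: cvgD.
exists l => // n; rewrite ler_norml; apply/andP; split.
  have h : u n - q n <= l by apply: nondecreasing_cvgn_le.
  rewrite -/(q n); lra.
have ul2 : (fun n => u n + q n) @ \oo --> l by rewrite -[l]addr0; apply: cvgD.
have h : limn (fun n => u n + q n) <= u n + q n.
  by apply: nonincreasing_cvgn_ge => //; apply/cvg_ex; exists l.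
rewrite (cvg_lim _ ul2)// in h; rewrite -/(q n); lra.
Qed.

(** Base point -1, so that the primitive is differentiable at 0 and after. *)
Definition prim (f : R -> R) (t : R) : R :=
  Rintegral lebesgue_measure `[-1, t] f - Rintegral lebesgue_measure `[-1, 0] f.

Lemma prim0 f : prim f 0 = 0. Proof. by rewrite /prim subrr. Qed.

Implicit Types f g : R -> R.

Lemma dr_prim f (t : R) : continuous f -> -1 < t -> dr (prim f) t (f t).
Proof.
move=> cf t1.
have [] := @continuous_FTC1_closed R f (-1) t (t + 1).
- by rewrite ltrDl.
- apply: continuous_compact_integrable; first exact: segment_compact.
  exact: cont_within.
- exact: t1.
- exact: cf.
move=> d1 d2.
have d3 : dr (fun x => Rintegral lebesgue_measure `[-1, x] f) t (f t).
  by split; [exact: d1|rewrite -derive1E].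
by apply: dr_eq (drB d3 (dr_cst (Rintegral lebesgue_measure `[-1, 0] f) t)) _; rewrite subr0.
Qed.

Lemma prim_dist f g (t C : R) : continuous f -> continuous g -> 0 <= t ->
  (forall s, 0 <= s <= t -> `|f s - g s| <= C) -> `|prim f t - prim g t| <= C * t.
Proof.
move=> cf cg t0 h.
have := @dr_lip R (fun s => prim f s - prim g s) (fun s => f s - g s) 0 t C _ h t0.
rewrite !prim0 !subr0; apply => s /andP[s0 _].
by apply: drB; apply: dr_prim => //; lra.
Qed.

Lemma prim_bound f (t C : R) : continuous f -> 0 <= t ->
  (forall s, 0 <= s <= t -> `|f s| <= C) -> `|prim f t| <= C * t.
Proof.
move=> cf t0 h.
have := @dr_lip R (prim f) f 0 t C _ h t0.
rewrite prim0 !subr0; apply => s /andP[s0 _].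
by apply: dr_prim => //; lra.
Qed.

Definition clampt (h s : R) : R := Num.max 0 (Num.min h s).

Lemma clampt_in h s : 0 <= h -> 0 <= clampt h s <= h.
Proof.
by move=> h0; rewrite /clampt le_max lexx /= ge_max h0 ge_min lexx.
Qed.

Lemma clampt_id h s : 0 <= s <= h -> clampt h s = s.
Proof.
by move=> /andP[s0 sh]; rewrite /clampt min_r// max_r.
Qed.

Lemma cont_clampt h : continuous (clampt h).
Proof.
move=> s; apply: continuous_max; first exact: cvg_cst.
by apply: continuous_min; [exact: cvg_cst|exact: cvg_id].
Qed.

Lemma unif_cont_limit (z : nat -> R -> R) (y : R -> R) (C : R) :
  (forall n, continuous (z n)) ->
  (forall n s, `|y s - z n s| <= C * 2^-1 ^+ n) -> continuous y.
Proof.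
move=> cz hz s; apply/cvgrPdist_lt => eps eps0.
have cq : (fun n => C * 2^-1 ^+ n) @ \oo --> (0 : R).
  rewrite -[X in _ --> X](mulr0 C); apply: cvgMr.
  by apply: cvg_expr; rewrite ger0_norm; lra.
have e3 : 0 < eps / 3 by rewrite divr_gt0.
have [N _ hN] : \forall n \near \oo, `|0 - C * 2^-1 ^+ n| < eps / 3.
  by move/cvgrPdist_lt : cq => /(_ _ e3).
have {hN} := hN N (leqnn N); rewrite sub0r normrN => hN.
have hN' : C * 2^-1 ^+ N < eps / 3 by apply: le_lt_trans (ler_norm _) hN.
have := cz N s => /cvgrPdist_lt /(_ _ e3); apply: filterS => r hr.
rewrite (_ : y s - y r = (y s - z N s) + (z N s - z N r) - (y r - z N r)); last by ring.
have := hz N s; have := hz N r.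
have := ler_normB (y s - z N s + (z N s - z N r)) (y r - z N r).
have := ler_normD (y s - z N s) (z N s - z N r).
lra.
Qed.

End limits.

Section picard.
Variables (R : realType) (M : nat).
Local Notation dr f x l := (is_derive (x : R) (1 : R) (f : R -> R) (l : R)).
Local Notation d := (M.*2).
Local Notation aX := (aX R M).
Local Notation X := (@kdvX R M).

Lemma normX_le k : (k < d)%N -> normX R M k <= aX.
Proof.
move=> kd; rewrite /aX (bigD1 (Ordinal kd))//=.
have : 0 <= \sum_(i < d | i != Ordinal kd) normX R M i.
  by apply: sumr_ge0 => i _; exact: normX_ge0.
have := normX_ge0 R M k; lra.
Qed.

Lemma kdvX_bound (r : R) (x : nat -> R) k : 1 <= r -> (k < d)%N ->
  (forall i, (i < d)%N -> `|x i| <= r) -> `|X x k| <= aX * r ^+ 2.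
Proof.
move=> r1 kd xr; apply: le_trans (polyb_bound r1 (polyb_kdvX _ kd) xr) _.
by rewrite ler_wpM2r ?sqr_ge0// normX_le.
Qed.

Lemma kdvX_lip (r D : R) (x z : nat -> R) k : 1 <= r -> (k < d)%N ->
  (forall i, (i < d)%N -> `|x i| <= r) -> (forall i, (i < d)%N -> `|z i| <= r) ->
  (forall i, (i < d)%N -> `|x i - z i| <= D) ->
  `|X x k - X z k| <= aX * (2 * r * D).
Proof.
move=> r1 kd xr zr xzD.
have pd : (partner k < d)%N by rewrite partner_ltn.
have D0 : 0 <= D by apply: le_trans (normr_ge0 _) (xzD k kd).
apply: (@le_trans _ _ (normX R M k * (2 * r * D))); last first.
  by rewrite ler_wpM2r ?normX_le// !mulr_ge0//; lra.
have -> : X x k - X z k = - (dsign R k * freq R k) *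
   (freq R k ^+ 2 * (x (partner k) - z (partner k)) + 3 * (gam M x (partner k) - gam M z (partner k))).
  by rewrite /kdvX /Dx /gradH freq_partner; ring.
have -> : gam M x (partner k) - gam M z (partner k) =
   \sum_(i < d) \sum_(j < d) b3 R i j (partner k) * (x i * x j - z i * z j).
  rewrite !gamE -sumrB; apply: eq_bigr => i _; rewrite -sumrB; apply: eq_bigr => j _; ring.
rewrite normrM normrN normrM (ger0_norm (ltW (freq_gt0 _ _))).
have -> : `|dsign R k| = 1 by rewrite /dsign; case: ifP; rewrite ?normrN1 ?normr1.
rewrite mul1r /normX -mulrA ler_wpM2l//; first exact: ltW (freq_gt0 _ _).
rewrite [X in _ <= X]mulrDl; apply: le_trans (ler_normD _ _) _; apply: lerD.
  rewrite normrM (ger0_norm (sqr_ge0 _)) ler_wpM2l ?sqr_ge0//.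
  by apply: le_trans (xzD _ pd) _; nra.
rewrite normrM (ger0_norm (ler0n _ 3)) -[3 * _ * _]mulrA ler_wpM2l ?ler0n//.
apply: le_trans (ler_norm_sum _ _ _) _; rewrite mulr_suml; apply: ler_sum => i _.
apply: le_trans (ler_norm_sum _ _ _) _; rewrite mulr_suml; apply: ler_sum => j _.
rewrite normrM ler_wpM2l//.
have -> : x i * x j - z i * z j = (x i - z i) * x j + z i * (x j - z j) by ring.
apply: le_trans (ler_normD _ _) _; rewrite !normrM.
have h1 : `|x i - z i| * `|x j| <= D * r by apply: ler_pM => //; [exact: xzD|exact: xr].
have h2 : `|z i| * `|x j - z j| <= r * D by apply: ler_pM => //; [exact: zr|exact: xzD].
lra.
Qed.

Lemma cont_kdvX (y : R -> nat -> R) k : (k < d)%N -> (forall i, continuous (y ^~ i)) ->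
  continuous (fun s => X (y s) k).
Proof.
move=> kd cy.
have H m c F : polyb M m c F -> continuous (fun s => F (y s)).
  elim=> {m c F} //.
  - by move=> c; exact: cont_cst.
  - by move=> m c c' F G _ h1 _ h2; exact: contD.
  - by move=> m m' c c' F G _ h1 _ h2; exact: contM.
exact: H (polyb_kdvX R kd).
Qed.

(** Picard iteration, the time being stopped at 0 and h so that the iterates are
   defined everywhere; 8 aX r h <= 1 makes the integral operator a contraction
   of factor 1/2.  The solution is extended beyond h so as to be defined and C^1
   on ]-1, +oo[. *)
Lemma galerkin_local (r h : R) (x : nat -> R) : 1 <= r -> 0 < h -> 8 * aX * r * h <= 1 ->
  (forall i, (i < d)%N -> `|x i| <= r) ->
  exists y Y : R -> nat -> R, [/\ forall i t, -1 < t -> dr (y ^~ i) t (Y t i),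
    forall i, continuous (Y ^~ i), forall i, y 0 i = x i,
    forall t i, 0 <= t <= h -> (i < d)%N -> `|y t i| <= 2 * r &
    forall t i, 0 <= t <= h -> (i < d)%N -> Y t i = X (y t) i].
Proof.
move=> r1 h0 hh xr.
have a1 := @aX_ge1 R M.
have h0' : 0 <= h by exact: ltW.
pose T (z : R -> nat -> R) (t : R) (i : nat) :=
  if (i < d)%N then x i + prim (fun s => X (z s) i) (clampt h t) else x i.
pose z n := iter n T (fun _ => x).
pose good (z : R -> nat -> R) := (forall i, continuous (z ^~ i)) /\
   (forall s i, (i < d)%N -> `|z s i - x i| <= r).
have goodb z' : good z' -> forall s i, (i < d)%N -> `|z' s i| <= 2 * r.
  move=> [_ b] s i id; have := b s i id; have := xr i id.
  have := ler_normD (z' s i - x i) (x i); rewrite subrK; lra.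
have r2 : 1 <= 2 * r by lra.
have goodT z' : good z' -> good (T z').
  move=> gz; have [cz bz] := gz; split=> [i|s i id]; rewrite /T.
    case id : (i < d)%N; last exact: cont_cst.
    apply: contD; first exact: cont_cst.
    move=> s; apply: (@continuous_comp _ _ _ (clampt h) (prim _)); first exact: cont_clampt.
    have /andP[c0 _] := clampt_in s h0'.
    by apply: dr_cont (dr_prim _ _); [exact: cont_kdvX|lra].
  rewrite id addrC addKr.
  have /andP[c0 c1] := clampt_in s h0'.
  apply: le_trans (prim_bound (C := aX * (2 * r) ^+ 2) _ c0 _) _.
  - exact: cont_kdvX.
  - by move=> q _; apply: kdvX_bound => // j jd; exact: goodb.
  - apply: (@le_trans _ _ (aX * (2 * r) ^+ 2 * h)).
      by rewrite ler_wpM2l// mulr_ge0 ?sqr_ge0//; lra.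
    rewrite (_ : aX * (2 * r) ^+ 2 * h = (8 * aX * r * h) * (r / 2)); last by field.
    by nra.
have goodz n : good (z n).
  elim: n => [|n IH]; last exact: goodT.
  by split=> [i|s i _]; [exact: cont_cst|rewrite subrr normr0; lra].
have contr z1 z2 (D : R) : good z1 -> good z2 ->
    (forall s i, (i < d)%N -> `|z1 s i - z2 s i| <= D) ->
    forall s i, (i < d)%N -> `|T z1 s i - T z2 s i| <= D / 2.
  move=> g1 g2 hD s i id; rewrite /T id.
  have D0 : 0 <= D by apply: le_trans (normr_ge0 _) (hD 0 i id).
  rewrite opprD addrACA subrr add0r.
  have /andP[c0 c1] := clampt_in s h0'.
  apply: le_trans (prim_dist (C := aX * (2 * (2 * r) * D)) _ _ c0 _) _.
  - by apply: cont_kdvX => //; have [] := g1.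
  - by apply: cont_kdvX => //; have [] := g2.
  - move=> q _; apply: kdvX_lip => // j jd; [exact: goodb|exact: goodb|exact: hD].
  - apply: (@le_trans _ _ (aX * (2 * (2 * r) * D) * h)).
      by rewrite ler_wpM2l// !mulr_ge0//; lra.
    rewrite (_ : aX * (2 * (2 * r) * D) * h = (8 * aX * r * h) * (D / 2)); last by field.
    by nra.
have dz n s i : (i < d)%N -> `|z n.+1 s i - z n s i| <= r * 2^-1 ^+ n.
  elim: n s i => [|n IH] s i id.
    by rewrite expr0 mulr1; have [_] := goodz 1%N; exact.
  apply: le_trans (contr (z n.+1) (z n) (r * 2^-1 ^+ n) (goodz _) (goodz _) IH s i id) _.
  by rewrite exprS; apply: eq_ler; field.
have zout n s i : (i < d)%N = false -> z n s i = x i.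
  by case: n => [//|n] id; rewrite /z /= /T id.
have r0 : 0 <= r by lra.
have [y hy] : exists y : R -> nat -> R, forall s i,
    `|y s i - y s i| = 0 /\ forall n, `|y s i - z n s i| <= 2 * r * 2^-1 ^+ n.
  have /choice[f hf] : forall p : R * nat, exists l : R, forall n, `|l - z n p.1 p.2| <= 2 * r * 2^-1 ^+ n.
    move=> [s i] /=; case: (boolP (i < d)%N) => [id|/negbTE id].
      by have [l _ hl] := geometric_cvg r0 (fun n => dz n s i id); exists l.
    exists (x i) => n; rewrite zout// subrr normr0 !mulr_ge0// exprn_ge0// invr_ge0//.
  by exists (fun s i => f (s, i)) => s i; split; [rewrite subrr normr0|exact: hf].
have {}hy s i n : `|y s i - z n s i| <= 2 * r * 2^-1 ^+ n by have [_] := hy s i.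
have cy i : continuous (y ^~ i).
  apply: (@unif_cont_limit R (fun n s => z n s i) _ (2 * r)) => [n|n s].
    by have [] := goodz n.
  exact: hy.
have small (a b C : R) : (forall n, `|a - b| <= C * 2^-1 ^+ n) -> a = b.
  move=> H; apply/eqP; rewrite -subr_eq0 -normr_le0.
  have cq : (fun n => C * 2^-1 ^+ n) @ \oo --> (0 : R).
    rewrite -[X in _ --> X](mulr0 C); apply: cvgMr.
    by apply: cvg_expr; rewrite ger0_norm; lra.
  rewrite -(cvg_lim _ cq)//; apply: limr_ge; first by apply/cvg_ex; exists 0.
  exact: nearW.
have gy : good y.
  split => // s i id.
  have H n : `|y s i - x i| <= r + 2 * r * 2^-1 ^+ n.
    have := ler_normD (y s i - z n s i) (z n s i - x i); rewrite addrA subrK => /le_trans; apply.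
    by have [_ b] := goodz n; have := b s i id; have := hy s i n; lra.
  have cq : (fun n => r + 2 * r * 2^-1 ^+ n) @ \oo --> r.
    rewrite -[X in _ --> X]addr0; apply: cvgD; first exact: cvg_cst.
    rewrite -[X in _ --> X](mulr0 (2 * r)); apply: cvgMr.
    by apply: cvg_expr; rewrite ger0_norm; lra.
  rewrite -(cvg_lim _ cq)//; apply: limr_ge; first by apply/cvg_ex; exists r.
  exact: nearW.
have yT s i : (i < d)%N -> y s i = T y s i.
  move=> id; apply: (small _ _ (2 * r)) => n.
  have h1 := hy s i n.+1.
  have h2 := contr (z n) y _ (goodz n) gy (fun s i id => _ : `|z n s i - y s i| <= 2 * r * 2^-1 ^+ n) s i id.
  have {}h2 : `|T (z n) s i - T y s i| <= 2 * r * 2^-1 ^+ n / 2.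
    by apply: h2 => s' i'; rewrite distrC; exact: hy.
  have := ler_normD (y s i - z n.+1 s i) (z n.+1 s i - T y s i); rewrite addrA subrK => /le_trans; apply.
  by apply: le_trans (lerD h1 h2) _; rewrite exprS; apply: eq_ler; field.
pose Y s i := if (i < d)%N then X (y s) i else 0.
exists (fun t i => x i + prim (Y ^~ i) t), Y.
have cY i : continuous (Y ^~ i).
  by rewrite /Y; case id : (i < d)%N; [exact: cont_kdvX|exact: cont_cst].
have ey t i : 0 <= t <= h -> (i < d)%N -> x i + prim (Y^~ i) t = y t i.
  by move=> th id; rewrite yT// /T id clampt_id// /Y id.
split.
- by move=> i t t1; apply: dr_eq (drD (dr_cst (x i) t) (dr_prim (cY i) t1)) _; rewrite add0r.
- exact: cY.
- by move=> i; rewrite prim0 addr0.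
- by move=> t i th id; rewrite ey//; exact: goodb.
- move=> t i th id; rewrite {1}/Y id.
  apply: (polyb_dep (polyb_kdvX R id)) => j jd; by rewrite ey.
Qed.

(** The field is orthogonal to the position (kdvX_momentum), so that a step
   chosen for a ball can be iterated forever. *)
Lemma galerkin_conserved (h : R) (y : R -> nat -> R) : 0 <= h ->
  (forall t i, 0 <= t <= h -> (i < d)%N -> dr (y ^~ i) t (X (y t) i)) ->
  forall t, 0 <= t <= h -> \sum_(i < d) y t i ^+ 2 = \sum_(i < d) y 0 i ^+ 2.
Proof.
move=> h0 dy t th.
have dS s : 0 <= s <= t -> dr (fun s => \sum_(i < d) y s i ^+ 2) s 0.
  move=> st; have sh : 0 <= s <= h by lra.
  apply: dr_eq (@dr_sum R _ _ _ (fun (i : 'I_d) s => y s i ^+ 2) (fun i : 'I_d => 2 * (y s i * X (y s) i)) s _) _.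
    move=> i _; under eq_fun do rewrite expr2.
    have hd := dy s i sh (ltn_ord i).
    by apply: dr_eq (drM hd hd) _; ring.
  by rewrite -mulr_sumr kdvX_momentum mulr0.
have t0 : 0 <= t by lra.
have := @dr_lip R _ (fun=> 0) 0 t 0 dS _ t0.
rewrite mul0r => H; apply/eqP; rewrite -subr_eq0 -normr_le0; apply: H => s _; by rewrite normr0.
Qed.

End picard.

(** * Smooth solutions of KdV and their antiderivatives *)

Section periodic_primitive.
Variable R : realType.
Local Notation dr f x l := (is_derive (x : R) (1 : R) (f : R -> R) (l : R)).
Implicit Types f g : R -> R.

Lemma for_cont_comp (X Y Z : topologicalType) (f : X -> Y) (g : Y -> Z) (x : X) :
  f y @[y --> x] --> f x -> {for f x, continuous g} -> {for x, continuous (fun y => g (f y))}.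
Proof. by move=> cf cg; exact: (@continuous_comp _ _ _ f g). Qed.

Lemma cont_shift f (x : R) : continuous f -> continuous (fun y => f (x + y)).
Proof.
move=> cf y; apply: (@continuous_comp _ _ _ (fun y => x + y) f); last exact: cf.
by apply: cvgD; [exact: cvg_cst|exact: cvg_id].
Qed.

Lemma dr_shift f (f' x y : R) : dr f (x + y) f' -> dr (fun y => f (x + y)) y f'.
Proof.
move=> df; apply: dr_eq (dr_comp (drD (dr_cst x y) (dr_id y)) df) _.
by rewrite add0r mulr1.
Qed.

Lemma dr_periodic f f' : periodic1 f -> (forall x : R, dr f x (f' x)) -> periodic1 f'.
Proof.
move=> pf df x; apply: (@dr_uniq R f x _ _ _ (df x)).
have h : dr (fun y => f (1 + y)) x (f' (1 + x)) by apply: dr_shift; exact: df.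
have e : (fun y => f (1 + y)) = f by apply/funext => y; rewrite addrC pf.
by rewrite e addrC in h.
Qed.

Lemma cont_joint_add f : continuous f -> continuous (fun p : R * R => f (p.1 + p.2)).
Proof.
move=> cf p; apply: (@continuous_comp _ _ _ (fun p : R * R => p.1 + p.2) f); last exact: cf.
exact: add_continuous.
Qed.

Lemma iT_shift f f' (x : R) : (forall x : R, dr f x (f' x)) -> continuous f' -> periodic1 f ->
  integralT (fun y => f (x + y)) = integralT f.
Proof.
move=> df cf' pf.
have H (a : R) : dr (fun x => integralT (fun y => f (x + y))) a 0.
  have -> : 0 = integralT (fun y => f' (a + y)).
    rewrite (iT_FTC (fun y => dr_shift (df (a + y))) (cont_shift (x := a) cf')).
    by rewrite pf addr0 subrr.
  apply: (@iT_dr_under R (a - 1) (a + 1) (fun x y => f (x + y)) (fun x y => f' (x + y))).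
  - by rewrite ltrBlDr ltrDl ltr01.
  - move=> t y _; have := @dr_shift f (f' (y + t)) y t (df _).
    by rewrite [y + t]addrC; under eq_fun do rewrite addrC.
  - by move=> t _; apply: cont_shift; exact: dr_continuous df.
  - exact: cont_shift.
  - by move=> y; exact: cont_joint_add.
by rewrite (dr_zero_cst H x 0); apply: iT_eq => y; rewrite add0r.
Qed.

(** Integration by parts against the sawtooth y recovers a periodic function,
   up to its mean, from its derivative. *)
Lemma iT_sawtooth f f' (x : R) : (forall x : R, dr f x (f' x)) -> continuous f' -> periodic1 f ->
  integralT (fun y => y * f' (x + y)) = f x - integralT f.
Proof.
move=> df cf' pf; rewrite -(iT_shift x df cf' pf).
have cf : continuous f := dr_continuous df.
have cid : continuous (fun y : R => y) by move=> y; exact: cvg_id.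
have c1 := cont_shift (x := x) cf; have c2 := cont_shift (x := x) cf'.
have D (y : R) : dr (fun y => y * f (x + y)) y (f (x + y) + y * f' (x + y)).
  by apply: dr_eq (drM (dr_id y) (dr_shift (df (x + y)))) _; rewrite mul1r.
have := iT_FTC D (contD c1 (contM cid c2)).
rewrite iTD//; last exact: contM.
rewrite mul0r mul1r pf subr0 => H.
by rewrite -H addrC addKr.
Qed.

(** The sawtooth formula iT_sawtooth and Cauchy-Schwarz; the sawtooth has square
   integral 1/3. *)
Lemma primitive_bound f f' f'' (x : R) : (forall x : R, dr f x (f' x)) ->
  (forall x : R, dr f' x (f'' x)) -> continuous f'' ->
  periodic1 f -> integralT f = 0 -> f x ^+ 2 <= integralT (fun y => f' y ^+ 2).
Proof.
move=> df df' cf'' pf f0; have cf' : continuous f' := dr_continuous df'.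
have pf' := dr_periodic pf df.
have := iT_sawtooth x df cf' pf; rewrite f0 subr0 => <-.
have cid : continuous (fun y : R => y) by move=> y; exact: cvg_id.
apply: le_trans (iT_CS cid (cont_shift (x := x) cf')) _.
have -> : integralT (fun y => f' (x + y) ^+ 2) = integralT (fun y => f' y ^+ 2).
  apply: (@iT_shift (fun y => f' y ^+ 2) (fun y => 2 * (f' y * f'' y))).
  - by move=> y; under eq_fun do rewrite expr2; apply: dr_eq (drM (df' y) (df' y)) _; ring.
  - by ct.
  - by move=> y; rewrite pf'.
rewrite ler_piMl//; first by apply: iT_ge0 => y; exact: sqr_ge0.
have D (y : R) : dr (fun y => 3^-1 * y ^+ 3) y (y ^+ 2).
  by apply: dr_eq (drZ 3^-1 (drX 3 y)) _; rewrite /=; field.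
have c2 : continuous (fun y : R => y ^+ 2) by ct.
by rewrite (iT_FTC D c2) expr1n expr0n /= mulr0 subr0 mulr1; lra.
Qed.

End periodic_primitive.

Section kdv_smooth.
Variables (R : realType) (u : R -> R -> R).
Local Notation dr f x l := (is_derive (x : R) (1 : R) (f : R -> R) (l : R)).
Hypothesis kdvu : kdv_solution u.

Let su : smooth2 u. Proof. by case: kdvu. Qed.
Let pu (t : R) : periodic1 (u t). Proof. by case: kdvu. Qed.

Lemma smooth2_x (v : R -> R -> R) : smooth2 v -> smooth2 (partial_x v).
Proof. by move=> sv k; have [_ []] := sv k.+1. Qed.
Lemma smooth2_t (v : R -> R -> R) : smooth2 v -> smooth2 (partial_t v).
Proof. by move=> sv k; have [_ []] := sv k.+1. Qed.
Lemma smooth2_cont (v : R -> R -> R) : smooth2 v -> continuous (fun p : R * R => v p.1 p.2).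
Proof. by move=> sv; have [] := sv 0%N. Qed.
Lemma smooth2_drx (v : R -> R -> R) (t x : R) : smooth2 v -> dr (v t) x (partial_x v t x).
Proof.
move=> sv; have [_ [_ dx _ _]] := sv 1%N.
by split; [exact: dx|rewrite -derive1E].
Qed.
Lemma smooth2_drt (v : R -> R -> R) (t x : R) : smooth2 v -> dr (v^~ x) t (partial_t v t x).
Proof.
move=> sv; have [_ [dt _ _ _]] := sv 1%N.
by split; [exact: dt|rewrite -derive1E].
Qed.
Lemma smooth2_cx (v : R -> R -> R) (t : R) : smooth2 v -> continuous (v t).
Proof. by move=> sv; apply: dr_continuous => x; exact: smooth2_drx. Qed.

Definition ux := partial_x u.
Definition uxx := partial_x ux.
Definition uxxx := partial_x uxx.
Let sux : smooth2 ux. Proof. exact: smooth2_x. Qed.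
Let suxx : smooth2 uxx. Proof. exact: smooth2_x. Qed.
Let suxxx : smooth2 uxxx. Proof. exact: smooth2_x. Qed.

Lemma kdv_ut (t x : R) : partial_t u t x = - uxxx t x + 6 * u t x * ux t x.
Proof.
have [_ _ /(_ t x)] := kdvu; rewrite -/ux -/uxx -/uxxx => h.
by apply/eqP; rewrite -subr_eq0 -h; apply/eqP; ring.
Qed.

Definition kdv_flux (t x : R) : R := - uxx t x + 3 * u t x ^+ 2.

Lemma dr_flux (t x : R) : dr (kdv_flux t) x (partial_t u t x).
Proof.
rewrite kdv_ut; have h := @smooth2_drx u t x su.
apply: dr_eq (drD (drN (@smooth2_drx uxx t x suxx)) (drZ 3 (drM h h))) _.
by rewrite /uxxx /ux; ring.
Qed.

Lemma ux_periodic t : periodic1 (ux t).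
Proof. by apply: dr_periodic (@pu t) _ => x; exact: smooth2_drx. Qed.
Lemma uxx_periodic t : periodic1 (uxx t).
Proof. by apply: dr_periodic (@ux_periodic t) _ => x; exact: smooth2_drx. Qed.
Lemma flux_periodic t : periodic1 (kdv_flux t).
Proof. by move=> x; rewrite /kdv_flux uxx_periodic pu. Qed.

Lemma jc_smooth2 (v : R -> R -> R) a b : smooth2 v -> jc a b v.
Proof. by move=> sv t x _; exact: smooth2_cont. Qed.

Lemma C1t_u a b : C1t a b u (partial_t u).
Proof.
split; [by move=> t x _; exact: smooth2_drt|exact: jc_smooth2|].
by apply: jc_smooth2; exact: smooth2_t.
Qed.

Lemma kdv_momentum (t : R) : integralT (fun x => u t x ^+ 2) = integralT (fun x => u 0 x ^+ 2).
Proof.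
suff H (s : R) : dr (fun t => integralT (fun x => u t x ^+ 2)) s 0 by exact: dr_zero_cst H t 0.
move: s => {}t.
have e : (fun t => integralT (fun x => u t x ^+ 2)) = fun t => integralT (fun x => u t x * u t x).
  by apply/funext => s; apply: iT_eq => x; rewrite expr2.
rewrite e; have ts : t - 1 < t < t + 1 by rewrite ltrBlDr ltrDl ltr01.
apply: dr_eq (C1t_int (C1tM (C1t_u (t - 1) (t + 1)) (C1t_u _ _)) ts) _.
have h0 := @smooth2_cx u t su; have h1 := @smooth2_cx ux t sux.
have h2 := @smooth2_cx uxx t suxx; have h3 := @smooth2_cx uxxx t suxxx.
rewrite (@iT_eq _ _ (fun x => - (2 * u t x * uxxx t x) + 12 * u t x ^+ 2 * ux t x)); last first.
  by move=> x; rewrite kdv_ut; ring.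
apply: (@iT_derive_periodic R (fun x => - (2 * u t x * uxx t x) + ux t x ^+ 2 + 4 * u t x ^+ 3)
  (fun x => - (2 * u t x * uxxx t x) + 12 * u t x ^+ 2 * ux t x)).
- move=> x; have d0 := @smooth2_drx u t x su; have d1 := @smooth2_drx ux t x sux; have d2 := @smooth2_drx uxx t x suxx.
  under eq_fun do rewrite expr2 !exprS expr0 mulr1 -mulrA.
  apply: dr_eq (drD (drD (drN (drZ 2 (drM d0 d2))) (drM d1 d1)) (drZ 4 (drM d0 (drM d0 d0)))) _.
  by rewrite -/ux -/uxx -/uxxx; ring.
- by ct.
- by move=> x; rewrite pu ux_periodic uxx_periodic.
Qed.

Lemma kdv_mean (t : R) : integralT (u t) = integralT (u 0).
Proof.
suff H (s : R) : dr (fun t => integralT (u t)) s 0 by exact: dr_zero_cst H t 0.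
move: s => {}t.
have ts : t - 1 < t < t + 1 by rewrite ltrBlDr ltrDl ltr01.
apply: dr_eq (C1t_int (C1t_u (t - 1) (t + 1)) ts) _.
apply: iT_derive_periodic (@dr_flux t) _ (@flux_periodic t).
by apply: smooth2_cx; exact: smooth2_t.
Qed.

Hypothesis u0 : integralT (u 0) = 0.
Let um (t : R) : integralT (u t) = 0. Proof. by rewrite kdv_mean. Qed.

(** The mean zero antiderivative of u, written with a fixed domain of
   integration so that it can be differentiated in t and in x alike. *)
Definition upot (t x : R) : R := integralT (fun y => y * u t (x + y)).

Let cid : continuous (fun y : R => y). Proof. by move=> y; exact: cvg_id. Qed.

Let cs (v : R -> R -> R) (t x : R) : smooth2 v -> continuous (fun y : R => y * v t (x + y)).
Proof. by move=> sv; apply: contM => //; apply: cont_shift; exact: smooth2_cx. Qed.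

Let joint3 (v : R -> R -> R) (p : R * R) (y : R) : smooth2 v ->
  {for (p, y), continuous (fun q : R * R * R => q.2 * v q.1.1 (q.1.2 + q.2))}.
Proof.
move=> sv.
have c11 : (fun q : R * R * R => q.1.1) @ (p, y) --> p.1.
  by apply: (@cvg_comp _ _ _ fst fst _ (nbhs p)); [exact: cvg_fst|exact: cvg_fst].
have c12 : (fun q : R * R * R => q.1.2) @ (p, y) --> p.2.
  by apply: (@cvg_comp _ _ _ fst snd _ (nbhs p)); [exact: cvg_fst|exact: cvg_snd].
have c2 : (fun q : R * R * R => q.2) @ (p, y) --> y by exact: cvg_snd.
have cp : (fun q : R * R * R => (q.1.1, q.1.2 + q.2)) @ (p, y) --> (p.1, p.2 + y).
  exact: (cvg_pair (F := nbhs (p, y)) (G := nbhs p.1) (H := nbhs (p.2 + y)) c11 (cvgD c12 c2)).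
have cv := @for_cont_comp _ _ _ (fun q : R * R * R => (q.1.1, q.1.2 + q.2)) (fun p : R * R => v p.1 p.2)
  (p, y) cp (@smooth2_cont v sv (p.1, p.2 + y)).
exact: (cvgM c2 cv).
Qed.

Lemma upot_cont (p : R * R) : {for p, continuous (fun p : R * R => upot p.1 p.2)}.
Proof.
apply: (@iT_cont_param R _ (fun (p : R * R) y => y * u p.1 (p.2 + y))) => [y|].
  exact: joint3.
by apply: (@nearW _ (nbhs p)) => q; exact: cs.
Qed.

Lemma dr_upot_x (t x : R) : dr (upot t) x (u t x).
Proof.
have ts : x - 1 < x < x + 1 by rewrite ltrBlDr ltrDl ltr01.
have -> : u t x = integralT (fun y => y * ux t (x + y)).
  have := iT_sawtooth x (fun z => @smooth2_drx u t z su) (@smooth2_cx ux t sux) (@pu t).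
  by rewrite um subr0.
apply: (@iT_dr_under R (x - 1) (x + 1) (fun x y => y * u t (x + y)) (fun x y => y * ux t (x + y)) x ts).
- move=> s y _; have h := @dr_shift R (u t) (ux t (y + s)) y s (@smooth2_drx u t _ su).
  by rewrite [s + y]addrC; under eq_fun do rewrite [_ + y]addrC; exact: drZ.
- by move=> s _; exact: cs.
- exact: cs.
- move=> y; have h := @joint3 _ (t, x) y sux.
  apply: (@for_cont_comp _ _ _ (fun p : R * R => ((t, p.1), p.2)) (fun q : R * R * R => q.2 * ux q.1.1 (q.1.2 + q.2)) (x, y) _ h).
  apply: (cvg_pair (F := nbhs (x, y)) (G := nbhs (t, x)) (H := nbhs y) _ cvg_snd).
  exact: (cvg_pair (F := nbhs (x, y)) (G := nbhs t) (H := nbhs x) (cvg_cst t) cvg_fst).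
Qed.

Lemma upot_periodic t : periodic1 (upot t).
Proof. by move=> x; apply: iT_eq => y; rewrite addrAC pu. Qed.

(** The constant is the mean of the flux: the antiderivative keeps mean zero. *)
Lemma dr_upot_t (t x : R) :
  dr (upot ^~ x) t (kdv_flux t x - 3 * integralT (fun y => u 0 y ^+ 2)).
Proof.
have ts : t - 1 < t < t + 1 by rewrite ltrBlDr ltrDl ltr01.
have sut := smooth2_t su.
have -> : kdv_flux t x - 3 * integralT (fun y => u 0 y ^+ 2) =
    integralT (fun y => y * partial_t u t (x + y)).
  have := iT_sawtooth x (@dr_flux t) (@smooth2_cx _ t sut) (@flux_periodic t) => ->.
  have h0 := @smooth2_cx u t su; have h2 := @smooth2_cx uxx t suxx.
  have i2 := iT_derive_periodic (fun y => @smooth2_drx ux t y sux) h2 (@ux_periodic t).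
  rewrite {2}/kdv_flux (iTD (contN h2) (contZ (contX h0))) iTN// iTZ; last exact: contX.
  by rewrite kdv_momentum -/uxx i2 oppr0 add0r.
apply: (@iT_dr_under R (t - 1) (t + 1) (fun t y => y * u t (x + y)) (fun t y => y * partial_t u t (x + y)) t ts).
- by move=> s y _; apply: drZ; exact: smooth2_drt.
- by move=> s _; exact: cs.
- exact: cs.
- move=> y; have h := @joint3 _ (t, x) y sut.
  apply: (@for_cont_comp _ _ _ (fun p : R * R => ((p.1, x), p.2)) (fun q : R * R * R => q.2 * partial_t u q.1.1 (q.1.2 + q.2)) (t, y) _ h).
  apply: (cvg_pair (F := nbhs (t, y)) (G := nbhs (t, x)) (H := nbhs y) _ cvg_snd).
  exact: (cvg_pair (F := nbhs (t, y)) (G := nbhs t) (H := nbhs x) cvg_fst (cvg_cst x)).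
Qed.

Lemma C1t_upot a b :
  C1t a b upot (fun t x => kdv_flux t x - 3 * integralT (fun y => u 0 y ^+ 2)).
Proof.
split; [by move=> t x _; exact: dr_upot_t|by move=> t x _; exact: upot_cont|].
apply: jcB; last exact: jc_cst.
apply: jcD; first by apply: jcN; exact: jc_smooth2.
have j := @jc_smooth2 u a b su.
by rewrite (_ : (fun t x => 3 * u t x ^+ 2) = fun t x => 3 * (u t x * u t x)); [exact: (jcZ (jcM j j))|].
Qed.

Lemma upot_mean (t : R) : integralT (upot t) = 0.
Proof.
have cu := @smooth2_cx u t su.
have := iT_sawtooth 0 (@dr_upot_x t) cu (@upot_periodic t).
have -> : integralT (fun y => y * u t (0 + y)) = upot t 0 by [].
by lra.
Qed.

End kdv_smooth.

(** * Static estimates for the error *)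

Section tools.
Variable R : realType.
Implicit Types f g : R -> R.

Lemma sum_CS (I : Type) (s : seq I) (P : pred I) (a b : I -> R) :
  (\sum_(i <- s | P i) a i * b i) ^+ 2 <=
  (\sum_(i <- s | P i) a i ^+ 2) * (\sum_(i <- s | P i) b i ^+ 2).
Proof.
rewrite -subr_ge0; set A := \sum_(i <- s | P i) a i ^+ 2; set B := \sum_(i <- s | P i) b i ^+ 2.
set C := \sum_(i <- s | P i) a i * b i.
have A0 : 0 <= A by apply: sumr_ge0 => i _; exact: sqr_ge0.
have B0 : 0 <= B by apply: sumr_ge0 => i _; exact: sqr_ge0.
have h (l m : R) : 0 <= l ^+ 2 * A + 2 * l * m * C + m ^+ 2 * B.
  have <- : \sum_(i <- s | P i) (l * a i + m * b i) ^+ 2 = l ^+ 2 * A + 2 * l * m * C + m ^+ 2 * B.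
    rewrite /A /B /C !mulr_sumr -!big_split; apply: eq_bigr => i _ /=; ring.
  by apply: sumr_ge0 => i _; exact: sqr_ge0.
have [B_0|Bn0] := eqVneq B 0.
  rewrite B_0 mulr0 sub0r; suff -> : C = 0 by rewrite expr0n oppr0.
  have := h C (- (A + 1) / 2); rewrite B_0 mulr0 addr0.
  have -> : C ^+ 2 * A + 2 * C * (- (A + 1) / 2) * C = - C ^+ 2 by field.
  by rewrite oppr_ge0 => h'; apply/eqP; rewrite -sqrf_eq0 eq_le h' sqr_ge0.
have := h B (- C).
have -> : B ^+ 2 * A + 2 * B * - C * C + (- C) ^+ 2 * B = B * (A * B - C ^+ 2) by ring.
by rewrite pmulr_rge0// lt0r Bn0.
Qed.

Lemma normr_le_sqr (x b : R) : 0 <= b -> x ^+ 2 <= b ^+ 2 -> `|x| <= b.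
Proof.
move=> b0 h; rewrite -(ler_pXn2r (ltn0Sn 1)) ?nnegrE//.
by rewrite real_normK ?num_real.
Qed.

Lemma iT_young f g (c : R) : 0 < c -> continuous f -> continuous g ->
  `|integralT (fun x => f x * g x)| <=
  2^-1 * (c * integralT (fun x => f x ^+ 2) + c^-1 * integralT (fun x => g x ^+ 2)).
Proof.
move=> c0 cf cg.
have -> : 2^-1 * (c * integralT (fun x => f x ^+ 2) + c^-1 * integralT (fun x => g x ^+ 2)) =
    integralT (fun x => 2^-1 * (c * f x ^+ 2 + c^-1 * g x ^+ 2)).
  by rewrite iTZ ?iTD ?iTZ//; ct.
apply: iT_abs_le; [by ct|by ct|move=> x].
rewrite normrM -(real_normK (num_real (f x))) -(real_normK (num_real (g x))).
have : 0 <= c^-1 * (c * `|f x| - `|g x|) ^+ 2 by rewrite mulr_ge0 ?sqr_ge0// invr_ge0 ltW.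
set a := `|f x|; set b := `|g x|.
have -> : c^-1 * (c * a - b) ^+ 2 = c * a ^+ 2 + c^-1 * b ^+ 2 - 2 * (a * b) by field; rewrite gt_eqF.
lra.
Qed.

Lemma iT_CS_abs f g (b : R) : continuous f -> continuous g -> 0 <= b ->
  integralT (fun x => f x ^+ 2) * integralT (fun x => g x ^+ 2) <= b ^+ 2 ->
  `|integralT (fun x => f x * g x)| <= b.
Proof.
by move=> cf cg b0 h; apply: normr_le_sqr => //; apply: le_trans (iT_CS cf cg) h.
Qed.

Lemma iT_sqr0 f : 0 <= integralT (fun x => f x ^+ 2).
Proof. by apply: iT_ge0 => x; exact: sqr_ge0. Qed.

Lemma coproj_idem M f : continuous f -> forall x, coproj M (coproj M f) x = coproj M f x.
Proof.
move=> cf x.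
have e : coproj M f = fun x => f x + (-1) * (integralT f + proj M f x).
  by apply/funext => y; rewrite /coproj; ring.
have cp := @cont_proj R M f; have cc := @cont_cst R (integralT f).
rewrite {1}e coprojD//; last by ct.
rewrite coprojZ; last by ct.
rewrite [X in _ + -1 * X](_ : _ = 0); first by rewrite mulr0 addr0.
apply: (@coproj_tpoly R M (fun x => integralT f + proj M f x)).
by apply: tpoly_add; [exact: tpoly_cst|exact: tpoly_proj].
Qed.

Lemma coprojB M f g : continuous f -> continuous g -> forall x,
  coproj M (fun x => f x - g x) x = coproj M f x - coproj M g x.
Proof.
move=> cf cg x; have -> : (fun x => f x - g x) = fun x => f x + (-1) * g x.
  by apply/funext => z; rewrite mulN1r.
by rewrite coprojD//; [rewrite coprojZ// mulN1r|ct].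
Qed.

Lemma sum_coef_le M f : continuous f ->
  \sum_(k < M.*2) coef f k ^+ 2 <= integralT (fun x => f x ^+ 2).
Proof.
move=> cf; have := iT_sqr0 (coproj M f); rewrite iT_coproj_sqr//.
by have := sqr_ge0 (integralT f); lra.
Qed.

Lemma iT_proj_le M f : continuous f ->
  integralT (fun x => proj M f x ^+ 2) <= integralT (fun x => f x ^+ 2).
Proof.
by move=> cf; apply: le_trans (sum_coef_le M cf); rewrite projE iT_vf_sqr.
Qed.

Lemma iT_coproj0 M f : continuous f -> integralT (coproj M f) = 0.
Proof.
move=> cf; rewrite /coproj !iTB//; try by ct; exact: cont_proj.
  by rewrite iT_cst subrr sub0r projE iT_vf oppr0.
Qed.

Lemma sum_emode2 M (x : R) : \sum_(k < M.*2) emode R k x ^+ 2 = M.*2%:R.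
Proof.
have h := @sum_partner R M (fun k => emode R k x ^+ 2).
have : \sum_(k < M.*2) (emode R k x ^+ 2 + emode R (partner k) x ^+ 2) = M.*2%:R * 2.
  rewrite (eq_bigr (fun=> 2)); last by move=> k _; rewrite emode_pair.
  by rewrite sumr_const card_ord mulr_natl.
rewrite big_split /= h; lra.
Qed.

Lemma vf_sup M (x : nat -> R) (t : R) :
  vf M x t ^+ 2 <= (\sum_(k < M.*2) x k ^+ 2) * M.*2%:R.
Proof. by apply: le_trans (sum_CS _ _ _ _) _; rewrite sum_emode2. Qed.

(** coproj M f is a trigonometric polynomial with N.*2 coordinates, to which the
   Cauchy-Schwarz bound vf_sup applies. *)
Lemma coproj_sup M N f : continuous f -> tpoly N f -> (M <= N)%N -> forall x,
  coproj M f x ^+ 2 <= integralT (fun x => coproj M f x ^+ 2) * N.*2%:R.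
Proof.
move=> cf tf MN x; set r := coproj M f.
have cr : continuous r by exact: cont_coproj.
have tr : tpoly N r.
  rewrite /r /coproj (_ : (fun x => _) = fun x => f x + (-1) * (integralT f + proj M f x)).
    apply: tpoly_add => //; apply: tpolyZ; apply: tpoly_add; first exact: tpoly_cst.
    exact: tpoly_le (tpoly_proj _ _).
  by apply/funext => y; ring.
have := coproj_tpoly tr x; rewrite /coproj -/r iT_coproj0// subr0 => /eqP.
rewrite subr_eq0 => /eqP ->; rewrite projE; apply: le_trans (vf_sup _ _ _) _.
by rewrite ler_wpM2r ?ler0n// sum_coef_le.
Qed.

Lemma vfI_sup M (x : nat -> R) (t : R) : vf M (Ix x) t ^+ 2 <= \sum_(k < M.*2) x k ^+ 2.
Proof.
rewrite -iT_vf_sqr; apply: (@primitive_bound R _ (vf M x) (vf M (Dx x))).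
- exact: dr_vfI.
- exact: dr_vf.
- exact: cont_vf.
- exact: vf_periodic.
- exact: iT_vf.
Qed.

Definition lo (L : nat) (x : nat -> R) (k : nat) : R := if (k < L.*2)%N then x k else 0.
Definition hi (L : nat) (x : nat -> R) (k : nat) : R := if (k < L.*2)%N then 0 else x k.

Lemma lohi L x k : x k = lo L x k + hi L x k.
Proof. by rewrite /lo /hi; case: ifP; rewrite ?addr0 ?add0r. Qed.

Lemma Ix_lo L x k : Ix (lo L x) k = lo L (Ix x) k.
Proof. by rewrite /Ix /lo partner_ltn; case: ifP; rewrite ?mulr0. Qed.
Lemma Ix_hi L x k : Ix (hi L x) k = hi L (Ix x) k.
Proof. by rewrite /Ix /hi partner_ltn; case: ifP; rewrite ?mulr0. Qed.

Lemma tpoly_lo M L x : tpoly L (vf M (lo L x)).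
Proof.
apply: tpoly_sum => k _; rewrite /lo; case kL : (k < L.*2)%N.
  by apply: tpolyZ; exact: tpoly_emode.
rewrite (_ : (fun x0 => _) = fun=> 0); first exact: tpoly_cst.
by apply/funext => t; rewrite mul0r.
Qed.

Lemma sum_lo M L x : \sum_(k < M.*2) lo L x k ^+ 2 <= \sum_(k < M.*2) x k ^+ 2.
Proof.
by apply: ler_sum => k _; rewrite /lo; case: ifP => // _; rewrite expr0n sqr_ge0.
Qed.
Lemma sum_hi M L x : \sum_(k < M.*2) hi L x k ^+ 2 <= \sum_(k < M.*2) x k ^+ 2.
Proof.
by apply: ler_sum => k _; rewrite /hi; case: ifP => // _; rewrite expr0n sqr_ge0.
Qed.

Lemma freq_ge (k : nat) : (k./2.+1)%:R <= freq R k.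
Proof.
rewrite /freq -[X in X <= _]mul1r ler_wpM2r ?ler0n//.
have := @pi_ge2 R; lra.
Qed.

(** Telescoping: freq^-2 <= 1 / M - 1 / (M + 1) at the two modes of index M. *)
Lemma sum_freq_hi M L : (0 < L)%N ->
  \sum_(k < M.*2) (if (k < L.*2)%N then 0 else (freq R k ^- 2)) <= 2 / L%:R.
Proof.
move=> L0; apply: (@le_trans _ _ (2 / L%:R - 2 / (maxn L M)%:R)); last first.
  by rewrite gerBl divr_ge0.
elim: M => [|M IH]; first by rewrite big_ord0 maxn0 subrr.
rewrite doubleS !big_ord_recr /=; case: (ltnP M L) => ML.
  have -> : (M.*2 < L.*2)%N by lia.
  have -> : (M.*2.+1 < L.*2)%N by lia.
  rewrite !addr0; apply: le_trans IH _.
  have e1 : maxn L M = L by lia.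
  have e2 : maxn L M.+1 = L by lia.
  by rewrite e1 e2.
have -> : (M.*2 < L.*2)%N = false by lia.
have -> : (M.*2.+1 < L.*2)%N = false by lia.
have e1 : maxn L M = M by lia.
have e2 : maxn L M.+1 = M.+1 by lia.
rewrite e1 in IH; rewrite e2.
have M0 : 0 < M%:R :> R by rewrite ltr0n; lia.
have key k : k./2 = M -> freq R k ^- 2 <= M%:R^-1 - M.+1%:R^-1.
  move=> kM; have := freq_ge k; rewrite kM => fk.
  have -> : M%:R^-1 - M.+1%:R^-1 = (M%:R * M.+1%:R)^-1 :> R.
    by rewrite -natr1; field; rewrite natr1 !pnatr_eq0; lia.
  have f0 := freq_gt0 R k.
  rewrite lef_pV2 ?posrE; [|exact: exprn_gt0|by rewrite mulr_gt0// ltr0n].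
  rewrite expr2; apply: ler_pM; rewrite ?ler0n//.
  by apply: le_trans fk; rewrite ler_nat.
have h1 := key M.*2 (doubleK M).
have h2 : freq R M.*2.+1 ^- 2 <= M%:R^-1 - M.+1%:R^-1 by apply: key; lia.
apply: le_trans (lerD (lerD IH h1) h2) _; apply: eq_ler; ring.
Qed.

Lemma vfI_hi_sup M L (x : nat -> R) (t : R) : (0 < L)%N ->
  vf M (Ix (hi L x)) t ^+ 2 <= (\sum_(k < M.*2) x k ^+ 2) * (4 / L%:R).
Proof.
move=> L0.
have -> : vf M (Ix (hi L x)) t = \sum_(k < M.*2) hi L x (partner k) *
    (if (k < L.*2)%N then 0 else dsign R k / freq R k * emode R k t).
  apply: eq_bigr => k _; rewrite /Ix /hi partner_ltn; case: ifP => _; ring.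
apply: le_trans (sum_CS _ _ _ _) _; apply: ler_pM.
- by apply: sumr_ge0 => i _; exact: sqr_ge0.
- by apply: sumr_ge0 => i _; exact: sqr_ge0.
- by rewrite (sum_partner M (fun k => hi L x k ^+ 2)) sum_hi.
have -> : 4 / L%:R = 2 * (2 / L%:R) :> R by rewrite mulrA -natrM.
apply: le_trans (ler_wpM2l _ (sum_freq_hi M L0)) => //.
rewrite mulr_sumr; apply: ler_sum => k _; case: ifP => _; first by rewrite expr0n mulr0.
have := emode_pair k t; have := sqr_ge0 (emode R (partner k) t) => h1 h2.
have -> : (dsign R k / freq R k * emode R k t) ^+ 2 = emode R k t ^+ 2 * freq R k ^- 2.
  transitivity (dsign R k * dsign R k * (emode R k t ^+ 2 * freq R k ^- 2)); last by rewrite dsign_sqr mul1r.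
  by field; rewrite gt_eqF ?freq_gt0.
by rewrite ler_wpM2r//; [rewrite invr_ge0 sqr_ge0|lra].
Qed.

End tools.

Lemma good_core_algebra (R : realType) (K A s kap n2 a4 rho E Z k P1 t4 P2 t8 P3 : R) :
  1 <= K -> 0 <= A -> 0 <= s -> 0 <= kap -> 0 <= n2 -> 0 <= a4 -> 0 <= rho -> 0 <= E -> 0 <= Z -> 0 <= k ->
  `|t4| <= n2 * (1 + a4) -> `|t8| <= 2^-1 * (n2 + Z) ->
  `|P1| <= 2^-1 * (n2 * K + E) + 2 * (n2 * (1 + a4)) + 2 * K * A * n2 ->
  `|P2| <= 2^-1 * (E + rho) + 2 * (2^-1 * (n2 + 2^-1 * (kap * a4 + k))) + n2 * (1 + s) ->
  `|K * P3| <= K * (2^-1 * (n2 + E) + 2 * (n2 * K) + 2 * K * n2) ->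
  `|12 * P1 - 12 * t4 + 12 * P2 - 12 * t8 + 6 * (4 * K) * P3| <=
  400 * K ^+ 2 * (1 + A + a4 + s) * n2 + 400 * K * (E + rho + kap * a4 + k + Z).
Proof.
move=> K1 A0 s0 kap0 n20 a40 rho0 E0 Z0 k0 H4 H8 HP1 HP2 KP3.
have K0 : 0 <= K by exact: le_trans ler01 K1.
have K2 : 1 <= K ^+ 2 by exact: exprn_ege1.
have KK : K <= K ^+ 2 by rewrite expr2 ler_peMr.
have cn : 6 * K + 36 * (1 + a4) + 24 * (K * A) + 30 + 12 * s + 12 * K + 96 * K ^+ 2 <=
    400 * K ^+ 2 * (1 + A + a4 + s).
  have := mulr_ge0 K0 A0; have := ler_wpM2r A0 KK; have := ler_wpM2r a40 K2; have := ler_wpM2r s0 K2.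
  lra.
have {}cn := ler_wpM2r n20 cn.
have cb : 12 * E + 6 * rho + 6 * (kap * a4 + k) + 6 * Z + 12 * (K * E) <=
    400 * K * (E + rho + kap * a4 + k + Z).
  have h1 : 0 <= kap * a4 by rewrite mulr_ge0.
  have := ler_wpM2r h1 K1; have := ler_wpM2r k0 K1; have := ler_wpM2r E0 K1.
  have := ler_wpM2r rho0 K1; have := ler_wpM2r Z0 K1; lra.
move: H4 H8 HP1 HP2 KP3; rewrite !ler_norml; lra.
Qed.

(** The integrand that drives the energy; B is the weight of the lowest order
   term of the energy. *)
Definition good_integrand (R : realType) (u v w W V g q G : R -> R) (m B : R) (x : R) : R :=
  12 * (W x * v x * (u x ^+ 2 - m - g x)) - 12 * (W x * w x * g x)
  + 12 * ((u x ^+ 2 - G x) * (V x * v x)) - 12 * (q x * (V x * g x))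
  + 6 * B * (W x * (u x ^+ 2 - m - g x)).

Section good_core.
Variables (R : realType) (u v w W V g q G e r z : R -> R) (m n2 K A kap a4 E rho Z s : R).
Hypotheses (cu : continuous u) (cv : continuous v) (cw : continuous w) (cW : continuous W).
Hypotheses (cV : continuous V) (cg : continuous g) (cq : continuous q) (cG : continuous G).
Hypotheses (ce : continuous e) (cr : continuous r) (cz : continuous z).
Hypotheses (K1 : 1 <= K) (kap0 : 0 < kap) (A0 : 0 <= A) (s0 : 0 <= s).
Hypothesis uE : forall x, u x = v x + w x.
Hypothesis mE : forall x, u x ^+ 2 - m - g x = e x + 2 * (w x * v x) + w x ^+ 2.
Hypothesis n2E : integralT (fun x => w x ^+ 2) = n2.
Hypothesis a4E : integralT (fun x => (v x ^+ 2) ^+ 2) = a4.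
Hypothesis EE : integralT (fun x => e x ^+ 2) = E.
Hypothesis rhoE : integralT (fun x => r x ^+ 2) = rho.
Hypothesis ZE : integralT (fun x => z x ^+ 2) = Z.
Hypothesis g2 : integralT (fun x => g x ^+ 2) <= a4.
Hypothesis v2K : integralT (fun x => v x ^+ 2) <= K.
Hypothesis vA : forall x, `|v x| <= A.
Hypothesis W2 : forall x, W x ^+ 2 <= n2.
Hypothesis WK : forall x, `|W x| <= 2 * K.
Hypothesis rsup : forall x, r x ^+ 2 <= s.
Hypothesis vr : integralT (fun x => v x ^+ 2 * r x) = integralT (fun x => e x * r x).
Hypothesis Gr : integralT (fun x => (u x ^+ 2 - G x) * (V x * v x)) = integralT (fun x => u x ^+ 2 * r x).
Hypothesis qz : integralT (fun x => q x * (V x * g x)) = integralT (fun x => w x * z x).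

Let n20 : 0 <= n2. Proof. rewrite -n2E; exact: iT_sqr0. Qed.
Let a40 : 0 <= a4. Proof. rewrite -a4E; exact: iT_sqr0. Qed.
Let rho0 : 0 <= rho. Proof. rewrite -rhoE; exact: iT_sqr0. Qed.
Let K0 : 0 <= K. Proof. exact: le_trans ler01 K1. Qed.

Let young (f h : R -> R) : continuous f -> continuous h -> `|integralT (fun x => f x * h x)| <=
  2^-1 * (integralT (fun x => f x ^+ 2) + integralT (fun x => h x ^+ 2)).
Proof. by move=> cf ch; have := iT_young ltr01 cf ch; rewrite invr1 !mul1r. Qed.

Let Ww2 : integralT (fun x => (W x * w x) ^+ 2) <= n2 ^+ 2.
Proof.
rewrite expr2 -{2}n2E -iTZ; last by ct.
by apply: iT_le => [||x]; [by ct|by ct|rewrite exprMn ler_wpM2r ?sqr_ge0].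
Qed.

Let sq1 (a : R) : 0 <= a -> a <= (1 + a) ^+ 2. Proof. by move=> a0; nra. Qed.

Let T1 : `|integralT (fun x => (W x * v x) * e x)| <= 2^-1 * (n2 * K + E).
Proof.
apply: le_trans (young (contM cW cv) ce) _.
rewrite EE ler_wpM2l// lerD2r; apply: (@le_trans _ _ (integralT (fun x => n2 * v x ^+ 2))).
  by apply: iT_le => [||x]; [by ct|by ct|rewrite exprMn ler_wpM2r ?sqr_ge0].
by rewrite iTZ ?ler_wpM2l//; ct.
Qed.

Let T2 : `|integralT (fun x => (W x * w x) * v x ^+ 2)| <= n2 * (1 + a4).
Proof.
apply: iT_CS_abs; [by ct|by ct|by rewrite mulr_ge0// addr_ge0|rewrite exprMn].
apply: ler_pM; [exact: iT_sqr0|exact: iT_sqr0|exact: Ww2|].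
by rewrite a4E; exact: sq1.
Qed.

Let T3 : `|integralT (fun x => (W x * v x) * w x ^+ 2)| <= 2 * K * A * n2.
Proof.
rewrite -n2E -iTZ; last by ct.
apply: iT_abs_le => [||x]; [by ct|by ct|].
rewrite normrM (ger0_norm (sqr_ge0 _)) ler_wpM2r ?sqr_ge0// normrM.
by apply: ler_pM.
Qed.

Let T4 : `|integralT (fun x => (W x * w x) * g x)| <= n2 * (1 + a4).
Proof.
apply: iT_CS_abs; [by ct|by ct|by rewrite mulr_ge0// addr_ge0|rewrite exprMn].
apply: ler_pM; [exact: iT_sqr0|exact: iT_sqr0|exact: Ww2|].
exact: le_trans g2 (sq1 a40).
Qed.

Let T5 : `|integralT (fun x => v x ^+ 2 * r x)| <= 2^-1 * (E + rho).
Proof. by rewrite vr; apply: le_trans (young ce cr) _; rewrite EE rhoE. Qed.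

Let r4 : integralT (fun x => (r x ^+ 2) ^+ 2) <= s * rho.
Proof.
rewrite -rhoE -[X in _ <= X]iTZ; last by ct.
apply: iT_le => [||x]; [by ct|by ct|].
by rewrite [_ ^+ 2 ^+ 2]expr2 ler_wpM2r ?sqr_ge0//; exact: rsup.
Qed.

Let T6 : `|integralT (fun x => w x * (v x * r x))| <=
  2^-1 * (n2 + 2^-1 * (kap * a4 + kap^-1 * (s * rho))).
Proof.
apply: le_trans (young cw (contM cv cr)) _.
rewrite n2E ler_wpM2l// lerD2l.
have -> : integralT (fun x => (v x * r x) ^+ 2) = integralT (fun x => v x ^+ 2 * r x ^+ 2).
  by apply: iT_eq => x; rewrite exprMn.
have := iT_young kap0 (contX (n := 2) cv) (contX (n := 2) cr).
move=> /(le_trans (ler_norm _)) /le_trans; apply.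
rewrite a4E ler_wpM2l// lerD2l.
by apply: ler_wpM2l r4; rewrite invr_ge0 ltW.
Qed.

Let T7 : `|integralT (fun x => w x ^+ 2 * r x)| <= n2 * (1 + s).
Proof.
have -> : n2 * (1 + s) = integralT (fun x => (1 + s) * w x ^+ 2).
  by rewrite iTZ ?n2E 1?mulrC//; ct.
apply: iT_abs_le => [||x]; [by ct|by ct|].
rewrite normrM (ger0_norm (sqr_ge0 _)) mulrC ler_wpM2r ?sqr_ge0//.
have := rsup x; rewrite -(real_normK (num_real (r x))); set a := `|r x|.
have := sqr_ge0 (a - 1); have := sqr_ge0 a; lra.
Qed.

Let T8 : `|integralT (fun x => q x * (V x * g x))| <= 2^-1 * (n2 + Z).
Proof. by rewrite qz; apply: le_trans (young cw cz) _; rewrite n2E ZE. Qed.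

Let T9 : `|integralT (fun x => W x * e x)| <= 2^-1 * (n2 + E).
Proof.
apply: le_trans (young cW ce) _; rewrite EE ler_wpM2l// lerD2r.
by rewrite -[X in _ <= X]iT_cst; apply: iT_le => //; ct.
Qed.

Let T10 : `|integralT (fun x => (W x * w x) * v x)| <= n2 * K.
Proof.
apply: iT_CS_abs; [by ct|by ct|by rewrite mulr_ge0|rewrite exprMn].
apply: ler_pM; [exact: iT_sqr0|exact: iT_sqr0|exact: Ww2|].
by apply: le_trans v2K _; rewrite expr2 ler_peMl.
Qed.

Let T11 : `|integralT (fun x => W x * w x ^+ 2)| <= 2 * K * n2.
Proof.
rewrite -n2E -iTZ; last by ct.
apply: iT_abs_le => [||x]; [by ct|by ct|].
by rewrite normrM (ger0_norm (sqr_ge0 _)) ler_wpM2r ?sqr_ge0.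
Qed.

Let goodE (B : R) : integralT (good_integrand u v w W V g q G m B) =
  12 * (integralT (fun x => (W x * v x) * e x) + 2 * integralT (fun x => (W x * w x) * v x ^+ 2)
       + integralT (fun x => (W x * v x) * w x ^+ 2))
  - 12 * integralT (fun x => (W x * w x) * g x)
  + 12 * (integralT (fun x => v x ^+ 2 * r x) + 2 * integralT (fun x => w x * (v x * r x))
       + integralT (fun x => w x ^+ 2 * r x))
  - 12 * integralT (fun x => q x * (V x * g x))
  + 6 * B * (integralT (fun x => W x * e x) + 2 * integralT (fun x => (W x * w x) * v x)
       + integralT (fun x => W x * w x ^+ 2)).
Proof.
have -> : integralT (fun x => v x ^+ 2 * r x) + 2 * integralT (fun x => w x * (v x * r x))
       + integralT (fun x => w x ^+ 2 * r x) =
    integralT (fun x => (u x ^+ 2 - G x) * (V x * v x)).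
  rewrite Gr -iTZ; last by ct.
  rewrite -iTD; [|by ct|by ct]; rewrite -iTD; [|by ct|by ct].
  by apply: iT_eq => x; rewrite uE; ring.
rewrite -!iTZ; try by ct.
rewrite -!iTD; try by ct.
rewrite -!iTZ; try by ct.
rewrite -!iTN; try by ct.
rewrite -!iTD; try by ct.
by apply: iT_eq => x; rewrite /good_integrand mE; ring.
Qed.

(** Each term is bounded by Young's inequality or by Cauchy-Schwarz.  The
   equations vr, Gr and qz move the projections so that only the high frequency
   parts e, r and z of products enter. *)
Lemma good_core : `|integralT (good_integrand u v w W V g q G m (4 * K))| <=
  400 * K ^+ 2 * (1 + A + a4 + s) * n2
  + 400 * K * (E + rho + kap * a4 + kap^-1 * (s * rho) + Z).
Proof.
rewrite goodE.
move: T1 T2 T3 T4 T5 T6 T7 T8 T9 T10 T11 => H1 H2 H3 H4 H5 H6 H7 H8 H9 H10 H11.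
set t1 := integralT _ in H1 *; set t2 := integralT _ in H2 *; set t3 := integralT _ in H3 *.
set t4 := integralT _ in H4 *; set t5 := integralT _ in H5 *; set t6 := integralT _ in H6 *.
set t7 := integralT _ in H7 *; set t8 := integralT _ in H8 *; set t9 := integralT _ in H9 *.
set t10 := integralT _ in H10 *; set t11 := integralT _ in H11 *.
have tri (a b c i j k : R) : `|a| <= i -> `|b| <= j -> `|c| <= k -> `|a + 2 * b + c| <= i + 2 * j + k.
  by rewrite !ler_norml; lra.
have := tri _ _ _ _ _ _ H9 H10 H11; have := tri _ _ _ _ _ _ H5 H6 H7.
have := tri _ _ _ _ _ _ H1 H2 H3; move: H4 H8; clearbody t1 t2 t3 t4 t5 t6 t7 t8 t9 t10 t11.
set P1 := t1 + _ + _; set P2 := t5 + _ + _; set P3 := t9 + _ + _ => H4 H8 HP1 HP2 HP3.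
have E0 : 0 <= E by rewrite -EE; exact: iT_sqr0.
have Z0 : 0 <= Z by rewrite -ZE; exact: iT_sqr0.
have KP3 : `|K * P3| <= K * (2^-1 * (n2 + E) + 2 * (n2 * K) + 2 * K * n2).
  by rewrite normrM (ger0_norm K0) ler_wpM2l.
have kk0 : 0 <= kap^-1 * (s * rho) by rewrite !mulr_ge0// invr_ge0 ltW.
exact: (good_core_algebra K1 A0 s0 (ltW kap0) n20 a40 rho0 E0 Z0 kk0 H4 H8 HP1 HP2 KP3).
Qed.

End good_core.

Lemma good_algebra (R : realType) (K A kap k' a b b2' E' F' rho' Z' n2' c m C : R) :
  0 <= C -> 0 < k' -> 1 <= k' -> 0 <= m -> 0 <= c -> 1 <= K -> 0 <= K -> 0 <= A -> 0 <= n2' -> 0 <= a -> 0 <= b ->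
  0 <= b2' -> 0 <= E' -> 0 <= rho' -> 0 <= Z' -> 0 < kap ->
  F' <= 4 * kap * a + 6 * k' * b -> E' <= F' -> rho' <= 4 * K * b2' -> Z' <= 8 * K * c + 2 * K * F' ->
  b2' ^+ 2 <= b ->
  C * K ^+ 2 * (1 + A + a + 4 * m * rho') * n2'
  + C * K * (E' + rho' + kap * a + k' * (4 * m * rho' * rho') + Z') <=
  C * 16 * K ^+ 3 * (1 + A + a + m * b2') * n2' +
  C * 64 * K ^+ 3 * (kap * a + k' * ((1 + m) * b) + b2' + c).
Proof.
move=> C0 k'0 k1 m0 c0 K1 K0 A0 n0 a0 b0 b20 E0 r0 Z0 k0 FE EF rE ZE bb.
have up (t : R) : 0 <= t -> t <= K * t /\ K * t <= K ^+ 2 * t.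
  move=> t0; split; first by rewrite ler_peMl.
  by rewrite expr2 -mulrA ler_peMl// mulr_ge0.
have kb0 : 0 <= k' * b by rewrite mulr_ge0// ltW.
have ka0 : 0 <= kap * a by rewrite mulr_ge0// ltW.
have mb0 : 0 <= m * b2' by rewrite mulr_ge0.
have kmb0 : 0 <= k' * (m * b) by rewrite mulr_ge0// ?mulr_ge0// ltW.
apply: lerD.
  rewrite ler_wpM2r//.
  rewrite (_ : C * 16 * K ^+ 3 * (1 + A + a + m * b2') = C * K ^+ 2 * (16 * (K * (1 + A + a + m * b2')))); last by ring.
  rewrite ler_wpM2l ?mulr_ge0 ?sqr_ge0//.
  have h1 : m * rho' <= m * (4 * K * b2') by rewrite ler_wpM2l.
  have s0 : 0 <= 1 + A + a by rewrite !addr_ge0.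
  have [+ _] := up _ s0; have [+ _] := up _ mb0; lra.
rewrite (_ : C * 64 * K ^+ 3 * (kap * a + k' * ((1 + m) * b) + b2' + c) =
  C * K * (64 * (K ^+ 2 * (kap * a + k' * b + k' * (m * b) + b2' + c)))); last by ring.
rewrite ler_wpM2l ?mulr_ge0//.
have r2 : rho' * rho' <= 16 * K ^+ 2 * b.
  apply: (@le_trans _ _ ((4 * K * b2') * (4 * K * b2'))); first by apply: ler_pM.
  have := ler_wpM2l (sqr_ge0 (4 * K)) bb; lra.
have h1 : k' * (4 * m * rho' * rho') <= 64 * (K ^+ 2 * (k' * (m * b))).
  have p0 : 0 <= k' * (4 * m) by rewrite !mulr_ge0// ltW.
  have := ler_wpM2l p0 r2; lra.
have h2 : K * F' <= K * (4 * kap * a + 6 * (k' * b)) by rewrite ler_wpM2l// mulrA.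
have [x1 x2] := up _ ka0; have [y1 y2] := up _ kb0; have [z1 z2] := up _ b20; have [t1 t2] := up _ c0.
lra.
Qed.

Section static_estimates.
Variables (R : realType) (M L : nat) (K A kap : R) (y : nat -> R) (u W w1 : R -> R).
Local Notation dr f x l := (is_derive (x : R) (1 : R) (f : R -> R) (l : R)).
Local Notation v := (vf M y).
Local Notation V := (vf M (Ix y)).
Local Notation g := (vf M (gam M y)).
Local Notation yh := (hi L y).
Local Notation vh := (vf M yh).
Local Notation vl := (vf M (lo L y)).
Local Notation Vh := (vf M (Ix yh)).
Local Notation Vl := (vf M (Ix (lo L y))).
Local Notation w := (fun x => u x - v x).
Hypotheses (L0 : (0 < L)%N) (LM : (3 * L <= M)%N) (K1 : 1 <= K) (kap0 : 0 < kap) (kap1 : kap <= 1).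
Hypotheses (yK : \sum_(k < M.*2) y k ^+ 2 <= K) (vA : forall x, `|v x| <= A).
Hypotheses (cu : continuous u) (dW : forall x : R, dr W x (w x)) (dw : forall x : R, dr w x (w1 x)).
Hypotheses (cw1 : continuous w1) (pW : periodic1 W) (W0 : integralT W = 0).
Hypothesis um : integralT (fun x => u x ^+ 2) = integralT (fun x => v x ^+ 2).

Let n2 := integralT (fun x => w x ^+ 2).
Definition al4 (x : nat -> R) := integralT (fun t => vf M x t ^+ 4).
Local Notation a4 := (al4 y).
Local Notation b4 := (al4 yh).
Let b2 := \sum_(k < M.*2) yh k ^+ 2.
Let E := integralT (fun x => coproj M (fun x => v x ^+ 2) x ^+ 2).
Let rho := integralT (fun x => coproj M (fun x => V x * v x) x ^+ 2).
Let Z := integralT (fun x => coproj M (fun x => V x * g x) x ^+ 2).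

Let cv : continuous v. Proof. exact: cont_vf. Qed.
Let cV : continuous V. Proof. exact: cont_vf. Qed.
Let cg : continuous g. Proof. exact: cont_vf. Qed.
Let cvh : continuous vh. Proof. exact: cont_vf. Qed.
Let cvl : continuous vl. Proof. exact: cont_vf. Qed.
Let cVh : continuous Vh. Proof. exact: cont_vf. Qed.
Let cVl : continuous Vl. Proof. exact: cont_vf. Qed.
Let cW : continuous W. Proof. exact: dr_continuous dW. Qed.
Let cw : continuous w. Proof. by ct. Qed.
Let n20 : 0 <= n2. Proof. exact: iT_sqr0. Qed.
Let a40 : 0 <= a4. Proof. by apply: iT_ge0 => x; rewrite -[4%N]/(2 * 2)%N exprM sqr_ge0. Qed.
Let b40 : 0 <= b4. Proof. by apply: iT_ge0 => x; rewrite -[4%N]/(2 * 2)%N exprM sqr_ge0. Qed.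
Let b20 : 0 <= b2. Proof. by apply: sumr_ge0 => k _; exact: sqr_ge0. Qed.
Let E0 : 0 <= E. Proof. exact: iT_sqr0. Qed.
Let rho0 : 0 <= rho. Proof. exact: iT_sqr0. Qed.
Let Z0 : 0 <= Z. Proof. exact: iT_sqr0. Qed.
Let A0 : 0 <= A. Proof. exact: le_trans (normr_ge0 _) (vA 0). Qed.
Let v2K : integralT (fun x => v x ^+ 2) <= K. Proof. by rewrite iT_vf_sqr. Qed.

Let K0 : 0 <= K. Proof. exact: le_trans ler01 K1. Qed.
Let LL : (L + L <= M)%N. Proof. by clear -LM; lia. Qed.
Let L3 : (L + (L + L) <= M)%N. Proof. by clear -LM; lia. Qed.

Let W2 x : W x ^+ 2 <= n2.
Proof. exact: (primitive_bound x dW dw cw1 pW W0). Qed.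

Let V2 x : V x ^+ 2 <= K. Proof. exact: le_trans (vfI_sup _ _ _) yK. Qed.
Let Vl2 x : Vl x ^+ 2 <= K.
Proof. exact: le_trans (vfI_sup _ _ _) (le_trans (sum_lo _ _ _) yK). Qed.
Let Vh2 x : Vh x ^+ 2 <= b2. Proof. exact: vfI_sup. Qed.
Let Vh2' x : Vh x ^+ 2 <= K * (4 / L%:R).
Proof.
apply: le_trans (vfI_hi_sup _ _ _ L0) _; rewrite ler_wpM2r// divr_ge0//.
Qed.

Let n2K : n2 <= 4 * K.
Proof.
apply: (@le_trans _ _ (integralT (fun x => 2 * u x ^+ 2 + 2 * v x ^+ 2))).
  by apply: iT_le => [||x]; [by ct|by ct|by have := sqr_ge0 (u x + v x); lra].
rewrite (iTD (contZ (contX cu)) (contZ (contX cv))) !iTZ; [|by ct|by ct].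
rewrite um -mulrDl (_ : 2 + 2 = 4 :> R); last by ring.
by rewrite ler_wpM2l.
Qed.

Let vE x : v x = vl x + vh x.
Proof. by rewrite -vfD; apply: eq_vf => k _; exact: lohi. Qed.
Let VE x : V x = Vl x + Vh x.
Proof. by rewrite -vfD; apply: eq_vf => k _; rewrite Ix_lo Ix_hi; exact: lohi. Qed.

Let tvl : tpoly L vl. Proof. exact: tpoly_lo. Qed.
Let tVl : tpoly L Vl.
Proof.
have -> : Vl = vf M (lo L (Ix y)); last exact: tpoly_lo.
by apply/funext => x; apply: eq_vf => k _; exact: Ix_lo.
Qed.

Let F := integralT (fun x => (v x ^+ 2 - vl x ^+ 2) ^+ 2).
(** v^2 - vl^2 = vh (2 v - vh), and vh is small in L^4. *)
Let FE : F <= 4 * kap * a4 + 6 / kap * b4.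
Proof.
rewrite /a4 /b4 -!iTZ; try by ct. rewrite -iTD; try by ct.
apply: iT_le => [||x]; [by ct|by ct|].
have -> : v x ^+ 2 - vl x ^+ 2 = vh x * (2 * v x - vh x) by rewrite vE; ring.
set p := v x; set q := vh x.
have k1 : 1 <= kap^-1 by rewrite invf_ge1.
(* Young's inequality with weight kap for p^2 q^2. *)
have : 0 <= 4 * kap^-1 * (kap * p ^+ 2 - q ^+ 2) ^+ 2 by rewrite mulr_ge0 ?sqr_ge0// mulr_ge0// invr_ge0 ltW.
have -> : 4 * kap^-1 * (kap * p ^+ 2 - q ^+ 2) ^+ 2 =
   4 * kap * p ^+ 4 - 8 * p ^+ 2 * q ^+ 2 + 4 / kap * q ^+ 4 by field; rewrite gt_eqF.
have h2 : 2 * q ^+ 4 <= 2 / kap * q ^+ 4.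
  by rewrite ler_wpM2r//; [rewrite -[4%N]/(2 * 2)%N exprM sqr_ge0|lra].
have h3 : (q * (2 * p - q)) ^+ 2 <= 8 * p ^+ 2 * q ^+ 2 + 2 * q ^+ 4.
  have : 0 <= q ^+ 2 * (2 * p + q) ^+ 2 by rewrite mulr_ge0 ?sqr_ge0.
  lra.
rewrite (_ : 6 / kap = 4 / kap + 2 / kap); last by rewrite -mulrDl -natrD.
by rewrite mulrDl; lra.
Qed.

Let EF : E <= F.
Proof.
rewrite /E (@iT_eq _ _ (fun x => coproj M (fun x => v x ^+ 2 - vl x ^+ 2) x ^+ 2)); last first.
  move=> x; rewrite coprojB; [|by ct|by ct].
  rewrite [X in _ - X](_ : _ = 0) ?subr0//; apply: (@coproj_tpoly R M (fun x => vl x ^+ 2)).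
  have -> : (fun x => vl x ^+ 2) = (fun x => vl x * vl x) by apply/funext => z; rewrite expr2.
  exact: (tpoly_le LL (tpolyM tvl tvl)).
by apply: iT_coproj_le; ct.
Qed.

(** The product Vl vl has no frequency above M, as L + L <= M. *)
Let rhoE : rho <= 4 * K * b2.
Proof.
rewrite /rho (@iT_eq _ _ (fun x => coproj M (fun x => V x * v x - Vl x * vl x) x ^+ 2)); last first.
  move=> x; rewrite coprojB; [|by ct|by ct].
  rewrite [X in _ - X](_ : _ = 0) ?subr0//; apply: (@coproj_tpoly R M (fun x => Vl x * vl x)).
  exact: (tpoly_le LL (tpolyM tVl tvl)).
apply: le_trans (iT_coproj_le _ _) _; first by ct.
apply: (@le_trans _ _ (integralT (fun x => (2 * b2) * v x ^+ 2 + (2 * K) * vh x ^+ 2))).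
  apply: iT_le => [||x]; [by ct|by ct|].
  have -> : V x * v x - Vl x * vl x = Vh x * v x + Vl x * vh x by rewrite VE vE; ring.
  set p := Vh x * v x; set q := Vl x * vh x.
  have h1 : p ^+ 2 <= b2 * v x ^+ 2 by rewrite exprMn ler_wpM2r ?sqr_ge0.
  have h2 : q ^+ 2 <= K * vh x ^+ 2 by rewrite exprMn ler_wpM2r ?sqr_ge0.
  by have := sqr_ge0 (p - q); lra.
rewrite iTD ?iTZ//; try by ct.
rewrite (iT_vf_sqr M yh) -/b2.
have : b2 * integralT (fun x => v x ^+ 2) <= b2 * K by rewrite ler_wpM2l.
by lra.
Qed.

Let rsup x : coproj M (fun x => V x * v x) x ^+ 2 <= 4 * M%:R * rho.
Proof.
have c : continuous (fun x => V x * v x) by ct.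
apply: le_trans (coproj_sup c (tpolyM (tpoly_vf M (Ix y)) (tpoly_vf M y)) (leq_addr M M) x) _.
have -> : (M + M).*2%:R = 4 * M%:R :> R by rewrite -muln2 natrM natrD; ring.
by rewrite mulrC.
Qed.

(** As for rhoE, with the product of Vl and of the mean zero part of vl^2, of
   degree 3 L <= M. *)
Let ZE : Z <= 8 * K / L%:R * a4 + 2 * K * F.
Proof.
pose g' x := vl x ^+ 2 - integralT (fun x => vl x ^+ 2).
have tl2 : tpoly (L + L) (fun x => vl x ^+ 2).
  have -> : (fun x => vl x ^+ 2) = (fun x => vl x * vl x) by apply/funext => z; rewrite expr2.
  exact: tpolyM.
have tg' : tpoly (L + L) g'.
  rewrite /g' (_ : (fun x => _) = fun x => vl x ^+ 2 + (-1) * integralT (fun x => vl x ^+ 2)).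
    by apply: tpoly_add => //; apply: tpolyZ; exact: tpoly_cst.
  by apply/funext => x; rewrite mulN1r.
have cg' : continuous g' by exact: tpoly_cont tg'.
have gg' x : g x - g' x = proj M (fun x => v x ^+ 2 - vl x ^+ 2) x.
  have h : g' x = proj M (fun x => vl x ^+ 2) x.
    have := @coproj_tpoly R M (fun x => vl x ^+ 2) (tpoly_le LL tl2) x.
    by rewrite /coproj /g' => h; apply/eqP; rewrite -subr_eq0 h.
  rewrite h (_ : g = proj M (fun x => v x ^+ 2))// !projE -vfB; apply: eq_vf => k _.
  rewrite /coef -iTB; first by apply: iT_eq => z; rewrite mulrBl.
    by ct; exact: cont_emode.
  by ct; exact: cont_emode.
have ggF : integralT (fun x => (g x - g' x) ^+ 2) <= F.
  by rewrite (iT_eq (fun x => congr1 (fun z => z ^+ 2) (gg' x))); apply: iT_proj_le; ct.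
have g2 : integralT (fun x => g x ^+ 2) <= a4.
  apply: le_trans (@iT_proj_le R M (fun x => v x ^+ 2) _) _; first by ct.
  by apply: eq_ler; apply: iT_eq => x; rewrite -exprM.
rewrite /Z (@iT_eq _ _ (fun x => coproj M (fun x => V x * g x - Vl x * g' x) x ^+ 2)); last first.
  move=> x; rewrite coprojB; [|by ct|by ct].
  rewrite [X in _ - X](_ : _ = 0) ?subr0//; apply: (@coproj_tpoly R M (fun x => Vl x * g' x)).
  exact: (tpoly_le L3 (tpolyM tVl tg')).
apply: le_trans (iT_coproj_le _ _) _; first by ct.
apply: (@le_trans _ _ (integralT (fun x => (8 * K / L%:R) * g x ^+ 2 + (2 * K) * (g x - g' x) ^+ 2))).
  apply: iT_le => [||x]; [by ct|by ct|].
  have -> : V x * g x - Vl x * g' x = Vh x * g x + Vl x * (g x - g' x) by rewrite VE; ring.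
  set p := Vh x * g x; set q := Vl x * (g x - g' x).
  have h1 : p ^+ 2 <= K * (4 / L%:R) * g x ^+ 2 by rewrite exprMn ler_wpM2r ?sqr_ge0.
  have h2 : q ^+ 2 <= K * (g x - g' x) ^+ 2 by rewrite exprMn ler_wpM2r ?sqr_ge0.
  have -> : 8 * K / L%:R = 2 * (K * (4 / L%:R)) by ring.
  by have := sqr_ge0 (p - q); lra.
rewrite iTD ?iTZ//; try by ct.
by apply: lerD; rewrite ler_wpM2l// ?mulr_ge0// invr_ge0.
Qed.

Let T0 : integralT (fun x => V x * v x) = 0.
Proof.
apply: (@iT_derive_periodic _ (fun x => 2^-1 * (V x * V x)) (fun x => V x * v x)).
- move=> x; have h := @dr_vfI R M y x.
  by apply: dr_eq (drZ 2^-1 (drM h h)) _; field.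
- by ct.
- by move=> x; rewrite !vf_periodic.
Qed.

Let g2 : integralT (fun x => g x ^+ 2) <= a4.
Proof.
apply: le_trans (@iT_proj_le R M (fun x => v x ^+ 2) _) _; first by ct.
by apply: eq_ler; apply: iT_eq => x; rewrite -exprM.
Qed.

Let WK x : `|W x| <= 2 * K.
Proof.
apply: normr_le_sqr; first by rewrite mulr_ge0.
apply: le_trans (W2 x) _; apply: le_trans n2K _.
by rewrite exprMn expr2 -natrM ler_wpM2l// expr2 ler_peMl.
Qed.

(** Means of rate are bounded and means of defect tend to 0 as the truncation
   level grows: for M = 3 k^2, L = k^2 and kap = 1/k, the samples satisfy
   b2 = O(1 / L) and b4 = O(1 / L^2) in mean. *)
Definition rate := 400 * 16 * K ^+ 3 * (1 + A + a4 + M%:R * b2).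
Definition defect := 400 * 64 * K ^+ 3 * (kap * a4 + kap^-1 * ((1 + M%:R) * b4) + b2 + a4 / L%:R).

Let core : `|integralT (good_integrand u v w W V g (coproj M u) (proj M (fun x => u x ^+ 2))
    (integralT (fun x => v x ^+ 2)) (4 * K))| <=
  400 * K ^+ 2 * (1 + A + a4 + 4 * M%:R * rho) * n2
  + 400 * K * (E + rho + kap * a4 + kap^-1 * (4 * M%:R * rho * rho) + Z).
Proof.
have cvv : continuous (fun x => v x ^+ 2) by ct.
have cuu : continuous (fun x => u x ^+ 2) by ct.
have cVv : continuous (fun x => V x * v x) by ct.
have cVg : continuous (fun x => V x * g x) by ct.
apply: (@good_core R u v w W V g (coproj M u) (proj M (fun x => u x ^+ 2))
  (coproj M (fun x => v x ^+ 2)) (coproj M (fun x => V x * v x)) (coproj M (fun x => V x * g x))) => //.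
- exact: cont_coproj.
- exact: cont_proj.
- exact: cont_coproj.
- exact: cont_coproj.
- exact: cont_coproj.
- exact: (mulr_ge0 (mulr_ge0 (ler0n _ 4) (ler0n _ M)) rho0).
- by move=> x; rewrite addrC subrK.
- by move=> x; rewrite /coproj -projE; ring.
- by apply: iT_eq => x; rewrite -exprM.
- rewrite -iT_coproj_sym; [|by []|exact: cont_coproj].
  by apply: iT_eq => x; rewrite coproj_idem.
- rewrite iT_coproj_sym//.
  rewrite [RHS](@iT_eq _ _ (fun x => (u x ^+ 2 - proj M (fun x => u x ^+ 2) x) * (V x * v x)
     - integralT (fun x => u x ^+ 2) * (V x * v x))); last by move=> x; rewrite /coproj; ring.
  have cp := @cont_proj R M (fun x => u x ^+ 2).
  by rewrite iTB ?iTZ ?T0 ?mulr0 ?subr0//; ct.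
- rewrite -iT_coproj_sym//.
  rewrite (@iT_eq _ _ (fun x => w x * coproj M (fun x => V x * g x) x + v x * coproj M (fun x => V x * g x) x)); last by move=> x; ring.
  have cz := cont_coproj (M := M) cVg.
  rewrite (iTD (contM cw cz) (contM cv cz)) [X in _ + X](_ : _ = 0) ?addr0//.
  rewrite iT_coproj_sym//.
  rewrite -[RHS](iT_cst 0); apply: iT_eq => x.
  by rewrite (coproj_tpoly (tpoly_vf M y)) mul0r.
Qed.

Let b2b4 : b2 ^+ 2 <= b4.
Proof.
rewrite /b2 -(iT_vf_sqr M yh); have := iT_CS (contX (n := 2) cvh) (@cont_cst R 1).
rewrite (@iT_eq _ (fun x => vh x ^+ 2 * 1) (fun x => vh x ^+ 2)); last by move=> x; rewrite mulr1.
move=> /le_trans; apply; rewrite (_ : integralT (fun _ => 1 ^+ 2) = 1) ?mulr1.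
  by apply: eq_ler; apply: iT_eq => x; rewrite -exprM.
by rewrite expr1n iT_cst.
Qed.

Lemma good_bound : `|integralT (good_integrand u v w W V g (coproj M u) (proj M (fun x => u x ^+ 2))
    (integralT (fun x => v x ^+ 2)) (4 * K))| <= rate * n2 + defect.
Proof.
apply: le_trans core _; rewrite /rate /defect.
apply: (@good_algebra R K A kap kap^-1 a4 b4 b2 E F rho Z n2 (a4 / L%:R) M%:R 400 (ler0n _ _) _ _
  (ler0n _ _) _ K1 K0 A0 n20 a40 b40 b20 E0 rho0 Z0 kap0 FE EF rhoE _ b2b4).
- by rewrite invr_gt0.
- by rewrite invf_ge1.
- by rewrite divr_ge0.
- by apply: le_trans ZE _; apply: eq_ler; congr (_ + _); rewrite mulrA mulrAC.
Qed.

End static_estimates.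

(** * The energy of the error and its derivative *)

(** A digit in a name is an order of x-derivation; the time derivatives have been
   replaced by the equations.  The right-hand side is the sum of a part that never
   differentiates w, of a part whose integral vanishes because w - q is a low
   frequency function and g is the projection of v^2, and of an x-derivative. *)
Lemma energy_identity (R : comPzRingType) (u u1 u2 u3 v v1 v2 v3 g g1 q q1 q2 q3 G G1 W V m B : R) :
  let w := u - v in let w1 := u1 - v1 in let w2 := u2 - v2 in let w3 := u3 - v3 in
  2 * (w * (- w3 + 3 * (2 * u * u1 - g1)))
  + 2 * (2 * (W * (- w2 + 3 * (u ^+ 2 - m - g))) * v + W ^+ 2 * (- v3 + 3 * g1))
  - 2 * ((- q3 + 3 * (2 * u * u1 - G1)) * V ^+ 2 + q * (2 * (V * (- v2 + 3 * g))))
  + B * (2 * (W * (- w2 + 3 * (u ^+ 2 - m - g))))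
  = (12 * (W * v * (u ^+ 2 - m - g)) - 12 * (W * w * g)
  + 12 * ((u ^+ 2 - G) * (V * v)) - 12 * (q * (V * g))
  + 6 * B * (W * (u ^+ 2 - m - g)))
  + (12 * (w * v * v1) - 6 * (w * g1) - 12 * (q * v * v1))
  + (- 2 * (w * w3) + 12 * (w ^+ 2 * w1) + 16 * (w * w1 * v) + 8 * (w ^+ 2 * v1)
     - 4 * (w * v * w1 + W * v1 * w1 + W * v * w2) + 4 * (w * w * v1 + W * w1 * v1 + W * w * v2)
     - 2 * (2 * (W * w * v2) + W ^+ 2 * v3) + 6 * (2 * (W * w * g) + W ^+ 2 * g1)
     + 2 * (q3 * V ^+ 2 + 2 * (q2 * V * v)) - 4 * (q2 * V * v + q1 * v * v + q1 * V * v1)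
     + 4 * (q1 * (v ^+ 2 + V * v1) + q * (3 * (v * v1) + V * v2))
     - 6 * ((2 * u * u1 - G1) * V ^+ 2 + 2 * ((u ^+ 2 - G) * (V * v))) - 2 * B * (W * w2)).
Proof. move=> w w1 w2 w3; rewrite /w /w1 /w2 /w3. ring. Qed.

Section energy_flux.
Variables (R : realType) (u u1 v v1 v2 v3 g g1 q q1 q2 q3 G G1 W V w w1 w2 w3 : R -> R) (B : R).
Local Notation dr f x l := (is_derive (x : R) (1 : R) (f : R -> R) (l : R)).
Hypotheses (du : forall x : R, dr u x (u1 x)) (dv : forall x : R, dr v x (v1 x)).
Hypotheses (dv1 : forall x : R, dr v1 x (v2 x)) (dv2 : forall x : R, dr v2 x (v3 x)).
Hypotheses (dg : forall x : R, dr g x (g1 x)) (dG : forall x : R, dr G x (G1 x)).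
Hypotheses (dq : forall x : R, dr q x (q1 x)) (dq1 : forall x : R, dr q1 x (q2 x)).
Hypotheses (dq2 : forall x : R, dr q2 x (q3 x)) (dW : forall x : R, dr W x (w x)).
Hypotheses (dV : forall x : R, dr V x (v x)) (dw : forall x : R, dr w x (w1 x)).
Hypotheses (dw1 : forall x : R, dr w1 x (w2 x)) (dw2 : forall x : R, dr w2 x (w3 x)).
Hypotheses (cu1 : continuous u1) (cv3 : continuous v3) (cg1 : continuous g1) (cG1 : continuous G1).
Hypotheses (cq3 : continuous q3) (cw3 : continuous w3).
Hypotheses (pu : periodic1 u) (pv : periodic1 v) (pg : periodic1 g) (pG : periodic1 G).
Hypotheses (pq : periodic1 q) (pW : periodic1 W) (pV : periodic1 V).

(** The x-derivative of a periodic function, see iT_flux'. *)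
Definition flux' x : R :=
 (- 2 * (w x * w3 x) + 12 * (w x ^+ 2 * w1 x) + 16 * (w x * w1 x * v x) + 8 * (w x ^+ 2 * v1 x)
     - 4 * (w x * v x * w1 x + W x * v1 x * w1 x + W x * v x * w2 x)
     + 4 * (w x * w x * v1 x + W x * w1 x * v1 x + W x * w x * v2 x)
     - 2 * (2 * (W x * w x * v2 x) + W x ^+ 2 * v3 x) + 6 * (2 * (W x * w x * g x) + W x ^+ 2 * g1 x)
     + 2 * (q3 x * V x ^+ 2 + 2 * (q2 x * V x * v x)) - 4 * (q2 x * V x * v x + q1 x * v x * v x + q1 x * V x * v1 x)
     + 4 * (q1 x * (v x ^+ 2 + V x * v1 x) + q x * (3 * (v x * v1 x) + V x * v2 x))
     - 6 * ((2 * u x * u1 x - G1 x) * V x ^+ 2 + 2 * ((u x ^+ 2 - G x) * (V x * v x))) - 2 * B * (W x * w2 x)).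

Let cu := dr_continuous du. Let cv := dr_continuous dv. Let cv1 := dr_continuous dv1.
Let cv2 := dr_continuous dv2. Let cg := dr_continuous dg. Let cG := dr_continuous dG.
Let cq := dr_continuous dq. Let cq1 := dr_continuous dq1. Let cq2 := dr_continuous dq2.
Let cW := dr_continuous dW. Let cV := dr_continuous dV. Let cw := dr_continuous dw.
Let cw1 := dr_continuous dw1. Let cw2 := dr_continuous dw2.

Lemma cont_flux' : continuous flux'.
Proof. rewrite /flux'; ct. Qed.

Lemma iT_flux' : integralT flux' = 0.
Proof.
have pv1 := dr_periodic pv dv; have pv2 := dr_periodic pv1 dv1.
have pw := dr_periodic pW dW; have pw1 := dr_periodic pw dw; have pw2 := dr_periodic pw1 dw1.
have pq1 := dr_periodic pq dq; have pq2 := dr_periodic pq1 dq1.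
have D (x : R) := (drD (drB (drD (drB (drD (drD (drB (drD (drB (drD (drD (drD
    (drZ (-2) (drM (dw x) (dw2 x))) (drM (dw1 x) (dw1 x))) (drZ 4 (drM (drM (dw x) (dw x)) (dw x))))
    (drZ 8 (drM (drM (dw x) (dw x)) (dv x)))) (drZ 4 (drM (dW x) (drM (dv x) (dw1 x))))) (drZ 4 (drM (dW x) (drM (dw x) (dv1 x)))))
    (drZ 2 (drM (drM (dW x) (dW x)) (dv2 x)))) (drZ 6 (drM (drM (dW x) (dW x)) (dg x)))) (drZ 2 (drM (dq2 x) (drM (dV x) (dV x)))))
    (drZ 4 (drM (dq1 x) (drM (dV x) (dv x))))) (drZ 4 (drM (dq x) (drD (drM (dv x) (dv x)) (drM (dV x) (dv1 x))))))
    (drZ 6 (drM (drB (drM (du x) (du x)) (dG x)) (drM (dV x) (dV x)))))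
    (drZ B (drD (drZ (-2) (drM (dW x) (dw1 x))) (drM (dw x) (dw x))))).
apply: iT_derive_periodic (fun x => dr_eq (D x) _) cont_flux' _ => x.
  rewrite /flux'; ring.
by rewrite /= ?(pu, pv, pg, pG, pq, pW, pV, pv1, pv2, pw, pw1, pw2, pq1, pq2).
Qed.

End energy_flux.

Section energy.
Variables (R : realType) (M : nat) (B : R) (u : R -> R -> R) (a b : R) (y Y : R -> nat -> R).
Local Notation dr f x l := (is_derive (x : R) (1 : R) (f : R -> R) (l : R)).
Hypotheses (kdvu : kdv_solution u) (u0 : integralT (u 0) = 0).
Hypothesis dy : forall i (t : R), a < t < b -> dr (y ^~ i) t (Y t i).
Hypothesis cY : forall i (t : R), a < t < b -> {for t, continuous (Y ^~ i)}.

Let su : smooth2 u. Proof. by case: kdvu. Qed.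
Let pu (t : R) : periodic1 (u t). Proof. by case: kdvu. Qed.
Local Notation m := (integralT (fun x => u 0 x ^+ 2)).
Local Notation v t := (vf M (y t)).
Local Notation V t := (vf M (Ix (y t))).
Local Notation c t := (coef (u t)).
Definition tail (t x : R) := u t x - vf M (coef (u t)) x.
Definition err (t x : R) := u t x - vf M (y t) x.
Definition errI (t x : R) := upot u t x - vf M (Ix (y t)) x.
Local Notation q := tail.
Local Notation w := err.
Local Notation W := errI.

Let um (t : R) : integralT (u t) = 0. Proof. by rewrite kdv_mean. Qed.

Let C1v : C1t a b (fun t x => vf M (y t) x) (fun t x => vf M (Y t) x).
Proof.
apply: (@C1t_sum R a b _ _ _ (fun (k : 'I_(M.*2)) t x => y t k * emode R k x)
  (fun (k : 'I_(M.*2)) t x => Y t k * emode R k x)) => k _.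
by apply: (C1t_tx (f := y^~ k) (f' := Y^~ k)) => [t tI|]; [exact: cY|exact: cont_emode].
Qed.

Let C1V : C1t a b (fun t x => vf M (Ix (y t)) x) (fun t x => vf M (Ix (Y t)) x).
Proof.
apply: C1t_sum => k _.
apply: (C1t_tx (f := fun t => Ix (y t) k) (f' := fun t => Ix (Y t) k)); [| |exact: cont_emode].
  by move=> t tI; apply: drZ; exact: dy.
by move=> t tI; apply: cvgM; [exact: cvg_cst|exact: cY].
Qed.

Let su_t : smooth2 (partial_t u). Proof. exact: smooth2_t. Qed.

Let dc k (t : R) : dr (fun t => c t k) t (coef (partial_t u t) k).
Proof.
have tI : t - 1 < t < t + 1 by rewrite ltrBlDr ltrDl ltr01.
have C := C1tM (C1t_u kdvu (t - 1) (t + 1)) (C1t_tx (e := emode R k) (fun t _ => dr_cst 1 t) (fun t _ => @cont_cst R 0 t) (@cont_emode R k)).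
have h := C1t_int C tI.
have -> : (fun t => c t k) = (fun t => integralT (fun x => u t x * (1 * emode R k x))).
  by apply/funext => s; apply: iT_eq => x; rewrite mul1r.
by apply: dr_eq h _; apply: iT_eq => x; rewrite mul1r mul0r mulr0 addr0.
Qed.

Let cc k (t : R) : {for t, continuous (fun t => coef (partial_t u t) k)}.
Proof.
apply: (@iT_cont_param R _ (fun t x => partial_t u t x * emode R k x)) => [x|].
  apply: cvgM; first exact: (@smooth2_cont _ _ su_t (t, x)).
  by apply: (@for_cont_comp _ _ _ snd (emode R k)); [exact: cvg_snd|exact: cont_emode].
by apply: (@nearW _ (nbhs t)) => s; apply: contM; [exact: smooth2_cx|exact: cont_emode].
Qed.

Let C1q : C1t a b q (fun t x => partial_t u t x - vf M (coef (partial_t u t)) x).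
Proof.
apply: C1tB; first exact: C1t_u.
apply: C1t_sum => k _; apply: (C1t_tx (f := fun t => c t k) (f' := fun t => coef (partial_t u t) k)).
- by move=> t _; exact: dc.
- by move=> t _; exact: cc.
- exact: cont_emode.
Qed.

Let C1w : C1t a b w (fun t x => partial_t u t x - vf M (Y t) x).
Proof. by apply: C1tB; [exact: C1t_u|exact: C1v]. Qed.

Let C1W : C1t a b W (fun t x => (kdv_flux u t x - 3 * m) - vf M (Ix (Y t)) x).
Proof. by apply: C1tB; [exact: C1t_upot|exact: C1V]. Qed.

(** Quadratic energy of the difference between the solution and its Galerkin
   approximation, corrected by terms of lower order so that the derivatives that
   the data do not control cancel. *)
Definition energy (t : R) : R := integralT (fun x =>
  w t x * w t x + 2 * (W t x * W t x * v t x) - 2 * (q t x * (V t x * V t x)) + B * (W t x * W t x)).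

Let energy' (t x : R) : R :=
  let wt := partial_t u t x - vf M (Y t) x in
  let Wt := (kdv_flux u t x - 3 * m) - vf M (Ix (Y t)) x in
  let qt := partial_t u t x - vf M (coef (partial_t u t)) x in
  let vt := vf M (Y t) x in let Vt := vf M (Ix (Y t)) x in
  2 * (w t x * wt) + 2 * (2 * (W t x * Wt) * v t x + W t x ^+ 2 * vt)
  - 2 * (qt * V t x ^+ 2 + q t x * (2 * (V t x * Vt))) + B * (2 * (W t x * Wt)).

Let dr_energy (t : R) : a < t < b -> dr energy t (integralT (energy' t)).
Proof.
move=> tI.
have C := C1tD (C1tB (C1tD (C1tM C1w C1w) (C1tZ 2 (C1tM (C1tM C1W C1W) C1v)))
   (C1tZ 2 (C1tM C1q (C1tM C1V C1V)))) (C1tZ B (C1tM C1W C1W)).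
apply: dr_eq (C1t_int C tI) _; apply: iT_eq => x; rewrite /energy'; ring.
Qed.

Let coef_dr (f f' : R -> R) k : (forall x : R, dr f x (f' x)) -> continuous f' -> periodic1 f ->
  coef f' k = Dx (coef f) k.
Proof.
move=> df cf' pf; have cf : continuous f := dr_continuous df.
have ce := @cont_emode R k; have ce' := @cont_emode R (partner k).
have D (x : R) := drM (df x) (dr_emode k x).
have cD : continuous (fun x => f' x * emode R k x + f x * (dsign R k * freq R k * emode R (partner k) x)).
  by ct.
have := iT_derive_periodic D cD _; rewrite iTD; [|by ct|by ct] => H.
have {}H := H (fun x => congr2 *%R (pf x) (emode_periodic k x)).
rewrite /Dx /coef mulNr; apply/eqP; rewrite -addr_eq0; apply/eqP; rewrite -[RHS]H; congr (_ + _).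
rewrite -iTZ; last by ct.
by apply: iT_eq => x; ring.
Qed.

Local Notation ux := (ux u).
Local Notation uxx := (uxx u).
Local Notation uxxx := (uxxx u).
Let sux : smooth2 ux. Proof. exact: smooth2_x. Qed.
Let suxx : smooth2 uxx. Proof. exact: smooth2_x. Qed.
Let suxxx : smooth2 uxxx. Proof. exact: smooth2_x. Qed.
Let cu t : continuous (u t). Proof. exact: smooth2_cx. Qed.
Let cux t : continuous (ux t). Proof. exact: smooth2_cx. Qed.
Let cuxx t : continuous (uxx t). Proof. exact: smooth2_cx. Qed.
Let cuxxx t : continuous (uxxx t). Proof. exact: smooth2_cx. Qed.
Let dux (t x : R) : dr (u t) x (ux t x). Proof. exact: smooth2_drx. Qed.
Let duxx (t x : R) : dr (ux t) x (uxx t x). Proof. exact: smooth2_drx. Qed.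
Let duxxx (t x : R) : dr (uxx t) x (uxxx t x). Proof. exact: smooth2_drx. Qed.

Local Notation G t := (proj M (fun x => u t x ^+ 2)).
Local Notation G1 t := (vf M (Dx (coef (fun x => u t x ^+ 2)))).
Let q1 (t x : R) := ux t x - vf M (Dx (c t)) x.
Let q2 (t x : R) := uxx t x - vf M (Dx (Dx (c t))) x.
Let q3 (t x : R) := uxxx t x - vf M (Dx (Dx (Dx (c t)))) x.

Let proj_ut t x : vf M (coef (partial_t u t)) x =
  - vf M (Dx (Dx (Dx (c t)))) x + 3 * G1 t x.
Proof.
rewrite -mulN1r -!vfZ -vfD; apply: eq_vf => k _.
have -> : coef (partial_t u t) k = Dx (coef (kdv_flux u t)) k.
  apply: (@coef_dr (kdv_flux u t)) => [z||]; [exact: dr_flux|exact: smooth2_cx|exact: flux_periodic].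
have e j : coef (kdv_flux u t) j = - Dx (Dx (c t)) j + 3 * coef (fun x => u t x ^+ 2) j.
  have ce := @cont_emode R j.
  have -> : Dx (Dx (c t)) j = coef (uxx t) j.
    have := @coef_dr (ux t) (uxx t) j (duxx t) (@cuxx t) (@ux_periodic _ _ kdvu t) => ->.
    by rewrite [LHS]/Dx [RHS]/Dx; congr (_ * _); have := @coef_dr (u t) (ux t) (partner j) (dux t) (@cux t) (@pu t).
  rewrite /coef -iTZ; last by have h := @cu t; ct.
  rewrite -iTN; last by have h := @cuxx t; ct.
  rewrite -iTD; [|by have h := @cuxx t; ct|by have h := @cu t; ct].
  by apply: iT_eq => z; rewrite /kdv_flux; ring.
rewrite {1}/Dx e [Dx (Dx (Dx _)) k]/Dx [Dx (coef _) k]/Dx; ring.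
Qed.

Let qE t x : coproj M (u t) x = q t x.
Proof. by rewrite /coproj um subr0 projE. Qed.

Section at_time.
Variable t : R.
Hypotheses (tI : a < t < b) (Yt : forall i, (i < M.*2)%N -> Y t i = kdvX M (y t) i).
Local Notation v1 := (vf M (Dx (y t))).
Local Notation v2 := (vf M (Dx (Dx (y t)))).
Local Notation v3 := (vf M (Dx (Dx (Dx (y t))))).
Local Notation g := (vf M (gam M (y t))).
Local Notation g1 := (vf M (Dx (gam M (y t)))).

Let vt x : vf M (Y t) x = - v3 x + 3 * g1 x.
Proof. by rewrite -vf_kdvX; exact: eq_vf. Qed.
Let Vt x : vf M (Ix (Y t)) x = - v2 x + 3 * g x.
Proof.
rewrite -vf_Ix_kdvX; apply: eq_vf => k kM; rewrite /Ix Yt// partner_ltn//.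
Qed.

Let R0 x : R := 12 * (w t x * v t x * v1 x) - 6 * (w t x * g1 x) - 12 * (q t x * v t x * v1 x).
Local Notation Phi' := (flux' (u t) (ux t) (v t) v1 v2 v3 g g1 (q t) (q1 t) (q2 t) (q3 t) (G t) (G1 t)
  (W t) (V t) (w t) (fun x => ux t x - v1 x) (fun x => uxx t x - v2 x) (fun x => uxxx t x - v3 x) B).

Let split x : energy' t x = good_integrand (u t) (v t) (w t) (W t) (V t) g (q t) (G t) m B x + R0 x + Phi' x.
Proof.
rewrite /energy' vt Vt proj_ut kdv_ut//.
rewrite /good_integrand /R0 /flux' /kdv_flux -(@energy_identity R (u t x) (ux t x) (uxx t x) (uxxx t x)
  (v t x) (v1 x) (v2 x) (v3 x) (g x) (g1 x) (q t x) (q1 t x) (q2 t x) (q3 t x) (G t x) (G1 t x) (W t x) (V t x) m B).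
rewrite /= /err /q3; ring.
Qed.

Let dW (x : R) : dr (W t) x (w t x).
Proof. by apply: drB; [exact: dr_upot_x|exact: dr_vfI]. Qed.
Let dw (x : R) : dr (w t) x (ux t x - v1 x).
Proof. by apply: drB; [exact: dux|exact: dr_vf]. Qed.
Let dw1 (x : R) : dr (fun x => ux t x - v1 x) x (uxx t x - v2 x).
Proof. by apply: drB; [exact: duxx|exact: dr_vf]. Qed.
Let dw2 (x : R) : dr (fun x => uxx t x - v2 x) x (uxxx t x - v3 x).
Proof. by apply: drB; [exact: duxxx|exact: dr_vf]. Qed.
Let dq (x : R) : dr (q t) x (q1 t x).
Proof. by apply: drB; [exact: dux|exact: dr_vf]. Qed.
Let dq1 (x : R) : dr (q1 t) x (q2 t x).
Proof. by apply: drB; [exact: duxx|exact: dr_vf]. Qed.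
Let dq2 (x : R) : dr (q2 t) x (q3 t x).
Proof. by apply: drB; [exact: duxxx|exact: dr_vf]. Qed.

Let cv : continuous (v t). Proof. exact: cont_vf. Qed.
Let cV : continuous (V t). Proof. exact: cont_vf. Qed.
Let cg : continuous g. Proof. exact: cont_vf. Qed.
Let cg1 : continuous g1. Proof. exact: cont_vf. Qed.
Let cv1 : continuous v1. Proof. exact: cont_vf. Qed.
Let cv2 : continuous v2. Proof. exact: cont_vf. Qed.
Let cv3 : continuous v3. Proof. exact: cont_vf. Qed.
Let cw : continuous (w t). Proof. exact: dr_continuous dw. Qed.
Let cW : continuous (W t). Proof. exact: dr_continuous dW. Qed.
Let cq : continuous (q t). Proof. exact: dr_continuous dq. Qed.
Let cq1 : continuous (q1 t). Proof. exact: dr_continuous dq1. Qed.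
Let cq2 : continuous (q2 t). Proof. exact: dr_continuous dq2. Qed.
Let cq3 : continuous (q3 t). Proof. by apply: contB; [exact: cuxxx|exact: cont_vf]. Qed.
Let cG : continuous (G t). Proof. exact: cont_vf. Qed.
Let cG1 : continuous (G1 t). Proof. exact: cont_vf. Qed.

Let intR0 : integralT R0 = 0.
Proof.
pose z k := c t k - y t k.
have zE x : vf M z x = w t x - q t x by rewrite vfB /err /tail; ring.
have czv : continuous (vf M z) by exact: cont_vf.
have cDz : continuous (vf M (Dx z)) by exact: cont_vf.
have I1 : integralT (fun x => q t x * g1 x) = 0.
  have -> : q t = coproj M (u t) by apply/funext => x; rewrite qE.
  rewrite -iT_coproj_sym; [|exact: cu|by []].
  rewrite -[RHS](iT_cst 0); apply: iT_eq => x; rewrite (coproj_tpoly (tpoly_vf _ _)) mulr0//.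
have I2 : integralT (fun x => vf M z x * (2 * (v t x * v1 x) - g1 x)) = 0.
  have D (x : R) : dr (fun x => vf M z x * (v t x * v t x - g x)) x
      (vf M (Dx z) x * (v t x ^+ 2 - g x) + vf M z x * (2 * (v t x * v1 x) - g1 x)).
    have h := @dr_vf R M (y t) x.
    by apply: dr_eq (drM (dr_vf M z x) (drB (drM h h) (dr_vf M (gam M (y t)) x))) _; ring.
  have := iT_derive_periodic D _ _.
  rewrite iTD; [|by ct|by ct].
  have -> : integralT (fun x => vf M (Dx z) x * (v t x ^+ 2 - g x)) = 0.
    rewrite (@iT_eq _ _ (fun x => vf M (Dx z) x * v t x ^+ 2 - vf M (Dx z) x * proj M (fun x => v t x ^+ 2) x)); last first.
      by move=> x; rewrite projE -/(gam M (y t)) mulrBr.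
    have cP := @cont_proj R M (fun x => v t x ^+ 2).
    rewrite iTB; [|by ct|by ct].
    rewrite iT_proj_sym; [|by ct|by ct].
    by under [X in _ - X]iT_eq do rewrite proj_vf; rewrite subrr.
  rewrite add0r; apply; first by ct.
  by move=> x; rewrite !vf_periodic.
rewrite (@iT_eq _ _ (fun x => 6 * (vf M z x * (2 * (v t x * v1 x) - g1 x)) - 6 * (q t x * g1 x))).
  by rewrite iTB ?iTZ ?I1 ?I2 ?mulr0 ?subrr//; ct.
by move=> x; rewrite zE /R0; ring.
Qed.

Let pw0 : periodic1 (W t).
Proof. by move=> x; rewrite /errI vf_periodic (@upot_periodic _ _ kdvu t). Qed.
Let pq0 : periodic1 (q t).
Proof. by move=> x; rewrite /tail vf_periodic pu. Qed.
Let dG x : dr (G t) x (G1 t x). Proof. exact: dr_vf. Qed.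
Let cw3 : continuous (fun x => uxxx t x - v3 x).
Proof. by apply: contB; [exact: cuxxx|exact: cont_vf]. Qed.
Let dv := dr_vf M (y t).
Let dv1 := dr_vf M (Dx (y t)).
Let dv2 := dr_vf M (Dx (Dx (y t))).
Let dg := dr_vf M (gam M (y t)).
Let dV := dr_vfI M (y t).

Let intPhi : integralT Phi' = 0.
Proof.
exact: (iT_flux' B (dux t) dv dv1 dv2 dg dG dq dq1 dq2 dW dV dw dw1 dw2 (@cux t) cv3 cg1 cG1 cq3 cw3 (@pu t)
  (@vf_periodic R M (y t)) (@vf_periodic R M (gam M (y t))) (@vf_periodic R M _) pq0 pw0 (@vf_periodic R M _)).
Qed.

Let cPhi : continuous Phi'.
Proof.
exact: (cont_flux' (dux t) dv dv1 dv2 dg dG dq dq1 dq2 dW dV dw dw1 dw2 (@cux t) cv3 cg1 cG1 cq3 cw3).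
Qed.

Lemma dr_energy_good : dr energy t (integralT
  (good_integrand (u t) (v t) (w t) (W t) (V t) g (coproj M (u t)) (proj M (fun x => u t x ^+ 2)) m B)).
Proof.
apply: dr_eq (dr_energy tI) _.
have -> : coproj M (u t) = q t by apply/funext => x; rewrite qE.
have h0 := @cu t; have h1 := @cux t; have h2 := @cuxx t; have h3 := @cuxxx t.
rewrite (iT_eq split) iTD.
- rewrite iTD ?intR0 ?intPhi ?addr0//; last by rewrite /R0; ct.
  by rewrite /good_integrand; ct.
- by rewrite /good_integrand /R0; ct.
- exact: cPhi.
Qed.

End at_time.

End energy.

(** * Growth of the energy over one time step *)

Section energy_lower_bound.
Variables (R : realType) (M L : nat) (K : R) (y : nat -> R) (u W w : R -> R).
Local Notation v := (vf M y).
Local Notation V := (vf M (Ix y)).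
Hypotheses (L0 : (0 < L)%N) (LL : (L + L <= M)%N) (K1 : 1 <= K).
Hypotheses (yK : \sum_(k < M.*2) y k ^+ 2 <= K).
Hypotheses (cu : continuous u) (cW : continuous W) (cw : continuous w).
Hypothesis uE : forall x, u x = v x + w x.
Hypothesis W2 : forall x, W x ^+ 2 <= integralT (fun x => w x ^+ 2).

(** The term in W^2 v is absorbed by 4 K W^2 since W^2 is pointwise at most
   int w^2; the term in q only sees the frequencies of V^2 above M, of square
   integral O(1 / L). *)
Lemma energy_lower : 2^-1 * integralT (fun x => w x ^+ 2) - 64 * K ^+ 2 / L%:R <=
  integralT (fun x => w x * w x + 2 * (W x * W x * v x) - 2 * (coproj M u x * (V x * V x))
    + 4 * K * (W x * W x)).
Proof.
have K0 : 0 < K by exact: lt_le_trans ltr01 K1.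
have cv : continuous v by exact: cont_vf.
have cV : continuous V by exact: cont_vf.
have cq := cont_coproj (M := M) cu.
have cVV : continuous (fun x => V x * V x) by ct.
have cz := cont_coproj (M := M) cVV.
have W2' := W2; set n2 := integralT _ in W2' *.
set z := coproj M (fun x => V x * V x) in cz.
rewrite iTD; [|by ct|by ct]; rewrite iTB; [|by ct|by ct]; rewrite iTD; [|by ct|by ct].
rewrite !iTZ; [|by ct|by ct|by ct].
have -> : integralT (fun x => w x * w x) = n2 by apply: iT_eq => x; rewrite expr2.
have n0 : 0 <= n2 by exact: iT_sqr0.
have h1 : `|integralT (fun x => W x * (W x * v x))| <=
    2^-1 * (4 * K * integralT (fun x => W x * W x) + (4 * K)^-1 * (n2 * K)).
  apply: le_trans (iT_young (_ : 0 < 4 * K) cW (contM cW cv)) _; first by rewrite mulr_gt0.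
  rewrite ler_wpM2l//; apply: lerD.
    by apply: eq_ler; congr (_ * _); apply: iT_eq => x; rewrite expr2.
  rewrite ler_wpM2l ?invr_ge0 ?mulr_ge0 ?(ltW K0)//.
  apply: (@le_trans _ _ (integralT (fun x => n2 * v x ^+ 2))).
    by apply: iT_le => [||x]; [by ct|by ct|rewrite exprMn ler_wpM2r ?sqr_ge0//; exact: W2'].
  by rewrite iTZ ?iT_vf_sqr ?ler_wpM2l//; ct.
have e1 : (4 * K)^-1 * (n2 * K) = n2 / 4 by field; rewrite gt_eqF.
rewrite e1 in h1.
have {}h1 : `|integralT (fun x => W x * W x * v x)| <= 2^-1 * (4 * K * integralT (fun x => W x * W x) + n2 / 4).
  by apply: le_trans h1; apply: eq_ler; congr (`|_|); apply: iT_eq => x; rewrite mulrA.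
have -> : integralT (fun x => coproj M u x * (V x * V x)) = integralT (fun x => w x * z x).
  rewrite -iT_coproj_sym//.
  rewrite (@iT_eq _ _ (fun x => w x * z x + v x * z x)); last by move=> x; rewrite uE -/z mulrDl addrC.
  rewrite (iTD (contM cw cz) (contM cv cz)) [X in _ + X](_ : _ = 0) ?addr0//.
  rewrite iT_coproj_sym//.
  rewrite -[RHS](iT_cst 0); apply: iT_eq => x.
  by rewrite (coproj_tpoly (tpoly_vf M y)) mul0r.
pose Vl := vf M (lo L (Ix y)); pose Vh := vf M (Ix (hi L y)).
have cVl : continuous Vl by exact: cont_vf.
have cVh : continuous Vh by exact: cont_vf.
have VE x : V x = Vl x + Vh x.
  by rewrite -vfD; apply: eq_vf => k _; rewrite Ix_hi; exact: lohi.
have Z2 : integralT (fun x => z x ^+ 2) <= 16 * K ^+ 2 / L%:R.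
  rewrite (@iT_eq _ _ (fun x => coproj M (fun x => V x * V x - Vl x * Vl x) x ^+ 2)); last first.
    move=> x; rewrite coprojB; [|by ct|by ct].
    rewrite [X in _ - X](_ : _ = 0) ?subr0//; apply: (@coproj_tpoly R M (fun x => Vl x * Vl x)).
    exact: (tpoly_le LL (tpolyM (tpoly_lo _ _ _) (tpoly_lo _ _ _))).
  apply: le_trans (iT_coproj_le _ _) _; first by ct.
  rewrite -[X in _ <= X]iT_cst; apply: iT_le => [||x]; [by ct|by ct|].
  have -> : V x * V x - Vl x * Vl x = Vh x * (V x + Vl x) by rewrite VE; ring.
  have hV : V x ^+ 2 <= K by exact: le_trans (vfI_sup _ _ _) yK.
  have hVl : Vl x ^+ 2 <= K.
    have -> : Vl x = vf M (Ix (lo L y)) x by apply: eq_vf => k _; rewrite Ix_lo.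
    exact: le_trans (vfI_sup _ _ _) (le_trans (sum_lo _ _ _) yK).
  have hVh : Vh x ^+ 2 <= K * (4 / L%:R).
    by apply: le_trans (vfI_hi_sup _ _ _ L0) _; rewrite ler_wpM2r// divr_ge0.
  have hs : (V x + Vl x) ^+ 2 <= 4 * K by have := sqr_ge0 (V x - Vl x); lra.
  rewrite exprMn (_ : 16 * K ^+ 2 / L%:R = K * (4 / L%:R) * (4 * K)); last by ring.
  by apply: ler_pM; rewrite ?sqr_ge0.
have h2 : `|integralT (fun x => w x * z x)| <= 2^-1 * (4^-1 * n2 + 4 * (16 * K ^+ 2 / L%:R)).
  have q4 : (0 : R) < 4^-1 by rewrite invr_gt0.
  apply: le_trans (iT_young q4 cw cz) _.
  by rewrite ler_wpM2l// lerD2l invrK ler_wpM2l.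
have -> : 64 * K ^+ 2 / L%:R = 4 * (16 * K ^+ 2 / L%:R) by ring.
move: h1 h2; set p1 := integralT (fun x => W x * W x * v x).
set p2 := integralT (fun x => w x * z x); set p3 := integralT (fun x => W x * W x).
set p4 := 16 * K ^+ 2 / L%:R.
rewrite !ler_norml; lra.
Qed.

End energy_lower_bound.

Lemma gronwall (R : realType) (f f' : R -> R) (c b t0 h : R) : 0 <= h -> 0 <= b -> 0 <= c ->
  (forall t, t0 <= t <= t0 + h -> is_derive t 1 f (f' t)) ->
  (forall t, t0 <= t <= t0 + h -> f' t <= c * f t + b) ->
  f (t0 + h) <= expR (c * h) * (f t0 + h * b).
Proof.
move=> h0 b0 c0 df hf.
have de (t : R) : is_derive t 1 (fun t => expR (- c * (t - t0))) (expR (- c * (t - t0)) * - c).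
  have h1 : is_derive t 1 (fun t => - c * (t - t0)) (- c).
    by apply: dr_eq (drZ (- c) (drB (dr_id t) (dr_cst t0 t))) _; ring.
  exact: (dr_comp h1 (is_derive_expR _)).
pose F t := - (expR (- c * (t - t0)) * f t - b * (t - t0)).
have dF (t : R) : t0 <= t <= t0 + h -> is_derive t 1 F (- (expR (- c * (t - t0)) * - c * f t + expR (- c * (t - t0)) * f' t - b)).
  move=> tI; apply: dr_eq (drN (drB (drM (de t) (df t tI)) (drZ b (drB (dr_id t) (dr_cst t0 t))))) _; ring.
have /= := @dr_nondecreasing R F _ t0 (t0 + h) dF _ _.
rewrite /F subrr !mulr0 expR0 mul1r subr0 (_ : t0 + h - t0 = h); last by ring.
move=> H; have {}H : expR (- c * h) * f (t0 + h) <= f t0 + h * b.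
  rewrite lerN2 in H; rewrite -lerBlDr [h * b]mulrC; apply: H; last by rewrite lerDl.
  move=> t tI; set E := expR _; rewrite oppr_ge0.
  have E0 : 0 <= E by exact: expR_ge0.
  have E1 : E <= 1.
    rewrite /E -[leRHS]expR0 ler_expR mulNr oppr_le0 mulr_ge0//; lra.
  have := hf t tI => h1; have := ler_wpM2l E0 h1; nra.
have -> : f (t0 + h) = expR (c * h) * (expR (- c * h) * f (t0 + h)).
  by rewrite mulrA -expRD mulNr subrr expR0 mul1r.
by rewrite ler_wpM2l ?expR_ge0.
Qed.

Section perturbation.
Variables (R : realType) (M L : nat) (eta : R) (x z : nat -> R).
Hypothesis xz : forall k, (k < M.*2)%N -> `|z k - x k| <= eta.
Local Notation eta1 := (4 * M%:R * eta).

Lemma vf_perturb t : `|vf M z t - vf M x t| <= eta1.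
Proof.
rewrite -vfB /vf; apply: le_trans (ler_norm_sum _ _ _) _.
apply: (@le_trans _ _ (\sum_(k < M.*2) (2 * eta))).
  apply: ler_sum => k _; rewrite normrM mulrC; apply: ler_pM => //; last exact: xz.
  apply: le_trans (emode_bound _ _) _; rewrite -[leRHS](ger0_norm (ler0n R 2)) -sqrtr_sqr ler_wsqrtr//.
  by rewrite expr2 -natrM ler_nat.
by rewrite sumr_const card_ord -[(2 * eta) *+ _]mulr_natr -muln2 natrM; apply: eq_ler; ring.
Qed.

Lemma al4_perturb : al4 M z <= 8 * al4 M x + 8 * eta1 ^+ 4.
Proof.
have c1 := @cont_vf R M x; have c2 := @cont_vf R M z.
rewrite /al4 -[X in _ + X]iT_cst -iTZ; last by ct.
rewrite -iTD; [|by ct|by ct]; apply: iT_le => [||t]; [by ct|by ct|].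
have h := vf_perturb t.
rewrite (_ : vf M z t = vf M x t + (vf M z t - vf M x t)); last by ring.
set p := vf M x t; set q := vf M z t - vf M x t in h *.
have q4 : q ^+ 4 <= eta1 ^+ 4.
  rewrite -[q ^+ 4](_ : `|q| ^+ 4 = _); last by rewrite -normrX ger0_norm// -[4%N]/(2 * 2)%N exprM sqr_ge0.
  by rewrite ler_pXn2r ?nnegrE// (le_trans _ h).
have : (p + q) ^+ 4 <= 8 * p ^+ 4 + 8 * q ^+ 4.
  rewrite -subr_ge0 (_ : _ - _ = (p - q) ^+ 2 * (7 * (p + q / 7 * 5) ^+ 2 + (7 - 25 / 7) * q ^+ 2)).
    by rewrite mulr_ge0 ?sqr_ge0// addr_ge0// mulr_ge0 ?sqr_ge0//; lra.
  by field.
lra.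
Qed.

Definition hi2 (x : nat -> R) : R := \sum_(k < M.*2) hi L x k ^+ 2.

Lemma hi2_perturb : hi2 z <= 2 * hi2 x + 4 * M%:R * eta ^+ 2.
Proof.
have -> : 4 * M%:R * eta ^+ 2 = \sum_(k < M.*2) 2 * eta ^+ 2.
  by rewrite sumr_const card_ord -[(2 * eta ^+ 2) *+ _]mulr_natr -muln2 natrM; ring.
rewrite mulr_sumr -big_split; apply: ler_sum => k _ /=; rewrite /hi; case: ifP => _.
  by rewrite expr0n mulr0 add0r mulr_ge0 ?sqr_ge0.
have := xz (ltn_ord k); set p := x k; set q := z k => h.
have : (q - p) ^+ 2 <= eta ^+ 2.
  rewrite -(real_normK (num_real (q - p))) ler_pXn2r ?nnegrE// (le_trans _ h)//.
by have := sqr_ge0 (q - 2 * p); lra.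
Qed.

End perturbation.

Lemma step_algebra (R : realType) (kap ki li az a bz b hz h : R) : 0 <= kap -> 0 <= li -> 0 <= h ->
  0 <= a * li -> 0 <= kap * a -> 0 <= ki * b -> kap * az <= kap * (8 * a + 8) ->
  az * li <= (8 * a + 8) * li -> ki * bz <= ki * (8 * b) + 8 * kap -> hz <= 2 * h + kap ->
  kap * az + ki * bz + hz + az * li <= 32 * (kap * (a + 1) + ki * b + h + (a + 1) * li).
Proof. rewrite !mulrDl !mulrDr; lra. Qed.

Section error_step.
Variables (R : realType) (M L : nat) (K A kap eta h t0 : R) (u : R -> R -> R).
Variables (x : nat -> R) (y Y : R -> nat -> R).
Local Notation dr f x l := (is_derive (x : R) (1 : R) (f : R -> R) (l : R)).
Hypotheses (L0 : (0 < L)%N) (LM : (3 * L <= M)%N) (K1 : 1 <= K) (kap0 : 0 < kap) (kap1 : kap <= 1).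
Hypotheses (kdvu : kdv_solution u) (u0 : integralT (u 0) = 0) (h0 : 0 < h).
Hypothesis ux2 : integralT (fun s => u 0 s ^+ 2) = \sum_(k < M.*2) x k ^+ 2.
Hypothesis xK : \sum_(k < M.*2) x k ^+ 2 <= K.
Hypothesis xA : forall s, `|vf M x s| <= A.
Hypothesis dy : forall i (t : R), -1 < t -> dr (y ^~ i) t (Y t i).
Hypothesis cY : forall i, continuous (Y ^~ i).
Hypothesis y0 : forall i, y 0 i = x i.
Hypothesis Yt : forall (t : R) i, 0 <= t <= h -> (i < M.*2)%N -> Y t i = kdvX M (y t) i.
Hypothesis yx : forall (t : R) i, 0 <= t <= h -> (i < M.*2)%N -> `|y t i - x i| <= eta.
Local Notation eta1 := (4 * M%:R * eta).
Hypotheses (eta0 : 0 <= eta) (eta1_le1 : eta <= 1) (eta_small : (1 + M%:R) * eta1 <= kap ^+ 2).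

(** The rate and the defect over a whole time step, as functions of its starting
   point. *)
Definition stepRate : R := 2 * (400 * 16 * 16 * K ^+ 3 * (1 + A + al4 M x + M%:R * hi2 M L x)).
Definition stepDefect : R := 400 * 64 * 32 * K ^+ 3 *
  (kap * (al4 M x + 1) + kap^-1 * ((1 + M%:R) * al4 M (hi L x)) + hi2 M L x + (al4 M x + 1) / L%:R).
(** The constant compensates the one in energy_lower, see corrected_ge. *)
Definition corrected (t : R) (z : nat -> R) : R :=
  energy M (4 * K) u (fun=> z) t + 64 * K ^+ 2 / L%:R.

Let K0 : 0 <= K. Proof. exact: le_trans ler01 K1. Qed.
Let al40 (z : nat -> R) : 0 <= al4 M z. Proof. by apply: iT_ge0 => s; rewrite -[4%N]/(2 * 2)%N exprM sqr_ge0. Qed.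
Let hi20 (z : nat -> R) : 0 <= hi2 M L z. Proof. by apply: sumr_ge0 => i _; exact: sqr_ge0. Qed.
Let A0 : 0 <= A. Proof. exact: le_trans (normr_ge0 _) (xA 0). Qed.

Let y1 (t : R) := y (t - t0).
Let Y1 (t : R) := Y (t - t0).
Let a := t0 - 1.
Let b := t0 + h + 1.

Let dy1 i (t : R) : a < t < b -> dr (y1 ^~ i) t (Y1 t i).
Proof.
move=> /andP[at_ _].
apply: dr_eq (dr_comp (drB (dr_id t) (dr_cst t0 t)) (@dy i (t - t0) _)) _; last by rewrite subr0 mulr1.
by rewrite /a in at_; lra.
Qed.

Let cY1 i (t : R) : a < t < b -> {for t, continuous (Y1 ^~ i)}.
Proof.
move=> _; apply: (@for_cont_comp _ _ _ (fun t => t - t0) (Y^~ i)); last exact: cY.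
by apply: cvgB; [exact: cvg_id|exact: cvg_cst].
Qed.

Section at_time.
Variable t : R.
Hypothesis tI : t0 <= t <= t0 + h.
Let sI : 0 <= t - t0 <= h. Proof. by move: tI; lra. Qed.
Let tab : a < t < b. Proof. by move: tI; rewrite /a /b => ?; move: (h0) => ?; lra. Qed.
Let z := y1 t.

Let zx k : (k < M.*2)%N -> `|z k - x k| <= eta. Proof. exact: yx. Qed.
Let zsum : \sum_(k < M.*2) z k ^+ 2 = \sum_(k < M.*2) x k ^+ 2.
Proof.
rewrite (@galerkin_conserved R M h y (ltW h0) _ _ sI).
  by apply: eq_bigr => k _; rewrite y0.
by move=> s i sI' id; rewrite -Yt//; apply: dy; lra.
Qed.

Let zA s : `|vf M z s| <= A + 1.
Proof.
have := ler_normD (vf M x s) (vf M z s - vf M x s); rewrite addrC subrK => /le_trans; apply.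
apply: lerD; first exact: xA.
apply: le_trans (@vf_perturb R M eta x z zx s) _.
have k2 : kap ^+ 2 <= 1 by rewrite exprn_ile1// ltW.
have e0 : 0 <= eta1 by rewrite !mulr_ge0.
have := mulr_ge0 (ler0n R M) e0; move: eta_small; lra.
Qed.

Let dW (s : R) : dr (errI M u y1 t) s (err M u y1 t s).
Proof. by apply: drB; [exact: dr_upot_x|exact: dr_vfI]. Qed.
Let su : smooth2 u. Proof. by case: kdvu. Qed.
Let dw (s : R) : dr (err M u y1 t) s (ux u t s - vf M (Dx z) s).
Proof. by apply: drB; [exact: smooth2_drx|exact: dr_vf]. Qed.
Let cw1 : continuous (fun s => ux u t s - vf M (Dx z) s).
Proof. by apply: contB; [apply: smooth2_cx; exact: smooth2_x|exact: cont_vf]. Qed.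
Let pW : periodic1 (errI M u y1 t).
Proof. by move=> s; rewrite /errI vf_periodic (@upot_periodic _ _ kdvu t). Qed.
Let W0 : integralT (errI M u y1 t) = 0.
Proof.
rewrite /errI iTB; [|by apply: dr_continuous => s; exact: dr_upot_x|exact: cont_vf].
by rewrite upot_mean// iT_vf subrr.
Qed.
Let cu : continuous (u t). Proof. exact: smooth2_cx. Qed.
Let n2 := integralT (fun s => err M u y1 t s ^+ 2).
Let mE : integralT (fun s => u 0 s ^+ 2) = integralT (fun s => vf M z s ^+ 2).
Proof. by rewrite iT_vf_sqr zsum. Qed.

Lemma corrected_ge : n2 <= 2 * corrected t z.
Proof.
have LL : (L + L <= M)%N by clear -LM; lia.
have zK : \sum_(k < M.*2) z k ^+ 2 <= K by rewrite zsum.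
have W2 s : errI M u y1 t s ^+ 2 <= n2 := primitive_bound s dW dw cw1 pW W0.
have := @energy_lower R M L K z (u t) (errI M u y1 t) (err M u y1 t) L0 LL K1 zK cu
  (dr_continuous dW) (dr_continuous dw) _ W2.
have -> : coproj M (u t) = tail M u t.
  by apply/funext => s; rewrite /coproj /tail kdv_mean// u0 subr0 projE.
rewrite /corrected -/n2 => H.
have : 2^-1 * n2 - 64 * K ^+ 2 / L%:R <= energy M (4 * K) u (fun=> z) t.
  by apply: H => s; rewrite /err -/z addrC subrK.
by lra.
Qed.

Let Good := integralT (good_integrand (u t) (vf M z) (err M u y1 t) (errI M u y1 t) (vf M (Ix z))
   (vf M (gam M z)) (coproj M (u t)) (proj M (fun s => u t s ^+ 2)) (integralT (fun s => u 0 s ^+ 2)) (4 * K)).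

Lemma dr_corrected : dr (fun t => corrected t (y1 t)) t Good.
Proof.
apply: dr_eq (drD (dr_energy_good (4 * K) kdvu u0 dy1 cY1 tab _) (dr_cst _ t)) _; last by rewrite addr0.
by move=> i iM; exact: Yt.
Qed.

Lemma good_le_step : Good <= stepRate * corrected t z + stepDefect.
Proof.
have zK : \sum_(k < M.*2) z k ^+ 2 <= K by rewrite zsum.
have um : integralT (fun s => u t s ^+ 2) = integralT (fun s => vf M z s ^+ 2).
  by rewrite kdv_momentum// mE.
have := @good_bound R M L K (A + 1) kap z (u t) (errI M u y1 t) (fun s => ux u t s - vf M (Dx z) s)
  L0 LM K1 kap0 kap1 zK zA cu dW dw cw1 pW W0 um.
rewrite /Good mE => /(le_trans (ler_norm _))/le_trans; apply.
have e0 : 0 <= eta1 by rewrite !mulr_ge0.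
have k2 : kap ^+ 2 <= kap by rewrite expr2 ler_piMr// ltW.
have m0 := ler0n R M.
have me : M%:R * eta1 <= kap ^+ 2 by move: eta_small; lra.
have me0 : 0 <= M%:R * eta1 by rewrite mulr_ge0.
have e1 : eta1 <= kap ^+ 2 by move: eta_small; lra.
have e11 : eta1 <= 1 by move: (kap1) => ?; lra.
have e4 : eta1 ^+ 4 <= eta1 by rewrite -[leRHS]expr1; apply: ler_wiXn2l.
have ee : 4 * M%:R * eta ^+ 2 <= eta1 by rewrite expr2 mulrA ler_piMr.
have p4 := @al4_perturb R M eta x z zx; have p2 := @hi2_perturb R M L eta x z zx.
have hx k : (k < M.*2)%N -> `|hi L z k - hi L x k| <= eta.
  by move=> kd; rewrite /hi; case: ifP; rewrite ?subrr ?normr0// => _; exact: zx.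
have ph := @al4_perturb R M eta (hi L x) (hi L z) hx.
have n20 : 0 <= n2 by exact: iT_sqr0.
have a40 := al40 x; have h20 := hi20 x; have h40 := al40 (hi L x).
have K30 : 0 <= K ^+ 3 by exact: exprn_ge0.
apply: lerD.
  apply: (@le_trans _ _ (400 * 16 * 16 * K ^+ 3 * (1 + A + al4 M x + M%:R * hi2 M L x) * n2)).
    rewrite ler_wpM2r// /rate.
    have h1 : M%:R * hi2 M L z <= M%:R * (2 * hi2 M L x + eta1).
      by rewrite ler_wpM2l//; lra.
    have h2 : 1 + (A + 1) + al4 M z + M%:R * hi2 M L z <= 16 * (1 + A + al4 M x + M%:R * hi2 M L x).
      have := mulr_ge0 m0 h20; move: A0 kap1 => *; lra.
    have h3 : 0 <= 400 * 16 * K ^+ 3 by exact: (mulr_ge0 (mulr_ge0 (ler0n _ _) (ler0n _ _)) K30).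
    have := ler_wpM2l h3 h2; rewrite /hi2; lra.
  rewrite /stepRate -[leRHS]mulrA mulrCA mulrC.
  have h3 : 0 <= 400 * 16 * 16 * K ^+ 3 * (1 + A + al4 M x + M%:R * hi2 M L x).
    apply: mulr_ge0; last by rewrite !addr_ge0// mulr_ge0.
    exact: (mulr_ge0 (mulr_ge0 (mulr_ge0 (ler0n _ _) (ler0n _ _)) (ler0n _ _)) K30).
  have := ler_wpM2l h3 corrected_ge; lra.
rewrite /defect /stepDefect.
set S1 := _ + _ + _ + _; set S2 := _ + _ + _ + _.
have h3 : 0 <= 400 * 64 * K ^+ 3 by exact: (mulr_ge0 (mulr_ge0 (ler0n _ _) (ler0n _ _)) K30).
suff h2 : S1 <= 32 * S2 by have := ler_wpM2l h3 h2; lra.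
rewrite /S1 /S2 -/(hi2 M L z).
have h1 : kap * al4 M z <= kap * (8 * al4 M x + 8) by apply: (ler_wpM2l (ltW kap0)); lra.
have h4 : al4 M z / L%:R <= (8 * al4 M x + 8) / L%:R by apply: ler_wpM2r; rewrite ?invr_ge0//; lra.
have h5 : kap^-1 * ((1 + M%:R) * al4 M (hi L z)) <= kap^-1 * (8 * ((1 + M%:R) * al4 M (hi L x)) + 8 * kap ^+ 2).
  apply: ler_wpM2l; first by rewrite invr_ge0 ltW.
  have q0 : 0 <= 1 + M%:R :> R by rewrite addr_ge0.
  have q1 : al4 M (hi L z) <= 8 * al4 M (hi L x) + 8 * eta1 by lra.
  have := ler_wpM2l q0 q1; move: eta_small; lra.
have h6 : kap^-1 * (8 * kap ^+ 2) = 8 * kap by field; rewrite gt_eqF.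
rewrite mulrDr h6 in h5.
have q1 : 0 <= al4 M x / L%:R by rewrite divr_ge0.
have q2 : 0 <= L%:R^-1 :> R by rewrite invr_ge0.
have q3 : 0 <= kap * al4 M x by rewrite mulr_ge0// ltW.
have q4 : 0 <= kap^-1 * ((1 + M%:R) * al4 M (hi L x)).
  apply: mulr_ge0; first by rewrite invr_ge0 ltW.
  by apply: mulr_ge0 => //; apply: addr_ge0.
have p2' : hi2 M L z <= 2 * hi2 M L x + kap.
  by apply: le_trans p2 _; rewrite lerD2l; exact: le_trans ee (le_trans e1 k2).
exact: (step_algebra (ltW kap0) q2 h20 q1 q3 q4 h1 h4 h5 p2').
Qed.

End at_time.

Lemma error_step : corrected (t0 + h) (y h) <=
  expR (stepRate * h) * (corrected t0 x + h * stepDefect).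
Proof.
have y00 : corrected t0 (y 0) = corrected t0 x.
  by congr (corrected _ _); apply/funext => i; exact: y0.
have e1 : y1 (t0 + h) = y h by rewrite /y1 addrC addKr.
have e2 : y1 t0 = y 0 by rewrite /y1 subrr.
rewrite -e1 -y00 -e2.
have K30 : 0 <= K ^+ 3 by exact: exprn_ge0.
apply: (@gronwall R (fun t => corrected t (y1 t)) _ stepRate stepDefect t0 h (ltW h0)).
- apply: mulr_ge0; last by rewrite !addr_ge0 ?divr_ge0 ?mulr_ge0 ?invr_ge0 ?addr_ge0 ?(ltW kap0).
  exact: (mulr_ge0 (mulr_ge0 (mulr_ge0 (ler0n _ _) (ler0n _ _)) (ler0n _ _)) K30).
- apply: (mulr_ge0 (ler0n _ 2)); apply: mulr_ge0; last by rewrite !addr_ge0// mulr_ge0.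
  exact: (mulr_ge0 (mulr_ge0 (mulr_ge0 (ler0n _ _) (ler0n _ _)) (ler0n _ _)) K30).
- by move=> t tI; exact: dr_corrected.
- by move=> t tI; exact: good_le_step.
Qed.

End error_step.

(** * Laws determined by their characteristic functionals *)

Section small_angles.
Variable R : realType.
Local Notation dr f x l := (is_derive (x : R) (1 : R) (f : R -> R) (l : R)).

Let ineq (f f' : R -> R) (y : R) : (forall x : R, dr f x (f' x)) ->
  (forall x : R, 0 <= x -> 0 <= f' x) -> f 0 = 0 -> 0 <= y -> 0 <= f y.
Proof.
move=> df f0 e y0; rewrite -e; apply: (dr_nondecreasing (f' := f')) => // x /andP[x0 _]; exact: f0.
Qed.

Lemma sin_le (y : R) : 0 <= y -> sin y <= y.
Proof.
move=> y0; rewrite -subr_ge0; apply: (@ineq (fun y => y - sin y) (fun y => 1 - cos y)) => //.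
- by rewrite sin0 subrr.
Qed.

Lemma one_minus_cos_le (y : R) : 1 - cos y <= y ^+ 2 / 2.
Proof.
suff H (z : R) : 0 <= z -> 1 - cos z <= z ^+ 2 / 2.
  have [y0|y0] := leP 0 y; first exact: H.
  by rewrite -cosN -sqrrN; apply: H; lra.
move=> z0; rewrite -subr_ge0.
apply: (@ineq (fun y => y ^+ 2 / 2 - (1 - cos y)) (fun y => y - sin y)) => //.
- move=> x; have h := drB (drM (dr_id x) (drM (dr_id x) (dr_cst 2^-1 x))) (drB (dr_cst 1 x) (is_derive_cos x)).
  under eq_fun do rewrite expr2 -mulrA.
  by apply: dr_eq h _; field.
- by move=> x x0; rewrite subr_ge0 sin_le.
- by rewrite cos0 subrr expr0n /= mul0r subr0.
Qed.

Lemma sin_ge (y : R) : 0 <= y -> y - y ^+ 3 / 6 <= sin y.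
Proof.
move=> y0; rewrite -subr_ge0.
apply: (@ineq (fun y => sin y - (y - y ^+ 3 / 6)) (fun y => y ^+ 2 / 2 - (1 - cos y))) => //.
- move=> x; have h := drB (is_derive_sin x) (drB (dr_id x) (drM (dr_id x) (drM (dr_id x) (drM (dr_id x) (dr_cst 6^-1 x))))).
  under eq_fun do rewrite !exprS expr0 mulr1 -!mulrA.
  by apply: dr_eq h _; field.
- by move=> x _; rewrite subr_ge0 one_minus_cos_le.
- by rewrite sin0 expr0n /= mul0r !subr0.
Qed.

Lemma one_minus_cos_ge (y : R) : y ^+ 2 / 2 - y ^+ 4 / 24 <= 1 - cos y.
Proof.
suff H (z : R) : 0 <= z -> z ^+ 2 / 2 - z ^+ 4 / 24 <= 1 - cos z.
  have [y0|y0] := leP 0 y; first exact: H.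
  have := H (- y); rewrite cosN sqrrN -[4%N]/(2 * 2)%N !exprM sqrrN; apply; lra.
move=> z0; rewrite -subr_ge0.
apply: (@ineq (fun y => 1 - cos y - (y ^+ 2 / 2 - y ^+ 4 / 24)) (fun y => sin y - (y - y ^+ 3 / 6))) => //.
- move=> x; have i := dr_id x; have h := drB (drB (dr_cst 1 x) (is_derive_cos x)) (drB (drM i (drM i (dr_cst 2^-1 x)))
    (drM i (drM i (drM i (drM i (dr_cst 24^-1 x)))))).
  under eq_fun do rewrite !exprS expr0 mulr1 -!mulrA.
  by apply: dr_eq h _; field.
- by move=> x x0; rewrite subr_ge0 sin_ge.
- by rewrite cos0 !expr0n /= !mul0r !subrr.
Qed.

Lemma cvg_rate (u : nat -> R) (l C : R) : (forall n : nat, `|u n - l| <= C / n.+1%:R) -> u @ \oo --> l.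
Proof.
move=> h; apply/cvgrPdist_lt => e e0.
have C0 : 0 <= C by have := le_trans (normr_ge0 _) (h 0%N); rewrite divr1.
have e1 : 0 < e / (C + 1) by rewrite divr_gt0// ltr_wpDl.
near=> n; rewrite distrC; apply: le_lt_trans (h n) _.
have hn : n.+1%:R^-1 < e / (C + 1) by near: n; exact: (near_infty_natSinv_lt (PosNum e1)).
apply: (@le_lt_trans _ _ (C * (e / (C + 1)))); first by rewrite ler_wpM2l// ltW.
rewrite mulrA ltr_pdivrMr ?ltr_wpDl//; lra.
Unshelve. all: end_near. Qed.

Lemma cvg_sin_rescale (a : R) : n.+1%:R * sin (a / n.+1%:R) @[n --> \oo] --> a.
Proof.
apply: (@cvg_rate _ _ (`|a| ^+ 3)) => n.
have n1 : 1 <= n.+1%:R :> R by rewrite ler1n.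
set m : R := n.+1%:R in n1 *; have m0 : 0 < m by exact: lt_le_trans ltr01 n1.
suff H (b : R) : 0 <= b -> `|m * sin (b / m) - b| <= b ^+ 3 / m.
  have [a0|a0] := leP 0 a; first by rewrite (ger0_norm a0) H.
  rewrite (ltr0_norm a0) -normrN opprB.
  have -> : a - m * sin (a / m) = m * sin (- a / m) - - a by rewrite mulNr sinN; ring.
  by apply: H; lra.
move=> b0; have q0 : 0 <= b / m by rewrite divr_ge0// ltW.
have h1 := ler_wpM2l (ltW m0) (sin_le q0); have h2 := ler_wpM2l (ltW m0) (sin_ge q0).
have e1 : m * (b / m) = b by field; rewrite gt_eqF.
have e2 : m * (b / m - (b / m) ^+ 3 / 6) = b - (b ^+ 3 / m) * (6^-1 * m^-1) by field; rewrite gt_eqF.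
rewrite e1 in h1; rewrite e2 in h2.
have m1 : m^-1 <= 1 by rewrite invf_le1.
have mi0 : 0 <= m^-1 by rewrite invr_ge0 ltW.
have c0 : 0 <= b ^+ 3 / m by rewrite divr_ge0 ?exprn_ge0// ltW.
have : b ^+ 3 / m * (6^-1 * m^-1) <= b ^+ 3 / m * 1   by apply: (ler_wpM2l c0); move: m1 mi0; set i := m^-1; lra.
move: h1 h2 c0; set X := _ * (6^-1 * _); set Y := b ^+ 3 / m; set Z := m * sin _.
by clearbody X Y Z; rewrite ler_norml; lra.
Qed.

End small_angles.

Section trigonometric_cylinders.
Variable R : realType.
Implicit Types (xi x : nat -> R) (z p : (nat -> R) -> R).

Definition lin (d : nat) xi x : R := \sum_(k < d) xi k * x k.

Lemma lin_widen d D xi x : (d <= D)%N -> lin d xi x = lin D (fun k => if (k < d)%N then xi k else 0) x.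
Proof.
move=> dD; rewrite /lin -(big_mkord xpredT (fun k => xi k * x k)).
rewrite -(big_mkord xpredT (fun k => (if (k < d)%N then xi k else 0) * x k)).
rewrite [RHS](big_cat_nat (n := d))//= [X in _ = _ + X](_ : _ = 0) ?addr0.
  by apply: eq_big_nat => k /andP[_ ->].
by rewrite big_nat_cond big1// => k /andP[/andP[dk _] _]; rewrite ltnNge dk mul0r.
Qed.

Lemma linD d xi eta x : lin d (fun k => xi k + eta k) x = lin d xi x + lin d eta x.
Proof. by rewrite /lin -big_split; apply: eq_bigr => k _; rewrite mulrDl. Qed.
Lemma linB d xi eta x : lin d (fun k => xi k - eta k) x = lin d xi x - lin d eta x.
Proof. by rewrite /lin -sumrB; apply: eq_bigr => k _; rewrite mulrBl. Qed.
Lemma linZ d (a : R) xi x : lin d (fun k => a * xi k) x = a * lin d xi x.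
Proof. by rewrite /lin mulr_sumr; apply: eq_bigr => k _; rewrite mulrA. Qed.

Inductive trigp : ((nat -> R) -> R) -> Prop :=
| trigp1 d xi a b : trigp (fun x => a * cos (lin d xi x) + b * sin (lin d xi x))
| trigpD p q : trigp p -> trigp q -> trigp (fun x => p x + q x).

Lemma trigp_cst (c : R) : trigp (fun=> c).
Proof.
rewrite (_ : (fun=> c) = fun x => c * cos (lin 0 (fun=> 0) x) + 0 * sin (lin 0 (fun=> 0) x)).
  exact: trigp1.
by apply/funext => x; rewrite /lin big_ord0 cos0 mulr1 mul0r addr0.
Qed.

Lemma trigpZ (c : R) p : trigp p -> trigp (fun x => c * p x).
Proof.
elim=> {p} [d xi a b|p q _ h1 _ h2].
  rewrite (_ : (fun x => _) = fun x => (c * a) * cos (lin d xi x) + (c * b) * sin (lin d xi x)).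
    exact: trigp1.
  by apply/funext => x; ring.
by under eq_fun do rewrite mulrDr; exact: trigpD.
Qed.

Lemma trigpM p q : trigp p -> trigp q -> trigp (fun x => p x * q x).
Proof.
move=> tp tq; elim: tp => {p} [d xi a b|p1 p2 _ h1 _ h2]; last first.
  by under eq_fun do rewrite mulrDl; exact: trigpD.
elim: tq => {q} [d' xi' a' b'|p1 p2 _ h1 _ h2]; last first.
  by under eq_fun do rewrite mulrDr; exact: trigpD.
set D := maxn d d'.
have e1 x : lin d xi x = lin D (fun k => if (k < d)%N then xi k else 0) x by apply: lin_widen; exact: leq_maxl.
have e2 x : lin d' xi' x = lin D (fun k => if (k < d')%N then xi' k else 0) x by apply: lin_widen; exact: leq_maxr.
set eta := (fun k => if (k < d)%N then xi k else 0) in e1.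
set eta' := (fun k => if (k < d')%N then xi' k else 0) in e2.
rewrite (_ : (fun x => _) = fun x => 2^-1 *
  (((a * a' + b * b') * cos (lin D (fun k => eta k - eta' k) x) + (b * a' - a * b') * sin (lin D (fun k => eta k - eta' k) x)) +
  ((a * a' - b * b') * cos (lin D (fun k => eta k + eta' k) x) + (a * b' + b * a') * sin (lin D (fun k => eta k + eta' k) x)))).
  by apply: trigpZ; apply: trigpD; exact: trigp1.
apply/funext => x; by rewrite e1 e2 linB linD cosB cosD sinB sinD; field.
Qed.

Lemma trigp_bdd p : trigp p -> exists2 C, 0 <= C & forall x, `|p x| <= C.
Proof.
elim=> {p} [d xi a b|p q _ [C C0 h1] _ [D D0 h2]].
  exists (`|a| + `|b|); first by rewrite addr_ge0.
  move=> x; apply: le_trans (ler_normD _ _) _; rewrite !normrM.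
  by apply: lerD; rewrite ler_piMr// ler_norml ?cos_geN1 ?cos_le1 ?sin_geN1 ?sin_le1.
exists (C + D); first exact: addr_ge0.
by move=> x; apply: le_trans (ler_normD _ _) _; exact: lerD.
Qed.

(** Uniform limits of trigonometric polynomials in finitely many coordinates;
   being closed under absolute values, they approximate indicators. *)
Definition trigcl z := forall e : R, 0 < e -> exists2 p, trigp p & forall x, `|z x - p x| <= e.

Lemma trigcl_trigp p : trigp p -> trigcl p.
Proof. by move=> tp e e0; exists p => // x; rewrite subrr normr0 ltW. Qed.

Lemma trigcl_bdd z : trigcl z -> exists2 C, 0 < C & forall x, `|z x| <= C.
Proof.
move=> /(_ _ ltr01)[p /trigp_bdd[C C0 h] zp]; exists (C + 1); first by rewrite ltr_wpDl.
by move=> x; have := zp x; have := h x; have := ler_normD (z x - p x) (p x); rewrite subrK; lra.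
Qed.

Lemma trigclD z1 z2 : trigcl z1 -> trigcl z2 -> trigcl (fun x => z1 x + z2 x).
Proof.
move=> h1 h2 e e0; have e2 : 0 < e / 2 by rewrite divr_gt0.
have [p tp hp] := h1 _ e2; have [q tq hq] := h2 _ e2.
exists (fun x => p x + q x); first exact: trigpD.
move=> x; rewrite opprD addrACA; apply: le_trans (ler_normD _ _) _.
by have := hp x; have := hq x; lra.
Qed.

Lemma trigclM z1 z2 : trigcl z1 -> trigcl z2 -> trigcl (fun x => z1 x * z2 x).
Proof.
move=> h1 h2 e e0.
have [C C0 hC] := trigcl_bdd h1; have [D D0 hD] := trigcl_bdd h2.
have e2 : 0 < e / (2 * D) by rewrite divr_gt0// mulr_gt0.
have [p tp hp] := h1 _ e2; have [B B0 hB] := trigp_bdd tp.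
have e3 : 0 < e / (2 * (B + 1)) by rewrite divr_gt0// mulr_gt0// ltr_wpDl.
have [q tq hq] := h2 _ e3.
exists (fun x => p x * q x); first exact: trigpM.
move=> x; have -> : z1 x * z2 x - p x * q x = (z1 x - p x) * z2 x + p x * (z2 x - q x) by ring.
apply: le_trans (ler_normD _ _) _; rewrite !normrM.
have k1 : `|z1 x - p x| * `|z2 x| <= e / (2 * D) * D by apply: ler_pM.
have k2 : `|p x| * `|z2 x - q x| <= (B + 1) * (e / (2 * (B + 1))).
  by apply: ler_pM => //; have := hB x; lra.
have k3 : e / (2 * D) * D = e / 2 by field; rewrite gt_eqF.
have k4 : (B + 1) * (e / (2 * (B + 1))) = e / 2 by field; rewrite gt_eqF// ltr_wpDl.
lra.
Qed.

Lemma trigcl_cst (c : R) : trigcl (fun=> c).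
Proof. exact/trigcl_trigp/trigp_cst. Qed.
Lemma trigclZ (c : R) z : trigcl z -> trigcl (fun x => c * z x).
Proof. by move=> h; apply: trigclM => //; exact: trigcl_cst. Qed.

Lemma trigcl_lim z : (forall e : R, 0 < e -> exists2 p, trigcl p & forall x, `|z x - p x| <= e) -> trigcl z.
Proof.
move=> h e e0; have e2 : 0 < e / 2 by rewrite divr_gt0.
have [p tp hp] := h _ e2; have [q tq hq] := tp _ e2; exists q => // x.
by have := ler_normD (z x - p x) (p x - q x); rewrite addrA subrK; have := hp x; have := hq x; lra.
Qed.

(** The classical iteration showing that |y| is a uniform limit of polynomials
   on [-1, 1]. *)
Fixpoint abs_approx (n : nat) (y : R) : R :=
  if n is m.+1 then abs_approx m y + (y ^+ 2 - abs_approx m y ^+ 2) / 2 else 0.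

Lemma abs_approxP n (y : R) : `|y| <= 1 -> 0 <= abs_approx n y /\
  0 <= `|y| - abs_approx n y <= 2 / n.+1%:R.
Proof.
move=> y1; have := normr_ge0 y; set t := `|y| in y1 *.
have y2 : y ^+ 2 = t ^+ 2 by rewrite /t real_normK ?num_real.
move=> t0; elim: n => [|n [p0 /andP[e0 e1]]] /=; first by rewrite subr0 divr1; split=> //; lra.
set p := abs_approx n y in p0 e0 e1 *; rewrite y2.
have n0 : 0 < n%:R + 1 :> R by rewrite ltr_wpDl.
have [a0 a1] : 0 < n%:R + 2 :> R /\ 0 < n%:R + 3 :> R by split; lra.
have a : n.+1%:R = n%:R + 1 :> R by rewrite natr1.
have -> : n.+2%:R = n%:R + 2 :> R by rewrite -[n.+2]addn2 natrD.
split; first by nra.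
have -> : t - (p + (t ^+ 2 - p ^+ 2) / 2) = (t - p) * (1 - (t + p) / 2) by field.
apply/andP; split; first by apply: mulr_ge0 => //; lra.
apply: (@le_trans _ _ ((t - p) * (1 - (t - p) / 2))).
  by apply: ler_wpM2l => //; lra.
set u := t - p in e0 e1 *; rewrite a in e1.
have u1 : u <= 1 by rewrite /u; lra.
rewrite -subr_ge0.
have um : u * (n%:R + 1) <= 2 by rewrite -ler_pdivlMr.
have m0 : 0 <= n%:R :> R by rewrite ler0n.
set m : R := n%:R in um n0 a0 a1 m0 *.
have -> : 2 / (m + 2) - u * (1 - u / 2) = (2 * 2 - (m + 2) * u * (2 - u)) / (2 * (m + 2)).
  by field; rewrite gt_eqF.
apply: divr_ge0; last by rewrite mulr_ge0// ltW.
have h1 : 0 <= (2 - u * (m + 1)) * (2 - u) by rewrite mulr_ge0//; lra.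
have := sqr_ge0 (u - 1); nra.
Qed.

Lemma trigcl_abs z : trigcl z -> trigcl (fun x => `|z x|).
Proof.
move=> tz; have [C C0 hC] := trigcl_bdd tz; apply: trigcl_lim => e e0.
have [n hn] : exists n : nat, C * (2 / n.+1%:R) <= e.
  have p0 : 0 <= C * 2 / e by rewrite divr_ge0 ?mulr_ge0 ?ltW.
  have := archi_boundP p0; set N := Num.bound _; rewrite ltr_pdivrMr// => h.
  have N1 : N%:R <= N.+1%:R :> R by rewrite ler_nat.
  exists N; rewrite mulrA ler_pdivrMr// mulrC; nra.
have ta k : trigcl (fun x => abs_approx k (C^-1 * z x)).
  elim: k => [|k IH] /=; first exact: trigcl_cst.
  apply: trigclD => //; under eq_fun do rewrite mulrC -mulN1r.
  apply: trigclZ; apply: trigclD.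
    by under eq_fun do rewrite expr2; apply: trigclM; exact: trigclZ.
  by apply: trigclZ; under eq_fun do rewrite expr2; exact: trigclM.
exists (fun x => C * abs_approx n (C^-1 * z x)); first exact: trigclZ.
move=> x; have y1 : `|C^-1 * z x| <= 1.
  by rewrite normrM (ger0_norm (_ : 0 <= C^-1)) ?invr_ge0 ?(ltW C0)// mulrC ler_pdivrMr// mul1r.
have [p0 /andP[h0 h1]] := abs_approxP n y1.
have -> : `|z x| = C * `|C^-1 * z x|.
  by rewrite normrM (ger0_norm (_ : 0 <= C^-1)) ?invr_ge0 ?(ltW C0)// mulrA divff ?mul1r// gt_eqF.
rewrite -mulrBr ger0_norm ?mulr_ge0 ?(ltW C0)//; apply: le_trans hn.
by rewrite ler_wpM2l// ltW.
Qed.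

Lemma trigcl_min z1 z2 : trigcl z1 -> trigcl z2 -> trigcl (fun x => Num.min (z1 x) (z2 x)).
Proof.
move=> h1 h2; have -> : (fun x => Num.min (z1 x) (z2 x)) =
    fun x => 2^-1 * ((z1 x + z2 x) + (-1) * `|z1 x + (-1) * z2 x|).
  apply/funext => x; rewrite !mulN1r; case: (leP (z1 x) (z2 x)) => h.
    by rewrite ler0_norm; [field|lra].
  by rewrite ger0_norm; [field|lra].
apply: trigclZ; apply: trigclD; first exact: trigclD.
by apply: trigclZ; apply: trigcl_abs; apply: trigclD => //; exact: trigclZ.
Qed.

Lemma trigclX z n : trigcl z -> trigcl (fun x => z x ^+ n).
Proof.
move=> h; elim: n => [|n IH]; first by under eq_fun do rewrite expr0; exact: trigcl_cst.
by under eq_fun do rewrite exprS; exact: trigclM.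
Qed.

End trigonometric_cylinders.

Section laws.
Variable R : realType.

(** A family of generators of the cylinder sigma-algebra that is closed under
   intersection and on which a characteristic functional decides. *)
Definition cylinder_sets : set (set (nat -> R)) :=
  [set A | exists2 z, trigcl z & A = [set x | 0 < z x]].
Definition seqT := g_sigma_algebraType cylinder_sets.

Lemma cylinder_setsI : setI_closed cylinder_sets.
Proof.
move=> _ _ [z1 h1 ->] [z2 h2 ->]; exists (fun x => Num.min (z1 x) (z2 x)); first exact: trigcl_min.
by apply/seteqP; split => x /=; rewrite lt_min; [move=> [-> ->]|move=> /andP].
Qed.

Lemma trigcl_meas (z : (nat -> R) -> R) : trigcl z -> measurable_fun setT (z : seqT -> R).
Proof.
move=> tz; apply: (measurability _ (RGenOInfty.measurableE R)) => _ [_ [c ->] <-].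
rewrite setTI; apply: sub_sigma_algebra; exists (fun x => z x + - c).
  by apply: trigclD => //; exact: trigcl_cst.
by apply/seteqP; split => x /=; rewrite in_itv /= andbT subr_gt0.
Qed.

Lemma coord_meas k : measurable_fun setT (fun x : seqT => x k).
Proof.
pose h n (x : seqT) : R := n.+1%:R * sin (lin k.+1 (fun j => if j == k then n.+1%:R^-1 else 0) x).
have e n x : h n x = n.+1%:R * sin (x k / n.+1%:R).
  rewrite /h /lin big_ord_recr /= eqxx big1 ?add0r 1?[_^-1 * _]mulrC// => i _.
  by rewrite (ltn_eqF (ltn_ord i)) mul0r.
apply: (@measurable_fun_cvg _ seqT R setT h).
  move=> n; apply: trigcl_meas; apply: trigclZ; apply: trigcl_trigp.
  rewrite (_ : (fun x => _) = fun x => 0 * cos (lin k.+1 (fun j => if j == k then n.+1%:R^-1 else 0) x) +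
    1 * sin (lin k.+1 (fun j => if j == k then n.+1%:R^-1 else 0) x)); first exact: trigp1.
  by apply/funext => x; rewrite mul0r add0r mul1r.
move=> x _; rewrite (_ : h^~ x = fun n => n.+1%:R * sin (x k / n.+1%:R)); last first.
  by apply/funext => n; exact: e.
exact: cvg_sin_rescale.
Qed.

Section equal_laws.
Context d (T : measurableType d) (P : probability T R).
Variables X Y : nat -> T -> R.
Hypotheses (mX : forall k, measurable_fun setT (X k)) (mY : forall k, measurable_fun setT (Y k)).
Local Notation Int f := (\int[P]_(w in setT) f w).
Local Notation ig f := (P.-integrable setT (EFin \o f)).
Hypothesis cosXY : forall n xi, Int (fun w => cos (lin n xi (X ^~ w))) = Int (fun w => cos (lin n xi (Y ^~ w))).
Hypothesis sinXY : forall n xi, Int (fun w => sin (lin n xi (X ^~ w))) = Int (fun w => sin (lin n xi (Y ^~ w))).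

Let mT : measurable (setT : set T). Proof. exact: measurableT. Qed.
Let PT : P setT = 1%E. Proof. exact: probability_setT. Qed.

Lemma lin_meas (Z : nat -> T -> R) n xi : (forall k, measurable_fun setT (Z k)) ->
  measurable_fun setT (fun w => lin n xi (Z ^~ w)).
Proof.
move=> mZ; apply: measurable_sum => k.
by apply: measurable_funM => //; exact: measurable_cst.
Qed.

Lemma trigcl_comp_meas (Z : nat -> T -> R) z : (forall k, measurable_fun setT (Z k)) -> trigcl z ->
  measurable_fun setT (fun w => z (Z ^~ w)).
Proof.
move=> mZ tz.
have mp p : trigp p -> measurable_fun setT (fun w => p (Z ^~ w)).
  elim=> {p} [n xi a b|p q _ h1 _ h2]; last exact: measurable_funD.
  by apply: measurable_funD; apply: measurable_funM => //; try exact: measurable_cst;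
    apply: measurableT_comp (lin_meas _ _ mZ);
    apply: continuous_measurable_fun; [exact: continuous_cos|exact: continuous_sin].
have /choice[p hp] : forall n : nat, exists p, trigp p /\ forall x, `|z x - p x| <= n.+1%:R^-1.
  by move=> n; have [|p tp hp] := tz (n.+1%:R^-1); [rewrite invr_gt0|exists p].
apply: (@measurable_fun_cvg _ _ _ _ (fun n w => p n (Z ^~ w))).
  by move=> n; apply: mp; have [] := hp n.
move=> w _; apply/cvgrPdist_le => e e0.
near=> n; have [_ h] := hp n; apply: le_trans (h _) _; apply: ltW.
by near: n; exact: (near_infty_natSinv_lt (PosNum e0)).
Unshelve. all: end_near. Qed.

Lemma Int_trigcl (z' : (nat -> R) -> R) : trigcl z' -> Int (fun w => z' (X ^~ w)) = Int (fun w => z' (Y ^~ w)).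
Proof.
move=> tz.
have igz (Z : nat -> T -> R) (z : (nat -> R) -> R) : (forall k, measurable_fun setT (Z k)) -> trigcl z -> ig (fun w => z (Z ^~ w)).
  move=> mZ h; have [C C0 hC] := trigcl_bdd h.
  by apply: (ig_bdd mT PT (C := C)) => //; exact: trigcl_comp_meas.
have Hp p : trigp p -> Int (fun w => p (X ^~ w)) = Int (fun w => p (Y ^~ w)).
  elim=> {p} [n xi a b|p q tp h1 tq h2].
    have tc : trigcl (fun x => cos (lin n xi x)).
      apply: trigcl_trigp; rewrite (_ : (fun x => _) = fun x => 1 * cos (lin n xi x) + 0 * sin (lin n xi x)).
        exact: trigp1.
      by apply/funext => x; rewrite mul1r mul0r addr0.
    have ts : trigcl (fun x => sin (lin n xi x)).
      apply: trigcl_trigp; rewrite (_ : (fun x => _) = fun x => 0 * cos (lin n xi x) + 1 * sin (lin n xi x)).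
        exact: trigp1.
      by apply/funext => x; rewrite mul1r mul0r add0r.
    have I (Z : nat -> T -> R) (mZ : forall k, measurable_fun setT (Z k)) :
      Int (fun w => a * cos (lin n xi (Z ^~ w)) + b * sin (lin n xi (Z ^~ w))) =
      a * Int (fun w => cos (lin n xi (Z ^~ w))) + b * Int (fun w => sin (lin n xi (Z ^~ w))).
      have i1 := igz _ _ mZ tc; have i2 := igz _ _ mZ ts.
      by rewrite (IntD mT (igZ mT a i1) (igZ mT b i2)) (IntZ mT _ i1) (IntZ mT _ i2).
    by rewrite !I// cosXY sinXY.
  have [cp cq] := (trigcl_trigp tp, trigcl_trigp tq).
  by rewrite (IntD mT (igz _ _ mX cp) (igz _ _ mX cq)) (IntD mT (igz _ _ mY cp) (igz _ _ mY cq)) h1 h2.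
apply/eqP; rewrite -subr_eq0 -normr_le0; apply/ler_addgt0Pl => e e0; rewrite addr0.
have e2 : 0 < e / 2 by rewrite divr_gt0.
have [p tp hp] := tz _ e2.
have B (Z : nat -> T -> R) (mZ : forall k, measurable_fun setT (Z k)) :
    `|Int (fun w => z' (Z ^~ w)) - Int (fun w => p (Z ^~ w))| <= e / 2.
  rewrite -(IntB mT (igz _ _ mZ tz) (igz _ _ mZ (trigcl_trigp tp))).
  apply: (Int_abs_bdd mT PT) => //; apply: measurable_funB; apply: trigcl_comp_meas => //.
  exact: trigcl_trigp.
have := B X mX; have := B Y mY; rewrite (Hp p tp).
rewrite !ler_norml; lra.
Qed.

Let to_seq (Z : nat -> T -> R) (w : T) : seqT := fun k => Z k w.

Lemma to_seq_meas (Z : nat -> T -> R) : (forall k, measurable_fun setT (Z k)) -> measurable_fun setT (to_seq Z).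
Proof.
move=> mZ; apply: (@measurability _ _ _ _ setT (to_seq Z) cylinder_sets) => // _ [_ [z tz ->] <-].
have := @trigcl_comp_meas Z z mZ tz measurableT [set` `]0, +oo[] (measurable_itv _).
by congr measurable; apply/seteqP; split => w /=; rewrite ?in_itv /= ?andbT.
Qed.

(** With c = min (max (z, 0), 1), the functions 1 - (1 - c)^n belong to trigcl
   and increase to the indicator of z > 0. *)
Let cylinder_prob (z : (nat -> R) -> R) : trigcl z ->
  P [set w | 0 < z (X ^~ w)] = P [set w | 0 < z (Y ^~ w)].
Proof.
move=> tz; pose c x := Num.min (2^-1 * (z x + `|z x|)) 1.
have tc : trigcl c.
  apply: trigcl_min; last exact: trigcl_cst.
  by apply: trigclZ; apply: trigclD => //; exact: trigcl_abs.
have c01 x : 0 <= c x <= 1.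
  rewrite /c ge_min lexx orbT andbT le_min ler01 andbT mulr_ge0//.
  by have := ler_norm (- z x); rewrite normrN; lra.
have c_pos x : 0 < z x -> 0 < c x.
  by move=> z0; rewrite /c lt_min ltr01 andbT ger0_norm ?ltW//; lra.
have c_neg x : z x <= 0 -> c x = 0.
  by move=> z0; rewrite /c ler0_norm// subrr mulr0 min_l.
have tf n : trigcl (fun x => 1 + (-1) * (1 + (-1) * c x) ^+ n).
  apply: trigclD; first exact: trigcl_cst.
  by apply: trigclZ; apply: trigclX; apply: trigclD; [exact: trigcl_cst|exact: trigclZ].
have lim (Z : nat -> T -> R) (mZ : forall k, measurable_fun setT (Z k)) :
    Int (fun w => 1 + (-1) * (1 + (-1) * c (Z ^~ w)) ^+ n) @[n --> \oo] --> fine (P [set w | 0 < z (Z ^~ w)]).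
  set A := [set w | 0 < z (Z ^~ w)].
  have mA : measurable A.
    have := @trigcl_comp_meas Z z mZ tz measurableT [set` `]0, +oo[] (measurable_itv _).
    by rewrite /A; congr measurable; apply/seteqP; split => w /=; rewrite ?in_itv /= ?andbT //; case.
  have -> : fine (P A) = Int (\1_A) by rewrite /Rintegral integral_indic// setIT.
  apply: (Int_dct mT (g := fun=> 1) _ _ _ _).2.
  - by move=> n; apply: (trigcl_comp_meas mZ (tf n)).
  - exact: (ig_cst mT PT).
  - move=> w _; rewrite indicE; have /andP[c0 c1] := c01 (Z ^~ w).
    case: (boolP (w \in A)) => [/set_mem wA|wA].
      have cp := c_pos _ wA; rewrite -[X in _ --> X]addr0; apply: cvgD; first exact: cvg_cst.
      rewrite -[X in _ --> X](mulr0 (-1)); apply: cvgMr; apply: cvg_expr.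
      by rewrite ger0_norm; lra.
    have z0 : z (Z ^~ w) <= 0 by rewrite leNgt; apply: contra wA => h; exact/mem_set.
    rewrite c_neg// mulr0 addr0; under eq_fun do rewrite expr1n mulr1 subrr; exact: cvg_cst.
  - move=> n w _; have /andP[c0 c1] := c01 (Z ^~ w).
    have p0 : 0 <= (1 + -1 * c (Z^~ w)) ^+ n by apply: exprn_ge0; lra.
    have p1 : (1 + -1 * c (Z^~ w)) ^+ n <= 1 by apply: exprn_ile1; lra.
    by rewrite ler_norml; lra.
have l1 := lim X mX; have l2 := lim Y mY.
rewrite (_ : (fun n => _) = (fun n => Int (fun w => 1 + (-1) * (1 + (-1) * c (Y ^~ w)) ^+ n))) in l1; last first.
  by apply/funext => n; exact: (Int_trigcl (tf n)).
have /= e := cvg_unique (@Rhausdorff R) l1 l2.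
have mA (Z : nat -> T -> R) (mZ : forall k, measurable_fun setT (Z k)) : measurable [set w | 0 < z (Z ^~ w)].
  have := @trigcl_comp_meas Z z mZ tz measurableT [set` `]0, +oo[] (measurable_itv _).
  by congr measurable; apply/seteqP; split => w /=; rewrite ?in_itv /= ?andbT //; case.
have := mA _ mX; have := mA _ mY => m1 m2.
by rewrite -[LHS]fineK ?fin_num_measure// e fineK ?fin_num_measure.
Qed.

Lemma law_event (B : set seqT) : measurable B -> P (to_seq X @^-1` B) = P (to_seq Y @^-1` B).
Proof.
pose H : set (set seqT) := [set B | [/\ measurable (to_seq X @^-1` B), measurable (to_seq Y @^-1` B) &
  P (to_seq X @^-1` B) = P (to_seq Y @^-1` B)]].
have dH : dynkin H.
  split.
  - by rewrite /H /= !preimage_setT; split.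
  - move=> A [m1 m2 e]; split; [exact: (measurableC m1)|exact: (measurableC m2)|].
    have e1 : P (~` (to_seq X @^-1` A)) = P (~` (to_seq Y @^-1` A)) by rewrite !probability_setC// e.
    exact: e1.
  - move=> F tF hF; rewrite /H /= !preimage_bigcup.
    have m1 i : measurable (to_seq X @^-1` F i) by have [] := hF i.
    have m2 i : measurable (to_seq Y @^-1` F i) by have [] := hF i.
    have b1 : measurable (\bigcup_i (to_seq X @^-1` F i)) by exact: bigcup_measurable.
    have b2 : measurable (\bigcup_i (to_seq Y @^-1` F i)) by exact: bigcup_measurable.
    split; [by []|by []|].
    have tr (f : T -> seqT) : trivIset setT (fun n => f @^-1` F n).
      apply/trivIsetP => i j _ _ ij; rewrite -preimage_setI.
      by move/trivIsetP : tF => /(_ _ _ I I ij) ->; rewrite preimage_set0.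
    rewrite !measure_semi_bigcup//.
    by apply: eq_eseriesr => i _; have [] := hF i.
have GH : cylinder_sets `<=` H.
  move=> A hA; have mA : measurable (A : set seqT) by exact: sub_sigma_algebra.
  split.
  - by rewrite -[X in measurable X]setTI; exact: to_seq_meas.
  - by rewrite -[X in measurable X]setTI; exact: to_seq_meas.
  - by have [z tz ->] := hA; exact: cylinder_prob.
move=> mB; have [] // := @lambda_system_subset _ _ cylinder_setsI setT H (iffLR (dynkin_lambda_system H) dH) GH _ B mB.
Qed.

Lemma law_expectation (F : (nat -> R) -> R) (C : R) : measurable_fun setT (F : seqT -> R) ->
  (forall x, `|F x| <= C) -> Int (fun w => F (X ^~ w)) = Int (fun w => F (Y ^~ w)).
Proof.
move=> mF FC; pose G x := F x + C.
have G0 x : 0 <= G x by have := FC x; rewrite ler_norml /G; lra.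
have mG : measurable_fun setT (G : seqT -> R) by apply: measurable_funD => //; exact: measurable_cst.
have mFZ (Z : nat -> T -> R) (mZ : forall k, measurable_fun setT (Z k)) : measurable_fun setT (fun w => F (Z ^~ w)).
  exact: (measurableT_comp (f := F : seqT -> R) mF (to_seq_meas mZ)).
have iF (Z : nat -> T -> R) (mZ : forall k, measurable_fun setT (Z k)) : ig (fun w => F (Z ^~ w)).
  by apply: (ig_bdd mT PT (C := C)) => //; exact: mFZ.
have e : Int (fun w => G (X ^~ w)) = Int (fun w => G (Y ^~ w)).
  rewrite /Rintegral; congr fine.
  have h1 := @ge0_integral_pushforward _ _ T seqT R (to_seq X) (to_seq_meas mX) P setT (fun x => (G x)%:E) measurableT.
  have h2 := @ge0_integral_pushforward _ _ T seqT R (to_seq Y) (to_seq_meas mY) P setT (fun x => (G x)%:E) measurableT.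
  rewrite -[LHS]h1; last 2 first.
  - exact/measurable_EFinP.
  - by move=> x _; rewrite lee_fin.
  rewrite -[RHS]h2; last 2 first.
  - exact/measurable_EFinP.
  - by move=> x _; rewrite lee_fin.
  exact: (@eq_measure_integral _ seqT R setT
    (measure_function_pushforward__canonical__measure_function_Measure P (to_seq_meas mY))
    (measure_function_pushforward__canonical__measure_function_Measure P (to_seq_meas mX))
    _ (fun B mB _ => law_event mB)).
have GE (Z : nat -> T -> R) (mZ : forall k, measurable_fun setT (Z k)) :
    Int (fun w => G (Z ^~ w)) = Int (fun w => F (Z ^~ w)) + C.
  by rewrite (IntD mT (iF _ mZ) (ig_cst mT PT C)) (Int_cst _ PT).
by move: e; rewrite !GE// => /addIr.
Qed.

End equal_laws.

End laws.

(** * Moments of Gaussian sequences *)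

Section gaussian.
Variable R : realType.
Context d (T : measurableType d) (P : probability T R).
Variable g : nat -> T -> R.
Local Notation dr f x l := (is_derive (x : R) (1 : R) (f : R -> R) (l : R)).
Local Notation Int f := (\int[P]_(w in setT) f w).
Local Notation ig f := (P.-integrable setT (EFin \o f)).
Hypothesis mg : forall k, measurable_fun setT (g k).

Local Notation l n xi := (fun w => lin n xi (g ^~ w)).
Definition sq (n : nat) (xi : nat -> R) : R := \sum_(k < n) xi k ^+ 2.
Hypothesis gcos : forall n xi, Int (fun w => cos (l n xi w)) = expR (- (2^-1 * sq n xi)).
Hypothesis gsin : forall n xi, Int (fun w => sin (l n xi w)) = 0.

Let mT : measurable (setT : set T). Proof. exact: measurableT. Qed.
Let PT : P setT = 1%E. Proof. exact: probability_setT. Qed.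

Let ml n xi : measurable_fun setT (l n xi). Proof. exact: lin_meas. Qed.
Let mcont (f : R -> R) (h : T -> R) : continuous f -> measurable_fun setT h -> measurable_fun setT (fun w => f (h w)).
Proof. by move=> cf mh; apply: measurableT_comp mh; exact: continuous_measurable_fun. Qed.

Let sq0 n xi : 0 <= sq n xi. Proof. by apply: sumr_ge0 => i _; exact: sqr_ge0. Qed.

Let z (n : nat) xi (t : R) := expR (- (2^-1 * (t ^+ 2 * sq n xi))).

Let cosE n xi (t : R) : Int (fun w => cos (t * l n xi w)) = z n xi t.
Proof.
have := gcos n (fun k => t * xi k); rewrite /z.
have -> : sq n (fun k => t * xi k) = t ^+ 2 * sq n xi.
  by rewrite /sq mulr_sumr; apply: eq_bigr => k _; rewrite exprMn.
by move=> <-; apply: eq_Rintegral => w _; rewrite linZ.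
Qed.

Let icos n xi (t : R) : ig (fun w => cos (t * l n xi w)).
Proof.
apply: (ig_bdd mT PT (C := 1)).
  apply: (mcont (f := fun y => cos (t * y))) => //; exact: (dr_continuous (fun y => dr_comp (drZ t (dr_id y)) (is_derive_cos (t * y)))).
by move=> w _; rewrite ler_norml cos_geN1 cos_le1.
Qed.

Let dct (F : nat -> T -> R) (f h : T -> R) : (forall m, measurable_fun setT (F m)) -> ig h ->
  (forall w, F ^~ w @ \oo --> f w) -> (forall m w, `|F m w| <= h w) ->
  Int (F m) @[m --> \oo] --> Int f.
Proof. by move=> h1 h2 h3 h4; have [] := Int_dct mT h1 h2 (fun w _ => h3 w) (fun m w _ => h4 m w). Qed.

Let cvg_sqr (u : nat -> R) (x : R) : u @ \oo --> x -> (fun m => u m ^+ 2) @ \oo --> x ^+ 2.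
Proof. by move=> h; under eq_fun do rewrite expr2; rewrite expr2; exact: cvgM. Qed.

Let aux (a i c : R) : 0 <= a -> 0 < i -> i <= 1 -> 0 <= c -> c <= 1 -> i ^+ 4 * a * c <= a * i * i ^+ 2.
Proof.
move=> a0 i0 i1 c0 c1.
rewrite (_ : i ^+ 4 * a * c = (a * i ^+ 3) * (i * c)); last by ring.
rewrite (_ : a * i * i ^+ 2 = (a * i ^+ 3) * 1); last by ring.
apply: ler_wpM2l; first by rewrite mulr_ge0// exprn_ge0// ltW.
by apply: mulr_ile1 => //; exact: ltW.
Qed.

Let inv (m : nat) : R := m.+1%:R^-1.
Let inv0 m : 0 < inv m. Proof. by rewrite invr_gt0. Qed.

(** Its mean is the second difference quotient at 0 of the characteristic function
   of the linear form. *)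
Let qd n xi m w := 2 * (1 - cos (inv m * l n xi w)) / inv m ^+ 2.

Let qd_ge0 n xi m w : 0 <= qd n xi m w.
Proof. by rewrite /qd divr_ge0 ?sqr_ge0// mulr_ge0// subr_ge0 cos_le1. Qed.

Let qd_le n xi m w : qd n xi m w <= l n xi w ^+ 2.
Proof.
rewrite /qd ler_pdivrMr ?exprn_gt0//.
by have := one_minus_cos_le (inv m * l n xi w); rewrite exprMn; lra.
Qed.

Let qd_cvg n xi w : qd n xi ^~ w @ \oo --> l n xi w ^+ 2.
Proof.
apply: (@cvg_rate R _ _ (l n xi w ^+ 4)) => m.
have := one_minus_cos_le (inv m * l n xi w); have := one_minus_cos_ge (inv m * l n xi w).
rewrite /qd -/(inv m) (exprMn _ (inv m)) (exprMn _ (inv m)).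
have i0 := inv0 m; set i := inv m in i0 *; set y := l n xi w; set c := cos _.
have i1 : i <= 1 by rewrite /i /inv invf_le1// ler1n.
have y4 : 0 <= y ^+ 4 by rewrite -[4%N]/(2 * 2)%N exprM sqr_ge0.
move=> h1 h2; rewrite ler_norml; apply/andP; split.
  rewrite lerBrDr addrC ler_pdivlMr ?exprn_gt0//.
  have : i ^+ 4 * y ^+ 4 * 12^-1 <= y ^+ 4 * i * i ^+ 2 by apply: aux => //; rewrite ?invr_ge0 ?invf_le1 ?ler1n.
  lra.
rewrite lerBlDr ler_pdivrMr ?exprn_gt0//.
have : 0 <= y ^+ 4 * i * i ^+ 2 by apply: mulr_ge0; [apply: mulr_ge0 => //; exact: ltW|exact: sqr_ge0].
lra.
Qed.

Let one_minus_exp (y : R) : 0 <= y -> y - y ^+ 2 / 2 <= 1 - expR (- y) <= y.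
Proof.
move=> y0; apply/andP; split; last by have := expR_ge1Dx (- y); lra.
have de (x : R) : dr (fun y => expR (- y)) x (- expR (- x)).
  by apply: dr_eq (dr_comp (drN (dr_id x)) (is_derive_expR _)) _; rewrite mulrN1.
have := @dr_nondecreasing R (fun y => 1 - expR (- y) - (y - y ^+ 2 / 2)) (fun y => expR (- y) - 1 + y) 0 y _ _ y0.
rewrite oppr0 expR0 subrr expr0n /= mul0r !subr0 subr_ge0; apply.
  move=> x _; have h := drB (drB (dr_cst 1 x) (de x)) (drB (dr_id x) (drM (dr_id x) (drM (dr_id x) (dr_cst 2^-1 x)))).
  under eq_fun do rewrite expr2 -mulrA.
  by apply: dr_eq h _; field.
by move=> x _; have := expR_ge1Dx (- x); lra.
Qed.

Let zcvg n xi : (1 - z n xi (inv m)) / inv m ^+ 2 @[m --> \oo] --> sq n xi / 2.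
Proof.
apply: (@cvg_rate R _ _ (sq n xi ^+ 2)) => m.
have i0 := inv0 m; have s0 := sq0 n xi; rewrite /z -/(inv m); set i := inv m in i0 *; set s := sq n xi in s0 *.
have i1 : i <= 1 by rewrite /i /inv invf_le1// ler1n.
have y0 : 0 <= 2^-1 * (i ^+ 2 * s) by apply: mulr_ge0 => //; apply: mulr_ge0 => //; exact: sqr_ge0.
have /andP[h1 h2] := one_minus_exp y0; set c := expR _ in h1 h2 *.
rewrite ler_norml; apply/andP; split.
  rewrite lerBrDr addrC ler_pdivlMr ?exprn_gt0//.
  have : i ^+ 4 * s ^+ 2 * 8^-1 <= s ^+ 2 * i * i ^+ 2 by apply: aux => //; rewrite ?invr_ge0 ?invf_le1 ?ler1n ?sqr_ge0.
  lra.
rewrite lerBlDr ler_pdivrMr ?exprn_gt0//.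
have : 0 <= s ^+ 2 * i * i ^+ 2 by apply: mulr_ge0; [apply: mulr_ge0; [exact: sqr_ge0|exact: ltW]|exact: sqr_ge0].
lra.
Qed.

Let zcvg1 n xi : z n xi (inv m) @[m --> \oo] --> (1 : R).
Proof.
apply: (@cvg_rate R _ _ (sq n xi)) => m.
have i0 := inv0 m; have s0 := sq0 n xi; rewrite /z -/(inv m); set i := inv m in i0 *; set s := sq n xi in s0 *.
have i1 : i <= 1 by rewrite /i /inv invf_le1// ler1n.
have y0 : 0 <= 2^-1 * (i ^+ 2 * s) by apply: mulr_ge0 => //; apply: mulr_ge0 => //; exact: sqr_ge0.
have /andP[_ h2] := one_minus_exp y0; have : expR (- (2^-1 * (i ^+ 2 * s))) <= expR 0 by rewrite ler_expR oppr_le0.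
rewrite expR0; set c := expR _ in h2 *.
have : 2^-1 * (i ^+ 2 * s) <= s * i.
  rewrite (_ : 2^-1 * (i ^+ 2 * s) = (s * i) * (i / 2)); last by ring.
  by rewrite ler_piMr ?mulr_ge0 ?(ltW i0)//; lra.
by move=> h3 h4; rewrite ler_norml; lra.
Qed.

Let iqd n xi m : ig (qd n xi m).
Proof.
have -> : qd n xi m = fun w => (2 / inv m ^+ 2) * (1 - cos (inv m * l n xi w)).
  by apply/funext => w; rewrite /qd; ring.
apply: (igZ mT); apply: (igB mT); first exact: (ig_cst mT PT).
exact: icos.
Qed.

Let qdE n xi m : Int (qd n xi m) = 2 * ((1 - z n xi (inv m)) / inv m ^+ 2).
Proof.
rewrite -cosE; have i1 := icos n xi (inv m).
have ic := ig_cst mT PT 1.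
rewrite (_ : Int (qd n xi m) = Int (fun w => (2 / inv m ^+ 2) * (1 - cos (inv m * l n xi w)))).
  by rewrite (IntZ mT _ (igB mT ic i1)) (IntB mT ic i1) (Int_cst mT PT); ring.
by apply: eq_Rintegral => w _; rewrite /qd; ring.
Qed.

Let l2_fatou n xi : ig (fun w => l n xi w ^+ 2) /\ Int (fun w => l n xi w ^+ 2) <= sq n xi.
Proof.
apply: (@ig_fatou _ _ _ P setT mT (qd n xi)).
- by move=> m; apply: ig_meas; exact: iqd.
- by move=> m w _; exact: qd_ge0.
- by move=> w _; exact: qd_cvg.
- by move=> m; exact: iqd.
move=> m; rewrite qdE; have i0 := inv0 m.
rewrite mulrA ler_pdivrMr ?exprn_gt0//.
have y0 : 0 <= 2^-1 * (inv m ^+ 2 * sq n xi) by apply: mulr_ge0 => //; apply: mulr_ge0; [exact: sqr_ge0|exact: sq0].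
by have /andP[_] := one_minus_exp y0; rewrite /z; lra.
Qed.

Lemma gauss_ig2 n xi : ig (fun w => l n xi w ^+ 2). Proof. by have [] := l2_fatou n xi. Qed.

Lemma gauss_int2 n xi : Int (fun w => l n xi w ^+ 2) = sq n xi.
Proof.
have h : Int (qd n xi m) @[m --> \oo] --> Int (fun w => l n xi w ^+ 2).
  apply: (dct (fun m => ig_meas (iqd n xi m)) (gauss_ig2 n xi) (fun w => @qd_cvg n xi w)) => m w.
  by rewrite ger0_norm.
have h2 : Int (qd n xi m) @[m --> \oo] --> sq n xi.
  under eq_fun do rewrite qdE.
  have -> : sq n xi = 2 * (sq n xi / 2) by field.
  by apply: cvgMr; exact: zcvg.
exact: (cvg_unique _ h h2).
Qed.

Let iqd2 n xi m : ig (fun w => qd n xi m w ^+ 2).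
Proof.
apply: (ig_bdd mT PT (C := (4 / inv m ^+ 2) ^+ 2)).
  have := measurable_funX 2 (ig_meas (iqd n xi m)); exact.
move=> w _; rewrite ger0_norm ?sqr_ge0//.
have q1 : qd n xi m w <= 4 / inv m ^+ 2.
  rewrite /qd ler_wpM2r ?invr_ge0 ?sqr_ge0//; have := cos_geN1 (inv m * l n xi w); lra.
by rewrite ler_pXn2r ?nnegrE// (le_trans _ q1).
Qed.

(** The doubling formula for the cosine expresses the square through the
   characteristic function at inv m and at 2 inv m. *)
Let qd2E n xi m : Int (fun w => qd n xi m w ^+ 2) =
  2 * ((1 - z n xi (inv m)) / inv m ^+ 2) ^+ 2 * (z n xi (inv m) ^+ 2 + 2 * z n xi (inv m) + 3).
Proof.
set i := inv m; set y := z n xi i.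
have e2 : z n xi (2 * i) = y ^+ 4.
  by rewrite /y /z -expRM_natl; congr expR; ring.
have i1 := icos n xi i; have i2 := icos n xi (2 * i); have ic := ig_cst mT PT (3 / 2).
have i0 : i != 0 by rewrite gt_eqF// inv0.
have -> : 2 * ((1 - y) / i ^+ 2) ^+ 2 * (y ^+ 2 + 2 * y + 3) = 4 / i ^+ 4 * (3 / 2 - 2 * y + 2^-1 * y ^+ 4).
  by field.
have -> : Int (fun w => qd n xi m w ^+ 2) = Int (fun w => 4 / i ^+ 4 * (3 / 2 - 2 * cos (i * l n xi w) + 2^-1 * cos (2 * i * l n xi w))); last first.
  rewrite (IntZ mT _ (igD mT (igB mT ic (igZ mT 2 i1)) (igZ mT 2^-1 i2))).
  rewrite (IntD mT (igB mT ic (igZ mT 2 i1)) (igZ mT 2^-1 i2)) (IntB mT ic (igZ mT 2 i1)).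
  by rewrite (IntZ mT 2 i1) (IntZ mT 2^-1 i2) (Int_cst mT PT) !cosE e2.
apply: eq_Rintegral => w _; rewrite /qd -/i -[2 * i * _]mulrA; set a := i * l n xi w.
have -> : cos (2 * a) = 2 * cos a ^+ 2 - 1.
  rewrite (_ : 2 * a = a + a); last by ring.
  by rewrite cosD; have := cos2Dsin2 a; rewrite !expr2; lra.
by field.
Qed.

Let l4_cvg n xi : Int (fun w => qd n xi m w ^+ 2) @[m --> \oo] --> 3 * sq n xi ^+ 2.
Proof.
under eq_fun do rewrite qd2E.
have -> : 3 * sq n xi ^+ 2 = 2 * (sq n xi / 2) ^+ 2 * (1 ^+ 2 + 2 * 1 + 3) by field.
apply: cvgM.
  by apply: cvgMr; apply: cvg_sqr; exact: zcvg.
apply: cvgD; last exact: cvg_cst.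
by apply: cvgD; [apply: cvg_sqr; exact: zcvg1|apply: cvgMr; exact: zcvg1].
Qed.

Let qd4_cvg n xi w : qd n xi m w ^+ 2 @[m --> \oo] --> l n xi w ^+ 4.
Proof. by rewrite -[4%N]/(2 * 2)%N exprM; apply: cvg_sqr; exact: qd_cvg. Qed.

Lemma gauss_ig4 n xi : ig (fun w => l n xi w ^+ 4).
Proof.
have [C hC] : exists C, forall m, Int (fun w => qd n xi m w ^+ 2) <= C.
  have /cvg_seq_bounded [C [_ hC]] : cvg (Int (fun w => qd n xi m w ^+ 2) @[m --> \oo]).
    by apply/cvg_ex; exists (3 * sq n xi ^+ 2); exact: l4_cvg.
  exists (C + 1) => m; apply: le_trans (ler_norm _) _; apply: hC => //; rewrite ltrDl//.
have [] // := @ig_fatou _ _ _ P setT mT (fun m w => qd n xi m w ^+ 2) (fun w => l n xi w ^+ 4) C.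
- by move=> m; apply: ig_meas; exact: iqd2.
- by move=> m w _; exact: sqr_ge0.
Qed.

Lemma gauss_int4 n xi : Int (fun w => l n xi w ^+ 4) = 3 * sq n xi ^+ 2.
Proof.
have h : Int (fun w => qd n xi m w ^+ 2) @[m --> \oo] --> Int (fun w => l n xi w ^+ 4).
  apply: (dct (fun m => ig_meas (iqd2 n xi m)) (gauss_ig4 n xi) (fun w => @qd4_cvg n xi w)) => m w.
  rewrite ger0_norm ?sqr_ge0// -[4%N]/(2 * 2)%N exprM.
  by rewrite ler_pXn2r ?nnegrE ?sqr_ge0.
exact: (cvg_unique _ h (@l4_cvg n xi)).
Qed.

End gaussian.

(** * Gaussian integration by parts *)

Section gaussian_ibp.
Variable R : realType.
Context d (T : measurableType d) (P : probability T R).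
Variable g : nat -> T -> R.
Local Notation dr f x l := (is_derive (x : R) (1 : R) (f : R -> R) (l : R)).
Local Notation Int f := (\int[P]_(w in setT) f w).
Local Notation ig f := (P.-integrable setT (EFin \o f)).
Hypothesis mg : forall k, measurable_fun setT (g k).
Hypothesis gcos : forall n xi, Int (fun w => cos (lin n xi (g ^~ w))) = expR (- (2^-1 * sq n xi)).
Hypothesis gsin : forall n xi, Int (fun w => sin (lin n xi (g ^~ w))) = 0.

Let mT : measurable (setT : set T). Proof. exact: measurableT. Qed.
Let PT : P setT = 1%E. Proof. exact: probability_setT. Qed.

Let dct (F : nat -> T -> R) (f h : T -> R) : (forall m, measurable_fun setT (F m)) -> ig h ->
  (forall w, F ^~ w @ \oo --> f w) -> (forall m w, `|F m w| <= h w) ->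
  Int (F m) @[m --> \oo] --> Int f.
Proof. by move=> h1 h2 h3 h4; have [] := Int_dct mT h1 h2 (fun w _ => h3 w) (fun m w _ => h4 m w). Qed.

Let igE (f h : T -> R) : (forall w, f w = h w) -> ig f -> ig h.
Proof. by move=> /funext ->. Qed.

Let pair (i k : nat) (a b : R) (j : nat) : R := a * (j == i)%:R + b * (j == k)%:R.

Let linpair i k a b x n : i != k -> (i < n)%N -> (k < n)%N -> lin n (pair i k a b) x = a * x i + b * x k.
Proof.
move=> ik ni nk; rewrite /lin (bigD1 (Ordinal ni))//= (bigD1 (Ordinal nk))/=; last first.
  by rewrite -val_eqE /= eq_sym.
rewrite /pair eqxx (negPf ik) eqxx eq_sym (negPf ik) !mulr1 !mulr0 addr0 add0r big1 ?addr0// => j /andP[].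
by rewrite -!val_eqE /= => /negPf -> /negPf ->; rewrite !mulr0 addr0 mul0r.
Qed.

Let sqpair i k a b n : i != k -> (i < n)%N -> (k < n)%N -> sq n (pair i k a b) = a ^+ 2 + b ^+ 2.
Proof.
move=> ik ni nk; rewrite /sq (bigD1 (Ordinal ni))//= (bigD1 (Ordinal nk))/=; last first.
  by rewrite -val_eqE /= eq_sym.
rewrite /pair eqxx (negPf ik) eqxx eq_sym (negPf ik) !mulr1 !mulr0 addr0 add0r big1 ?addr0// => j /andP[].
by rewrite -!val_eqE /= => /negPf -> /negPf ->; rewrite !mulr0 addr0 expr0n.
Qed.

Let ab4 i k a b : i != k -> ig (fun w => (a * g i w + b * g k w) ^+ 4) /\
  Int (fun w => (a * g i w + b * g k w) ^+ 4) = 3 * (a ^+ 2 + b ^+ 2) ^+ 2.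
Proof.
move=> ik; have ni : (i < (maxn i k).+1)%N by rewrite ltnS leq_maxl.
have nk : (k < (maxn i k).+1)%N by rewrite ltnS leq_maxr.
have e w : lin (maxn i k).+1 (pair i k a b) (g ^~ w) = a * g i w + b * g k w by rewrite linpair.
have i4 := gauss_ig4 mg gcos (maxn i k).+1 (pair i k a b); have e4 := gauss_int4 mg gcos (maxn i k).+1 (pair i k a b).
split; first by apply: igE i4 => w; rewrite e.
rewrite -(sqpair a b ik ni nk) -e4; by apply: eq_Rintegral => w _; rewrite e.
Qed.

Let ab2 i k a b : i != k -> ig (fun w => (a * g i w + b * g k w) ^+ 2) /\
  Int (fun w => (a * g i w + b * g k w) ^+ 2) = a ^+ 2 + b ^+ 2.
Proof.
move=> ik; have ni : (i < (maxn i k).+1)%N by rewrite ltnS leq_maxl.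
have nk : (k < (maxn i k).+1)%N by rewrite ltnS leq_maxr.
have e w : lin (maxn i k).+1 (pair i k a b) (g ^~ w) = a * g i w + b * g k w by rewrite linpair.
have i4 := gauss_ig2 mg gcos (maxn i k).+1 (pair i k a b); have e4 := gauss_int2 mg gcos (maxn i k).+1 (pair i k a b).
split; first by apply: igE i4 => w; rewrite e.
rewrite -(sqpair a b ik ni nk) -e4; by apply: eq_Rintegral => w _; rewrite e.
Qed.

Let nS (k : nat) : k != k.+1. Proof. by rewrite neq_ltn ltnSn. Qed.

Lemma coord_ig2 k : ig (fun w => g k w ^+ 2).
Proof.
have [h _] := ab2 1 0 (nS k).
by apply: igE h => w; rewrite mul1r mul0r addr0.
Qed.

Lemma coord_ig k : ig (fun w => `|g k w|).
Proof.
apply: (ig_dom mT (g := fun w => 1 + g k w ^+ 2)).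
- exact: measurableT_comp.
- by apply: (igD mT); [exact: (ig_cst mT PT)|exact: coord_ig2].
move=> w _; rewrite normr_id -(real_normK (num_real (g k w))).
by have := sqr_ge0 (`|g k w| - 1); have := normr_ge0 (g k w); lra.
Qed.

Let coord_int2 k : Int (fun w => g k w ^+ 2) = 1.
Proof.
have [_] := ab2 1 0 (nS k); rewrite expr1n expr0n addr0 => <-.
by apply: eq_Rintegral => w _; rewrite mul1r mul0r addr0.
Qed.

Let coord4 k : ig (fun w => g k w ^+ 4) /\ Int (fun w => g k w ^+ 4) = 3.
Proof.
have [h1 h2] := ab4 1 0 (nS k); move: h2; rewrite expr1n expr0n addr0 expr1n mulr1 => h2.
have e w : g k w ^+ 4 = (1 * g k w + 0 * g k.+1 w) ^+ 4 by rewrite mul1r mul0r addr0.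
by split; [apply: igE h1 => w; rewrite -e|under eq_Rintegral do rewrite e].
Qed.

Let coord22 i k : i != k -> ig (fun w => g i w ^+ 2 * g k w ^+ 2) /\ Int (fun w => g i w ^+ 2 * g k w ^+ 2) = 1.
Proof.
move=> ik; have [i1 e1] := ab4 1 1 ik; have [i2 e2] := ab4 1 (-1) ik.
have [i3 e3] := coord4 i; have [i4 e4] := coord4 k.
have e w : g i w ^+ 2 * g k w ^+ 2 = 12^-1 * (((1 * g i w + 1 * g k w) ^+ 4 + (1 * g i w + -1 * g k w) ^+ 4)
   - (2 * g i w ^+ 4 + 2 * g k w ^+ 4)) by field.
have j1 := igD mT i1 i2; have j2 := igD mT (igZ mT 2 i3) (igZ mT 2 i4).
split.
  by apply: igE (igZ mT 12^-1 (igB mT j1 j2)) => w; rewrite -e.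
under eq_Rintegral do rewrite e.
rewrite (IntZ mT _ (igB mT j1 j2)) (IntB mT j1 j2) (IntD mT i1 i2) (IntD mT (igZ mT 2 i3) (igZ mT 2 i4)).
by rewrite (IntZ mT _ i3) (IntZ mT _ i4) e1 e2 e3 e4; field.
Qed.

(** The weak law of large numbers for the squares, from their fourth moments. *)
Let lln (D N : nat) : let S w := \sum_(D <= k < D + N) (g k w ^+ 2 - 1) in
  ig (fun w => S w ^+ 2) /\ Int (fun w => S w ^+ 2) = 2 * N%:R.
Proof.
move=> S; pose c i k w := (g i w ^+ 2 - 1) * (g k w ^+ 2 - 1).
have hc i k : ig (c i k) /\ Int (c i k) = if i == k then 2 else 0.
  have e w : c i k w = (g i w ^+ 2 * g k w ^+ 2 + 1) - (g i w ^+ 2 + g k w ^+ 2) by rewrite /c; ring.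
  have [h1 h2] : ig (fun w => g i w ^+ 2 * g k w ^+ 2) /\ Int (fun w => g i w ^+ 2 * g k w ^+ 2) = if i == k then 3 else 1.
    case: eqVneq => [->|ik]; last exact: coord22.
    have [h1 h2] := coord4 k; split.
      by apply: igE h1 => w; rewrite -exprD.
    by under eq_Rintegral do rewrite -exprD.
  have ic := ig_cst mT PT 1; have j1 := igD mT h1 ic; have j2 := igD mT (coord_ig2 i) (coord_ig2 k).
  rewrite (_ : c i k = fun w => (g i w ^+ 2 * g k w ^+ 2 + 1) - (g i w ^+ 2 + g k w ^+ 2)); last by apply/funext.
  split; first exact: (igB mT j1 j2).
  rewrite (IntB mT j1 j2) (IntD mT h1 ic) (IntD mT (coord_ig2 i) (coord_ig2 k)) (Int_cst mT PT) h2 !coord_int2.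
  by case: eqVneq => _; ring.
have SE : (fun w => S w ^+ 2) = fun w => \sum_(D <= i < D + N) \sum_(D <= k < D + N) c i k w.
  apply/funext => w; rewrite expr2 /S mulr_suml; apply: eq_bigr => i _; rewrite mulr_sumr; exact: eq_bigr.
have i1 i : ig (fun w => \sum_(D <= k < D + N) c i k w).
  by apply: (ig_sum mT PT) => k _; have [] := hc i k.
rewrite SE; split; first by apply: (ig_sum mT PT) => i _.
rewrite (Int_sum mT PT) => [|i _]; last exact: i1.
rewrite (eq_big_nat _ _ (F2 := fun=> 2)).
  by rewrite sumr_const_nat addKn mulr_natr.
move=> i iD; rewrite (Int_sum mT PT) => [|k _]; last by have [] := hc i k.
rewrite (bigD1_seq i) ?iota_uniq ?mem_index_iota//= (hc i i).2 eqxx big1 ?addr0// => k ki.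
by rewrite (hc i k).2 eq_sym (negPf ki).
Qed.

Definition upd (x : nat -> R) (i : nat) (t : R) (j : nat) : R := if j == i then t else x j.

Section rotation.
Variables (i k : nat).
Hypothesis ik : i != k.

Let rot (t : R) (j : nat) (w : T) : R := if j == i then cos t * g i w + sin t * g k w
  else if j == k then cos t * g k w - sin t * g i w else g j w.

Let mrot t j : measurable_fun setT (rot t j).
Proof.
have mc (c : R) j' : measurable_fun setT (fun w => c * g j' w).
  by apply: measurable_funM => //; exact: measurable_cst.
rewrite /rot; case: eqP => _; first exact: measurable_funD.
by case: eqP => _ //; exact: measurable_funB.
Qed.

Let lin_rot t n xi : exists n' xi', sq n' xi' = sq n xi /\
  forall w, lin n xi (rot t ^~ w) = lin n' xi' (g ^~ w).
Proof.
pose D := maxn n (maxn i k).+1; pose eta j := if (j < n)%N then xi j else 0.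
have iD : (i < D)%N by rewrite /D; lia.
have kD : (k < D)%N by rewrite /D; lia.
pose xi' j := if j == i then cos t * eta i - sin t * eta k
  else if j == k then sin t * eta i + cos t * eta k else eta j.
have ki : Ordinal kD != Ordinal iD by rewrite -val_eqE /= eq_sym.
exists D, xi'; split.
  have -> : sq n xi = sq D eta.
    have := @lin_widen R n D xi xi (leq_maxl _ _); rewrite /lin /sq.
    under eq_bigr do rewrite -expr2; move=> ->; apply: eq_bigr => j _; rewrite /eta.
    by case: ifP => _; rewrite ?expr2// mul0r mulr0.
  rewrite /sq (bigD1 (Ordinal iD))//= (bigD1 (Ordinal kD))//= [RHS](bigD1 (Ordinal iD))//= [in RHS](bigD1 (Ordinal kD))//=.
  rewrite !addrA; congr (_ + _).
    rewrite /xi' eqxx [k == i]eq_sym (negPf ik) eqxx.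
    have := cos2Dsin2 t => h; rewrite -[eta i ^+ 2]mul1r -[eta k ^+ 2]mul1r -h; ring.
  apply: eq_bigr => j /andP[]; rewrite -!val_eqE /= /xi' => /negPf -> /negPf ->//.
move=> w; rewrite (@lin_widen R n D xi _ (leq_maxl _ _)) -/eta.
rewrite /lin (bigD1 (Ordinal iD))//= (bigD1 (Ordinal kD))//= [RHS](bigD1 (Ordinal iD))//= [in RHS](bigD1 (Ordinal kD))//=.
rewrite !addrA; congr (_ + _).
  rewrite /xi' /rot eqxx [k == i]eq_sym (negPf ik) eqxx -/(eta i) -/(eta k); ring.
by apply: eq_bigr => j /andP[]; rewrite -!val_eqE /= /xi' /rot => /negPf -> /negPf ->.
Qed.

(** A rotation preserves sq, hence the characteristic functional, hence the law. *)
Let rot_law t (F : (nat -> R) -> R) (C : R) : measurable_fun setT (F : seqT R -> R) ->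
  (forall x, `|F x| <= C) -> Int (fun w => F (rot t ^~ w)) = Int (fun w => F (g ^~ w)).
Proof.
apply: (law_expectation (mrot t) mg) => n xi; have [n' [xi' [es el]]] := lin_rot t n xi.
  by under eq_Rintegral do rewrite el; rewrite !gcos es.
by under eq_Rintegral do rewrite el; rewrite !gsin.
Qed.

Variables (G dG : (nat -> R) -> R) (C0 C1 : R).
Hypotheses (mG : measurable_fun setT (G : seqT R -> R)) (mdG : measurable_fun setT (dG : seqT R -> R)).
Hypotheses (GC : forall x, `|G x| <= C0) (dGC : forall x, `|dG x| <= C1).
Hypothesis hG : forall x (t : R), dr (fun t => G (upd x i t)) t (dG (upd x i t)).
Hypothesis Gk : forall x t, G (upd x k t) = G x.

Let mcomp (F : (nat -> R) -> R) : measurable_fun setT (F : seqT R -> R) -> measurable_fun setT (fun w => F (g ^~ w)).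
Proof. by move=> mF; apply: (measurableT_comp (f := F : seqT R -> R) mF); exact: to_seq_meas. Qed.

Let der_quot (f : R -> R) (a : R) : dr f 0 a ->
  (f (m.+1%:R^-1) - f 0) / m.+1%:R^-1 @[m --> \oo] --> a.
Proof.
move=> [df <-]; rewrite /derive.
set Q := fun h : R => h^-1 *: ((f \o shift 0) (h *: 1) - f 0).
have c : (fun m => m.+1%:R^-1 : R) @ \oo --> (0 : R)^'.
  move=> A /= hA; have h : \forall m \near \oo, (m.+1%:R^-1 != 0 :> R) -> A (m.+1%:R^-1 : R) := @cvg_harmonic R _ hA.
  change (\forall m \near \oo, A (m.+1%:R^-1 : R)).
  by apply: filterS h => m; apply; rewrite invr_neq0// pnatr_eq0.
have dQ : Q @ 0^' --> lim (Q @ 0^') by exact: df.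
have h := @cvg_comp _ _ _ (fun m => m.+1%:R^-1 : R) Q _ _ _ c dQ.
rewrite (_ : (fun m => _) = Q \o (fun m => m.+1%:R^-1 : R)); first exact: h.
by apply/funext => m; rewrite /Q /= /GRing.scale /= mulr1 addr0 mulrC.
Qed.

Let C00 : 0 <= C0. Proof. exact: le_trans (normr_ge0 _) (GC (fun=> 0)). Qed.
Let C10 : 0 <= C1. Proof. exact: le_trans (normr_ge0 _) (dGC (fun=> 0)). Qed.

(** Differentiating E[G x_k] along the rotation in the (i, k) plane; x_k is
   replaced by the bounded m sin (x_k / m). *)
Let ibp_m (m : nat) : let b := m.+1%:R : R in
  Int (fun w => dG (g ^~ w) * g k w * (b * sin (g k w / b)) - G (g ^~ w) * (cos (g k w / b) * g i w)) = 0.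
Proof.
move=> b; have b0 : 0 < b by rewrite ltr0n.
pose F x := G x * (b * sin (x k / b)).
have mk : measurable_fun setT (fun x : seqT R => x k) by exact: coord_meas.
have csin : continuous (fun y : R => b * sin (y / b)).
  by apply: contZ; apply: (dr_continuous (fun y => dr_comp (drM (dr_id y) (dr_cst b^-1 y)) (is_derive_sin _))).
have ccos : continuous (fun y : R => cos (y / b)).
  by apply: (dr_continuous (fun y => dr_comp (drM (dr_id y) (dr_cst b^-1 y)) (is_derive_cos _))).
have mF : measurable_fun setT (F : seqT R -> R).
  by apply: measurable_funM => //; apply: (measurableT_comp (continuous_measurable_fun csin)).
have FC x : `|F x| <= C0 * b.
  rewrite /F normrM; apply: ler_pM => //; rewrite normrM ger0_norm ?(ltW b0)//.
  by rewrite ler_piMr ?(ltW b0)// ler_norml sin_geN1 sin_le1.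
pose f w t := F (rot t ^~ w).
pose yi w t := cos t * g i w + sin t * g k w.
pose yk w t := cos t * g k w - sin t * g i w.
pose f' w t := dG (upd (g ^~ w) i (yi w t)) * yk w t * (b * sin (yk w t / b))
  - G (upd (g ^~ w) i (yi w t)) * (cos (yk w t / b) * yi w t).
have dyi w (t : R) : dr (yi w) t (yk w t).
  apply: dr_eq (drD (drM (is_derive_cos t) (dr_cst (g i w) t)) (drM (is_derive_sin t) (dr_cst (g k w) t))) _.
  by rewrite /yk; ring.
have dyk w (t : R) : dr (yk w) t (- yi w t).
  apply: dr_eq (drB (drM (is_derive_cos t) (dr_cst (g k w) t)) (drM (is_derive_sin t) (dr_cst (g i w) t))) _.
  by rewrite /yi; ring.
have fE w t : f w t = G (upd (g ^~ w) i (yi w t)) * (b * sin (yk w t / b)).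
  rewrite /f /F {2}/rot eq_sym (negPf ik) eqxx; congr (_ * _).
  rewrite -(Gk (upd (g ^~ w) i (yi w t)) (yk w t)); congr G; apply/funext => j.
  rewrite /rot /upd; case: (eqVneq j i) => [->|ji]; first by rewrite (negPf ik).
  by case: eqP.
have df w (t : R) : dr (f w) t (f' w t).
  have -> : f w = fun t => G (upd (g ^~ w) i (yi w t)) * (b * sin (yk w t / b)) by apply/funext => s; exact: fE.
  have h1 := dr_comp (dyi w t) (hG (g ^~ w) (yi w t)).
  have h2 := dr_comp (drM (dyk w t) (dr_cst b^-1 t)) (is_derive_sin (yk w t * b^-1)).
  apply: dr_eq (drM h1 (drZ b h2)) _; rewrite /f'; field; exact: lt0r_neq0.
have yib w t : `|yi w t| <= `|g i w| + `|g k w|.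
  apply: le_trans (ler_normD _ _) _; rewrite !normrM; apply: lerD; rewrite ler_piMl// ler_norml.
    by rewrite cos_geN1 cos_le1.
  by rewrite sin_geN1 sin_le1.
have ykb w t : `|yk w t| <= `|g i w| + `|g k w|.
  apply: le_trans (ler_normB _ _) _; rewrite !normrM addrC; apply: lerD; rewrite ler_piMl// ler_norml.
    by rewrite sin_geN1 sin_le1.
  by rewrite cos_geN1 cos_le1.
have f'b w t : `|f' w t| <= (C1 * b + C0) * (`|g i w| + `|g k w|).
  rewrite /f' [(C1 * b + C0) * _]mulrDl; apply: le_trans (ler_normB _ _) _; apply: lerD; rewrite !normrM.
    rewrite mulrAC (ger0_norm (ltW b0)).
    apply: (@ler_pM _ _ (C1 * b)); [by rewrite !mulr_ge0// ltW|exact: normr_ge0| |exact: ykb].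
    apply: ler_pM; [exact: normr_ge0|by rewrite mulr_ge0// ltW|exact: dGC|].
    by rewrite ler_piMr ?(ltW b0)// ler_norml sin_geN1 sin_le1.
  apply: ler_pM; [exact: normr_ge0|by rewrite mulr_ge0|exact: GC|].
  by apply: le_trans (yib w t); rewrite ler_piMl// ler_norml cos_geN1 cos_le1.
pose q p w := (f w p.+1%:R^-1 - f w 0) / p.+1%:R^-1.
have mf t : measurable_fun setT (f ^~ t).
  by apply: (measurableT_comp (f := F : seqT R -> R) mF); exact: to_seq_meas.
have h := @dct q (f' ^~ 0) (fun w => (C1 * b + C0) * (`|g i w| + `|g k w|)) _ _ _ _.
have {}h : Int (q p) @[p --> \oo] --> Int (f' ^~ 0).
  apply: h.
  - by move=> p; apply: measurable_funM; [exact: measurable_funB|exact: measurable_cst].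
  - by apply: (igZ mT); apply: (igD mT); exact: coord_ig.
  - by move=> w; exact: der_quot.
  - move=> p w; rewrite /q normrM normfV (ger0_norm (_ : 0 <= p.+1%:R^-1)) ?invr_ge0// ler_pdivrMr ?invr_gt0//.
    have := @dr_lip R (f w) (f' w) 0 p.+1%:R^-1 _ (fun t _ => df w t) (fun t _ => f'b w t).
    by rewrite subr0; apply; rewrite invr_ge0.
have q0 p : Int (q p) = 0.
  have ift t : ig (f ^~ t).
    apply: (ig_bdd mT PT (C := C0 * b)) => // w _; exact: FC.
  rewrite (_ : Int (q p) = Int (fun w => p.+1%:R * (f w p.+1%:R^-1 - f w 0))).
    rewrite (IntZ mT _ (igB mT (ift _) (ift _))) (IntB mT (ift _) (ift _)).
    by rewrite !(rot_law _ mF FC) subrr mulr0.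
  by apply: eq_Rintegral => w _; rewrite /q invrK mulrC.
have {}h : Int (f' ^~ 0) = 0.
  have c0 : (fun p => Int (q p)) @ \oo --> (0 : R) by under eq_fun do rewrite q0; exact: cvg_cst.
  exact: (cvg_unique _ h c0).
rewrite -h; apply: eq_Rintegral => w _; rewrite /f' /yk /yi cos0 sin0 !mul1r !mul0r addr0 subr0.
have -> : upd (g ^~ w) i (g i w) = g ^~ w; last by [].
by apply/funext => j; rewrite /upd; case: eqP => [->|].
Qed.

Lemma ibp_sqr : ig (fun w => dG (g ^~ w) * g k w ^+ 2) /\
  Int (fun w => dG (g ^~ w) * g k w ^+ 2) = Int (fun w => G (g ^~ w) * g i w).
Proof.
have m1 := mcomp mG; have m2 := mcomp mdG.
have mm (f : R -> R) j : continuous f -> measurable_fun setT (fun w => f (g j w)).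
  by move=> cf; apply: (measurableT_comp (continuous_measurable_fun cf)).
pose b m := m.+1%:R : R.
have b0 m : 0 < b m by rewrite ltr0n.
have csin m : continuous (fun y : R => b m * sin (y / b m)).
  by apply: contZ; apply: (dr_continuous (fun y => dr_comp (drM (dr_id y) (dr_cst (b m)^-1 y)) (is_derive_sin _))).
have ccos m : continuous (fun y : R => cos (y / b m)).
  by apply: (dr_continuous (fun y => dr_comp (drM (dr_id y) (dr_cst (b m)^-1 y)) (is_derive_cos _))).
pose F m w := dG (g ^~ w) * g k w * (b m * sin (g k w / b m)).
pose H m w := G (g ^~ w) * (cos (g k w / b m) * g i w).
have mF m : measurable_fun setT (F m).
  by apply: measurable_funM; [exact: measurable_funM|exact: (mm _ _ (csin m))].
have mH m : measurable_fun setT (H m).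
  by apply: measurable_funM => //; apply: measurable_funM => //; exact: (mm _ _ (ccos m)).
have sb m (y : R) : `|b m * sin (y / b m)| <= `|y|.
  suff P0 (z : R) : 0 <= z -> `|b m * sin (z / b m)| <= z.
    have [y0|y0] := leP 0 y; first by rewrite (ger0_norm y0) P0.
    rewrite (ltr0_norm y0) -normrN -mulrN -sinN -mulNr; apply: P0; lra.
  move=> z0; have q0 : 0 <= z / b m by rewrite divr_ge0// ltW.
  have := sin_le q0 => h1.
  rewrite normrM (ger0_norm (ltW (b0 m))) mulrC -ler_pdivlMr//; rewrite ler_norml h1 andbT.
  set t := z / b m in q0 h1 *; clearbody t.
  have [zb|zb] := leP t 1; last by have := sin_geN1 t; lra.
  have := sin_ge q0.
  have : t ^+ 3 <= t * 1 by rewrite exprS ler_wpM2l// exprn_ile1.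
  lra.
have Fb m w : `|F m w| <= C1 * g k w ^+ 2.
  rewrite /F !normrM -mulrA; apply: ler_pM => //; rewrite ?mulr_ge0//.
  by rewrite -(real_normK (num_real (g k w))) expr2 ler_wpM2l// -normrM.
have Hb m w : `|H m w| <= C0 * `|g i w|.
  rewrite /H normrM; apply: ler_pM => //; rewrite normrM ler_piMl// ler_norml cos_geN1 cos_le1//.
have iF := igZ mT C1 (coord_ig2 k); have iH := igZ mT C0 (coord_ig i).
have Fc w : F ^~ w @ \oo --> dG (g ^~ w) * g k w ^+ 2.
  rewrite expr2 mulrA; apply: cvgMr; exact: cvg_sin_rescale.
have Hc w : H ^~ w @ \oo --> G (g ^~ w) * g i w.
  apply: cvgMr; rewrite -[X in _ --> X]mul1r; apply: cvgMl.
  apply: (@cvg_rate R _ _ (g k w ^+ 2)) => m.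
  have := one_minus_cos_le (g k w / b m); have := cos_le1 (g k w / b m); set c := cos _.
  have e : (g k w / b m) ^+ 2 / 2 = g k w ^+ 2 / b m * (2^-1 / b m) by field; exact: lt0r_neq0.
  rewrite e -/(b m) => h1 h2.
  have b1 : (b m)^-1 <= 1 by rewrite invf_le1// ler1n.
  have bi : 0 <= (b m)^-1 by rewrite invr_ge0 ltW.
  have : g k w ^+ 2 / b m * (2^-1 / b m) <= g k w ^+ 2 / b m * 1.
    apply: ler_wpM2l; first by rewrite divr_ge0 ?sqr_ge0// ltW.
    by move: b1 bi; set z := (b m)^-1; clearbody z; lra.
  move: h1 h2; set X := _ * (2^-1 / _); set Y := g k w ^+ 2 / b m; clearbody X Y c.
  by rewrite ler_norml; lra.
have L1 := dct mF iF Fc Fb; have L2 := dct mH iH Hc Hb.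
have i1 : ig (fun w => dG (g ^~ w) * g k w ^+ 2).
  apply: (ig_dom mT _ iF); first by apply: measurable_funM => //; exact: (mm (fun y => y ^+ 2) k (@exprn_continuous R 2)).
  by move=> w _; rewrite normrM (ger0_norm (sqr_ge0 _)) ler_wpM2r ?sqr_ge0.
split => //; apply: (cvg_unique (@Rhausdorff R) L1).
rewrite (_ : (fun m => Int (F m)) = (fun m => Int (H m)))//; apply/funext => m.
have iFm : ig (F m) by exact: (ig_dom mT (mF m) iF (fun w _ => Fb m w)).
have iHm : ig (H m) by exact: (ig_dom mT (mH m) iH (fun w _ => Hb m w)).
have := ibp_m m; rewrite /= -/(b m) => h; apply/eqP; rewrite -subr_eq0 -(IntB mT iFm iHm); apply/eqP; exact: h.
Qed.

End rotation.

(** Average ibp_sqr over k >= D: the averages of the g_k^2 tend to 1 in L^2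
   by lln. *)
Lemma gaussian_ibp (D i : nat) (G dG : (nat -> R) -> R) (C0 C1 : R) : (i < D)%N ->
  measurable_fun setT (G : seqT R -> R) -> measurable_fun setT (dG : seqT R -> R) ->
  (forall x, `|G x| <= C0) -> (forall x, `|dG x| <= C1) ->
  (forall x (t : R), dr (fun t => G (upd x i t)) t (dG (upd x i t))) ->
  (forall x k t, (D <= k)%N -> G (upd x k t) = G x) ->
  Int (fun w => dG (g ^~ w)) = Int (fun w => G (g ^~ w) * g i w).
Proof.
move=> iD mG mdG GC dGC hG Gk.
have ik k : (D <= k)%N -> i != k by move=> Dk; rewrite neq_ltn (leq_trans iD Dk).
pose I := Int (fun w => G (g ^~ w) * g i w); rewrite -/I.
have C10 : 0 <= C1 by exact: le_trans (normr_ge0 _) (dGC (fun=> 0)).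
have m2 : measurable_fun setT (fun w => dG (g ^~ w)).
  by apply: (measurableT_comp (f := dG : seqT R -> R) mdG); exact: to_seq_meas.
have i2 : ig (fun w => dG (g ^~ w)) by apply: (ig_bdd mT PT (C := C1)) => // w _.
pose S N w := \sum_(D <= k < D + N) (g k w ^+ 2 - 1).
(* Cauchy-Schwarz, the sum of N + 1 centered squares having variance 2 (N + 1). *)
have key N : `|I - Int (fun w => dG (g ^~ w))| ^+ 2 * N.+1%:R ^+ 2 <= C1 ^+ 2 * (2 * N.+1%:R).
  have [iS eS] := lln D N.+1; rewrite -/(S N.+1) in iS eS.
  have hk k : (D <= k < D + N.+1)%N -> ig (fun w => dG (g ^~ w) * (g k w ^+ 2 - 1)) /\
      Int (fun w => dG (g ^~ w) * (g k w ^+ 2 - 1)) = I - Int (fun w => dG (g ^~ w)).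
    move=> /andP[Dk _]; have [j1 j2] := ibp_sqr (ik k Dk) mG mdG GC dGC hG (fun x t => Gk x k t Dk).
    have e w : dG (g ^~ w) * (g k w ^+ 2 - 1) = dG (g ^~ w) * g k w ^+ 2 - dG (g ^~ w) by ring.
    split; first by apply: igE (igB mT j1 i2) => w; rewrite e.
    by under eq_Rintegral do rewrite e; rewrite (IntB mT j1 i2) j2.
  have eI : Int (fun w => dG (g ^~ w) * S N.+1 w) = N.+1%:R * (I - Int (fun w => dG (g ^~ w))).
    rewrite (_ : Int (fun w => dG (g ^~ w) * S N.+1 w) =
        Int (fun w => \sum_(D <= k < D + N.+1 | (D <= k < D + N.+1)%N) dG (g ^~ w) * (g k w ^+ 2 - 1))).
      rewrite (Int_sum mT PT) => [|k /hk[]//].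
      rewrite (eq_bigr (fun=> I - Int (fun w => dG (g ^~ w)))); last by move=> k /hk[].
      by rewrite -big_nat sumr_const_nat addKn mulr_natl.
    by apply: eq_Rintegral => w _; rewrite -big_nat /S mulr_sumr.
  have mS : measurable_fun setT (S N.+1).
    apply: measurable_sum => k; apply: measurable_funB; last exact: measurable_cst.
    exact: measurable_funX.
  have iA : ig (fun w => (dG (g ^~ w) * S N.+1 w) ^+ 2).
    apply: (ig_dom mT _ (igZ mT (C1 ^+ 2) iS)).
      by apply: measurable_funX; exact: measurable_funM.
    move=> w _; rewrite ger0_norm ?sqr_ge0// exprMn ler_wpM2r ?sqr_ge0//.
    by rewrite -(real_normK (num_real (dG _))) ler_pXn2r ?nnegrE.
  have iB : ig (fun w => dG (g ^~ w) * S N.+1 w).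
    apply: (ig_dom mT _ (igD mT (ig_cst mT PT 1) iA)); first exact: measurable_funM.
    move=> w _; set y := _ * _; rewrite -(real_normK (num_real y)).
    by have := sqr_ge0 (`|y| - 1); have := normr_ge0 y; lra.
  have := Int_sqr_le mT PT iB iA; rewrite eI exprMn.
  rewrite real_normK ?num_real// mulrC => /le_trans; apply.
  rewrite -eS -(IntZ mT _ iS); apply: (Int_le mT iA (igZ mT _ iS)) => w _.
  rewrite exprMn ler_wpM2r ?sqr_ge0// -(real_normK (num_real (dG _))) ler_pXn2r ?nnegrE//.
have z : (fun _ : nat => `|I - Int (fun w => dG (g ^~ w))| ^+ 2) @ \oo --> (0 : R).
  apply: (@cvg_rate R _ _ (C1 ^+ 2 * 2)) => N; rewrite subr0 normrX normr_id.
  rewrite ler_pdivlMr ?ltr0n// -(ler_pM2r (_ : 0 < N.+1%:R)) ?ltr0n//.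
  by have := key N; rewrite expr2 !mulrA.
have e := cvg_unique (@Rhausdorff R) z (cvg_cst (`|I - Int (fun w => dG (g ^~ w))| ^+ 2)).
by apply/esym/eqP; rewrite -subr_eq0 -normr_eq0 -sqrf_eq0 -e.
Qed.

End gaussian_ibp.

(** * Gaussian tails *)

Section exponential_moment.
Variable R : realType.
Context d (T : measurableType d) (P : probability T R).
Variable g : nat -> T -> R.
Local Notation dr f x l := (is_derive (x : R) (1 : R) (f : R -> R) (l : R)).
Local Notation Int f := (\int[P]_(w in setT) f w).
Local Notation ig f := (P.-integrable setT (EFin \o f)).
Hypothesis mg : forall k, measurable_fun setT (g k).
Hypothesis gcos : forall n xi, Int (fun w => cos (lin n xi (g ^~ w))) = expR (- (2^-1 * sq n xi)).
Hypothesis gsin : forall n xi, Int (fun w => sin (lin n xi (g ^~ w))) = 0.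

Let mT : measurable (setT : set T). Proof. exact: measurableT. Qed.
Let PT : P setT = 1%E. Proof. exact: probability_setT. Qed.

Lemma lin_upd n c x i (t : R) : (i < n)%N -> lin n c (upd x i t) = lin n c (upd x i 0) + c i * t.
Proof.
move=> ni; rewrite /lin (bigD1 (Ordinal ni))//= [in RHS](bigD1 (Ordinal ni))//= /upd eqxx mulr0 add0r addrC.
congr (_ + _); apply: eq_bigr => j; rewrite -val_eqE /= => /negPf -> //.
Qed.

Lemma lin_upd_out n c x k (t : R) : (n <= k)%N -> lin n c (upd x k t) = lin n c x.
Proof.
move=> nk; apply: eq_bigr => j _; rewrite /upd ifF//.
by apply/negbTE; rewrite neq_ltn (leq_trans (ltn_ord j) nk).
Qed.

(** Gaussian integration by parts in each coordinate of the linear form, summed. *)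
Lemma ibp_lin n c (h h' : R -> R) (C0 C1 : R) : (forall y : R, dr h y (h' y)) ->
  continuous h' -> (forall y, `|h y| <= C0) -> (forall y, `|h' y| <= C1) ->
  Int (fun w => lin n c (g ^~ w) * h (lin n c (g ^~ w))) = sq n c * Int (fun w => h' (lin n c (g ^~ w))).
Proof.
move=> dh ch' hC h'C.
have ch : continuous h by exact: dr_continuous dh.
have ml := @lin_meas R _ _ g n c mg.
have mls : measurable_fun setT (fun x : seqT R => lin n c x).
  apply: measurable_sum => k; apply: measurable_funM; [exact: measurable_cst|exact: coord_meas].
have ih' : ig (fun w => h' (lin n c (g ^~ w))).
  apply: (ig_bdd mT PT (C := C1)) => [|w _]; last exact: h'C.
  exact: (measurableT_comp (continuous_measurable_fun ch')).
have mh : measurable_fun setT (fun w => h (lin n c (g ^~ w))).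
  exact: (measurableT_comp (continuous_measurable_fun ch)).
have ihg i : ig (fun w => h (lin n c (g ^~ w)) * g i w).
  apply: (ig_dom mT _ (igZ mT C0 (coord_ig mg gcos i))); first exact: measurable_funM.
  by move=> w _; rewrite normrM ler_wpM2r.
have key i : (i < n)%N -> c i * Int (fun w => h' (lin n c (g ^~ w))) = Int (fun w => h (lin n c (g ^~ w)) * g i w).
  move=> ni; rewrite -(IntZ mT _ ih').
  apply: (gaussian_ibp mg gcos gsin (D := n) (i := i) (G := fun x => h (lin n c x))
     (dG := fun x => c i * h' (lin n c x)) (C0 := C0) (C1 := `|c i| * C1)) => //.
  - exact: (measurableT_comp (continuous_measurable_fun ch)).
  - apply: measurable_funM; first exact: measurable_cst.
    exact: (measurableT_comp (continuous_measurable_fun ch')).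
  - by move=> x; rewrite normrM ler_wpM2l.
  - move=> x t; rewrite (lin_upd c x t ni).
    under [X in is_derive _ _ X]eq_fun do rewrite (lin_upd c x _ ni).
    have h1 := drD (dr_cst (lin n c (upd x i 0)) t) (drZ (c i) (dr_id t)).
    by apply: dr_eq (dr_comp h1 (dh _)) _; ring.
  - by move=> x k t nk; rewrite lin_upd_out.
rewrite (_ : Int (fun w => _ * _) = Int (fun w => \sum_(i < n) c i * (h (lin n c (g ^~ w)) * g i w))); last first.
  by apply: eq_Rintegral => w _; rewrite {1}/lin mulr_suml; apply: eq_bigr => i _; ring.
rewrite (Int_sum mT PT) => [|i _]; last exact: igZ.
rewrite /sq mulr_suml; apply: eq_bigr => i _.
by rewrite (IntZ mT _ (ihg i)) -key// expr2; ring.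
Qed.

Section truncated.
Variables (n : nat) (c : nat -> R) (a dl : R).
Hypotheses (a0 : 0 < a) (as2 : a * sq n c <= 4^-1) (dl0 : 0 < dl).

Let q (y : R) : R := 1 + dl * y ^+ 2.
Let psi (y : R) : R := a * y ^+ 2 / q y.
Let rho (y : R) : R := expR (psi y) / q y.
Let h (y : R) : R := y * rho y.
Let h' (y : R) : R := rho y * (1 + 2 * a * y ^+ 2 / (q y ^+ 2) - 2 * dl * y ^+ 2 / q y).

Let q1 y : 1 <= q y. Proof. by rewrite lerDl mulr_ge0 ?sqr_ge0// ltW. Qed.
Let q0 y : 0 < q y. Proof. exact: lt_le_trans ltr01 (q1 y). Qed.
Let qn y : q y != 0. Proof. by rewrite gt_eqF. Qed.

Let dq (y : R) : dr q y (2 * dl * y).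
Proof.
by apply: dr_eq (drD (dr_cst 1 y) (drZ dl (drX 2 y))) _; rewrite /=; ring.
Qed.

Let dqi (y : R) : dr (fun y => (q y)^-1) y (- (q y) ^- 2 * (2 * dl * y)).
Proof.
have h1 := is_deriveV (qn y) (dq y); apply: dr_eq h1 _.
by rewrite /GRing.scale /=.
Qed.

Let drho (y : R) : dr rho y (rho y * (2 * a * y / (q y ^+ 2) - 2 * dl * y / q y)).
Proof.
have h1 : dr psi y (2 * a * y / q y ^+ 2).
  apply: dr_eq (drM (drZ a (drX 2 y)) (dqi y)) _; rewrite /= expr1.
  have := qn y; rewrite /q => z; by field.
apply: dr_eq (drM (dr_comp h1 (is_derive_expR _)) (dqi y)) _.
rewrite /rho; set E := expR _; have z := qn y; by field.
Qed.

Let dh (y : R) : dr h y (h' y).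
Proof.
by apply: dr_eq (drM (dr_id y) (drho y)) _; rewrite /h'; set r := rho y; have z := qn y; field.
Qed.

Let psi_ge0 y : 0 <= psi y.
Proof. by rewrite /psi divr_ge0// ?(ltW (q0 y))// mulr_ge0 ?sqr_ge0// ltW. Qed.

Let psi_le y : psi y <= a / dl.
Proof.
rewrite /psi ler_pdivrMr// (_ : a / dl * q y = a / dl + a * y ^+ 2); last by rewrite /q; field; rewrite gt_eqF.
by rewrite lerDr divr_ge0// ltW.
Qed.

Let rho_ge0 y : 0 <= rho y. Proof. by rewrite /rho divr_ge0 ?expR_ge0// ltW. Qed.

Let rho_q y : rho y * q y <= expR (a / dl).
Proof. by rewrite /rho divfK ?qn// ler_expR psi_le. Qed.

Let rho_le y : rho y <= expR (a / dl).
Proof. by apply: le_trans (rho_q y); rewrite ler_peMr. Qed.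

Let y2rho_le y : y ^+ 2 * rho y <= expR (a / dl) / dl.
Proof.
rewrite ler_pdivlMr//; apply: le_trans (rho_q y); rewrite -mulrA mulrC -mulrA ler_wpM2l//.
by rewrite /q lerDr.
Qed.

Let ch' : continuous h'.
Proof.
have cq : continuous (fun y => (q y)^-1) by exact: dr_continuous dqi.
have cr : continuous rho by exact: dr_continuous drho.
have c2 : continuous (fun y : R => y ^+ 2) by apply: contX => ?; exact: cvg_id.
apply: contM => //; apply: contB.
  apply: contD; first exact: cont_cst.
  apply: contM; first by apply: contM => //; exact: cont_cst.
  by under eq_fun do rewrite -exprVn; exact: contX.
by apply: contM => //; apply: contM => //; exact: cont_cst.
Qed.

Let h'_abs y : `|h' y| <= expR (a / dl) * (3 + 2 * a / dl).
Proof.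
rewrite /h' normrM (ger0_norm (rho_ge0 y)); apply: ler_pM => //.
have iq : 0 <= (q y)^-1 <= 1 by rewrite invr_ge0 (ltW (q0 y)) invf_le1 ?q0 ?q1.
have e1 : 0 <= dl * y ^+ 2 / q y <= 1.
  have z0 := ltW (q0 y); have d0 := ltW dl0.
  have d1 : 0 <= dl * y ^+ 2 by rewrite mulr_ge0 ?sqr_ge0.
  by apply/andP; split; [exact: divr_ge0|rewrite ler_pdivrMr ?q0// mul1r /q lerDr].
have e2 : 2 * a * y ^+ 2 / q y ^+ 2 = 2 * (a / dl) * ((dl * y ^+ 2 / q y) * (q y)^-1).
  by have z := qn y; field; rewrite z gt_eqF.
have e3 : 2 * dl * y ^+ 2 / q y = 2 * (dl * y ^+ 2 / q y) by rewrite !mulrA.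
rewrite e2 e3; have : 0 <= (dl * y ^+ 2 / q y) * (q y)^-1 <= 1.
  move/andP: e1 => [u1 u2]; move/andP: iq => [u3 u4]; rewrite mulr_ge0//= mulr_ile1//.
have ad : 0 <= a / dl by rewrite divr_ge0// ltW.
have -> : 2 * a / dl = 2 * (a / dl) by rewrite mulrA.
move: e1; set A := dl * y ^+ 2 / q y; set B := A * _; set C := a / dl; move: ad; rewrite -/C.
clearbody A B C; move=> C0 A1 B1; rewrite ler_norml; apply/andP; split; nra.
Qed.

Let h_abs y : `|h y| <= expR (a / dl) + expR (a / dl) / dl.
Proof.
rewrite /h normrM (ger0_norm (rho_ge0 y)).
apply: le_trans (lerD (rho_le y) (y2rho_le y)).
have := rho_ge0 y; have -> : rho y + y ^+ 2 * rho y = (1 + `|y| ^+ 2) * rho y.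
  by rewrite real_normK ?num_real// mulrDl mul1r.
move=> r0; rewrite ler_wpM2r//; have := sqr_ge0 (`|y| - 1); have := normr_ge0 y; lra.
Qed.

(** Integration by parts for h bounds a E[l^2 rho(l)] in terms of E[rho(l)] and of
   itself, and a sq <= 1/4 makes this solvable; where a l^2 <= 1, rho is at most
   e, elsewhere it is at most a l^2 rho(l). *)
Lemma truncated_moment : let rl w := rho (lin n c (g ^~ w)) in
  [/\ measurable_fun setT rl, ig rl & Int rl <= 2 * expR 1].
Proof.
move=> rl; have ml := @lin_meas R _ _ g n c mg.
have cr : continuous rho by exact: dr_continuous drho.
have mr : measurable_fun setT rl by exact: (measurableT_comp (continuous_measurable_fun cr)).
have ir : ig rl by apply: (ig_bdd mT PT (C := expR (a / dl))) => // w _; rewrite ger0_norm /rl ?rho_le ?rho_ge0.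
pose l2 w := a * ((lin n c (g ^~ w)) ^+ 2 * rl w).
have m2 : measurable_fun setT (fun w => (lin n c (g ^~ w)) ^+ 2 * rl w).
  by apply: measurable_funM => //; exact: measurable_funX.
have i2' : ig (fun w => (lin n c (g ^~ w)) ^+ 2 * rl w).
  apply: (ig_bdd mT PT (C := expR (a / dl) / dl)) => // w _;
  rewrite ger0_norm ?y2rho_le//; apply: mulr_ge0; [exact: sqr_ge0|exact: rho_ge0].
have i2 : ig l2 := igZ mT a i2'.
split => //.
have := ibp_lin n c dh ch' h_abs h'_abs.
rewrite (_ : Int (fun w => _ * _) = Int (fun w => (lin n c (g ^~ w)) ^+ 2 * rl w)); last first.
  by apply: eq_Rintegral => w _; rewrite /h /rl; ring.
move=> e.
have s0 : 0 <= sq n c by apply: sumr_ge0 => i _; exact: sqr_ge0.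
have ih' : ig (fun w => h' (lin n c (g ^~ w))).
  apply: (ig_bdd mT PT (C := expR (a / dl) * (3 + 2 * a / dl))) => [|w _]; last exact: h'_abs.
  exact: (measurableT_comp (continuous_measurable_fun ch')).
have le1 : Int (fun w => h' (lin n c (g ^~ w))) <= Int (fun w => rl w + 2 * l2 w).
  apply: (Int_le mT ih' (igD mT ir (igZ mT 2 i2))) => w _.
  rewrite /h' /l2 /rl; set y := lin _ _ _.
  rewrite (_ : rho y + _ = rho y * (1 + 2 * a * y ^+ 2)); last by ring.
  rewrite ler_wpM2l//.
  have : 2 * a * y ^+ 2 / q y ^+ 2 <= 2 * a * y ^+ 2.
    rewrite ler_pdivrMr ?exprn_gt0// ler_peMr ?exprn_ege1//.
    by apply: mulr_ge0 (sqr_ge0 _); rewrite mulr_ge0// ltW.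
  have : 0 <= 2 * dl * y ^+ 2 / q y.
    apply: divr_ge0; last exact: ltW (q0 y).
    by apply: mulr_ge0 (sqr_ge0 _); rewrite mulr_ge0// ltW.
  lra.
have e1 : Int l2 = a * sq n c * Int (fun w => h' (lin n c (g ^~ w))).
  by rewrite (IntZ mT _ i2') e mulrA.
have r0 : 0 <= Int rl by apply: Int_ge0 => w _; exact: rho_ge0.
have le2 : Int l2 <= 4^-1 * (Int rl + 2 * Int l2).
  rewrite {1}e1; apply: (@le_trans _ _ (a * sq n c * Int (fun w => rl w + 2 * l2 w))).
    by apply: ler_wpM2l => //; rewrite mulr_ge0// ltW.
  rewrite (IntD mT ir (igZ mT 2 i2)) (IntZ mT _ i2) ler_wpM2r// addr_ge0// mulr_ge0//.
  apply: Int_ge0 => w _; rewrite /l2 mulr_ge0 ?(ltW a0)// mulr_ge0 ?sqr_ge0//; exact: rho_ge0.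
have : Int rl <= Int (fun w => expR 1 + l2 w).
  apply: (Int_le mT ir (igD mT (ig_cst mT PT _) i2)) => w _; rewrite /l2 /rl; set y := lin _ _ _.
  have [y1|y1] := leP (a * y ^+ 2) 1.
    apply: ler_wpDr; first by rewrite mulr_ge0 ?(ltW a0)// mulr_ge0 ?sqr_ge0.
    rewrite /rho ler_pdivrMr//; apply: (@le_trans _ _ (expR 1)); last by rewrite ler_peMr ?expR_ge0.
    by rewrite ler_expR /psi ler_pdivrMr// mul1r; apply: le_trans y1 _.
  by apply: ler_wpDl; [exact: expR_ge0|rewrite mulrA ler_peMl// ltW].
rewrite (IntD mT (ig_cst mT PT _) i2) (Int_cst mT PT); lra.
Qed.

End truncated.

(** Gaussian tails, obtained by feeding (a truncation of) y exp(a y^2) to the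
   scalar integration by parts. *)
Lemma exp_moment n c (a : R) : 0 < a -> a * sq n c <= 4^-1 ->
  ig (fun w => expR (a * lin n c (g ^~ w) ^+ 2)) /\
  Int (fun w => expR (a * lin n c (g ^~ w) ^+ 2)) <= 2 * expR 1.
Proof.
move=> a0 as2; have p0 m : 0 < m.+1%:R^-1 :> R by rewrite invr_gt0 ltr0n.
have H m := truncated_moment a0 as2 (p0 m).
apply: (ig_fatou mT (F := fun m w => expR (a * lin n c (g ^~ w) ^+ 2 / (1 + m.+1%:R^-1 * lin n c (g ^~ w) ^+ 2))
    / (1 + m.+1%:R^-1 * lin n c (g ^~ w) ^+ 2))).
- by move=> m; have [] := H m.
- move=> m w _; rewrite divr_ge0 ?expR_ge0// addr_ge0// mulr_ge0 ?sqr_ge0//.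
- move=> w _; set y := lin _ _ _.
  have c1 : (1 + m.+1%:R^-1 * y ^+ 2) @[m --> \oo] --> (1 + 0 * y ^+ 2 : R).
    by apply: cvgD; [exact: cvg_cst|apply: cvgMl; exact: cvg_harmonic].
  rewrite mul0r addr0 in c1.
  have c2 : (1 + m.+1%:R^-1 * y ^+ 2)^-1 @[m --> \oo] --> (1 : R).
    by rewrite -[X in _ --> X]invr1; exact: (cvgV (oner_neq0 R) c1).
  have c3 : (a * y ^+ 2) * (1 + m.+1%:R^-1 * y ^+ 2)^-1 @[m --> \oo] --> (a * y ^+ 2).
    by rewrite -[X in _ --> X]mulr1; exact: (cvgMr c2).
  have c4 : expR (a * y ^+ 2 / (1 + m.+1%:R^-1 * y ^+ 2)) @[m --> \oo] --> expR (a * y ^+ 2).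
    exact: (continuous_cvg _ (@continuous_expR R _) c3).
  by rewrite -[X in _ --> X]mulr1; exact: (cvgM c4 c2).
- by move=> m; have [] := H m.
- by move=> m; have [] := H m.
Qed.

Lemma pow4_le_exp (z : R) : 0 <= z -> z ^+ 4 <= 4 ^+ 4 * expR z.
Proof.
move=> z0; have {2}-> : z = 4%:R * (z / 4) by field.
rewrite expRM_natl; have {1}-> : z = 4 * (z / 4) by field.
rewrite exprMn ler_wpM2l ?exprn_ge0// ler_pXn2r ?nnegrE ?expR_ge0//; last by lra.
by have := expR_ge1Dx (z / 4); lra.
Qed.

Definition C8 : R := 4 ^+ 4 * 4 ^+ 4 * (2 * expR 1).

Lemma moment8 n c (s : R) : 0 < s -> sq n c <= s -> ig (fun w => lin n c (g ^~ w) ^+ 8) /\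
  Int (fun w => lin n c (g ^~ w) ^+ 8) <= C8 * s ^+ 4.
Proof.
move=> s0 cs; pose a := (4 * s)^-1.
have a0 : 0 < a by rewrite invr_gt0 mulr_gt0.
have as2 : a * sq n c <= 4^-1.
  by rewrite mulrC ler_pdivrMr ?mulr_gt0// mulrA mulVf ?mul1r.
have [i1 h1] := exp_moment a0 as2.
have ml := @lin_meas R _ _ g n c mg.
have pw w : lin n c (g ^~ w) ^+ 8 <= 4 ^+ 4 * 4 ^+ 4 * s ^+ 4 * expR (a * lin n c (g ^~ w) ^+ 2).
  set y := lin _ _ _; have := @pow4_le_exp (a * y ^+ 2) (mulr_ge0 (ltW a0) (sqr_ge0 _)).
  have -> : y ^+ 8 = (4 ^+ 4 * s ^+ 4) * (a * y ^+ 2) ^+ 4 by rewrite /a; field; rewrite gt_eqF.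
  have q0 : 0 <= 4 ^+ 4 * s ^+ 4 by rewrite mulr_ge0 ?exprn_ge0// ltW.
  move=> h; rewrite (_ : 4 ^+ 4 * 4 ^+ 4 * s ^+ 4 * _ = (4 ^+ 4 * s ^+ 4) * (4 ^+ 4 * expR (a * y ^+ 2))); last by ring.
  exact: ler_wpM2l.
have i8 : ig (fun w => lin n c (g ^~ w) ^+ 8).
  apply: (ig_dom mT _ (igZ mT (4 ^+ 4 * 4 ^+ 4 * s ^+ 4) i1)); first exact: measurable_funX.
  by move=> w _; rewrite ger0_norm// exprn_even_ge0.
split => //; apply: le_trans (Int_le mT i8 (igZ mT _ i1) (fun w _ => pw w)) _.
rewrite (IntZ mT _ i1) /C8 [leRHS]mulrAC; apply: ler_wpM2l => //.
by rewrite !mulr_ge0 ?exprn_ge0// ltW.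
Qed.

End exponential_moment.

(** * The Gibbs density *)

Section gibbs_weight.
Variables (R : realType) (M : nat) (eps K : R).
Local Notation dr f x l := (is_derive (x : R) (1 : R) (f : R -> R) (l : R)).
Local Notation d := (M.*2).
Hypotheses (eps0 : 0 < eps) (K1 : 1 <= K).
Implicit Types x : nat -> R.

Lemma dr_vf_upd x i (t y : R) : (i < d)%N ->
  vf M (upd x i t) y = vf M (upd x i 0) y + t * emode R i y.
Proof.
move=> id; have := lin_upd (emode R ^~ y) x t id.
rewrite /lin /vf; under eq_bigr do rewrite mulrC.
by move=> ->; rewrite mulrC; congr (_ + _); apply: eq_bigr => k _; rewrite mulrC.
Qed.

Lemma dr_gam_upd x i k (t : R) : (i < d)%N ->
  dr (fun t => gam M (upd x i t) k) t
     (2 * integralT (fun y => vf M (upd x i t) y * emode R i y * emode R k y)).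
Proof.
move=> id; have cv z := @cont_vf R M z; have ce := @cont_emode R.
pose A := vf M (upd x i 0); have cA : continuous A by exact: cv.
have E (s : R) : gam M (upd x i s) k = integralT (fun y => A y ^+ 2 * emode R k y)
   + (2 * integralT (fun y => A y * emode R i y * emode R k y)) * s
   + integralT (fun y => emode R i y ^+ 2 * emode R k y) * s ^+ 2.
  rewrite /gam /coef (@iT_eq _ _ (fun y => A y ^+ 2 * emode R k y +
    (2 * s) * (A y * emode R i y * emode R k y) + s ^+ 2 * (emode R i y ^+ 2 * emode R k y))); last first.
    by move=> y; rewrite dr_vf_upd//; rewrite -/A; ring.
  by rewrite iTD ?iTD ?iTZ; try (by ct); ring.
rewrite (_ : (fun t => _) = fun s => integralT (fun y => A y ^+ 2 * emode R k y)
   + (2 * integralT (fun y => A y * emode R i y * emode R k y)) * s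
   + integralT (fun y => emode R i y ^+ 2 * emode R k y) * s ^+ 2); last by apply/funext => s; exact: E.
apply: dr_eq (drD (drD (dr_cst _ t) (drZ _ (dr_id t))) (drZ _ (drX 2 t))) _.
rewrite (@iT_eq _ (fun y => vf M (upd x i t) y * emode R i y * emode R k y) (fun y => A y * emode R i y * emode R k y + t * (emode R i y ^+ 2 * emode R k y))); last first.
  by move=> y; rewrite dr_vf_upd// -/A; ring.
by rewrite iTD ?iTZ; try (by ct); rewrite /=; ring.
Qed.

Definition cub x : R := integralT (fun y => vf M x y ^+ 3).

Lemma cubE x : cub x = \sum_(k < d) gam M x k * x k.
Proof.
rewrite -iT_vfM; first by apply: iT_eq => y; rewrite exprSr.
by apply: contX; exact: cont_vf.
Qed.

Lemma dr_cub_upd x i (t : R) : (i < d)%N ->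
  dr (fun t => cub (upd x i t)) t (3 * gam M (upd x i t) i).
Proof.
move=> id; have cv z := @cont_vf R M z; have ce := @cont_emode R.
pose A := vf M (upd x i 0); have cA : continuous A by exact: cv.
pose e := emode R i; have ce' : continuous e by exact: ce.
have E (s : R) : cub (upd x i s) = integralT (fun y => A y ^+ 3)
   + (3 * integralT (fun y => A y ^+ 2 * e y)) * s
   + (3 * integralT (fun y => A y * e y ^+ 2)) * s ^+ 2 + integralT (fun y => e y ^+ 3) * s ^+ 3.
  rewrite /cub (@iT_eq _ _ (fun y => A y ^+ 3 +
    (3 * s) * (A y ^+ 2 * e y) + (3 * s ^+ 2) * (A y * e y ^+ 2) + s ^+ 3 * e y ^+ 3)); last first.
    by move=> y; rewrite dr_vf_upd//; rewrite -/A -/(e y); ring.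
  by rewrite iTD ?iTD ?iTD ?iTZ; try (by ct); ring.
rewrite (_ : (fun t => _) = fun s => integralT (fun y => A y ^+ 3)
   + (3 * integralT (fun y => A y ^+ 2 * e y)) * s
   + (3 * integralT (fun y => A y * e y ^+ 2)) * s ^+ 2 + integralT (fun y => e y ^+ 3) * s ^+ 3); last by apply/funext => s; exact: E.
apply: dr_eq (drD (drD (drD (dr_cst _ t) (drZ _ (dr_id t))) (drZ _ (drX 2 t))) (drZ _ (drX 3 t))) _.
rewrite /gam /coef (@iT_eq _ (fun y => vf M (upd x i t) y ^+ 2 * emode R i y) (fun y => A y ^+ 2 * e y + (2 * t) * (A y * e y ^+ 2) + t ^+ 2 * e y ^+ 3)); last first.
  by move=> y; rewrite dr_vf_upd// -/A -/(e y); ring.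
by rewrite iTD ?iTD ?iTZ; try (by ct); rewrite /=; ring.
Qed.

(** Diagonal entries of the Jacobian matrix of the field. *)
Definition diagX x i : R := - (dsign R i * freq R i) *
  (6 * integralT (fun y => vf M x y * emode R i y * emode R (partner i) y)).

Lemma partner_neq i : (partner i == i) = false.
Proof. by apply/negbTE/negP => /eqP /(congr1 odd); rewrite odd_partner; case: odd. Qed.

Lemma dr_kdvX_upd x i (t : R) : (i < d)%N ->
  dr (fun t => kdvX M (upd x i t) i) t (diagX (upd x i t) i).
Proof.
move=> id; rewrite (_ : (fun t => _) = fun t => - (dsign R i * freq R i) *
   (freq R i ^+ 2 * x (partner i) + 3 * gam M (upd x i t) (partner i))); last first.
  by apply/funext => s; rewrite /kdvX /Dx /gradH freq_partner {1}/upd partner_neq.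
apply: dr_eq (drZ _ (drD (dr_cst (freq R i ^+ 2 * x (partner i)) t) (drZ 3 (dr_gam_upd x (partner i) t id)))) _.
by rewrite /diagX; ring.
Qed.

(** The diagonal derivatives at the cosine and at the sine coordinate of one
   frequency are opposite. *)
Lemma div_kdvX x : \sum_(i < d) diagX x i = 0.
Proof.
have h : \sum_(i < d) diagX x i = - \sum_(i < d) diagX x i.
  rewrite -[LHS](sum_partner _ (diagX x)) -sumrN; apply: eq_bigr => i _.
  rewrite /diagX partnerK freq_partner dsign_partner.
  rewrite (@iT_eq _ _ (fun y => vf M x y * emode R i y * emode R (partner i) y)); last by move=> y; ring.
  by ring.
by move: h; set s := \sum_(i < d) _; lra.
Qed.

Definition mass x : R := \sum_(k < d) x k ^+ 2.
Definition pos1 (s : R) : R := Num.max 0 s.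
Definition pos2 (s : R) : R := pos1 s ^+ 2.

Lemma pos1E : pos1 = fun s : R => 2^-1 * (s + `|s|).
Proof.
apply/funext => z; rewrite /pos1; have [z0|z0] := leP 0 z; first by rewrite ger0_norm//; field.
by rewrite ltr0_norm//; field.
Qed.

Lemma cont_pos1 : continuous pos1.
Proof.
rewrite pos1E; apply: contZ; apply: contD; first by move=> ?; exact: cvg_id.
by apply: cont_abs => ?; exact: cvg_id.
Qed.

Lemma dr_pos2 (s : R) : dr pos2 s (2 * pos1 s).
Proof.
have E : pos2 = fun s : R => 2^-1 * (s ^+ 2 + s * `|s|).
  apply/funext => z; rewrite /pos2 /pos1; have [z0|z0] := leP 0 z.
    by rewrite ger0_norm//; field.
  by rewrite ltr0_norm// expr0n /=; field.
have [s0|s0|->] := ltgtP s 0.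
- rewrite (_ : 2 * pos1 s = 0); last by rewrite /pos1 max_l ?mulr0// ltW.
  have h := @near_eq_is_derive R R R (fun=> 0) pos2 s 1 0 _ (dr_cst 0 s).
  apply: h; near=> z; rewrite /pos2 /pos1 max_l ?expr0n//.
  by apply: ltW; near: z; exact: lt_nbhsl.
- rewrite (_ : 2 * pos1 s = 2%:R * s ^+ 1); last by rewrite /pos1 max_r ?expr1// ltW.
  have h := @near_eq_is_derive R R R (fun z => z ^+ 2) pos2 s 1 (2%:R * s ^+ 1) _ (drX 2 s).
  apply: h; near=> z; rewrite /pos2 /pos1 max_r//.
  by apply: ltW; near: z; exact: lt_nbhsr.
rewrite /pos1 maxxx mulr0.
have q0 : (fun h : R => h^-1 *: (pos2 (h *: 1 + 0) - pos2 0)) @ 0^' --> (0 : R).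
  have P1 : (fun h : R => pos1 h) @ 0^' --> (0 : R).
    have z : pos1 0 = 0 by rewrite /pos1 maxxx.
    have c0 : pos1 @ (0 : R) --> (0 : R) by rewrite -[X in _ --> X]z; exact: cont_pos1.
    by apply: cvg_trans c0; apply: cvg_app; exact: cvg_within.
  apply: cvg_trans P1; apply: near_eq_cvg; near=> z.
  have z0 : z != 0 by near: z; exact: nbhs_dnbhs_neq.
  rewrite /= /GRing.scale /= mulr1 addr0 /pos2 [pos1 0]/pos1 maxxx expr0n subr0 /pos1.
  by have [zp|zn] := leP 0 z; [field|rewrite expr0n mulr0].
apply: DeriveDef; first by apply/cvg_ex; exists 0.
exact: (cvg_lim (@Rhausdorff R) q0).
Unshelve. all: by end_near.
Qed.

Definition gexp x : R := expR (- (eps * cub x)).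
Definition room x : R := 1 - mass x / K.
(** Density, relative to the Gaussian law with inverse covariance
   1 + eps freq^2, of a smoothly cut-off function of the energy and the
   momentum; squaring the positive part makes it C^1. *)
Definition gibbs x : R := gexp x * pos2 (room x).
Definition dgibbs i x : R :=
  gexp x * (- (3 * eps * gam M x i) * pos2 (room x) - 4 / K * x i * pos1 (room x)).

Lemma dr_gibbs x i (t : R) : (i < d)%N -> dr (fun t => gibbs (upd x i t)) t (dgibbs i (upd x i t)).
Proof.
move=> id; have h1 := dr_cub_upd x t id.
have E (s : R) : mass (upd x i s) = mass (upd x i 0) + s ^+ 2.
  rewrite /mass (bigD1 (Ordinal id))//= [in RHS](bigD1 (Ordinal id))//= /upd eqxx expr0n add0r addrC.
  by congr (_ + _); apply: eq_bigr => j; rewrite -val_eqE /= => /negPf ->.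
have h2 : dr (fun t => room (upd x i t)) t (- (2 / K * t)).
  rewrite (_ : (fun t => _) = fun s => (1 - mass (upd x i 0) / K) - K^-1 * s ^+ 2); last first.
    by apply/funext => s; rewrite /room E; ring.
  by apply: dr_eq (drB (dr_cst _ t) (drZ K^-1 (drX 2 t))) _; rewrite /=; ring.
have h3 := dr_comp h2 (dr_pos2 _); have h4 := dr_comp (drN (drZ eps h1)) (is_derive_expR _).
apply: dr_eq (drM h4 h3) _; rewrite /dgibbs /gexp {9}/upd eqxx.
by rewrite /pos2; ring.
Qed.

(** By conservation of energy, the derivative of the density along the field
   compensates that of the Gaussian weight exp(- eps/2 sum freq^2 x^2). *)
Lemma sum_kdvX_dgibbs x : \sum_(i < d) kdvX M x i * dgibbs i x =
  eps * (\sum_(i < d) freq R i ^+ 2 * x i * kdvX M x i) * gibbs x.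
Proof.
have h1 := kdvX_momentum M x; have h2 := kdvX_energy M x.
have -> : \sum_(i < d) freq R i ^+ 2 * x i * kdvX M x i = - (3 * \sum_(i < d) gam M x i * kdvX M x i).
  have := h2; rewrite (eq_bigr (fun i : 'I_d => freq R i ^+ 2 * x i * kdvX M x i + 3 * (gam M x i * kdvX M x i))).
    by rewrite big_split /= -mulr_sumr; lra.
  by move=> i _; rewrite /gradH; ring.
rewrite (eq_bigr (fun i : 'I_d => gibbs x * (- (3 * eps)) * (gam M x i * kdvX M x i)
  + (- (4 / K) * gexp x * pos1 (room x)) * (x i * kdvX M x i))); last first.
  by move=> i _; rewrite /dgibbs /gibbs; ring.
rewrite big_split /= -!mulr_sumr h1; ring.
Qed.

Definition polyn (F : (nat -> R) -> R) := exists m c, polyb M m c F.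

Lemma polyn_cst (c : R) : polyn (fun=> c).
Proof. by exists 0%N, `|c|; exact: polyb_cst. Qed.
Lemma polyn_coord i : (i < d)%N -> polyn (fun x => x i).
Proof. by move=> id; exists 1%N, 1; exact: polyb_x. Qed.
Lemma polynD F G : polyn F -> polyn G -> polyn (fun x => F x + G x).
Proof.
move=> [m [c p]] [m' [c' p']]; exists (maxn m m'), (c + c'); apply: polyb_add.
  by apply: polyb_le p => //; exact: leq_maxl.
by apply: polyb_le p' => //; exact: leq_maxr.
Qed.
Lemma polynM F G : polyn F -> polyn G -> polyn (fun x => F x * G x).
Proof. by move=> [m [c p]] [m' [c' p']]; exists (m + m')%N, (c * c'); exact: polyb_mul. Qed.
Lemma polynZ (c : R) F : polyn F -> polyn (fun x => c * F x).
Proof. by move=> p; apply: polynM => //; exact: polyn_cst. Qed.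
Lemma polynX n F : polyn F -> polyn (fun x => F x ^+ n).
Proof.
move=> p; elim: n => [|n IH]; first exact: polyn_cst.
by under eq_fun do rewrite exprS; exact: polynM.
Qed.
Lemma polyn_sum (I : Type) (s : seq I) (Q : pred I) (F : I -> (nat -> R) -> R) : (forall i, Q i -> polyn (F i)) ->
  polyn (fun x => \sum_(i <- s | Q i) F i x).
Proof.
move=> h; elim: s => [|i s IH].
  by under eq_fun do rewrite big_nil; exact: polyn_cst.
under eq_fun do rewrite big_cons; case Qi: (Q i) => //.
by apply: polynD => //; exact: h.
Qed.
Lemma polyn_gam k : polyn (fun x => gam M x k).
Proof.
under eq_fun do rewrite gamE; apply: polyn_sum => i _; apply: polyn_sum => j _.
by apply: polynZ; apply: polynM; exact: polyn_coord.
Qed.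
Lemma polyn_kdvX k : (k < d)%N -> polyn (fun x => kdvX M x k).
Proof. by move=> kd; exists 2%N, (normX R M k); exact: polyb_kdvX. Qed.
Lemma polyn_cub : polyn cub.
Proof.
rewrite (_ : cub = fun x => \sum_(k < d) gam M x k * x k); last by apply/funext => x; exact: cubE.
by apply: polyn_sum => k _; apply: polynM; [exact: polyn_gam|exact: polyn_coord].
Qed.
Lemma polyn_mass : polyn mass.
Proof. by apply: polyn_sum => k _; apply: polynX; exact: polyn_coord. Qed.

Lemma polyn_meas F : polyn F -> measurable_fun setT (F : seqT R -> R).
Proof.
move=> [m [c]]; elim=> {m c F} //.
- by move=> i _; exact: coord_meas.
- by move=> m c c' F G _ mF _ mG; exact: measurable_funD.
- by move=> m m' c c' F G _ mF _ mG; exact: measurable_funM.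
Qed.

Lemma polyn_dep F x z : polyn F -> (forall i, (i < d)%N -> x i = z i) -> F x = F z.
Proof. by move=> [m [c p]]; exact: polyb_dep p. Qed.

Lemma coord_le_mass x i : (i < d)%N -> mass x <= K -> `|x i| <= K.
Proof.
move=> id h; have K0 : 0 <= K by apply: le_trans K1; exact: ler01.
rewrite -(ler_pXn2r (_ : (0 < 2)%N)) ?nnegrE// real_normK ?num_real//.
apply: (@le_trans _ _ K); last by rewrite expr2 ler_peMr.
apply: le_trans h; rewrite /mass (bigD1 (Ordinal id))//= lerDl.
by apply: sumr_ge0 => j _; exact: sqr_ge0.
Qed.

(** The class of functions that the Gibbs density makes bounded. *)
Definition bdd_on_ball (F : (nat -> R) -> R) := measurable_fun setT (F : seqT R -> R) /\
  exists2 C, 0 <= C & forall x, mass x <= K -> `|F x| <= C.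

Lemma bob_polyn F : polyn F -> bdd_on_ball F.
Proof.
move=> pF; split; first exact: polyn_meas.
have [m [c p]] := pF; exists (c * K ^+ m) => [|x h].
  by apply: mulr_ge0; [exact: polyb_ge0 p|apply: exprn_ge0; apply: le_trans K1; exact: ler01].
by apply: polyb_bound p _ => // i id; exact: coord_le_mass.
Qed.

Lemma bobM F G : bdd_on_ball F -> bdd_on_ball G -> bdd_on_ball (fun x => F x * G x).
Proof.
move=> [mF [C C0 hC]] [mG [D D0 hD]]; split; first exact: measurable_funM.
exists (C * D); first exact: mulr_ge0.
by move=> x h; rewrite normrM; apply: ler_pM => //; [exact: hC|exact: hD].
Qed.

Lemma bob_gexp : bdd_on_ball gexp.
Proof.
have [m1 [C C0 hC]] := bob_polyn (polynZ eps polyn_cub).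
split; first by apply: (measurableT_comp (continuous_measurable_fun (@continuous_expR R))); exact: measurable_funN.
exists (expR C); first exact: expR_ge0.
move=> x h; rewrite ger0_norm ?expR_ge0// ler_expR.
by have := hC x h; rewrite ler_norml; lra.
Qed.

Lemma room_gt0 x : 0 < room x -> mass x <= K.
Proof.
have K0 : 0 < K by apply: lt_le_trans K1; exact: ltr01.
by rewrite /room subr_gt0 ltr_pdivrMr// mul1r => /ltW.
Qed.

Lemma room_le1 x : room x <= 1.
Proof.
rewrite /room gerBl divr_ge0//; last by apply: le_trans K1; exact: ler01.
by apply: sumr_ge0 => i _; exact: sqr_ge0.
Qed.

Lemma pos1_meas : measurable_fun setT (fun x : seqT R => pos1 (room x)).
Proof.
apply: (measurableT_comp (continuous_measurable_fun cont_pos1)).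
by apply: measurable_funB; [exact: measurable_cst|apply: measurable_funM; [exact: polyn_meas polyn_mass|exact: measurable_cst]].
Qed.

Lemma bob_cutoff F n : bdd_on_ball F -> measurable_fun setT (fun x : seqT R => F x * pos1 (room x) ^+ n.+1) /\
  exists C, forall x, `|F x * pos1 (room x) ^+ n.+1| <= C.
Proof.
move=> [mF [C C0 hC]]; split.
  by apply: measurable_funM => //; apply: measurable_funX; exact: pos1_meas.
exists C => x; have [r0|r0] := leP (room x) 0.
  by rewrite /pos1 max_l// expr0n /= mulr0 normr0.
have -> : pos1 (room x) = room x by rewrite /pos1 max_r// ltW.
rewrite normrM -[leRHS]mulr1; apply: ler_pM => //.
  by apply: hC; exact: room_gt0.
by rewrite normrX exprn_ile1// ger0_norm ?room_le1// ltW.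
Qed.

Lemma bob_gibbs F : bdd_on_ball F -> measurable_fun setT (fun x : seqT R => F x * gibbs x) /\
  exists C, forall x, `|F x * gibbs x| <= C.
Proof.
move=> bF; have := bob_cutoff 1 (bobM bF bob_gexp).
have -> : (fun x => F x * gibbs x) = fun x => F x * gexp x * pos1 (room x) ^+ 2.
  by apply/funext => x; rewrite /gibbs mulrA.
move=> [h1 [C h2]]; split=> //; exists C => x; have := h2 x; by rewrite /gibbs mulrA.
Qed.

End gibbs_weight.

(** * Infinitesimal invariance of the Gibbs measure *)

Section gibbs_invariance.
Variables (R : realType) (M : nat) (eps K : R).
Local Notation dr f x l := (is_derive (x : R) (1 : R) (f : R -> R) (l : R)).
Local Notation d := (M.*2).
Hypotheses (eps0 : 0 < eps) (K1 : 1 <= K).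
Context dd (T : measurableType dd) (P : probability T R).
Variable g : nat -> T -> R.
Local Notation Int f := (\int[P]_(w in setT) f w).
Local Notation ig f := (P.-integrable setT (EFin \o f)).
Hypothesis mg : forall k, measurable_fun setT (g k).
Hypothesis gcos : forall n xi, Int (fun w => cos (lin n xi (g ^~ w))) = expR (- (2^-1 * sq n xi)).
Hypothesis gsin : forall n xi, Int (fun w => sin (lin n xi (g ^~ w))) = 0.

Let mT : measurable (setT : set T). Proof. exact: measurableT. Qed.
Let PT : P setT = 1%E. Proof. exact: probability_setT. Qed.

(** Standard deviations of the regularized Gaussian vector. *)
Definition lam (k : nat) : R := (Num.sqrt (1 + eps * freq R k ^+ 2))^-1.

Let base_gt0 k : 0 < 1 + eps * freq R k ^+ 2.
Proof. by rewrite ltr_pwDl// mulr_ge0 ?sqr_ge0// ltW. Qed.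

Lemma lam_gt0 k : 0 < lam k.
Proof. by rewrite invr_gt0 sqrtr_gt0. Qed.

Lemma lam_sqr k : lam k ^- 2 = 1 + eps * freq R k ^+ 2.
Proof. by rewrite /lam -exprVn invrK sqr_sqrtr// ltW. Qed.

(** The Gaussian vector of covariance 1 / (1 + eps freq^2). *)
Definition smoothed (w : T) (k : nat) : R := lam k * g k w.

Lemma smoothed_meas k : measurable_fun setT (smoothed ^~ k).
Proof. by apply: measurable_funM => //; exact: measurable_cst. Qed.

Lemma seq_meas (F : (nat -> R) -> R) (X : T -> nat -> R) : (forall k, measurable_fun setT (X ^~ k)) ->
  measurable_fun setT (F : seqT R -> R) -> measurable_fun setT (fun w => F (X w)).
Proof.
move=> mX mF; apply: (measurableT_comp (f := F : seqT R -> R) mF).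
exact: (to_seq_meas (Z := fun k w => X w k) mX).
Qed.

Let sc (x : nat -> R) (k : nat) : R := lam k * x k.

Let sc_meas (F : (nat -> R) -> R) : measurable_fun setT (F : seqT R -> R) ->
  measurable_fun setT (fun x : seqT R => F (sc x)).
Proof.
move=> mF; apply: (measurableT_comp (f := F : seqT R -> R) mF).
apply: (to_seq_meas (Z := fun k (x : seqT R) => sc x k)) => k.
by apply: measurable_funM; [exact: measurable_cst|exact: coord_meas].
Qed.

Let sc_upd x i (t : R) : sc (upd x i t) = upd (sc x) i (lam i * t).
Proof. by apply/funext => j; rewrite /sc /upd; case: eqP => [->|]. Qed.

Let ibp_smoothed i (G dG : (nat -> R) -> R) (C0 C1 : R) : (i < d)%N ->
  measurable_fun setT (G : seqT R -> R) -> measurable_fun setT (dG : seqT R -> R) ->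
  (forall x, `|G x| <= C0) -> (forall x, `|dG x| <= C1) ->
  (forall x (t : R), dr (fun t => G (upd x i t)) t (dG (upd x i t))) ->
  (forall x z, (forall j, (j < d)%N -> x j = z j) -> G x = G z) ->
  Int (fun w => dG (smoothed w)) = (1 + eps * freq R i ^+ 2) * Int (fun w => G (smoothed w) * smoothed w i).
Proof.
move=> id mG mdG GC dGC hG depG; have l0 := lam_gt0 i.
have h := gaussian_ibp mg gcos gsin id (G := fun x => G (sc x)) (dG := fun x => lam i * dG (sc x)) (C0 := C0) (C1 := lam i * C1).
have mS k := smoothed_meas k.
have i1 : ig (fun w => dG (smoothed w)).
  by apply: (ig_bdd mT PT (C := C1)) => //; exact: (seq_meas mS).
have i2 : ig (fun w => G (smoothed w) * g i w).
  apply: (ig_dom mT _ (igZ mT C0 (coord_ig mg gcos i))).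
    by apply: measurable_funM => //; exact: (seq_meas mS).
  by move=> w _; rewrite normrM ler_wpM2r.
have e : lam i * Int (fun w => dG (smoothed w)) = Int (fun w => G (smoothed w) * g i w).
  rewrite -(IntZ mT _ i1); apply: h => //.
  - exact: sc_meas.
  - by apply: measurable_funM; [exact: measurable_cst|exact: sc_meas].
  - by move=> x; rewrite normrM ger0_norm ?(ltW l0)// ler_wpM2l// ltW.
  - move=> x t; rewrite (sc_upd x i t); under [X in is_derive _ _ X]eq_fun do rewrite sc_upd.
    have h1 := dr_comp (drZ (lam i) (dr_id t)) (hG (sc x) (lam i * t)).
    by apply: dr_eq h1 _; ring.
  - move=> x k t dk; apply: depG => j jd; rewrite /sc /upd ifF//.
    by apply/negbTE; rewrite neq_ltn (leq_trans jd dk).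
rewrite -lam_sqr (_ : Int (fun w => G (smoothed w) * smoothed w i) = lam i * Int (fun w => G (smoothed w) * g i w)).
  by rewrite -e; field; rewrite gt_eqF.
by rewrite -(IntZ mT _ i2); apply: eq_Rintegral => w _; rewrite /smoothed; ring.
Qed.

Local Notation D w := (gibbs M eps K (smoothed w)).

Lemma ig_gibbs F : polyn M F -> ig (fun w => F (smoothed w) * D w).
Proof.
move=> pF; have [m [C hC]] := bob_gibbs eps K1 (bob_polyn K1 pF).
apply: (ig_bdd mT PT (C := C)); last by move=> w _; exact: hC.
exact: (seq_meas (F := fun x => F x * gibbs M eps K x) smoothed_meas m).
Qed.

(** Integrate by parts the divergence of the field times F times the density: the
   field is divergence free and the density, Gaussian weight included, is
   constant along it. *)
Lemma gibbs_lie F G : polyn M F -> is_lie M F G -> Int (fun w => G (smoothed w) * D w) = 0.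
Proof.
move=> pF [dF [pdF gF GE]].
have dFu i x (t : R) : (i < d)%N -> dr (fun t => F (upd x i t)) t (dF i (upd x i t)).
  move=> id; have := gF (fun s => upd x i s) (fun j => (j == i)%:R) t.
  rewrite (bigD1 (Ordinal id))//= eqxx mul1r big1 ?addr0; first apply.
    move=> j jd; rewrite /upd; case: (eqVneq j i) => _; [exact: dr_id|exact: dr_cst].
  by move=> j; rewrite -val_eqE /= => /negPf ->; rewrite mul0r.
have pX i : (i < d)%N -> polyn M (fun x : nat -> R => kdvX M x i) by exact: polyn_kdvX.
pose Phi (i : nat) x := kdvX M x i * F x * gibbs M eps K x.
pose dPhi (i : nat) x := (diagX M x i * F x + kdvX M x i * dF i x) * gibbs M eps K x
   + kdvX M x i * F x * dgibbs M eps K i x.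
have pdiag i : (i < d)%N -> polyn M (fun x : nat -> R => diagX M x i).
  move=> id; rewrite (_ : (fun x : nat -> R => diagX M x i) = fun x => - (dsign R i * freq R i) *
     (6 * \sum_(j < d) x j * b3 R j i (partner i))); last first.
    apply/funext => x; rewrite /diagX; congr (_ * (_ * _)).
    rewrite (@iT_eq _ _ (fun y => \sum_(j < d) x j * (emode R j y * emode R i y * emode R (partner i) y))).
      rewrite iT_sum; last by move=> j _; ct; exact: cont_emode.
      by apply: eq_bigr => j _; rewrite iTZ//; ct; exact: cont_emode.
    by move=> y; rewrite /vf !mulr_suml; apply: eq_bigr => j _; ring.
  apply: polynZ; apply: polynZ; apply: polyn_sum => j _.
  by under eq_fun do rewrite mulrC; apply: polynZ; exact: polyn_coord.
have bob1 i : (i < d)%N -> bdd_on_ball M K (fun x => kdvX M x i * F x).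
  by move=> id; apply: bob_polyn => //; apply: polynM => //; exact: pX.
have hPhi i : (i < d)%N -> [/\ measurable_fun setT (Phi i : seqT R -> R), measurable_fun setT (dPhi i : seqT R -> R),
    exists C, forall x, `|Phi i x| <= C & exists C, forall x, `|dPhi i x| <= C].
  move=> id; have [m1 [C1 h1]] := bob_gibbs eps K1 (bob1 i id).
  have [m2 [C2 h2]] := bob_gibbs eps K1 (bob_polyn K1 (polynD (polynM (pdiag i id) pF) (polynM (pX i id) (pdF i)))).
  have [m3 [C3 h3]] := bob_gibbs eps K1 (bob_polyn K1 (polynM (polynM (pX i id) pF) (polynZ (- (3 * eps)) (polyn_gam R M i)))).
  have [m4 [C4 h4]] := bob_cutoff K1 0 (bobM (bob_polyn K1 (polynM (polynM (pX i id) pF) (polynZ (- (4 / K)) (polyn_coord R id)))) (bob_gexp M eps K1)).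
  have e : dPhi i = fun x => (diagX M x i * F x + kdvX M x i * dF i x) * gibbs M eps K x +
     (kdvX M x i * F x * (- (3 * eps) * gam M x i) * gibbs M eps K x +
     kdvX M x i * F x * (- (4 / K) * x i) * gexp M eps x * pos1 (room M K x) ^+ 1).
    by apply/funext => x; rewrite /dPhi /dgibbs /gibbs expr1; ring.
  split => //; [|by exists C1|].
    by rewrite e; apply: measurable_funD => //; exact: measurable_funD.
  exists (C2 + (C3 + C4)) => x; rewrite e; apply: le_trans (ler_normD _ _) _; apply: lerD => //.
  by apply: le_trans (ler_normD _ _) _; apply: lerD.
have ibp i : (i < d)%N -> Int (fun w => dPhi i (smoothed w)) =
    (1 + eps * freq R i ^+ 2) * Int (fun w => Phi i (smoothed w) * smoothed w i).
  move=> id; have [m1 m2 [C1 h1] [C2 h2]] := hPhi i id.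
  apply: (ibp_smoothed id m1 m2 h1 h2).
    move=> x t; have k1 := dr_kdvX_upd x t id; have k2 := dFu i x t id.
    have k3 := dr_gibbs eps K x t id.
    apply: dr_eq (drM (drM k1 k2) k3) _; by rewrite /dPhi; ring.
  move=> x z xz; rewrite /Phi (polyn_dep (pX i id) xz) (polyn_dep pF xz).
  by rewrite /gibbs /gexp /room (polyn_dep (polyn_cub R M) xz) (polyn_dep (polyn_mass R M) xz).
have iPhi i : (i < d)%N -> ig (fun w => Phi i (smoothed w) * smoothed w i).
  move=> id; have h := ig_gibbs (polynM (polynM (pX i id) pF) (polyn_coord R id)).
  by move: h; congr (_.-integrable _ (EFin \o _)); apply/funext => w; rewrite /Phi; ring.
have idPhi i : (i < d)%N -> ig (fun w => dPhi i (smoothed w)).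
  move=> id; have [m1 m2 [C1 h1] [C2 h2]] := hPhi i id.
  by apply: (ig_bdd mT PT (C := C2)) => //; exact: (seq_meas smoothed_meas m2).
(* The terms that are not G cancel by div_kdvX and the conservation laws. *)
have key x : G x * gibbs M eps K x =
    \sum_(i < d) (dPhi i x - (1 + eps * freq R i ^+ 2) * (Phi i x * x i)).
  rewrite (eq_bigr (fun i : 'I_d => gibbs M eps K x * (kdvX M x i * dF i x) + F x * gibbs M eps K x * diagX M x i
     + F x * (kdvX M x i * dgibbs M eps K i x) - (F x * gibbs M eps K x) * (x i * kdvX M x i)
     - (F x * gibbs M eps K x * eps) * (freq R i ^+ 2 * x i * kdvX M x i))); last first.
    by move=> i _; rewrite /dPhi /Phi; ring.
  rewrite !sumrB !big_split /= -!mulr_sumr div_kdvX sum_kdvX_dgibbs kdvX_momentum GE; ring.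
have ->: Int (fun w => G (smoothed w) * D w) =
    Int (fun w => \sum_(i < d) (dPhi i (smoothed w) - (1 + eps * freq R i ^+ 2) * (Phi i (smoothed w) * smoothed w i))).
  by apply: eq_Rintegral => w _; exact: key.
rewrite (Int_sum mT PT); last by move=> i _; apply: (igB mT); [exact: idPhi|apply: igZ => //; exact: iPhi].
rewrite big1// => i _; rewrite (IntB mT) ?(IntZ mT) ?ibp ?subrr//.
- exact: iPhi.
- exact: idPhi.
- by apply: igZ => //; exact: iPhi.
Qed.

End gibbs_invariance.

(** * Invariance along the discretized Galerkin flow *)

Section trig_approximation.
Variable R : realType.
Local Notation dr f x l := (is_derive (x : R) (1 : R) (f : R -> R) (l : R)).

(** Taylor polynomials; ab lists the coefficients of the successive derivatives. *)
Lemma trig_approx (a b B e : R) : 0 <= B -> 0 < e -> exists n (c : nat -> R),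
  forall y : R, `|y| <= B -> `|a * cos y + b * sin y - \sum_(k < n) c k * y ^+ k| <= e.
Proof.
move=> B0 e0.
pose ab k := iter k (fun p : R * R => (p.2, - p.1)) (a, b).
have abS k : ab k.+1 = ((ab k).2, - (ab k).1) by [].
have abB k : `|(ab k).1| <= `|a| + `|b| /\ `|(ab k).2| <= `|a| + `|b|.
  elim: k => [|k [h1 h2]]; first by rewrite /= lerDl lerDr !normr_ge0.
  by rewrite abS /= normrN.
pose C := 2 * (`|a| + `|b|).
have C0 : 0 <= C by rewrite mulr_ge0// addr_ge0.
have [n hn] : exists n : nat, C * (B ^+ n / n`!%:R) <= e.
  have C1 : 0 < C + 1 by lra.
  have ec : 0 < e / (C + 1) by rewrite divr_gt0.
  have /cvgrPdist_le/(_ _ ec)[n _ hn] := @cvg_exp_coeff R B.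
  exists n; have := hn n (leqnn n); rewrite sub0r normrN /exp_coeff /= ger0_norm ?divr_ge0 ?exprn_ge0//.
  rewrite ler_pdivlMr// => h; apply: le_trans h; rewrite mulrC ler_wpM2l ?divr_ge0 ?exprn_ge0//; lra.
exists n, (fun k => (ab k).1 / k`!%:R) => y yB.
pose phi (k : nat) (s : R) := y ^+ k * ((ab k).1 * cos (s * y) + (ab k).2 * sin (s * y)).
have dphi k (s : R) : 0 <= s <= 1 -> dr (phi k) s (phi k.+1 s).
  move=> _; have h := drM (dr_id s) (dr_cst y s).
  apply: dr_eq (drZ (y ^+ k) (drD (drZ (ab k).1 (dr_comp h (is_derive_cos _))) (drZ (ab k).2 (dr_comp h (is_derive_sin _))))) _.
  by rewrite /phi abS exprS /=; ring.
have bphi (s : R) : 0 <= s <= 1 -> `|phi n s| <= B ^+ n * C.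
  move=> _; rewrite /phi normrM normrX; apply: ler_pM; [by apply: exprn_ge0|by []|by apply: lerXn2r; rewrite ?nnegrE|].
  have [h1 h2] := abB n; rewrite /C mulr_natl mulr2n.
  apply: le_trans (ler_normD _ _) _; rewrite !normrM; apply: lerD; rewrite -[leRHS]mulr1; apply: ler_pM => //.
    by rewrite ler_norml cos_geN1 cos_le1.
  by rewrite ler_norml sin_geN1 sin_le1.
have i1 : (0 : R) <= (1 : R) <= (1 : R) by rewrite ler01 lexx.
have := taylor_tower (@ler01 R) dphi bphi i1.
rewrite {1}/phi expr0 !mul1r expr1n mulr1 => h; apply: le_trans hn; rewrite mulrA [C * _]mulrC; apply: le_trans h.
apply: eq_ler; congr (`|_ - _|); apply: eq_bigr => k _; rewrite /phi mul0r cos0 sin0 expr1n.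
by rewrite !mulr0 addr0 mulr1; ring.
Qed.

End trig_approximation.

Section galerkin_chain.
Variables (R : realType) (M : nat) (eps K h : R).
Local Notation dr f x l := (is_derive (x : R) (1 : R) (f : R -> R) (l : R)).
Local Notation d := (M.*2).
Local Notation aX := (aX R M).
Local Notation mass := (mass M).
Hypotheses (eps0 : 0 < eps) (K1 : 1 <= K) (h0 : 0 < h) (hsmall : 8 * aX * K ^+ 2 * h <= 1).

Let a1 : 1 <= aX. Proof. exact: aX_ge1. Qed.
Let K0 : 0 <= K. Proof. exact: le_trans K1. Qed.

(** y solves the system on [0, h] only; Y extends y' to a neighbourhood of this
   interval, so that two-sided derivatives make sense at its ends. *)
Definition galerkin_arc (x : nat -> R) (y Y : R -> nat -> R) :=
  [/\ forall i (t : R), -1 < t -> dr (y ^~ i) t (Y t i), forall i, continuous (Y ^~ i),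
      forall i, y 0 i = x i & forall (t : R) i, 0 <= t <= h -> (i < d)%N -> Y t i = kdvX M (y t) i].

Lemma galerkin_arc_mass x y Y : galerkin_arc x y Y -> forall t, 0 <= t <= h -> mass (y t) = mass x.
Proof.
move=> [dy _ y0 hY] t th.
rewrite /mass (@galerkin_conserved R M h y (ltW h0) _ _ th).
  by apply: eq_bigr => k _; rewrite y0.
by move=> s i sI id; rewrite -hY//; apply: dy; lra.
Qed.

(** Outside of the ball, where the density vanishes, the step is the identity. *)
Lemma galerkin_step_exists : exists Psi : (nat -> R) -> nat -> R, forall x,
  (mass x <= K -> exists y Y, galerkin_arc x y Y /\ forall i, (i < d)%N -> Psi x i = y h i) /\
  (forall i, ~~ (mass x <= K) || (d <= i)%N -> Psi x i = x i).
Proof.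
suff /choice[Psi H] : forall x : nat -> R, exists z : nat -> R,
    (mass x <= K -> exists y Y, galerkin_arc x y Y /\ forall i, (i < d)%N -> z i = y h i) /\
    (forall i, ~~ (mass x <= K) || (d <= i)%N -> z i = x i).
  by exists Psi.
move=> x; have [xK|xK] := boolP (mass x <= K); last first.
  by exists x; split => //; rewrite (negPf xK).
have hs : 8 * aX * K * h <= 1.
  apply: le_trans hsmall; rewrite ler_wpM2r ?(ltW h0)// ler_wpM2l ?mulr_ge0 ?(le_trans ler01 a1)//.
  by rewrite expr2 ler_peMl.
have [y [Y [dy cY y0 _ hY]]] := galerkin_local K1 h0 hs (fun i id => coord_le_mass K1 id xK).
exists (fun i => if (i < d)%N then y h i else x i); split.
  move=> _; exists y, Y; split => //.
  by move=> i ->.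
by move=> i /=; rewrite leqNgt => /negPf ->.
Qed.

Definition step : (nat -> R) -> nat -> R := sval (cid galerkin_step_exists).

Lemma step_arc x : mass x <= K -> exists y Y, galerkin_arc x y Y /\ forall i, (i < d)%N -> step x i = y h i.
Proof. by rewrite /step; case: cid => Psi H /=; have [] := H x. Qed.

Lemma step_out x i : ~~ (mass x <= K) || (d <= i)%N -> step x i = x i.
Proof. by rewrite /step; case: cid => Psi H /=; have [_] := H x; apply. Qed.

Lemma eq_mass (x z : nat -> R) : (forall i, (i < d)%N -> x i = z i) -> mass x = mass z.
Proof. by move=> xz; apply: eq_bigr => k _; rewrite xz. Qed.

Lemma mass_step x : mass (step x) = mass x.
Proof.
have [xK|xK] := boolP (mass x <= K); last by apply: eq_mass => i _; rewrite step_out// xK.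
have [y [Y [ya e]]] := step_arc xK; rewrite (eq_mass e).
by apply: (galerkin_arc_mass ya); rewrite ltW//= lexx.
Qed.

Lemma step_taylor m c F (Fs : nat -> (nat -> R) -> R) x : polyb M m c F -> Fs 0%N = F ->
  (forall k, is_lie M (Fs k) (Fs k.+1)) ->
  (forall k, polyb M (m + k.*2) (c * aX ^+ k * (2 ^+ (m + k.*2) * k`!%:R)) (Fs k)) ->
  mass x <= K -> forall n,
  `|F (step x) - \sum_(k < n) h ^+ k / k`!%:R * Fs k x| <= c * (2 * K) ^+ m * 2^-1 ^+ n.
Proof.
move=> pF F0 lF pFs xK n; have [y [Y [ya e]]] := step_arc xK.
have [dy _ y0 hY] := ya; have ym := galerkin_arc_mass ya.
have yK (t : R) i : 0 <= t <= h -> (i < d)%N -> `|y t i| <= K.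
  by move=> th id; apply: (coord_le_mass K1 id); rewrite ym.
have dX (t : R) i : 0 <= t <= h -> (i < d)%N -> dr (y ^~ i) t (kdvX M (y t) i).
  by move=> th id; rewrite -hY//; apply: dy; lra.
have := taylor_along K1 (ltW h0) pF F0 lF pFs yK dX n.
rewrite (polyb_dep (z := step x) pF); last by move=> i id; rewrite e.
rewrite (eq_bigr (fun k : 'I_n => h ^+ k / k`!%:R * Fs k x)); last first.
  by move=> k _; congr (_ * _); apply: (polyb_dep (pFs k)) => i id; rewrite y0.
move=> /le_trans; apply; apply: ler_wpM2l.
  by rewrite mulr_ge0 ?exprn_ge0 ?mulr_ge0//; exact: polyb_ge0 pF.
apply: lerXn2r; rewrite ?nnegrE ?invr_ge0//.
  by rewrite !mulr_ge0 ?exprn_ge0 ?(ltW h0)// (le_trans ler01 a1).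
by move: hsmall; lra.
Qed.

Variables (dd : measure_display) (T : measurableType dd) (P : probability T R).
Variable g : nat -> T -> R.
Local Notation Int f := (\int[P]_(w in setT) f w).
Local Notation ig f := (P.-integrable setT (EFin \o f)).
Hypothesis mg : forall k, measurable_fun setT (g k).
Hypothesis gcos : forall n xi, Int (fun w => cos (lin n xi (g ^~ w))) = expR (- (2^-1 * sq n xi)).
Hypothesis gsin : forall n xi, Int (fun w => sin (lin n xi (g ^~ w))) = 0.

Let mT : measurable (setT : set T). Proof. exact: measurableT. Qed.
Let PT : P setT = 1%E. Proof. exact: probability_setT. Qed.

Local Notation X0 := (smoothed eps g).
Local Notation D w := (gibbs M eps K (X0 w)).

Definition chain (j : nat) (w : T) : nat -> R := iter j step (X0 w).

Lemma mass_chain j w : mass (chain j w) = mass (X0 w).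
Proof. by elim: j => [//|j IH]; rewrite /chain iterS mass_step. Qed.

Lemma poly_lie_tower F : polyn M F -> exists m c, polyb M m c F /\ exists Fs : nat -> (nat -> R) -> R,
  [/\ Fs 0%N = F, forall k, is_lie M (Fs k) (Fs k.+1) &
   forall k, polyb M (m + k.*2) (c * aX ^+ k * (2 ^+ (m + k.*2) * k`!%:R)) (Fs k)].
Proof. by move=> [m [c p]]; exists m, c; split => //; exact: polyb_lie_tower. Qed.

Let half_cvg (C : R) : (fun n => C * 2^-1 ^+ n) @ \oo --> (0 : R).
Proof.
rewrite -[X in _ --> X](mulr0 C); apply: cvgMr.
by apply: cvg_expr; rewrite ger0_norm; lra.
Qed.

Let squeeze_dist (u : nat -> R) (l C : R) : (forall n, `|l - u n| <= C * 2^-1 ^+ n) -> u @ \oo --> l.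
Proof.
move=> H; apply/cvgrPdist_le => e e0; have /cvgrPdist_le/(_ _ e0) := half_cvg C.
apply: filterS => n; rewrite sub0r normrN => h1; apply: le_trans (H n) _.
exact: le_trans (ler_norm _) h1.
Qed.

(** The step is obtained by choice; it is measurable as a pointwise limit of
   Taylor polynomials of the coordinates. *)
Lemma chain_meas j k : measurable_fun setT (fun w => chain j w k).
Proof.
elim: j k => [|j IH] k; first exact: smoothed_meas.
have pm F : polyn M F -> measurable_fun setT (fun w => F (chain j w)).
  by move=> pF; apply: (seq_meas IH); exact: polyn_meas pF.
have [kd|kd] := ltnP k d; last first.
  rewrite (_ : (fun w => _) = fun w => chain j w k)//.
  by apply/funext => w; rewrite /chain iterS step_out// kd orbT.
have [m [c [pF [Fs [F0 lF pFs]]]]] := poly_lie_tower (polyn_coord R kd).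
pose S n w := if mass (chain j w) <= K then \sum_(i < n) h ^+ i / i`!%:R * Fs i (chain j w) else chain j w k.
apply: (@measurable_fun_cvg _ _ _ setT S) => [n|w _].
  apply: measurable_fun_ifT => //.
    by apply: measurable_fun_ler; [apply: pm; exact: polyn_mass|exact: measurable_cst].
  apply: measurable_sum => i; apply: measurable_funM; first exact: measurable_cst.
  by apply: pm; eexists _, _; exact: pFs.
rewrite /S; have [xK|xK] := boolP (mass (chain j w) <= K).
  apply: (@squeeze_dist _ _ (c * (2 * K) ^+ m)) => n.
  by have := step_taylor pF F0 lF pFs xK n.
rewrite /chain iterS -/(chain j w) step_out ?xK//; exact: cvg_cst.
Qed.

Lemma D_ge0 w : 0 <= D w.
Proof. by rewrite /gibbs mulr_ge0 ?expR_ge0 ?sqr_ge0. Qed.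

Lemma D_off_ball w : ~~ (mass (X0 w) <= K) -> D w = 0.
Proof.
move=> xK; rewrite /gibbs /pos2 /pos1 max_l ?expr0n ?mulr0//.
have Kp : 0 < K by apply: lt_le_trans K1.
by rewrite /room subr_le0 ler_pdivlMr// mul1r ltW// ltNge.
Qed.

Lemma ig_D : ig (fun w => D w).
Proof.
have := ig_gibbs eps K1 P mg (polyn_cst M (1 : R)).
by congr (_.-integrable _ (EFin \o _)); apply/funext => w; rewrite mul1r.
Qed.

Lemma ig_on_ball (f : T -> R) (C : R) : measurable_fun setT f ->
  (forall w, mass (X0 w) <= K -> `|f w| <= C) -> ig (fun w => f w * D w).
Proof.
move=> mf fC; have iD := ig_D.
apply: (ig_dom mT _ (igZ mT C iD)); first by apply: measurable_funM => //; exact: (ig_meas iD).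
move=> w _; have [xK|xK] := boolP (mass (X0 w) <= K).
  by rewrite normrM (ger0_norm (D_ge0 w)); apply: ler_wpM2r; [exact: D_ge0|exact: fC].
by rewrite D_off_ball// !mulr0 normr0.
Qed.

Lemma ig_chain F j : polyn M F -> ig (fun w => F (chain j w) * D w).
Proof.
move=> pF; have [_ [C _ hC]] := bob_polyn K1 pF.
apply: (@ig_on_ball _ C); first by apply: (seq_meas (chain_meas j)); exact: polyn_meas pF.
by move=> w xK; apply: hC; rewrite mass_chain.
Qed.

(** Expand one step in its Taylor series: all terms but the first have mean zero
   by gibbs_lie, and step_taylor bounds the remainder on the ball that carries
   the density. *)
Lemma chain_moment F j : polyn M F -> Int (fun w => F (chain j w) * D w) = Int (fun w => F (X0 w) * D w).
Proof.
elim: j F => [//|j IH] F pF.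
have [m [c [pbF [Fs [F0 lF pFs]]]]] := poly_lie_tower pF.
have pFk k : polyn M (Fs k) by eexists _, _; exact: pFs.
have iD := ig_D.
pose C := c * (2 * K) ^+ m.
have key n : `|Int (fun w => F (chain j.+1 w) * D w) - Int (fun w => F (X0 w) * D w)| <= (C * Int (fun w => D w)) * 2^-1 ^+ n.+1.
  pose S w := \sum_(k < n.+1) h ^+ k / k`!%:R * (Fs k (chain j w) * D w).
  have iS : ig S.
    by apply: (ig_sum mT PT) => k _; apply: (igZ mT); exact: ig_chain.
  have eS : Int S = Int (fun w => F (X0 w) * D w).
    rewrite (Int_sum mT PT); last by move=> k _; apply: (igZ mT); exact: ig_chain.
    rewrite big_ord_recl big1 ?addr0.
      by rewrite (IntZ mT _ (ig_chain j (pFk 0%N))) expr0 fact0 divr1 mul1r IH// F0.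
    move=> k _; rewrite (IntZ mT _ (ig_chain j (pFk _))) IH//.
    by rewrite (gibbs_lie eps0 K1 mg gcos gsin (pFk k) (lF k)) mulr0.
  have i1 := ig_chain j.+1 pF.
  rewrite -eS -(IntB mT i1 iS) mulrAC -(IntZ mT _ iD).
  apply: (Int_abs_le mT (ig_meas (igB mT i1 iS)) (igZ mT _ iD)) => w _.
  rewrite (_ : S w = (\sum_(k < n.+1) h ^+ k / k`!%:R * Fs k (chain j w)) * D w); last first.
    by rewrite mulr_suml; apply: eq_bigr => k _; rewrite mulrA.
  rewrite -mulrBl; have [xK|xK] := boolP (mass (X0 w) <= K); last by rewrite D_off_ball// !mulr0 normr0.
  rewrite normrM (ger0_norm (D_ge0 w)); apply: ler_wpM2r; first exact: D_ge0.
  by apply: (step_taylor pbF F0 lF pFs); rewrite mass_chain.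
apply/eqP; rewrite -subr_eq0 -normr_le0.
set A := `|_|; have cA := half_cvg (C * Int (fun w => D w)).
rewrite -(cvg_lim (@Rhausdorff R) cA); apply: limr_ge; first by apply/cvg_ex; exists 0.
by exists 1%N => // [[//|n]] _ /=; exact: key.
Qed.

(** On the ball the linear form is bounded, so that sinusoids are there uniform
   limits of polynomials. *)
Lemma chain_trig n (xi : nat -> R) (a b : R) j : (n <= d)%N ->
  Int (fun w => (a * cos (lin n xi (chain j w)) + b * sin (lin n xi (chain j w))) * D w) =
  Int (fun w => (a * cos (lin n xi (X0 w)) + b * sin (lin n xi (X0 w))) * D w).
Proof.
move=> nd; pose B := \sum_(k < n) `|xi k| * K.
have B0 : 0 <= B by apply: sumr_ge0 => k _; exact: mulr_ge0.
have iD := ig_D.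
have linB x : mass x <= K -> `|lin n xi x| <= B.
  move=> xK; apply: le_trans (ler_norm_sum _ _ _) _; apply: ler_sum => k _.
  by rewrite normrM ler_wpM2l// (coord_le_mass K1 _ xK)// (leq_trans (ltn_ord k)).
pose f (y : R) := a * cos y + b * sin y.
have cf : continuous f.
  have ccos : continuous (@cos R) by apply: dr_continuous => x; exact: is_derive_cos.
  have csin : continuous (@sin R) by apply: dr_continuous => x; exact: is_derive_sin.
  by apply: contD; apply: contZ.
have ED0 : 0 <= Int (fun w => D w) by apply: Int_ge0 => w _; exact: D_ge0.
have fb y : `|f y| <= `|a| + `|b|.
  apply: le_trans (ler_normD _ _) _; rewrite !normrM; apply: lerD; rewrite ler_piMr// ler_norml.
    by rewrite cos_geN1 cos_le1.
  by rewrite sin_geN1 sin_le1.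
have if_ j' : ig (fun w => f (lin n xi (chain j' w)) * D w).
  apply: (@ig_on_ball _ (`|a| + `|b|)) => //.
  apply: (measurableT_comp (continuous_measurable_fun cf)).
  by apply: (lin_meas (Z := fun k w => chain j' w k)) => k; exact: chain_meas.
apply/eqP; rewrite -subr_eq0 -normr_le0; apply/ler_addgt0Pr => e e0; rewrite add0r.
pose del := e / (2 * (Int (fun w => D w) + 1)).
have del0 : 0 < del by rewrite divr_gt0// mulr_gt0//; lra.
have [N [c hc]] := trig_approx a b B0 del0.
pose p x := \sum_(k < N) c k * lin n xi x ^+ k.
have pp : polyn M p.
  apply: polyn_sum => k _; apply: polynZ; apply: polynX; apply: polyn_sum => i _.
  by apply: polynZ; apply: polyn_coord; apply: leq_trans nd.
have near_ j' : `|Int (fun w => f (lin n xi (chain j' w)) * D w) - Int (fun w => p (chain j' w) * D w)| <= e / 2.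
  rewrite -(IntB mT (if_ j') (ig_chain j' pp)).
  apply: (@le_trans _ _ (Int (fun w => del * D w))).
    apply: (Int_abs_le mT (ig_meas (igB mT (if_ j') (ig_chain j' pp))) (igZ mT _ iD)) => w _.
    rewrite -mulrBl; have [xK|xK] := boolP (mass (X0 w) <= K); last by rewrite D_off_ball// !mulr0 normr0.
    rewrite normrM (ger0_norm (D_ge0 w)); apply: ler_wpM2r; first exact: D_ge0.
    by apply: hc; apply: linB; rewrite mass_chain.
  rewrite (IntZ mT _ iD) /del; move: ED0; set I := Int (fun w => D w) => ED0.
  rewrite (_ : e / (2 * (I + 1)) * I = (e / 2) * (I / (I + 1))); last by field; lra.
  by rewrite ler_piMr ?divr_ge0 ?(ltW e0)// ler_pdivrMr ?mul1r; lra.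
have e1 := near_ j; have e2 := near_ 0%N; have e3 := chain_moment j pp.
rewrite e3 in e1; move: e1 e2; rewrite [in X in _ -> X -> _]distrC => e1 e2.
by apply: le_trans (ler_distD _ _ _) (le_trans (lerD e1 e2) _); lra.
Qed.

End galerkin_chain.

(** * Growth of the error along the chain *)

Section chain_error.
Variables (R : realType) (M L : nat) (K kap h : R) (A : (nat -> R) -> R).
Local Notation dr f x l := (is_derive (x : R) (1 : R) (f : R -> R) (l : R)).
Local Notation d := (M.*2).
Hypotheses (L0 : (0 < L)%N) (LM : (3 * L <= M)%N) (kap0 : 0 < kap) (kap1 : kap <= 1).
Hypotheses (K1 : 1 <= K) (h0 : 0 < h) (hsmall : 8 * aX R M * K ^+ 2 * h <= 1).
Hypothesis hkap : (1 + M%:R) * (4 * M%:R * (aX R M * K ^+ 2 * h)) <= kap ^+ 2.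
Hypothesis AV : forall x, mass M x <= K -> forall s, `|vf M x s| <= A x.
Variables (u : R -> R -> R) (x0 : nat -> R).
Hypotheses (kdvu : kdv_solution u) (u0 : u 0 = vf M x0) (x0K : mass M x0 <= K).

Local Notation X j := (iter j (step K1 h0 hsmall) x0).
Local Notation corr := (corrected M L K u).

Lemma stepRate_ge0 (a : R) x : 0 <= a -> 0 <= stepRate M L K a x.
Proof.
move=> a0; have K30 : 0 <= K ^+ 3 by apply: exprn_ge0; exact: le_trans K1.
have h20 : 0 <= hi2 M L x by apply: sumr_ge0 => i _; exact: sqr_ge0.
have a40 : 0 <= al4 M x by apply: iT_ge0 => s; rewrite -[4%N]/(2 * 2)%N exprM sqr_ge0.
apply: (mulr_ge0 (ler0n _ 2)); apply: mulr_ge0; last by rewrite !addr_ge0// mulr_ge0.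
exact: (mulr_ge0 (mulr_ge0 (mulr_ge0 (ler0n _ _) (ler0n _ _)) (ler0n _ _)) K30).
Qed.

Lemma stepDefect_ge0 x : 0 <= stepDefect M L K kap x.
Proof.
have K30 : 0 <= K ^+ 3 by apply: exprn_ge0; exact: le_trans K1.
have h20 : 0 <= hi2 M L x by apply: sumr_ge0 => i _; exact: sqr_ge0.
have a40 (z : nat -> R) : 0 <= al4 M z by apply: iT_ge0 => s; rewrite -[4%N]/(2 * 2)%N exprM sqr_ge0.
have k0 := ltW kap0; have m0 := ler0n R M; have a41 : 0 <= al4 M x + 1 by have := a40 x; lra.
have b4 : 0 <= kap^-1 * ((1 + M%:R) * al4 M (hi L x)).
  by apply: mulr_ge0; [rewrite invr_ge0|apply: mulr_ge0; [lra|exact: a40]].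
apply: mulr_ge0; last first.
  apply: addr_ge0; last by rewrite divr_ge0.
  by apply: addr_ge0 => //; apply: addr_ge0 => //; exact: mulr_ge0.
exact: (mulr_ge0 (mulr_ge0 (mulr_ge0 (ler0n _ _) (ler0n _ _)) (ler0n _ _)) K30).
Qed.

Let massX j : mass M (X j) = mass M x0.
Proof. by elim: j => [//|j IH]; rewrite iterS mass_step. Qed.

Let XK j : mass M (X j) <= K. Proof. by rewrite massX. Qed.

Lemma eq_corrected (t : R) x z : (forall i, (i < d)%N -> x i = z i) -> corr t x = corr t z.
Proof.
move=> xz; have e1 : vf M x = vf M z by apply/funext; exact: eq_vf.
have e2 : vf M (Ix x) = vf M (Ix z).
  by apply/funext; apply: eq_vf => k kd; rewrite /Ix xz// partner_ltn.
by rewrite /corrected /energy /err /errI e1 e2.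
Qed.

Let u0m : integralT (u 0) = 0. Proof. by rewrite u0 iT_vf. Qed.

Let corr0 : corr 0 x0 = 64 * K ^+ 2 / L%:R.
Proof.
have e1 s : err M u (fun=> x0) 0 s = 0 by rewrite /err u0 subrr.
have dW (s : R) : dr (errI M u (fun=> x0) 0) s 0.
  by apply: dr_eq (drB (dr_upot_x kdvu u0m 0 s) (dr_vfI M x0 s)) _; rewrite u0 subrr.
have e2 s : errI M u (fun=> x0) 0 s = 0.
  rewrite (dr_zero_cst dW s 0) -[LHS]iT_cst.
  rewrite (@iT_eq _ _ (errI M u (fun=> x0) 0)); last by move=> y; exact: dr_zero_cst.
  rewrite /errI iTB; [|by apply: dr_continuous => y; exact: dr_upot_x|exact: cont_vf].
  by rewrite upot_mean// iT_vf subrr.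
have e3 s : tail M u 0 s = 0.
  by rewrite /tail u0 -projE proj_vf subrr.
rewrite /corrected /energy (@iT_eq _ _ (fun=> 0)) ?iT_cst ?add0r// => s.
by rewrite e1 e2 e3; ring.
Qed.

Let step_bound (t0 : R) j : corr (t0 + h) (X j.+1) <= expR (stepRate M L K (A (X j)) (X j) * h) *
  (corr t0 (X j) + h * stepDefect M L K kap (X j)).
Proof.
have [y [Y [ya e]]] := step_arc K1 h0 hsmall (XK j); have [dy cY y0 hY] := ya.
have ym := galerkin_arc_mass h0 ya.
have K0 : 0 <= K by exact: le_trans K1.
have a0 : 0 <= aX R M by exact: le_trans (aX_ge1 R M).
pose eta := aX R M * K ^+ 2 * h.
have eta0 : 0 <= eta by rewrite !mulr_ge0 ?exprn_ge0// ltW.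
have eta1 : eta <= 1.
  have : 8 * eta <= 1 by move: hsmall; rewrite /eta; lra.
  lra.
have ux2 : integralT (fun s => u 0 s ^+ 2) = \sum_(k < d) (X j) k ^+ 2.
  by rewrite u0 iT_vf_sqr; exact/esym/massX.
have yx (t : R) i : 0 <= t <= h -> (i < d)%N -> `|y t i - (X j) i| <= eta.
  move=> /andP[t0' th] id; rewrite -y0.
  have := @dr_lip R (y ^~ i) (fun s => kdvX M (y s) i) 0 t (aX R M * K ^+ 2) _ _ t0'.
  rewrite subr0 => H; apply: (le_trans (H _ _)).
  - by move=> s sI; rewrite -hY//; [apply: dy; lra|lra].
  - move=> s sI; apply: kdvX_bound => // k kd; apply: (coord_le_mass K1 kd).
    by rewrite ym//; lra.
  - by rewrite /eta ler_wpM2l// mulr_ge0// exprn_ge0.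
have := @error_step R M L K (A (X j)) kap eta h t0 u (X j) y Y L0 LM K1 kap0 kap1 kdvu u0m h0 ux2 (XK j)
  (AV (XK j)) dy cY y0 hY yx eta0 eta1 hkap.
by rewrite iterS; congr (_ <= _); apply/esym/eq_corrected.
Qed.

Lemma chain_error N : integralT (fun s => (u (N%:R * h) s - vf M (X N) s) ^+ 2) <=
  2 * (expR (\sum_(j < N) stepRate M L K (A (X j)) (X j) * h) *
   (64 * K ^+ 2 / L%:R + \sum_(j < N) h * stepDefect M L K kap (X j))).
Proof.
have A0 j : 0 <= A (X j) by exact: le_trans (normr_ge0 _) (AV (XK j) 0).
have r0 j : 0 <= stepRate M L K (A (X j)) (X j) * h by rewrite mulr_ge0 ?(ltW h0)// stepRate_ge0.
have b0 j : 0 <= h * stepDefect M L K kap (X j) by rewrite mulr_ge0 ?(ltW h0)// stepDefect_ge0.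
have key n : corr (n%:R * h) (X n) <= expR (\sum_(j < n) stepRate M L K (A (X j)) (X j) * h) *
   (64 * K ^+ 2 / L%:R + \sum_(j < n) h * stepDefect M L K kap (X j)).
  elim: n => [|n IH]; first by rewrite !big_ord0 mul0r expR0 mul1r addr0 corr0.
  rewrite -natr1 mulrDl mul1r !big_ord_recr /=.
  apply: le_trans (step_bound _ n) _.
  rewrite expRD; set r := stepRate _ _ _ _ _ * h; set E := expR (\sum_(i < n) _).
  rewrite (mulrC E) -(mulrA (expR r)); apply: ler_wpM2l; first exact: expR_ge0.
  rewrite addrA mulrDr; apply: lerD => //.
  by rewrite ler_peMl// -expR0 ler_expR; apply: sumr_ge0.
have [y [Y [ya e]]] := step_arc K1 h0 hsmall (XK N); have [dy cY y0 hY] := ya.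
have tI : N%:R * h <= N%:R * h <= N%:R * h + h by rewrite lexx lerDl ltW.
have := @corrected_ge R M L K h (N%:R * h) u (X N) y Y L0 LM K1 kdvu u0m h0 (XK N) dy y0 hY _ tI.
rewrite subrr (@eq_corrected _ (y 0) (X N)); last by move=> i _.
rewrite (@iT_eq _ _ (fun s => (u (N%:R * h) s - vf M (X N) s) ^+ 2)); last first.
  move=> s; rewrite /err subrr (_ : y 0 = X N)//.
  by apply/funext => i.
by move=> /le_trans; apply; rewrite ler_wpM2l.
Qed.

End chain_error.

(** * Polynomial bounds for the sup norm *)

Section tonelli.
Variable R : realType.
Context d (T : measurableType d) (P : probability T R).
Local Notation Int f := (\int[P]_(w in setT) f w).
Local Notation ig f := (P.-integrable setT (EFin \o f)).
Local Notation leb := (@lebesgue_measure R).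
Local Notation I01 := (`[0, 1]%classic : set (measurableTypeR R)).

Lemma tonelli_le (F : T -> R -> R) (C : R) :
  measurable_fun setT (fun z : T * measurableTypeR R => F z.1 z.2) ->
  (forall w t, 0 <= F w t) -> (forall w, continuous (F w)) ->
  (forall t : R, 0 <= t <= 1 -> ig (F ^~ t) /\ Int (F ^~ t) <= C) ->
  ig (fun w => integralT (F w)) /\ Int (fun w => integralT (F w)) <= C.
Proof.
move=> mF F0 cF hF.
have mI : measurable I01 by exact: measurable_itv.
pose f (z : T * measurableTypeR R) : \bar R := (F z.1 z.2 * \1_I01 z.2)%:E.
have mf : measurable_fun setT f.
  apply/measurable_EFinP; apply: measurable_funM => //.
  have ms : measurable_fun setT (fun t : measurableTypeR R => \1_I01 t : R) by exact: measurable_indic.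
  exact: (measurableT_comp ms (@measurable_snd _ _ T (measurableTypeR R))).
have f0 z : (0 <= f z)%E by rewrite lee_fin mulr_ge0.
have ind (h : measurableTypeR R -> \bar R) : (\int[leb]_(t in I01) h t = \int[leb]_t (h t * (\1_I01 t)%:E))%E.
  rewrite integral_mkcond; apply: eq_integral => t _.
  by rewrite patchE indicE; case: (t \in _); rewrite ?mule1 ?mule0.
have e1 w : (\int[leb]_t f (w, t) = (integralT (F w))%:E)%E.
  rewrite /integralT -Int_EFin ?ind//; last exact: cont_ig.
have fub := @fubini_tonelli _ _ T (measurableTypeR R) R P leb f mf f0.
have le1 : (\int[P]_w (integralT (F w))%:E <= C%:E)%E.
  under eq_integral do rewrite -e1.
  rewrite fub; apply: (@le_trans _ _ (\int[leb]_(t in I01) C%:E)%E); last first.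
    rewrite integral_cst//; rewrite [X in (_ * X)%E](_ : _ = 1%E) ?mule1//; exact: mu01.
  rewrite ind; apply: ge0_le_integral => //.
  - by move=> t _; apply: integral_ge0 => w _; exact: f0.
  - exact: measurable_fun_fubini_tonelli_G.
  - apply: emeasurable_funM; first exact: measurable_cst.
    by apply/measurable_EFinP; exact: measurable_indic.
  - move=> t _; rewrite indicE; have [tI|tI] := boolP (t \in I01).
      have t01 : 0 <= t <= 1 by move/set_mem: tI; rewrite /= in_itv.
      have [i1 i2] := hF t t01; rewrite mule1.
      rewrite (eq_integral (fun w => (F w t)%:E)); first by rewrite Int_EFin// lee_fin.
      by move=> w _; rewrite /f /= indicE tI mulr1.
    rewrite mule0 (eq_integral (fun=> 0%E)) ?integral0// => w _.
    by rewrite /f /= indicE (negPf tI) mulr0.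
have mi : measurable_fun setT (fun w => integralT (F w)).
  apply/measurable_EFinP; rewrite (_ : _ \o _ = fun w => \int[leb]_t f (w, t))%E.
    exact: measurable_fun_fubini_tonelli_F.
  by apply/funext => w; rewrite /= e1.
have ii : ig (fun w => integralT (F w)).
  apply/integrableP; split; first exact/measurable_EFinP.
  apply: le_lt_trans (ltry C); apply: le_trans le1; rewrite le_eqVlt; apply/orP; left; apply/eqP.
  by apply: eq_integral => w _ /=; rewrite ger0_norm// iT_ge0.
by split => //; rewrite -lee_fin -Int_EFin.
Qed.

End tonelli.

Section dyadic_chaining.
Variable R : realType.

Lemma periodic_floor (f : R -> R) : periodic1 f -> forall y, exists2 z, 0 <= z < 1 & f y = f z.
Proof.
move=> pf y; have hn (n : nat) z : f (z + n%:R) = f z.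
  elim: n z => [|n IH] z; first by rewrite addr0.
  by rewrite -natr1 addrA pf IH.
have hz (n : int) z : f (z + n%:~R) = f z.
  case: n => n; first exact: hn.
  by rewrite NegzE mulrNz -[LHS](hn n.+1) -addrA addNr addr0.
exists (y - (Num.floor y)%:~R); last by rewrite -[RHS](hz (Num.floor y)) subrK.
by have := floor_itv y; rewrite intrD; lra.
Qed.

(** Chaining along the binary expansion of the point. *)
Lemma dyadic_chain (v : R -> R) (B : nat -> R) (C : R) (J : nat) :
  (forall i k, (k < 2 ^ i)%N -> `|v (k%:R / 2 ^+ i + (2 ^+ i.+1)^-1) - v (k%:R / 2 ^+ i)| <= B i) ->
  (forall i, 0 <= B i) ->
  (forall y z, y <= z -> `|v z - v y| <= C * (z - y)) ->
  forall y, 0 <= y < 1 -> `|v y| <= `|v 0| + \sum_(i < J) B i + `|C| / 2 ^+ J.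
Proof.
move=> hB B0 hC y y01.
have key j : exists k, [/\ (k < 2 ^ j)%N, k%:R / 2 ^+ j <= y < k%:R / 2 ^+ j + (2 ^+ j)^-1 &
    `|v (k%:R / 2 ^+ j)| <= `|v 0| + \sum_(i < j) B i].
  elim: j => [|j [k [kj yk IH]]].
    by exists 0%N; split; rewrite ?big_ord0 ?expr0 ?invr1 ?mul0r ?add0r ?addr0.
  have e2 : (2 ^+ j)^-1 = 2 * (2 ^+ j.+1)^-1 :> R by rewrite exprS; field; rewrite expf_neq0.
  set q := (2 ^+ j.+1)^-1 in e2 *.
  have ek : (2 * k)%:R * q = k%:R / 2 ^+ j by rewrite e2 natrM; ring.
  rewrite big_ord_recr /=; have [yl|yl] := ltP y (k%:R / 2 ^+ j + q).
    exists (2 * k)%N; split.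
    - by rewrite expnS ltn_mul2l.
    - by rewrite -/q ek yl andbT; case/andP: yk.
    - by rewrite -/q ek; apply: le_trans IH _; rewrite addrA lerDl.
  have ek1 : (2 * k).+1%:R * q = k%:R / 2 ^+ j + q by rewrite -natr1 mulrDl mul1r ek.
  exists (2 * k).+1; split.
  - by rewrite expnS; clear -kj; lia.
  - rewrite -/q ek1 yl /=; case/andP: yk => _; rewrite e2; lra.
  - rewrite -/q ek1; have := hB j k kj; rewrite -/q => h.
    have := ler_normD (v (k%:R / 2 ^+ j)) (v (k%:R / 2 ^+ j + q) - v (k%:R / 2 ^+ j)).
    rewrite addrCA subrr addr0; lra.
have [k [_ yk hk]] := key J; move/andP: yk => [y1 y2].
have h1 := hC _ _ y1.
have h2 : C * (y - k%:R / 2 ^+ J) <= `|C| / 2 ^+ J.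
  apply: le_trans (ler_wpM2r _ (ler_norm C)) _; first lra.
  by apply: ler_wpM2l => //; lra.
have := ler_normD (v (k%:R / 2 ^+ J)) (v y - v (k%:R / 2 ^+ J)); rewrite addrCA subrr addr0; lra.
Qed.

Lemma young4 (m dl : R) : 0 < dl -> `|m| <= dl + m ^+ 4 / dl ^+ 3.
Proof.
move=> d0; have [md|md] := leP `|m| dl.
  apply: ler_wpDr => //; apply: divr_ge0; last by apply: exprn_ge0; exact: ltW.
  by rewrite -[4%N]/(2 * 2)%N exprM sqr_ge0.
apply: ler_wpDl; first exact: ltW.
have e : m ^+ 4 = `|m| ^+ 4 by rewrite -normrX ger0_norm// -[4%N]/(2 * 2)%N exprM sqr_ge0.
rewrite ler_pdivlMr ?exprn_gt0// e [leRHS]exprS; apply: ler_wpM2l => //.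
by apply: lerXn2r; rewrite ?nnegrE ?(ltW d0)// ltW.
Qed.

Lemma geom_le (q : R) J : 0 <= q < 1 -> \sum_(i < J) q ^+ i <= (1 - q)^-1.
Proof.
move=> /andP[q0 q1]; have p : 0 < 1 - q by lra.
rewrite -[leRHS]mul1r ler_pdivlMr//.
have -> : (\sum_(i < J) q ^+ i) * (1 - q) = 1 - q ^+ J.
  elim: J => [|J IH]; first by rewrite big_ord0 mul0r expr0 subrr.
  by rewrite big_ord_recr mulrDl /= IH exprS; ring.
by have := exprn_ge0 J q0; lra.
Qed.

End dyadic_chaining.

Section sup_bound.
Variables (R : realType) (M : nat) (K : R).
Local Notation d := (M.*2).
Hypothesis K1 : 1 <= K.
Local Notation dr f x l := (is_derive (x : R) (1 : R) (f : R -> R) (l : R)).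

Definition incr (x : nat -> R) (i k : nat) : R :=
  vf M x (k%:R / 2 ^+ i + (2 ^+ i.+1)^-1) - vf M x (k%:R / 2 ^+ i).

Local Notation dl i := ((9 / 10) ^+ i : R).

(** A polynomial in the coordinates that dominates the sup norm.  The weights
   (9/10)^i of the chaining are such that both sum (9/10)^i and
   sum 2^i 4^-i (10/9)^(3 i) converge, 4^-i being the order of the fourth moments
   of the increments. *)
Definition supPoly (J : nat) (x : nat -> R) : R :=
  12 + vf M x 0 ^+ 4 + \sum_(i < J) \sum_(k < 2 ^ i) incr x i k ^+ 4 / dl i ^+ 3.

Let dl0 i : 0 < dl i. Proof. by apply: exprn_gt0; lra. Qed.
Let p4 (m : R) : 0 <= m ^+ 4. Proof. by rewrite -[4%N]/(2 * 2)%N exprM sqr_ge0. Qed.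

Lemma supPoly_bound : exists J, forall x, mass M x <= K -> forall s, `|vf M x s| <= supPoly J x.
Proof.
have K0 : 0 <= K by exact: le_trans K1.
(* A Lipschitz constant of vf M x on the ball; it decides the depth J only. *)
pose B := (\sum_(k < d) (freq R k * K) ^+ 2) * d%:R + 1.
have B1 : 1 <= B by rewrite lerDr mulr_ge0//; apply: sumr_ge0 => k _; exact: sqr_ge0.
have [J hJ] : exists J, B <= 2 ^+ J.
  exists (Num.bound B); have := archi_boundP (le_trans ler01 B1) => h.
  apply: le_trans (ltW h) _; rewrite -natrX ler_nat; exact: ltnW (ltn_expl _ _).
exists J => x xK s.
have [s' s01 ->] := periodic_floor (vf_periodic M x) s.
pose b i := dl i + \sum_(k < 2 ^ i) incr x i k ^+ 4 / dl i ^+ 3.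
have b0 i : 0 <= b i.
  apply: addr_ge0; first exact: ltW.
  by apply: sumr_ge0 => k _; rewrite divr_ge0 ?p4// exprn_ge0// ltW.
have hb i k : (k < 2 ^ i)%N -> `|incr x i k| <= b i.
  move=> ki; apply: le_trans (young4 _ (dl0 i)) _; rewrite /b lerD2l (bigD1 (Ordinal ki))//= lerDl.
  by apply: sumr_ge0 => j _; rewrite divr_ge0 ?p4// exprn_ge0// ltW.
have hC (y z : R) : y <= z -> `|vf M x z - vf M x y| <= B * (z - y).
  move=> yz; apply: (@dr_lip _ _ (vf M (Dx x))) => // t _; first exact: dr_vf.
  apply: normr_le_sqr; first exact: le_trans B1.
  apply: le_trans (vf_sup M (Dx x) t) _; apply: (@le_trans _ _ B); last by rewrite expr2 ler_peMl// (le_trans ler01).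
  apply: ler_wpDr => //; rewrite ler_wpM2r//.
  rewrite -(sum_partner M (fun k => (freq R k * K) ^+ 2)); apply: ler_sum => k _.
  rewrite /Dx freq_partner; set w := freq R k; set xp := x (partner k).
  rewrite (_ : (- (dsign R k * w) * xp) ^+ 2 = (dsign R k * dsign R k) * (w ^+ 2 * xp ^+ 2)); last by ring.
  have xp_le : `|xp| <= K by apply: (coord_le_mass K1 _ xK); rewrite partner_ltn.
  rewrite dsign_sqr mul1r; clearbody w xp; rewrite exprMn; apply: ler_wpM2l; first exact: sqr_ge0.
  by rewrite -(real_normK (num_real xp)); apply: lerXn2r; rewrite ?nnegrE.
apply: le_trans (dyadic_chain J hb b0 hC s01) _.
have -> : \sum_(i < J) b i = \sum_(i < J) dl i + \sum_(i < J) \sum_(k < 2 ^ i) incr x i k ^+ 4 / dl i ^+ 3.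
  by rewrite -big_split.
have g : \sum_(i < J) dl i <= (1 - 9 / 10)^-1 by apply: geom_le; lra.
have e10 : (1 - 9 / 10)^-1 = 10 :> R by field.
have h1 := young4 (vf M x 0) (ltr01 : 0 < (1 : R)).
rewrite expr1n divr1 in h1.
have h2 : `|B| / 2 ^+ J <= 1.
  by rewrite ger0_norm ?(le_trans ler01 B1)// ler_pdivrMr ?exprn_gt0// mul1r.
(* 12 = 10 + 1 + 1: the geometric sum, the value at 0 and the last scale. *)
rewrite /supPoly; move: g h1 h2; rewrite e10; lra.
Qed.

Lemma polyn_vf t : polyn M (fun x : nat -> R => vf M x t).
Proof.
apply: polyn_sum => k _; rewrite (_ : (fun x => _) = fun x : nat -> R => emode R k t * x k).
  by apply: polynZ; exact: polyn_coord.
by apply/funext => x; rewrite mulrC.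
Qed.

Lemma polyn_supPoly J : polyn M (supPoly J).
Proof.
apply: polynD.
  by apply: polynD; [exact: polyn_cst|apply: polynX; exact: polyn_vf].
apply: polyn_sum => i _; apply: polyn_sum => k _.
rewrite (_ : (fun x => _) = fun x : nat -> R => (dl i ^+ 3)^-1 * incr x i k ^+ 4).
  apply: polynZ; apply: polynX; apply: polynD; first exact: polyn_vf.
  rewrite (_ : (fun x => _) = fun x : nat -> R => (-1) * vf M x (k%:R / 2 ^+ i)).
    by apply: polynZ; exact: polyn_vf.
  by apply/funext => x; rewrite mulN1r.
by apply/funext => x; rewrite mulrC.
Qed.

Lemma polyn_al4 : polyn M (al4 M : (nat -> R) -> R).
Proof.
rewrite (_ : al4 M = fun x : nat -> R => \sum_(i < d) \sum_(j < d) \sum_(k < d) \sum_(l < d)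
   integralT (fun t => emode R i t * emode R j t * (emode R k t * emode R l t)) * (x i * x j * (x k * x l))).
  do 4 (apply: polyn_sum => ? _); apply: polynZ.
  by apply: polynM; apply: polynM; exact: polyn_coord.
apply/funext => x; have ce := @cont_emode R.
rewrite /al4 (@iT_eq _ _ (fun t => \sum_(i < d) \sum_(j < d) \sum_(k < d) \sum_(l < d)
  (x i * x j * (x k * x l)) * (emode R i t * emode R j t * (emode R k t * emode R l t)))).
  rewrite iT_sum => [|i _]; last by do 3 (apply: cont_sum => ? _); ct.
  apply: eq_bigr => i _; rewrite iT_sum => [|j _]; last by do 2 (apply: cont_sum => ? _); ct.
  apply: eq_bigr => j _; rewrite iT_sum => [|k _]; last by do 1 (apply: cont_sum => ? _); ct.
  apply: eq_bigr => k _; rewrite iT_sum => [|l _]; last by ct.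
  by apply: eq_bigr => l _; rewrite iTZ 1?mulrC//; ct.
move=> t; rewrite -[4%N]/(2 + 2)%N exprD expr2 /vf big_distrlr /= mulr_suml; apply: eq_bigr => i _.
rewrite mulr_suml; apply: eq_bigr => j _; rewrite mulr_sumr; apply: eq_bigr => k _.
rewrite mulr_sumr; apply: eq_bigr => l _; ring.
Qed.

Lemma polyn_hi L (F : (nat -> R) -> R) : polyn M F -> polyn M (fun x => F (hi L x)).
Proof.
move=> [m [c]]; elim=> {m c F}.
- by move=> c; exact: polyn_cst.
- move=> i id; rewrite (_ : (fun x => _) = if (i < L.*2)%N then fun=> 0 else fun x : nat -> R => x i).
    by case: ifP => _; [exact: polyn_cst|exact: polyn_coord].
  by apply/funext => x; rewrite /hi; case: ifP.
- by move=> m c c' F G _ h1 _ h2; exact: polynD.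
- by move=> m m' c c' F G _ h1 _ h2; exact: polynM.
- by [].
Qed.

Lemma polyn_hi2 L : polyn M (hi2 M L : (nat -> R) -> R).
Proof. exact: (polyn_hi L (polyn_mass R M)). Qed.

End sup_bound.

(** * Moments of the smoothed noise *)

Section weighted_moments.
Variables (R : realType) (M : nat) (V : R).
Local Notation d := (M.*2).
Context dd (T : measurableType dd) (P : probability T R).
Variable g : nat -> T -> R.
Local Notation Int f := (\int[P]_(w in setT) f w).
Local Notation ig f := (P.-integrable setT (EFin \o f)).
Hypothesis mg : forall k, measurable_fun setT (g k).
Hypothesis gcos : forall n xi, Int (fun w => cos (lin n xi (g ^~ w))) = expR (- (2^-1 * sq n xi)).
Hypothesis gsin : forall n xi, Int (fun w => sin (lin n xi (g ^~ w))) = 0.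
Variable D : T -> R.
Hypotheses (mD : measurable_fun setT D) (D0 : forall w, 0 <= D w).
Hypotheses (iD2 : ig (fun w => D w ^+ 2)) (DV : Int (fun w => D w ^+ 2) <= V).

Let mT : measurable (setT : set T). Proof. exact: measurableT. Qed.
Let PT : P setT = 1%E. Proof. exact: probability_setT. Qed.

Definition Cw : R := C8 R + V + 1.

Let C80 : 0 <= C8 R.
Proof. by rewrite /C8 !mulr_ge0 ?exprn_ge0 ?expR_ge0. Qed.

Let V0 : 0 <= V.
Proof. by apply: le_trans DV; apply: Int_ge0 => w _; exact: sqr_ge0. Qed.

Lemma ig_weight : ig D.
Proof.
apply: (ig_dom mT mD (igD mT (ig_cst mT PT 1) iD2)) => w _.
rewrite ger0_norm//; have := sqr_ge0 (D w - 1); have := D0 w; lra.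
Qed.

Lemma weight_mean : Int D <= Cw.
Proof.
have h : Int D <= Int (fun w => 1 + D w ^+ 2).
  apply: (Int_le mT ig_weight (igD mT (ig_cst mT PT 1) iD2)) => w _.
  by have := sqr_ge0 (D w - 1); have := D0 w; lra.
move: h; rewrite (IntD mT (ig_cst mT PT 1) iD2) (Int_cst mT PT) /Cw; move: DV C80; lra.
Qed.

(** Young's inequality between the density, square integrable, and the eighth
   power. *)
Lemma weighted_quartic n c (s : R) : 0 < s -> sq n c <= s ->
  ig (fun w => lin n c (g ^~ w) ^+ 4 * D w) /\ Int (fun w => lin n c (g ^~ w) ^+ 4 * D w) <= Cw * s ^+ 2.
Proof.
move=> s0 cs; have [i8 h8] := moment8 mg gcos gsin s0 cs.
have ml := @lin_meas R _ _ g n c mg.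
have s20 : 0 < s ^+ 2 by exact: exprn_gt0.
have pw w : lin n c (g ^~ w) ^+ 4 * D w <= 2^-1 * (s ^- 2 * lin n c (g ^~ w) ^+ 8) + 2^-1 * (s ^+ 2 * D w ^+ 2).
  set y := lin _ _ _; rewrite -subr_ge0.
  rewrite (_ : _ - _ = 2^-1 * s ^- 2 * (y ^+ 4 - s ^+ 2 * D w) ^+ 2); last by field; rewrite gt_eqF.
  by rewrite mulr_ge0 ?sqr_ge0// mulr_ge0 ?invr_ge0// ltW.
have j1 := igZ mT 2^-1 (igZ mT (s ^- 2) i8); have j2 := igZ mT 2^-1 (igZ mT (s ^+ 2) iD2).
have i4 : ig (fun w => lin n c (g ^~ w) ^+ 4 * D w).
  apply: (ig_dom mT _ (igD mT j1 j2)).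
    by apply: measurable_funM => //; exact: measurable_funX.
  move=> w _; rewrite ger0_norm ?pw// mulr_ge0//.
  by rewrite -[4%N]/(2 * 2)%N exprM sqr_ge0.
split => //; apply: le_trans (Int_le mT i4 (igD mT j1 j2) (fun w _ => pw w)) _.
rewrite (IntD mT j1 j2) (IntZ mT _ (igZ mT _ i8)) (IntZ mT _ i8) (IntZ mT _ (igZ mT _ iD2)) (IntZ mT _ iD2).
have h1 : s ^- 2 * Int (fun w => lin n c (g ^~ w) ^+ 8) <= C8 R * s ^+ 2.
  rewrite mulrC ler_pdivrMr//; apply: le_trans h8 _.
  by apply: eq_ler; ring.
have h2 : s ^+ 2 * Int (fun w => D w ^+ 2) <= s ^+ 2 * V by rewrite ler_wpM2l// ltW.
have := mulr_ge0 C80 (ltW s20); have := mulr_ge0 V0 (ltW s20).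
rewrite /Cw; lra.
Qed.

Lemma weighted_square n c (s : R) : 0 < s -> sq n c <= s ->
  ig (fun w => lin n c (g ^~ w) ^+ 2 * D w) /\ Int (fun w => lin n c (g ^~ w) ^+ 2 * D w) <= Cw * s.
Proof.
move=> s0 cs; have [i4 h4] := weighted_quartic s0 cs.
have ml := @lin_meas R _ _ g n c mg; have iD := ig_weight; have wm := weight_mean.
have pw w : lin n c (g ^~ w) ^+ 2 * D w <= (2^-1 * s) * D w + (2 * s)^-1 * (lin n c (g ^~ w) ^+ 4 * D w).
  set y := lin _ _ _; rewrite -subr_ge0.
  rewrite (_ : _ - _ = (2 * s)^-1 * (y ^+ 2 - s) ^+ 2 * D w); last by field; rewrite gt_eqF.
  by rewrite mulr_ge0// mulr_ge0 ?sqr_ge0// invr_ge0 mulr_ge0// ltW.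
have j1 := igZ mT (2^-1 * s) iD; have j2 := igZ mT (2 * s)^-1 i4.
have i2 : ig (fun w => lin n c (g ^~ w) ^+ 2 * D w).
  apply: (ig_dom mT _ (igD mT j1 j2)).
    by apply: measurable_funM => //; exact: measurable_funX.
  by move=> w _; rewrite ger0_norm ?pw// mulr_ge0// sqr_ge0.
split => //; apply: le_trans (Int_le mT i2 (igD mT j1 j2) (fun w _ => pw w)) _.
rewrite (IntD mT j1 j2) (IntZ mT _ iD) (IntZ mT _ i4).
have h1 : (2 * s)^-1 * Int (fun w => lin n c (g ^~ w) ^+ 4 * D w) <= 2^-1 * (Cw * s).
  rewrite mulrC ler_pdivrMr ?mulr_gt0//; apply: le_trans h4 _.
  by apply: eq_ler; field.
have := ler_wpM2l (ltW s0) wm; lra.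
Qed.

Local Notation e := (emode R).

Lemma vf_lin (a : nat -> R) w t : vf M (fun k => a k * g k w) t = lin d (fun k => a k * e k t) (g ^~ w).
Proof. by apply: eq_bigr => k _; ring. Qed.

Lemma joint_meas (a : nat -> R) :
  measurable_fun setT (fun z : T * measurableTypeR R => vf M (fun k => a k * g k z.1) z.2).
Proof.
apply: measurable_sum => k; apply: measurable_funM.
  apply: measurable_funM; first exact: measurable_cst.
  exact: (measurableT_comp (mg k) (@measurable_fst _ _ T (measurableTypeR R))).
have me : measurable_fun setT (fun t : measurableTypeR R => e k t).
  by apply: cont_meas; exact: cont_emode.
exact: (measurableT_comp me (@measurable_snd _ _ T (measurableTypeR R))).
Qed.

Lemma weighted_power (p : nat) (a : nat -> R) (C : R) :
  (forall t w, 0 <= vf M (fun k => a k * g k w) t ^+ p) ->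
  (forall t, ig (fun w => lin d (fun k => a k * e k t) (g ^~ w) ^+ p * D w) /\
     Int (fun w => lin d (fun k => a k * e k t) (g ^~ w) ^+ p * D w) <= C) ->
  ig (fun w => integralT (fun t => vf M (fun k => a k * g k w) t ^+ p) * D w) /\
  Int (fun w => integralT (fun t => vf M (fun k => a k * g k w) t ^+ p) * D w) <= C.
Proof.
move=> p0 h; pose F w t := D w * vf M (fun k => a k * g k w) t ^+ p.
have cv w : continuous (fun t => vf M (fun k => a k * g k w) t ^+ p) by apply: contX; exact: cont_vf.
have E : (fun w => integralT (fun t => vf M (fun k => a k * g k w) t ^+ p) * D w) = fun w => integralT (F w).
  by apply/funext => w; rewrite mulrC /F iTZ.
have E' t : F ^~ t = fun w => lin d (fun k => a k * e k t) (g ^~ w) ^+ p * D w.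
  by apply/funext => w; rewrite /F vf_lin mulrC.
rewrite E; apply: tonelli_le.
- apply: measurable_funM; first exact: (measurableT_comp mD (@measurable_fst _ _ T (measurableTypeR R))).
  by apply: measurable_funX; exact: joint_meas.
- by move=> w t; rewrite mulr_ge0.
- by move=> w; apply: contZ.
- by move=> t _; rewrite E'.
Qed.

Variable eps : R.
Hypothesis eps0 : 0 < eps.
Local Notation lam := (lam eps).
Local Notation X0 := (smoothed eps g).

Lemma lam2_le1 k : lam k ^+ 2 <= 1.
Proof.
have b0 : 0 <= eps * freq R k ^+ 2 by apply: mulr_ge0 (sqr_ge0 _); exact: ltW.
by rewrite -[lam k ^+ 2]invrK lam_sqr// invf_le1 ?lerDl// ltr_pwDl.
Qed.

Lemma lam2_le k : lam k ^+ 2 <= eps^-1 * freq R k ^- 2.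
Proof.
have b0 : 0 < eps * freq R k ^+ 2 by rewrite mulr_gt0// exprn_gt0// freq_gt0.
rewrite -[lam k ^+ 2]invrK lam_sqr// -invfM lef_pV2 ?posrE ?lerDr//.
by rewrite ltr_pwDl// ltW.
Qed.

Let e2_le2 k t : e k t ^+ 2 <= 2.
Proof.
rewrite -(real_normK (num_real (e k t))) -(sq2_sqr R) -expr2; apply: lerXn2r; rewrite ?nnegrE ?sqrtr_ge0//.
exact: emode_bound.
Qed.

Lemma lam2_hi_sum L : (0 < L)%N -> \sum_(k < d) hi L lam k ^+ 2 <= 2 / (eps * L%:R).
Proof.
move=> L0; apply: (@le_trans _ _ (\sum_(k < d) eps^-1 * (if (k < L.*2)%N then 0 else freq R k ^- 2))).
  apply: ler_sum => k _; rewrite /hi; case: ifP => _; last exact: lam2_le.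
  by rewrite expr0n mulr0.
rewrite -mulr_sumr invfM mulrCA; apply: ler_wpM2l; first by rewrite invr_ge0 ltW.
exact: sum_freq_hi.
Qed.

Lemma lam2_sum L : (0 < L)%N -> \sum_(k < d) lam k ^+ 2 <= 2 * L%:R + 2 / (eps * L%:R).
Proof.
move=> L0; apply: (@le_trans _ _ (\sum_(k < d) ((k < L.*2)%N%:R + hi L lam k ^+ 2))).
  apply: ler_sum => k _; rewrite /hi; case: ifP => _; last by rewrite add0r.
  by rewrite expr0n addr0 lam2_le1.
rewrite big_split /=; apply: lerD; last exact: lam2_hi_sum.
have h n : \sum_(k < n) ((k < L.*2)%N%:R : R) = (minn n L.*2)%:R.
  elim: n => [|n IH]; first by rewrite big_ord0 min0n.
  rewrite big_ord_recr IH /=; case: ltnP => nL.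
    by rewrite !(minn_idPl _) ?natr1// ltnW.
  by rewrite !(minn_idPr _) ?addr0// ltnW.
by rewrite h -natrM mul2n ler_nat geq_minr.
Qed.

Lemma var_point L t : (0 < L)%N -> sq d (fun k => lam k * e k t) <= 4 * L%:R + 4 / (eps * L%:R).
Proof.
move=> L0; apply: (@le_trans _ _ (2 * \sum_(k < d) lam k ^+ 2)).
  rewrite mulr_sumr; apply: ler_sum => k _; rewrite exprMn mulrC; apply: ler_wpM2r; first exact: sqr_ge0.
  exact: e2_le2.
by have := lam2_sum L0; lra.
Qed.

Lemma var_hi L t : (0 < L)%N -> sq d (fun k => hi L lam k * e k t) <= 4 / (eps * L%:R).
Proof.
move=> L0; apply: (@le_trans _ _ (2 * \sum_(k < d) hi L lam k ^+ 2)).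
  rewrite mulr_sumr; apply: ler_sum => k _; rewrite exprMn mulrC; apply: ler_wpM2r; first exact: sqr_ge0.
  exact: e2_le2.
by have := lam2_hi_sum L0; lra.
Qed.

(** The modes are Lipschitz, which serves below frequency 2^i; above, the decay
   of lam does. *)
Lemma var_incr i (a : R) :
  sq d (fun k => lam k * (e k (a + (2 ^+ i.+1)^-1) - e k a)) <= 17 / (eps * 2 ^+ i).
Proof.
set h := (2 ^+ i.+1)^-1; have h0 : 0 < h by rewrite invr_gt0 exprn_gt0.
have L0 : (0 < 2 ^ i)%N by rewrite expn_gt0.
have lip k : (e k (a + h) - e k a) ^+ 2 <= 2 * freq R k ^+ 2 * h ^+ 2.
  have := @dr_lip R (e k) (fun t => dsign R k * freq R k * e (partner k) t) a (a + h) (Num.sqrt 2 * freq R k).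
  rewrite (_ : a + h - a = h) => [H|]; last by ring.
  have {}H : `|e k (a + h) - e k a| <= Num.sqrt 2 * freq R k * h.
    apply: H; [by move=> *; exact: dr_emode| |by rewrite lerDl ltW].
    move=> t _; rewrite normrM [`|dsign R k * _|]normrM (_ : `|dsign R k| = 1); last by rewrite /dsign; case: ifP; rewrite ?normrN1 ?normr1.
    by rewrite mul1r (ger0_norm (ltW (freq_gt0 R k))) mulrC ler_wpM2r ?(ltW (freq_gt0 R k))// emode_bound.
  rewrite -(real_normK (num_real (_ - _))) (_ : 2 * _ * _ = (Num.sqrt 2 * freq R k * h) ^+ 2); last first.
    by rewrite !exprMn sqr_sqrtr.
  have q0 : 0 <= Num.sqrt 2 * freq R k * h.
    by apply: mulr_ge0 (ltW h0); apply: mulr_ge0 (ltW (freq_gt0 R k)); exact: sqrtr_ge0.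
  by apply: lerXn2r; rewrite ?nnegrE.
have big_ k : (e k (a + h) - e k a) ^+ 2 <= 8.
  have := e2_le2 k (a + h); have := e2_le2 k a; have := sqr_ge0 (e k (a + h) + e k a); lra.
apply: (@le_trans _ _ (\sum_(k < d) ((k < (2 ^ i).*2)%N%:R * (2 * h ^+ 2 / eps) + 8 * hi (2 ^ i) lam k ^+ 2))).
  apply: ler_sum => k _; rewrite exprMn /hi; case: ifP => _.
    rewrite mul1r expr0n mulr0 addr0.
    apply: (@le_trans _ _ ((eps^-1 * freq R k ^- 2) * (2 * freq R k ^+ 2 * h ^+ 2))).
      by apply: ler_pM; rewrite ?sqr_ge0// lam2_le.
    apply: eq_ler; have f0 := freq_gt0 R k.
    by move: f0; set f := freq R k; clearbody f => f0; field; rewrite !gt_eqF.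
  by rewrite mul0r add0r mulrC; apply: ler_wpM2r => //; exact: sqr_ge0.
rewrite big_split /= -mulr_suml -mulr_sumr.
have hn n : \sum_(k < n) ((k < (2 ^ i).*2)%N%:R : R) <= (2 ^ i).*2%:R.
  suff : \sum_(k < n) ((k < (2 ^ i).*2)%N%:R : R) = (minn n (2 ^ i).*2)%:R by move=> ->; rewrite ler_nat geq_minr.
  elim: n => [|n IH]; first by rewrite big_ord0 min0n.
  rewrite big_ord_recr IH /=; case: ltnP => nL.
    by rewrite !(minn_idPl _) ?natr1// ltnW.
  by rewrite !(minn_idPr _) ?addr0// ltnW.
have h1 : (\sum_(k < d) ((k < (2 ^ i).*2)%N%:R : R)) * (2 * h ^+ 2 / eps) <= 1 / (eps * 2 ^+ i).
  apply: (@le_trans _ _ ((2 ^ i).*2%:R * (2 * h ^+ 2 / eps))).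
    by apply: ler_wpM2r; [rewrite divr_ge0 ?(ltW eps0)// mulr_ge0// exprn_ge0// ltW|exact: hn].
  rewrite -mul2n natrM natrX; apply: eq_ler; have -> : h = (2 * 2 ^+ i)^-1 by rewrite /h exprS.
  have p0 : (2 : R) ^+ i != 0 by rewrite expf_neq0.
  by move: p0; set p := 2 ^+ i; clearbody p => p0; field; rewrite p0 gt_eqF.
have := lam2_hi_sum L0; rewrite natrX => h2.
have -> : 17 / (eps * 2 ^+ i) = 1 / (eps * 2 ^+ i) + 8 * (2 / (eps * 2 ^+ i)) by field; rewrite expf_neq0 ?gt_eqF.
by apply: lerD => //; apply: ler_wpM2l.
Qed.

(** A bound for the weighted mean of supPoly that depends neither on the number
   of modes nor on the depth of the chaining. *)
Definition Csup : R := 13 * Cw + Cw * (4 + 4 / eps) ^+ 2 + 4 * (Cw * (17 / eps) ^+ 2).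

Let Cw0 : 0 <= Cw.
Proof. by rewrite /Cw; move: C80 V0; lra. Qed.

Lemma weighted_supPoly J : ig (fun w => supPoly M J (X0 w) * D w) /\ Int (fun w => supPoly M J (X0 w) * D w) <= Csup.
Proof.
have iD := ig_weight.
have s1 : 0 < 4 + 4 / eps by rewrite addr_gt0// divr_gt0.
have v0 : sq d (fun k => lam k * e k 0) <= 4 + 4 / eps.
  by have := @var_point 1 0 isT; rewrite !mulr1.
have [i0 h0] := weighted_quartic s1 v0.
have hI i k : ig (fun w => incr M (X0 w) i k ^+ 4 * D w) /\
    Int (fun w => incr M (X0 w) i k ^+ 4 * D w) <= Cw * (17 / (eps * 2 ^+ i)) ^+ 2.
  have s0 : 0 < 17 / (eps * 2 ^+ i) by rewrite divr_gt0// mulr_gt0// exprn_gt0.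
  have := weighted_quartic s0 (var_incr i (k%:R / 2 ^+ i)).
  rewrite (_ : (fun w => lin _ _ _ ^+ 4 * D w) = fun w => incr M (X0 w) i k ^+ 4 * D w)//.
  apply/funext => w; rewrite /incr /vf -sumrB; congr (_ ^+ 4 * _); apply: eq_bigr => j _.
  by rewrite /smoothed; ring.
pose S w := \sum_(i < J) \sum_(k < 2 ^ i) (((9 / 10) ^+ i) ^+ 3)^-1 * (incr M (X0 w) i k ^+ 4 * D w).
have iS i : ig (fun w => \sum_(k < 2 ^ i) (((9 / 10) ^+ i) ^+ 3)^-1 * (incr M (X0 w) i k ^+ 4 * D w)).
  by apply: (ig_sum mT PT) => k _; apply: (igZ mT); have [] := hI i k.
have iSS : ig S by apply: (ig_sum mT PT).
have E : (fun w => supPoly M J (X0 w) * D w) = fun w => (12 * D w + lin d (fun k => lam k * e k 0) (g ^~ w) ^+ 4 * D w) + S w.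
  apply/funext => w; rewrite /supPoly /S !mulrDl; congr (_ + _ ^+ 4 * _ + _).
    by rewrite -vf_lin.
  by rewrite mulr_suml; apply: eq_bigr => i _; rewrite mulr_suml; apply: eq_bigr => k _; ring.
have j1 := igD mT (igZ mT 12 iD) i0.
rewrite E; split; first exact: (igD mT j1 iSS).
rewrite (IntD mT j1 iSS) (IntD mT (igZ mT 12 iD) i0) (IntZ mT _ iD) /Csup.
have hS : Int S <= Cw * (17 / eps) ^+ 2 * \sum_(i < J) (500 / 729) ^+ i.
  rewrite (Int_sum mT PT)// mulr_sumr; apply: ler_sum => i _.
  rewrite (Int_sum mT PT) => [|k _]; last by apply: (igZ mT); have [] := hI i k.
  apply: (@le_trans _ _ (\sum_(k < 2 ^ i) (((9 / 10) ^+ i) ^+ 3)^-1 * (Cw * (17 / (eps * 2 ^+ i)) ^+ 2))).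
    apply: ler_sum => k _; rewrite (IntZ mT _ (hI i k).1); apply: ler_wpM2l; last exact: (hI i k).2.
    by rewrite invr_ge0 !exprn_ge0//; lra.
  rewrite sumr_const card_ord -[_ *+ (2 ^ i)]mulr_natr natrX; apply: eq_ler.
  have -> : ((9 / 10) ^+ i) ^+ 3 = (729 / 1000) ^+ i :> R.
    by rewrite -exprM mulnC exprM; congr (_ ^+ i); field.
  have -> : (500 / 729 : R) ^+ i = (729 / 1000) ^- i / 2 ^+ i.
    by rewrite -!exprVn -exprMn; congr (_ ^+ i); field.
  have p0 : (2 : R) ^+ i != 0 by rewrite expf_neq0.
  move: p0; set p := 2 ^+ i; set q := (729 / 1000) ^- i; clearbody p q => p0.
  by field; rewrite p0 gt_eqF.
have g1 : \sum_(i < J) (500 / 729 : R) ^+ i <= (1 - 500 / 729)^-1 by apply: geom_le; lra.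
have g2 : (1 - 500 / 729)^-1 <= 4 :> R.
  by rewrite (_ : (1 - 500 / 729)^-1 = 729 / 229 :> R); [lra|field].
have c0 : 0 <= Cw * (17 / eps) ^+ 2 by rewrite mulr_ge0 ?sqr_ge0.
have := ler_wpM2l c0 (le_trans g1 g2); have := weight_mean; move: h0 hS Cw0; lra.
Qed.

Lemma weighted_al4 : ig (fun w => al4 M (X0 w) * D w) /\ Int (fun w => al4 M (X0 w) * D w) <= Cw * (4 + 4 / eps) ^+ 2.
Proof.
apply: (@weighted_power 4 lam) => [t w|t]; first by rewrite -[4%N]/(2 * 2)%N exprM sqr_ge0.
apply: weighted_quartic; first by rewrite addr_gt0// divr_gt0.
by have := @var_point 1 t isT; rewrite !mulr1.
Qed.

Let hi_smoothed L w : hi L (X0 w) = fun k => hi L lam k * g k w.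
Proof. by apply/funext => k; rewrite /hi; case: ifP => _; rewrite ?mul0r. Qed.

Lemma weighted_al4_hi L : (0 < L)%N -> ig (fun w => al4 M (hi L (X0 w)) * D w) /\
  Int (fun w => al4 M (hi L (X0 w)) * D w) <= Cw * (4 / (eps * L%:R)) ^+ 2.
Proof.
move=> L0; under [X in ig X]eq_fun do rewrite hi_smoothed.
under [X in Int X]eq_fun do rewrite hi_smoothed.
apply: (@weighted_power 4 (hi L lam)) => [t w|t]; first by rewrite -[4%N]/(2 * 2)%N exprM sqr_ge0.
by apply: weighted_quartic; [rewrite divr_gt0// mulr_gt0// ltr0n|exact: var_hi].
Qed.

Lemma weighted_hi2 L : (0 < L)%N -> ig (fun w => hi2 M L (X0 w) * D w) /\
  Int (fun w => hi2 M L (X0 w) * D w) <= Cw * (4 / (eps * L%:R)).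
Proof.
move=> L0; have E : (fun w => hi2 M L (X0 w) * D w) =
    fun w => integralT (fun t => vf M (fun k => hi L lam k * g k w) t ^+ 2) * D w.
  by apply/funext => w; rewrite iT_vf_sqr /hi2 hi_smoothed.
rewrite E; apply: (@weighted_power 2 (hi L lam)) => [t w|t]; first exact: sqr_ge0.
by apply: weighted_square; [rewrite divr_gt0// mulr_gt0// ltr0n|exact: var_hi].
Qed.

End weighted_moments.

(** * Convergence of the density to 1 *)

Section square_root_exponential.
Variable R : realType.

(** Let l be the square root, and suppose l > 1.  The pointwise bound
   1 + (z^2 - l^2) / (2 l) <= expR (1 + z - l) has mean 1 on its left. *)
Lemma exp_sqrt_le (z : R -> R) : continuous z -> (forall x, 0 <= z x) ->
  expR (Num.sqrt (integralT (fun x => z x ^+ 2))) <= expR 1 * integralT (fun x => expR (z x)).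
Proof.
move=> cz z0; set Y := integralT _; set l := Num.sqrt Y.
have cexp : continuous (fun x => expR (z x)).
  by move=> x; apply: continuous_comp; [exact: cz|exact: continuous_expR].
have c2 : continuous (fun x => z x ^+ 2) by exact: contX.
have E1 : 1 <= integralT (fun x => expR (z x)).
  rewrite -[leLHS](iT_cst (1 : R)); apply: iT_le => [|//|x]; first exact: cont_cst.
  by rewrite -expR0 ler_expR.
have [l1|l1] := leP l 1.
  apply: (@le_trans _ _ (expR 1)); first by rewrite ler_expR.
  by rewrite ler_peMr// expR_ge0.
have l0 : 0 < l by lra.
have Y0 : 0 <= Y by exact: iT_sqr0.
have lY : l ^+ 2 = Y by rewrite sqr_sqrtr.
have pw (x : R) : 1 + (2 * l)^-1 * (z x ^+ 2 - Y) <= expR (1 - l) * expR (z x).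
  rewrite -expRD -lY; have := z0 x; set y := z x => y0.
  have -> : 1 + (2 * l)^-1 * (y ^+ 2 - l ^+ 2) = 1 + (y - l) + (2 * l)^-1 * (y - l) ^+ 2.
    by field; rewrite gt_eqF.
  have -> : 1 - l + y = 1 + (y - l) by ring.
  set s := y - l; have il : (2 * l)^-1 <= 2^-1 by rewrite lef_pV2 ?posrE ?mulr_gt0//; lra.
  have [s0|s0] := leP 0 s.
    have s1 : 0 <= 1 + s by lra.
    have := expR_ge1Dxn 1 s1; rewrite (_ : 2`!%:R = 2 :> R)//.
    have : (2 * l)^-1 * s ^+ 2 <= 2^-1 * s ^+ 2 by rewrite ler_wpM2r// sqr_ge0.
    lra.
  have q : (2 * l)^-1 * s ^+ 2 <= - (s / 2).
    have -> : - (s / 2) = (2 * l)^-1 * (l * (- s)) by field; rewrite gt_eqF.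
    apply: ler_wpM2l; first by rewrite invr_ge0 mulr_ge0// ltW.
    have sl : - s <= l by rewrite /s; lra.
    rewrite (_ : s ^+ 2 = (- s) * (- s)); last by ring.
    by apply: ler_wpM2r => //; lra.
  have := expR_ge1Dx (1 + s); have := expR_ge0 (1 + s).
  have [s2|s2] := leP s (-2); lra.
have := iT_le _ _ pw; rewrite iTD ?iT_cst ?iTZ ?iTB ?iT_cst; try by ct.
rewrite -/Y subrr mulr0 addr0 => H.
have {}H : 1 <= expR (1 - l) * integralT (fun x => expR (z x)).
  by apply: H; [apply: contD; [exact: cont_cst|apply: contZ; apply: contB => //; exact: cont_cst]|apply: contZ].
have := ler_wpM2l (expR_ge0 l) H; rewrite mulr1 mulrA -expRD (_ : l + (1 - l) = 1)//; ring.
Qed.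

End square_root_exponential.

Section density_near_one.
Variables (R : realType) (M : nat) (n : R).
Local Notation d := (M.*2).
Local Notation eps := (n ^- 8).
Local Notation K := (n ^+ 6).
Hypothesis n64 : 64 <= n.
Context dd (T : measurableType dd) (P : probability T R).
Variable g : nat -> T -> R.
Local Notation Int f := (\int[P]_(w in setT) f w).
Local Notation ig f := (P.-integrable setT (EFin \o f)).
Hypothesis mg : forall k, measurable_fun setT (g k).
Hypothesis gcos : forall n xi, Int (fun w => cos (lin n xi (g ^~ w))) = expR (- (2^-1 * sq n xi)).
Hypothesis gsin : forall n xi, Int (fun w => sin (lin n xi (g ^~ w))) = 0.

Let mT : measurable (setT : set T). Proof. exact: measurableT. Qed.
Let PT : P setT = 1%E. Proof. exact: probability_setT. Qed.
Let n0 : 0 < n. Proof. by move: n64; lra. Qed.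
Let nn : n != 0. Proof. by rewrite gt_eqF. Qed.
Let eps0 : 0 < eps. Proof. by rewrite invr_gt0 exprn_gt0. Qed.
Let K0 : 0 < K. Proof. by rewrite exprn_gt0. Qed.
Let K1 : 1 <= K. Proof. by apply: exprn_ege1; move: n64; lra. Qed.

Local Notation X0 := (smoothed eps g).
Local Notation D w := (gibbs M eps K (X0 w)).

(** The largest exponent that exp_moment allows for a variance 16 n^4, which
   bounds that of the pointwise values. *)
Let a : R := (64 * n ^+ 4)^-1.
Let a0 : 0 < a. Proof. by rewrite invr_gt0 mulr_gt0// exprn_gt0. Qed.
Let Lam w : R := a * Num.sqrt (al4 M (X0 w)).

Variable L : nat.
Hypothesis nL : n ^+ 4 <= L%:R <= 2 * n ^+ 4.

Let L0 : (0 < L)%N.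
Proof. by rewrite -(ltr_nat R); move: nL => /andP[+ _]; apply: lt_le_trans; rewrite exprn_gt0. Qed.

Let var_le : 2 * L%:R + 2 / (eps * L%:R) <= 8 * n ^+ 4.
Proof.
move/andP: nL => [h1 h2]; have h4 : 0 < n ^+ 4 by rewrite exprn_gt0.
have : 2 / (eps * L%:R) <= 2 * n ^+ 4.
  rewrite ler_pdivrMr ?mulr_gt0 ?ltr0n// (_ : 2 * n ^+ 4 * (eps * L%:R) = 2 * (L%:R / n ^+ 4)); last by field.
  have : 1 <= L%:R / n ^+ 4 by rewrite ler_pdivlMr// mul1r.
  lra.
lra.
Qed.

Let point_moment t : ig (fun w => expR (a * vf M (X0 w) t ^+ 2)) /\ Int (fun w => expR (a * vf M (X0 w) t ^+ 2)) <= 2 * expR 1.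
Proof.
have e w : vf M (X0 w) t = lin d (fun k => lam eps k * emode R k t) (g ^~ w) by exact: (vf_lin M g (lam eps) w t).
under [X in ig X]eq_fun do rewrite e.
under [X in Int X]eq_fun do rewrite e.
apply: exp_moment => //; have v := var_point M eps0 t L0.
rewrite /a mulrC ler_pdivrMr ?mulr_gt0 ?exprn_gt0//; apply: le_trans v _.
by move: var_le; lra.
Qed.

Let al40 w : 0 <= al4 M (X0 w). Proof. by apply: iT_ge0 => s; rewrite -[4%N]/(2 * 2)%N exprM sqr_ge0. Qed.

Let exp_Lam : ig (fun w => expR (Lam w)) /\ Int (fun w => expR (Lam w)) <= expR 1 * (2 * expR 1).
Proof.
have ma : measurable_fun setT (fun w => al4 M (X0 w)).
  by apply: (seq_meas (fun k => smoothed_meas eps mg k)); exact: polyn_meas (polyn_al4 R M).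
have [i1 h1] : ig (fun w => integralT (fun t => expR (a * vf M (X0 w) t ^+ 2))) /\
    Int (fun w => integralT (fun t => expR (a * vf M (X0 w) t ^+ 2))) <= 2 * expR 1.
  apply: tonelli_le => [|w t|w|t _]; last exact: point_moment.
  - apply: (measurableT_comp (continuous_measurable_fun (@continuous_expR R))).
    apply: measurable_funM; first exact: measurable_cst.
    by apply: measurable_funX; exact: (joint_meas M mg (lam eps)).
  - exact: expR_ge0.
  - move=> t; apply: continuous_comp; last exact: continuous_expR.
    by apply: contZ; apply: contX; exact: cont_vf.
have pw w : expR (Lam w) <= expR 1 * integralT (fun t => expR (a * vf M (X0 w) t ^+ 2)).
  have cz : continuous (fun t => a * vf M (X0 w) t ^+ 2) by apply: contZ; apply: contX; exact: cont_vf.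
  have := exp_sqrt_le cz (fun t => mulr_ge0 (ltW a0) (sqr_ge0 _)).
  have -> : integralT (fun t => (a * vf M (X0 w) t ^+ 2) ^+ 2) = a ^+ 2 * al4 M (X0 w).
    rewrite /al4 -iTZ; last by apply: contX; exact: cont_vf.
    by apply: iT_eq => t; ring.
  by rewrite sqrtrM ?sqr_ge0// sqrtr_sqr ger0_norm// ltW.
have j1 := igZ mT (expR 1) i1.
have iL : ig (fun w => expR (Lam w)).
  apply: (ig_dom mT _ j1) => [|w _]; last by rewrite ger0_norm ?expR_ge0.
  apply: (measurableT_comp (continuous_measurable_fun (@continuous_expR R))).
  apply: measurable_funM; first exact: measurable_cst.
  exact: (measurableT_comp (continuous_measurable_fun (@sqrt_continuous R))).
split => //; apply: le_trans (Int_le mT iL j1 (fun w _ => pw w)) _.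
by rewrite (IntZ mT _ i1) ler_wpM2l// expR_ge0.
Qed.

(** Cauchy-Schwarz between v and v^2; the momentum is at most n^6. *)
Let cub_le w : mass M (X0 w) <= K -> eps * `|cub M (X0 w)| <= 64 / n * Lam w.
Proof.
move=> mK; set v := vf M (X0 w).
have cv : continuous v by exact: cont_vf.
have h : `|cub M (X0 w)| <= n ^+ 3 * Num.sqrt (al4 M (X0 w)).
  apply: normr_le_sqr; first by rewrite mulr_ge0 ?sqrtr_ge0// exprn_ge0// ltW.
  rewrite exprMn sqr_sqrtr// -exprM.
  have := iT_CS cv (contX (n := 2) cv); rewrite iT_vf_sqr -/(mass M (X0 w)).
  rewrite (@iT_eq _ (fun x => v x * v x ^+ 2) (fun x => v x ^+ 3)); last by move=> x; rewrite exprS.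
  rewrite (@iT_eq _ (fun x => (v x ^+ 2) ^+ 2) (fun x => v x ^+ 4)); last by move=> x; rewrite -exprM.
  by move=> /le_trans; apply; rewrite ler_wpM2r//; exact: al40.
apply: le_trans (ler_wpM2l (ltW eps0) h) _; apply: eq_ler; rewrite /Lam /a.
by field.
Qed.

Let r0 : 0 < 64 / n <= 1.
Proof. by rewrite divr_gt0//= ler_pdivrMr// mul1r. Qed.

Let Lam0 w : 0 <= Lam w. Proof. by rewrite mulr_ge0 ?sqrtr_ge0// ltW. Qed.

Hypothesis n128 : 128 <= n.
Let r2 : 64 / n <= 2^-1.
Proof. by rewrite ler_pdivrMr//; move: n128; lra. Qed.

Let room_cases w : (mass M (X0 w) <= K /\ 0 <= room M K (X0 w)) \/ (K < mass M (X0 w) /\ room M K (X0 w) < 0).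
Proof.
have [h|h] := leP (mass M (X0 w)) K; [left|right]; split => //.
  by rewrite /room subr_ge0 ler_pdivrMr// mul1r.
by rewrite /room subr_lt0 ltr_pdivlMr// mul1r.
Qed.

Lemma density_square : ig (fun w => D w ^+ 2) /\ Int (fun w => D w ^+ 2) <= expR 1 * (2 * expR 1).
Proof.
have [iL hL] := exp_Lam.
have iD : ig (fun w => D w) by exact: ig_D.
have mD := ig_meas iD.
have pw w : D w ^+ 2 <= expR (Lam w).
  case: (room_cases w) => [[mK rm]|[mK rm]].
    rewrite /gibbs exprMn; have -> : pos2 (room M K (X0 w)) = room M K (X0 w) ^+ 2 by rewrite /pos2 /pos1 max_r.
    rewrite -[leRHS]mulr1; apply: ler_pM; rewrite ?sqr_ge0//.
      rewrite /gexp -expRM_natl ler_expR.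
      have := cub_le mK; have := ler_wpM2r (Lam0 w) r2; have := ler_norm (- cub M (X0 w)); rewrite normrN.
      move=> h; have := ler_wpM2l (ltW eps0) h; lra.
    by rewrite -exprM exprn_ile1// room_le1.
  by rewrite /gibbs /pos2 /pos1 max_l ?ltW// expr0n mulr0 expr0n expR_gt0.
have i2 : ig (fun w => D w ^+ 2).
  apply: (ig_dom mT _ iL) => [|w _]; first exact: measurable_funX.
  by rewrite ger0_norm ?sqr_ge0.
by split => //; apply: le_trans (Int_le mT i2 iL (fun w _ => pw w)) _.
Qed.

(** The exponent is at most (64 / n) Lam, and the cut-off costs twice
   mass / K, whose mean is of order n^4 / n^6. *)
Lemma density_near_one : ig (fun w => `|D w - 1|) /\
  Int (fun w => `|D w - 1|) <= 128 / n * (expR 1 * (2 * expR 1)) + 16 / n ^+ 2.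
Proof.
have [iL hL] := exp_Lam.
have iD : ig (fun w => D w) by exact: ig_D.
have im1 : ig (fun w => mass M (X0 w)) /\ Int (fun w => mass M (X0 w)) <= 8 * n ^+ 4.
  have hk k : ig (fun w => X0 w k ^+ 2) /\ Int (fun w => X0 w k ^+ 2) = lam eps k ^+ 2.
    have h2 := coord_ig2 mg gcos k; have j := igZ mT (lam eps k ^+ 2) h2.
    have E : (fun w => X0 w k ^+ 2) = fun w => lam eps k ^+ 2 * g k w ^+ 2 by apply/funext => w; rewrite /smoothed exprMn.
    rewrite E; split => //; rewrite (IntZ mT _ h2).
    have := gauss_int2 mg gcos k.+1 (fun j => (j == k)%:R).
    have -> : (fun w => lin k.+1 (fun j => (j == k)%:R) (g ^~ w) ^+ 2) = fun w => g k w ^+ 2.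
      apply/funext => w; rewrite /lin big_ord_recr /= eqxx mul1r big1 ?add0r// => i _.
      by rewrite ltn_eqF// mul0r.
    move=> ->; rewrite /sq big_ord_recr /= eqxx big1 ?add0r ?expr1n ?mulr1// => i _.
    by rewrite ltn_eqF// expr0n.
  rewrite /mass; split; first by apply: (ig_sum mT PT) => k _; have [] := hk k.
  rewrite (Int_sum mT PT) => [|k _]; last by have [] := hk k.
  rewrite (eq_bigr (fun k : 'I_d => lam eps k ^+ 2)) => [|k _]; last by have [] := hk k.
  exact: le_trans (lam2_sum M eps0 L0) var_le.
have [im hm] := im1.
have pw w : `|D w - 1| <= 128 / n * expR (Lam w) + 2 / K * mass M (X0 w).
  have e0 := expR_ge0 (Lam w); have [rp _] := andP r0.
  have re0 : 0 <= 128 / n * expR (Lam w) by rewrite mulr_ge0 ?divr_ge0// ltW.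
  case: (room_cases w) => [[mK rm]|[mK rm]]; last first.
    rewrite /gibbs /pos2 /pos1 max_l ?ltW// expr0n mulr0 sub0r normrN1.
    have : 1 < K^-1 * mass M (X0 w) by rewrite mulrC ltr_pdivlMr// mul1r.
    lra.
  have r1 := room_le1 M K1 (X0 w).
  have -> : D w = gexp M eps (X0 w) * room M K (X0 w) ^+ 2 by rewrite /gibbs /pos2 /pos1 max_r.
  set E := gexp _ _ _; set r := room _ _ _ in rm r1 *.
  have rE : mass M (X0 w) / K = 1 - r by rewrite /r /room; ring.
  have -> : 2 / K * mass M (X0 w) = 2 * (1 - r) by rewrite -rE; ring.
  have hE : `|E - 1| <= 128 / n * expR (Lam w).
    rewrite /E /gexp; set X := eps * cub M (X0 w).
    have hX : `|X| <= 64 / n * Lam w by rewrite /X normrM ger0_norm ?(ltW eps0)//; exact: cub_le.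
    have h1 : `|expR (- X) - 1| <= `|X| * expR `|X|.
      have b (y : R) : 0 <= y -> expR y - 1 <= y * expR y.
        move=> y0; have := expR_ge1Dx (- y); rewrite expRN => h.
        have := ler_wpM2l (expR_ge0 y) h; rewrite divff ?gt_eqF ?expR_gt0//; lra.
      have [X0'|X0'] := leP 0 X.
        have e1 : expR (- X) <= 1 by rewrite -expR0 ler_expR; lra.
        rewrite ler0_norm ?subr_le0// (ger0_norm X0').
        have := expR_ge1Dx (- X); have : X * 1 <= X * expR X by rewrite ler_wpM2l// -expR0 ler_expR.
        lra.
      have e1 : 1 <= expR (- X) by rewrite -expR0 ler_expR; lra.
      rewrite ger0_norm ?subr_ge0// (ltr0_norm X0'); apply: b; lra.
    apply: le_trans h1 _.
    have l0 := Lam0 w; have l2 : 0 <= Lam w / 2 by rewrite divr_ge0.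
    apply: (@le_trans _ _ ((64 / n * Lam w) * expR (Lam w / 2))).
      apply: ler_pM; [exact: normr_ge0|exact: expR_ge0|exact: hX|].
      rewrite ler_expR; apply: le_trans hX _.
      by have := ler_wpM2r l0 r2; lra.
    have h2 : Lam w <= 2 * expR (Lam w / 2) by have := expR_ge1Dx (Lam w / 2); lra.
    have h3 : expR (Lam w) = expR (Lam w / 2) * expR (Lam w / 2) by rewrite -expRD; congr expR; field.
    rewrite h3 (_ : 128 / n * (expR (Lam w / 2) * expR (Lam w / 2)) =
      64 / n * (2 * expR (Lam w / 2)) * expR (Lam w / 2)); last by field.
    by apply: ler_wpM2r; [exact: expR_ge0|apply: ler_wpM2l => //; exact: ltW].
  have r20 : 0 <= r ^+ 2 <= 1 by rewrite sqr_ge0 exprn_ile1.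
  rewrite (_ : E * r ^+ 2 - 1 = (E - 1) * r ^+ 2 + - (1 - r ^+ 2)); last by ring.
  apply: le_trans (ler_normD _ _) _; apply: lerD.
    rewrite normrM (ger0_norm (sqr_ge0 _)); apply: le_trans hE; rewrite ler_piMr//.
    by case/andP: r20.
  rewrite normrN ger0_norm; last by case/andP: r20 => ?; lra.
  have := sqr_ge0 (1 - r); lra.
have j1 := igZ mT (128 / n) iL; have j2 := igZ mT (2 / K) im.
have i1 : ig (fun w => `|D w - 1|) by apply: (ig_abs (D := setT)) => //; apply: (igB mT iD (ig_cst mT PT 1)).
split => //; apply: le_trans (Int_le mT i1 (igD mT j1 j2) (fun w _ => pw w)) _.
rewrite (IntD mT j1 j2) (IntZ mT _ iL) (IntZ mT _ im); apply: lerD.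
  by rewrite ler_wpM2l// divr_ge0// ltW.
have -> : 16 / n ^+ 2 = 2 / K * (8 * n ^+ 4) by field.
by rewrite ler_wpM2l// divr_ge0// ltW.
Qed.

End density_near_one.

(** * KdV against the Galerkin chain *)

Lemma sinusoid_lip (R : realType) (a b p q : R) : `|a| + `|b| <= 1 ->
  `|(a * cos p + b * sin p) - (a * cos q + b * sin q)| <= `|p - q|.
Proof.
move=> ab; wlog pq : p q / q <= p.
  move=> H; have [h|h] := leP q p; first exact: H.
  by rewrite distrC [leRHS]distrC; apply: H; exact: ltW.
have := @dr_lip R (fun s => a * cos s + b * sin s) (fun s => a * (- sin s) + b * cos s) q p 1.
rewrite mul1r (ger0_norm (_ : 0 <= p - q)) ?subr_ge0//; apply => //.
move=> s _; apply: le_trans (ler_normD _ _) _; apply: le_trans ab; rewrite !normrM; apply: lerD.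
  by rewrite ler_piMr// normrN ler_norml sin_geN1 sin_le1.
by rewrite ler_piMr// ler_norml cos_geN1 cos_le1.
Qed.

Lemma sinusoid_le1 (R : realType) (a b p : R) : `|a| + `|b| <= 1 -> `|a * cos p + b * sin p| <= 1.
Proof.
move=> ab; apply: le_trans (ler_normD _ _) _; apply: le_trans ab; rewrite !normrM; apply: lerD.
  by rewrite ler_piMr// ler_norml cos_geN1 cos_le1.
by rewrite ler_piMr// ler_norml sin_geN1 sin_le1.
Qed.

(** Here r stands for 1 / k, so that L = r^-2 and M + 1 = O(r^-2). *)
Lemma defect_algebra (R : realType) (r eps C c4 a4 d0 b4 h2 M1 : R) : 0 < r -> r <= 1 -> 0 < eps ->
  0 <= C -> 0 <= c4 -> 0 <= a4 -> a4 <= c4 -> 0 <= d0 -> d0 <= C ->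
  0 <= b4 -> b4 <= C * (4 / (eps * r ^- 2)) ^+ 2 -> h2 <= C * (4 / (eps * r ^- 2)) ->
  0 <= M1 -> M1 <= 4 * r ^- 2 ->
  (r + r ^+ 2) * (a4 + d0) + (r^-1 * M1) * b4 + h2 <= (2 * (c4 + C) + 64 * C / eps ^+ 2 + 4 * C / eps) * r.
Proof.
move=> r0 r1 e0 C0 c40 a40 a4c d00 dC b40 b4c h2c M0 M1c.
have r2 : r ^+ 2 <= r by rewrite expr2 ler_piMr// ltW.
have r20 : 0 <= r ^+ 2 by exact: sqr_ge0.
have A1 : (r + r ^+ 2) * (a4 + d0) <= 2 * (c4 + C) * r.
  apply: (@le_trans _ _ ((2 * r) * (c4 + C))); last by apply: eq_ler; ring.
  by apply: ler_pM; lra.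
have A2 : (r^-1 * M1) * b4 <= 64 * C / eps ^+ 2 * r.
  apply: (@le_trans _ _ (r^-1 * (4 * r ^- 2) * (C * (4 / (eps * r ^- 2)) ^+ 2))).
    apply: ler_pM => //; first by rewrite mulr_ge0// invr_ge0 ltW.
    by rewrite ler_wpM2l// invr_ge0 ltW.
  by apply: eq_ler; field; rewrite !gt_eqF.
have A3 : h2 <= 4 * C / eps * r.
  apply: le_trans h2c _.
  rewrite (_ : C * (4 / (eps * r ^- 2)) = 4 * C / eps * r ^+ 2); last by field; rewrite !gt_eqF.
  by rewrite ler_wpM2l// divr_ge0 ?(ltW e0)// mulr_ge0.
by move: (lerD (lerD A1 A2) A3) => /le_trans; apply; apply: eq_ler; ring.
Qed.

Section galerkin_limit.
Variables (R : realType) (eps K V : R).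
Hypotheses (eps0 : 0 < eps) (K1 : 1 <= K).
Context dd (T : measurableType dd) (P : probability T R).
Variable g : nat -> T -> R.
Local Notation Int f := (\int[P]_(w in setT) f w).
Local Notation ig f := (P.-integrable setT (EFin \o f)).
Hypothesis mg : forall k, measurable_fun setT (g k).
Hypothesis gcos : forall n xi, Int (fun w => cos (lin n xi (g ^~ w))) = expR (- (2^-1 * sq n xi)).
Hypothesis gsin : forall n xi, Int (fun w => sin (lin n xi (g ^~ w))) = 0.

Let mT : measurable (setT : set T). Proof. exact: measurableT. Qed.
Let PT : P setT = 1%E. Proof. exact: probability_setT. Qed.
Let K0 : 0 <= K. Proof. exact: le_trans K1. Qed.
Let K30 : 0 <= K ^+ 3. Proof. exact: exprn_ge0. Qed.

Local Notation X0 := (smoothed eps g).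
Local Notation Cw := (Cw V).
Local Notation c4 := (Cw * (4 + 4 / eps) ^+ 2).

(** Bounds for the means of stepRate and k * stepDefect, independent of k. *)
Definition Crate : R := 2 * (400 * 16 * 16 * K ^+ 3 * (Cw + Csup V eps + c4 + 12 * Cw / eps)).
Definition Cdef : R := 400 * 64 * 32 * K ^+ 3 * (2 * (c4 + Cw) + 64 * Cw / eps ^+ 2 + 4 * Cw / eps).

(** Truncation at frequency M = 3 L with L = k^2: products of three functions of
   frequency at most L stay below the truncation. *)
Section at_level.
Variable k : nat.
Hypothesis k0 : (0 < k)%N.
Local Notation M := (3 * k ^ 2)%N.
Local Notation L := (k ^ 2)%N.
Local Notation D w := (gibbs M eps K (X0 w)).
Hypotheses (iD2 : ig (fun w => D w ^+ 2)) (DV : Int (fun w => D w ^+ 2) <= V).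

Let D0 w : 0 <= D w. Proof. exact: D_ge0. Qed.
Let mD : measurable_fun setT (fun w => D w). Proof. exact: ig_meas (ig_D M eps K1 P mg). Qed.
Let iD := ig_weight mD D0 iD2.
Let hD := weight_mean mD D0 iD2 DV.
Let L0 : (0 < L)%N. Proof. by rewrite expn_gt0 k0. Qed.
Let kR : 0 < k%:R :> R. Proof. by rewrite ltr0n. Qed.
Let k1 : 1 <= k%:R :> R. Proof. by rewrite ler1n. Qed.
Let LR : L%:R = k%:R ^+ 2 :> R. Proof. by rewrite natrX. Qed.
Let MR : M%:R = 3 * k%:R ^+ 2 :> R. Proof. by rewrite natrM natrX. Qed.

Let Cw0 : 0 <= Cw.
Proof. by apply: le_trans hD; apply: Int_ge0 => w _; exact: D0. Qed.

Let M1_le : 1 + 3 * k%:R ^+ 2 <= 4 * k%:R ^+ 2 :> R.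
Proof. by have : 1 <= k%:R ^+ 2 :> R; [exact: exprn_ege1|lra]. Qed.

Lemma rate_mean J : ig (fun w => stepRate M L K (supPoly M J (X0 w)) (X0 w) * D w) /\
  Int (fun w => stepRate M L K (supPoly M J (X0 w)) (X0 w) * D w) <= Crate.
Proof.
have [i1 h1] := weighted_supPoly M mg gcos gsin mD D0 iD2 DV eps0 J.
have [i2 h2] := weighted_al4 M mg gcos gsin mD D0 iD2 DV eps0.
have [i3 h3] := weighted_hi2 M mg gcos gsin mD D0 iD2 DV eps0 L0.
set C := 2 * (400 * 16 * 16 * K ^+ 3).
have C0 : 0 <= C.
  exact: (mulr_ge0 (ler0n _ 2) (mulr_ge0 (mulr_ge0 (mulr_ge0 (ler0n _ _) (ler0n _ _)) (ler0n _ _)) K30)).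
have E : (fun w => stepRate M L K (supPoly M J (X0 w)) (X0 w) * D w) = fun w =>
    C * (((D w + supPoly M J (X0 w) * D w) + al4 M (X0 w) * D w) + M%:R * (hi2 M L (X0 w) * D w)).
  by apply/funext => w; rewrite /stepRate /C; ring.
have j1 := igD mT iD i1; have j2 := igD mT j1 i2; have j3 := igD mT j2 (igZ mT M%:R i3).
rewrite E; split; first exact: igZ.
rewrite (IntZ mT _ j3) (IntD mT j2 (igZ mT M%:R i3)) (IntD mT j1 i2) (IntD mT iD i1) (IntZ mT _ i3).
rewrite /Crate (_ : 2 * (400 * 16 * 16 * K ^+ 3 * _) = C * (Cw + Csup V eps + c4 + 12 * Cw / eps)); last by rewrite /C; ring.
apply: ler_wpM2l => //; apply: lerD; first by apply: lerD => //; apply: lerD.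
apply: (@le_trans _ _ (M%:R * (Cw * (4 / (eps * L%:R))))); first by rewrite ler_wpM2l.
by apply: eq_ler; rewrite MR LR; field; rewrite !gt_eqF.
Qed.

Lemma defect_mean : ig (fun w => stepDefect M L K k%:R^-1 (X0 w) * D w) /\
  Int (fun w => stepDefect M L K k%:R^-1 (X0 w) * D w) <= Cdef / k%:R.
Proof.
have [i1 h1] := weighted_al4_hi M mg gcos gsin mD D0 iD2 DV eps0 L0.
have [i2 h2] := weighted_al4 M mg gcos gsin mD D0 iD2 DV eps0.
have [i3 h3] := weighted_hi2 M mg gcos gsin mD D0 iD2 DV eps0 L0.
set C := 400 * 64 * 32 * K ^+ 3.
have C0 : 0 <= C by exact: (mulr_ge0 (mulr_ge0 (mulr_ge0 (ler0n _ _) (ler0n _ _)) (ler0n _ _)) K30).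
pose r := k%:R^-1 : R; have r0 : 0 < r by rewrite invr_gt0.
have r1 : r <= 1 by rewrite invf_le1.
have E : (fun w => stepDefect M L K k%:R^-1 (X0 w) * D w) = fun w =>
    C * ((((r + L%:R^-1) * (al4 M (X0 w) * D w + D w)) + (r^-1 * (1 + M%:R)) * (al4 M (hi L (X0 w)) * D w))
     + hi2 M L (X0 w) * D w).
  by apply/funext => w; rewrite /stepDefect -/r /C; ring.
have j1 := igZ mT (r + L%:R^-1) (igD mT i2 iD); have j2 := igZ mT (r^-1 * (1 + M%:R)) i1.
have j3 := igD mT j1 j2; have j4 := igD mT j3 i3.
rewrite E; split; first exact: igZ.
rewrite (IntZ mT _ j4) (IntD mT j3 i3) (IntD mT j1 j2) (IntZ mT _ (igD mT i2 iD)) (IntD mT i2 iD) (IntZ mT _ i1).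
rewrite /Cdef -/C -mulrA; apply: ler_wpM2l => //.
have e1 : L%:R^-1 = r ^+ 2 :> R by rewrite LR /r -exprVn.
have e2 : L%:R = r ^- 2 :> R by rewrite -[LHS]invrK e1.
rewrite e2 in h1 h3; rewrite e1; apply: defect_algebra => //.
- by rewrite mulr_ge0// sqr_ge0.
- apply: Int_ge0 => w _; apply: mulr_ge0 => //.
  by apply: iT_ge0 => s; rewrite -[4%N]/(2 * 2)%N exprM sqr_ge0.
- by apply: Int_ge0 => w _.
- apply: Int_ge0 => w _; apply: mulr_ge0 => //.
  by apply: iT_ge0 => s; rewrite -[4%N]/(2 * 2)%N exprM sqr_ge0.
- by rewrite MR -e2 LR; apply: M1_le.
Qed.

Variables (t : R) (m : nat) (xi : nat -> R) (a b : R) (Z : T -> R).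
Hypotheses (t0 : 0 < t) (mM : (m <= M.*2)%N) (ab : `|a| + `|b| <= 1).
Hypothesis mZ : measurable_fun setT Z.
Hypothesis hZ : forall w, exists u, [/\ kdv_solution u, u 0 = vf M (X0 w) & Z w = lin m xi (coef (u t))].

Local Notation f y := (a * cos y + b * sin y).

Let cf : continuous (fun y : R => f y).
Proof.
have ccos : continuous (@cos R) by apply: dr_continuous => x; exact: is_derive_cos.
have csin : continuous (@sin R) by apply: dr_continuous => x; exact: is_derive_sin.
by apply: contD; apply: contZ.
Qed.

(** By the bound on the mean rate, the Gronwall exponent exceeds G with small
   probability; below G the error is controlled by the mean defect, and th is
   the threshold in Markov's inequality. *)
Lemma flow_vs_chain (G th : R) : 0 < G -> 0 < th ->
  `|Int (fun w => f (Z w) * D w) - Int (fun w => f (lin m xi (X0 w)) * D w)| <=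
  2 / G * (t * Crate) + th * Cw + 2 * sq m xi * expR G / th * (64 * K ^+ 2 * Cw / k%:R + t * Cdef / k%:R).
Proof.
move=> G0 th0.
have [J hJ] := supPoly_bound M K1.
(* q h <= 1 makes the step h short enough both for the existence of the arcs
   and for the rates to vary little along them. *)
pose q := 8 * aX R M * K ^+ 2 + (1 + M%:R) * (4 * M%:R * (aX R M * K ^+ 2)) * k%:R ^+ 2.
have a1 := @aX_ge1 R M; have aX0 : 0 <= aX R M by lra.
have q1 : 0 <= 8 * aX R M * K ^+ 2 by rewrite !mulr_ge0 ?exprn_ge0.
have q2 : 0 <= (1 + M%:R) * (4 * M%:R * (aX R M * K ^+ 2)) * k%:R ^+ 2.
  have k20 := @exprn_ge0 R 2 k%:R (ler0n _ _); have K20 := @exprn_ge0 R 2 K K0.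
  by apply: mulr_ge0 k20; apply: mulr_ge0; [rewrite addr_ge0|rewrite mulr_ge0// mulr_ge0].
pose N := (Num.bound (q * t)).+1.
have Nq : q * t <= N%:R.
  have := archi_boundP (mulr_ge0 (addr_ge0 q1 q2) (ltW t0)); rewrite -/q => h.
  by rewrite /N -natr1; lra.
have N0 : 0 < N%:R :> R by rewrite ltr0n.
pose h := t / N%:R; have h0 : 0 < h by rewrite divr_gt0.
have qh : q * h <= 1 by rewrite /h mulrA ler_pdivrMr// mul1r.
have hsmall : 8 * aX R M * K ^+ 2 * h <= 1.
  by apply: le_trans qh; rewrite ler_wpM2r ?(ltW h0)// lerDl.
pose kap := k%:R^-1 : R.
have kap0 : 0 < kap by rewrite invr_gt0.
have kap1 : kap <= 1 by rewrite invf_le1.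
have hkap : (1 + M%:R) * (4 * M%:R * (aX R M * K ^+ 2 * h)) <= kap ^+ 2.
  rewrite /kap exprVn -[leRHS]mul1r ler_pdivlMr ?exprn_gt0//; apply: le_trans qh.
  rewrite (_ : (1 + _) * _ * _ = (1 + M%:R) * (4 * M%:R * (aX R M * K ^+ 2)) * k%:R ^+ 2 * h); last by ring.
  by rewrite ler_wpM2r ?(ltW h0)// lerDr.
have NhE : N%:R * h = t by rewrite /h mulrC divfK// gt_eqF.
pose X j w := chain eps K1 h0 hsmall g j w.
(* Gronwall exponent and accumulated defect along the chain. *)
pose Gam w := \sum_(j < N) stepRate M L K (supPoly M J (X j w)) (X j w) * h.
pose bet w := 64 * K ^+ 2 / L%:R + \sum_(j < N) h * stepDefect M L K kap (X j w).
have S0 : 0 <= sq m xi by apply: sumr_ge0 => i _; exact: sqr_ge0.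
have XK j w : mass M (X0 w) <= K -> mass M (X j w) <= K by rewrite mass_chain.
have sup0 j w : mass M (X0 w) <= K -> 0 <= supPoly M J (X j w).
  by move=> wK; apply: le_trans (normr_ge0 _) (hJ _ (XK j w wK) 0).
have Gam0 w : mass M (X0 w) <= K -> 0 <= Gam w.
  by move=> wK; apply: sumr_ge0 => j _; rewrite mulr_ge0 ?(ltW h0)// stepRate_ge0// sup0.
have bet0 w : 0 <= bet w.
  apply: addr_ge0; first by rewrite divr_ge0// mulr_ge0// sqr_ge0.
  by apply: sumr_ge0 => j _; rewrite mulr_ge0 ?(ltW h0)// stepDefect_ge0.
have path w : mass M (X0 w) <= K -> (Z w - lin m xi (X N w)) ^+ 2 <= sq m xi * (2 * (expR (Gam w) * bet w)).
  move=> wK; have [u [kdvu u0 zE]] := hZ w.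
  have := chain_error L0 (leqnn _) kap0 kap1 K1 h0 hsmall hkap hJ kdvu u0 wK N.
  rewrite NhE -/(Gam w) -/(bet w) => H.
  have ct : continuous (u t) by case: kdvu => su _ _; exact: smooth2_cx.
  have cv : continuous (vf M (X N w)) by exact: cont_vf.
  rewrite zE /lin -sumrB (eq_bigr (fun i : 'I_m => xi i * (coef (u t) i - X N w i))); last first.
    by move=> i _; rewrite mulrBr.
  apply: le_trans (sum_CS _ _ _ _) _; apply: ler_wpM2l => //; apply: le_trans H.
  apply: le_trans (sum_coef_le M (contB ct cv)).
  rewrite (eq_bigr (fun i : 'I_m => coef (fun s => u t s - vf M (X N w) s) i ^+ 2)); last first.
    move=> i _; congr (_ ^+ 2); rewrite -[X in _ - X](@coef_vf R M (X N w) i (leq_trans (ltn_ord i) mM)).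
    rewrite /coef (@iT_eq _ (fun x => (u t x - vf M (X N w) x) * emode R i x)
       (fun x => u t x * emode R i x - vf M (X N w) x * emode R i x)); last by move=> s; ring.
    by rewrite iTB//; apply: contM => //; exact: cont_emode.
  rewrite -(big_mkord xpredT (fun i => coef (fun s => u t s - vf M (X N w) s) i ^+ 2)).
  rewrite -(big_mkord xpredT (fun i => coef (fun s => u t s - vf M (X N w) s) i ^+ 2)).
  by rewrite [leRHS](big_cat_nat _ mM)//= lerDl; apply: sumr_ge0 => i _; exact: sqr_ge0.
have pw w : mass M (X0 w) <= K -> `|f (Z w) - f (lin m xi (X N w))| <=
    2 / G * Gam w + th + 2 * sq m xi * expR G / th * bet w.
  move=> wK; have g0 := Gam0 w wK; have b0 := bet0 w.
  have p1 : 0 <= 2 / G * Gam w by rewrite mulr_ge0// divr_ge0// ltW.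
  have p2 : 0 <= 2 * sq m xi * expR G / th * bet w.
    by rewrite mulr_ge0// divr_ge0 ?(ltW th0)// !mulr_ge0 ?expR_ge0.
  have [GG|GG] := leP (Gam w) G; last first.
    have : 2 <= 2 / G * Gam w by rewrite mulrAC ler_pdivlMr// ler_wpM2l// ltW.
    have := ler_normB (f (Z w)) (f (lin m xi (X N w))).
    by have := sinusoid_le1 (Z w) ab; have := sinusoid_le1 (lin m xi (X N w)) ab; lra.
  apply: le_trans (sinusoid_lip _ _ ab) _; set rho := `|_|.
  have r2 : rho ^+ 2 <= 2 * sq m xi * expR G * bet w.
    rewrite /rho real_normK ?num_real//; apply: le_trans (path w wK) _.
    rewrite (_ : 2 * _ * _ * _ = sq m xi * (2 * (expR G * bet w))); last by ring.
    by rewrite !ler_wpM2l// ler_wpM2r// ler_expR.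
  have r0 : 0 <= rho by exact: normr_ge0.
  have : rho <= th + rho ^+ 2 / th.
    have [rt|rt] := leP rho th; first by rewrite ler_wpDr// divr_ge0 ?sqr_ge0// ltW.
    by rewrite ler_wpDl ?(ltW th0)// ler_pdivlMr// expr2 ler_wpM2l// ltW.
  have : rho ^+ 2 / th <= 2 * sq m xi * expR G / th * bet w.
    rewrite [leRHS]mulrAC; apply: ler_wpM2r => //; by rewrite invr_ge0 ltW.
  lra.
have pS j : ig (fun w => stepRate M L K (supPoly M J (X j w)) (X j w) * D w) /\
    Int (fun w => stepRate M L K (supPoly M J (X j w)) (X j w) * D w) <= Crate.
  have pp : polyn M (fun x => stepRate M L K (supPoly M J x) x).
    apply: polynZ; apply: polynZ; apply: polynD.
      apply: polynD; [apply: polynD; [exact: polyn_cst|exact: polyn_supPoly]|exact: polyn_al4].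
    by apply: polynZ; exact: polyn_hi2.
  split; first exact: (ig_chain eps K1 h0 hsmall P mg j pp).
  by rewrite (chain_moment eps0 K1 h0 hsmall mg gcos gsin j pp); have [] := rate_mean J.
have pD j : ig (fun w => stepDefect M L K kap (X j w) * D w) /\
    Int (fun w => stepDefect M L K kap (X j w) * D w) <= Cdef / k%:R.
  have pp : polyn M (fun x => stepDefect M L K kap x).
    apply: polynZ; apply: polynD.
      apply: polynD; last exact: polyn_hi2.
      apply: polynD; first by apply: polynZ; apply: polynD; [exact: polyn_al4|exact: polyn_cst].
      by apply: polynZ; apply: polynZ; apply: polyn_hi; exact: polyn_al4.
    rewrite (_ : (fun x => _) = fun x => L%:R^-1 * (al4 M x + 1)); last by apply/funext => x; rewrite mulrC.
    by apply: polynZ; apply: polynD; [exact: polyn_al4|exact: polyn_cst].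
  split; first exact: (ig_chain eps K1 h0 hsmall P mg j pp).
  by rewrite (chain_moment eps0 K1 h0 hsmall mg gcos gsin j pp); have [] := defect_mean.
have iG : ig (fun w => Gam w * D w) /\ Int (fun w => Gam w * D w) <= t * Crate.
  have E : (fun w => Gam w * D w) = fun w => \sum_(j < N) h * (stepRate M L K (supPoly M J (X j w)) (X j w) * D w).
    by apply/funext => w; rewrite /Gam mulr_suml; apply: eq_bigr => j _; ring.
  rewrite E; split; first by apply: (ig_sum mT PT) => j _; apply: (igZ mT); have [] := pS j.
  rewrite (Int_sum mT PT) => [|j _]; last by apply: (igZ mT); have [] := pS j.
  apply: (@le_trans _ _ (\sum_(j < N) h * Crate)).
    by apply: ler_sum => j _; rewrite (IntZ mT _ (pS j).1) ler_wpM2l ?(ltW h0)//; have [] := pS j.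
  by rewrite sumr_const card_ord -mulrnAl -[h *+ N]mulr_natl NhE.
have iB : ig (fun w => bet w * D w) /\ Int (fun w => bet w * D w) <= 64 * K ^+ 2 * Cw / k%:R + t * Cdef / k%:R.
  have E : (fun w => bet w * D w) = fun w => (64 * K ^+ 2 / L%:R) * D w + \sum_(j < N) h * (stepDefect M L K kap (X j w) * D w).
    by apply/funext => w; rewrite /bet mulrDl mulr_suml; congr (_ + _); apply: eq_bigr => j _; rewrite mulrA.
  have iS : ig (fun w => \sum_(j < N) h * (stepDefect M L K kap (X j w) * D w)).
    by apply: (ig_sum mT PT) => j _; apply: (igZ mT); have [] := pD j.
  have iZ := igZ mT (64 * K ^+ 2 / L%:R) iD.
  rewrite E; split; first exact: (igD mT iZ iS).
  rewrite (IntD mT iZ iS) (IntZ mT _ iD); apply: lerD.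
    have c0 : 0 <= 64 * K ^+ 2 by rewrite mulr_ge0// sqr_ge0.
    rewrite (_ : 64 * K ^+ 2 * Cw / k%:R = (64 * K ^+ 2 / k%:R) * Cw); last by ring.
    apply: ler_pM => //; [by rewrite divr_ge0|by apply: Int_ge0 => w _; exact: D0|].
    rewrite LR ler_wpM2l// lef_pV2 ?posrE ?exprn_gt0// expr2 ler_peMr// ltW.
  rewrite (Int_sum mT PT) => [|j _]; last by apply: (igZ mT); have [] := pD j.
  apply: (@le_trans _ _ (\sum_(j < N) h * (Cdef / k%:R))).
    by apply: ler_sum => j _; rewrite (IntZ mT _ (pD j).1) ler_wpM2l ?(ltW h0)//; have [] := pD j.
  by rewrite sumr_const card_ord -mulrnAl -[h *+ N]mulr_natl NhE mulrA.
have mf (Y : T -> R) : measurable_fun setT Y -> ig (fun w => f (Y w) * D w).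
  move=> mY; apply: (ig_on_ball K1 P mg (C := 1)); last by move=> w _; exact: sinusoid_le1.
  exact: (measurableT_comp (continuous_measurable_fun cf) mY).
have mX : measurable_fun setT (fun w => lin m xi (X N w)).
  by apply: (lin_meas (Z := fun k w => X N w k)) => i; exact: chain_meas.
have i1 := mf _ mZ; have i2 := mf _ mX.
rewrite -(chain_trig eps0 K1 h0 hsmall mg gcos gsin xi a b N mM) -(IntB mT i1 i2).
have [jG hG] := iG; have [jB hB] := iB.
set c1 := 2 / G; set c2 := 2 * sq m xi * expR G / th.
have c10 : 0 <= c1 by rewrite divr_ge0// ltW.
have c20 : 0 <= c2 by rewrite divr_ge0 ?(ltW th0)// !mulr_ge0 ?expR_ge0.
have j1 := igZ mT c1 jG; have j2 := igZ mT th iD; have j3 := igZ mT c2 jB.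
have j12 := igD mT j1 j2; have j123 := igD mT j12 j3.
apply: le_trans (Int_abs_le mT (ig_meas (igB mT i1 i2)) j123 _) _.
  move=> w _; rewrite -mulrBl; have [wK|wK] := boolP (mass M (X0 w) <= K); last by rewrite D_off_ball// !mulr0 normr0 !addr0.
  rewrite normrM (ger0_norm (D0 w)); apply: le_trans (ler_wpM2r (D0 w) (pw w wK)) _.
  by apply: eq_ler; rewrite -/c1 -/c2; ring.
rewrite (IntD mT j12 j3) (IntD mT j1 j2) (IntZ mT _ jG) (IntZ mT _ iD) (IntZ mT _ jB).
apply: lerD; last exact: ler_wpM2l.
apply: lerD; first exact: ler_wpM2l.
by rewrite ler_wpM2l// ltW.
Qed.

End at_level.

End galerkin_limit.

(** * Coordinates on Sobolev spaces *)

Section coordinates.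
Variables (R : realType) (s : R).
Local Notation dr f x l := (is_derive (x : R) (1 : R) (f : R -> R) (l : R)).
Local Notation e := (emode R).
Implicit Types (U : test_function R -> R) (z : nat -> R).

Definition homogeneous U := forall (a : R) (f h : test_function R), (forall x, h x = a * f x) -> U h = a * U f.

Lemma distribution_homogeneous (u : distribution R) : homogeneous u.
Proof.
move=> a f h hf; rewrite (@pairing_linear R u (a - 1) f f h); last by move=> x; rewrite hf; ring.
by ring.
Qed.

Lemma sub_homogeneous (u v : distribution R) : homogeneous (u \- v).
Proof. by move=> a f h hf; rewrite /= !(distribution_homogeneous _ hf); ring. Qed.

Definition wgt (j : nat) : R := j.+1%:R `^ (2 * s).
(** Partial sums of the squared Sobolev norm, in the real trigonometric basis. *)
Definition psum (N : nat) z : R := \sum_(j < N) wgt j * (z j.*2 ^+ 2 + z j.*2.+1 ^+ 2).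

Lemma wgt_gt0 j : 0 < wgt j. Proof. by apply: powR_gt0; rewrite ltr0n. Qed.

Lemma psum_term_ge0 j z : 0 <= wgt j * (z j.*2 ^+ 2 + z j.*2.+1 ^+ 2).
Proof. by rewrite mulr_ge0 ?addr_ge0 ?sqr_ge0// ltW// wgt_gt0. Qed.

Lemma psum_mono N N' z : (N <= N')%N -> psum N z <= psum N' z.
Proof.
move=> NN; rewrite /psum -!(big_mkord xpredT (fun j => wgt j * (z j.*2 ^+ 2 + z j.*2.+1 ^+ 2))).
by rewrite [leRHS](big_cat_nat _ NN)//= lerDl; apply: sumr_ge0 => j _; exact: psum_term_ge0.
Qed.

Definition nonzero_int (k : nat) : int := if odd k then - (k./2.+1)%:Z else (k./2.+1)%:Z.

Lemma nonzero_int_bij : set_bij [set: nat] [set n : int | n != 0] nonzero_int.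
Proof.
split.
- by move=> k _ /=; rewrite /nonzero_int; case: odd; rewrite ?oppr_eq0.
- move=> i j _ _; rewrite /nonzero_int => h.
  rewrite -(odd_double_half i) -(odd_double_half j).
  by move: h; case: (odd i); case: (odd j) => h; move: h; lia.
- move=> [n|n] /= n0.
    exists (n.-1).*2 => //; rewrite /nonzero_int odd_double doubleK; case: n n0 => [//|n _ /=].
    by [].
  exists (n.*2.+1) => //; rewrite /nonzero_int /= odd_double /= uphalf_double NegzE.
  by [].
Qed.

Lemma emode_cos (j : nat) U : homogeneous U -> U (e j.*2) = Num.sqrt 2 * U (cos_mode R j.+1).
Proof.
move=> hU; apply: hU => x; rewrite emodeE /cos_amp /sin_amp odd_double mul0r addr0 /=.
by rewrite /trig mul1r mul0r addr0 /freq doubleK.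
Qed.

Lemma emode_sin (j : nat) U : homogeneous U -> U (e j.*2.+1) = Num.sqrt 2 * U (sin_mode R j.+1).
Proof.
move=> hU; apply: hU => x; rewrite emodeE /cos_amp /sin_amp /= odd_double /= mul0r add0r.
by rewrite /trig mul1r mul0r add0r /freq /= uphalf_double.
Qed.

Lemma fourier_sqmod_coord U k : homogeneous U ->
  fourier_sqmod U (nonzero_int k) = 2^-1 * (U (e (k./2).*2) ^+ 2 + U (e (k./2).*2.+1) ^+ 2).
Proof.
move=> hU; rewrite emode_cos// emode_sin// !exprMn sqr_sqrtr// /fourier_sqmod /nonzero_int.
case: (odd k); last by field.
have -> : U (cos_mode R (- (k./2.+1)%:Z)) = U (cos_mode R k./2.+1).
  rewrite -[RHS]mul1r; apply: hU => x; rewrite /= /trig !mul0r !addr0 !mul1r mulrNz mulrN mulNr cosN//.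
have -> : U (sin_mode R (- (k./2.+1)%:Z)) = - U (sin_mode R k./2.+1).
  rewrite -[RHS]mulN1r; apply: hU => x; rewrite /= /trig !mul0r !add0r !mul1r mulrNz mulrN mulNr sinN mulN1r//.
by field.
Qed.

Let b U k : R := wgt k./2 * (2^-1 * (U (e (k./2).*2) ^+ 2 + U (e (k./2).*2.+1) ^+ 2)).

Let b0 U k : 0 <= b U k.
Proof. by rewrite mulr_ge0 ?(ltW (wgt_gt0 _))// mulr_ge0 ?addr_ge0 ?sqr_ge0. Qed.

Let sqnorm_series U : homogeneous U -> (sobolev_sqnorm s U = \sum_(k <oo) (b U k)%:E)%E.
Proof.
move=> hU; rewrite /sobolev_sqnorm (@reindex_esum R _ _ _ _ nonzero_int _ nonzero_int_bij) nneseries_esumT; last first.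
  by move=> k; rewrite lee_fin.
apply: eq_esum => k _; rewrite fourier_sqmod_coord// /b /wgt; congr (_ `^ _ * _)%:E.
rewrite /nonzero_int; case: odd; first by rewrite mulrNz normrN; rewrite ger0_norm.
by rewrite ger0_norm.
Qed.

Let psum_series U N : \sum_(0 <= k < N.*2) b U k = psum N (fun k => U (e k)).
Proof.
elim: N => [|N IH]; first by rewrite big_nil /psum big_ord0.
rewrite doubleS !big_nat_recr//= IH /psum big_ord_recr /= /b /= uphalf_double doubleK.
by field.
Qed.

(** The modes n and - n of a real distribution have the same modulus, and both
   are given by the coordinates of one frequency. *)
Lemma sqnorm_le U (c : R) : homogeneous U ->
  (sobolev_sqnorm s U <= c%:E)%E <-> forall N, psum N (fun k => U (e k)) <= c.
Proof.
move=> hU; rewrite sqnorm_series//; split=> [h N|h].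
  rewrite -lee_fin; apply: le_trans h; rewrite -psum_series -sumEFin.
  by apply: nneseries_lim_ge => k _ _; rewrite lee_fin.
apply: lime_le; first by apply: is_cvg_nneseries => k _ _; rewrite lee_fin.
apply: nearW => n; rewrite sumEFin lee_fin; apply: le_trans (h n).
rewrite -psum_series (big_cat_nat (leq0n n) (_ : (n <= n.*2)%N))//=; last by rewrite -addnn leq_addr.
by rewrite lerDl; apply: sumr_ge0.
Qed.

Lemma sobolev_norm_le U (q : R) : homogeneous U -> 0 <= q ->
  (forall N, psum N (fun k => U (e k)) <= q ^+ 2) -> sobolev_norm s U <= q.
Proof.
move=> hU q0 /(sqnorm_le _ hU) h; rewrite /sobolev_norm -[leRHS]ger0_norm// -sqrtr_sqr.
apply: ler_wsqrtr; rewrite -lee_fin fineK// ge0_fin_numE ?sobolev_sqnorm_ge0//.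
exact: le_lt_trans h (ltry _).
Qed.

Lemma psum_le_norm U N : homogeneous U -> (sobolev_sqnorm s U < +oo)%E ->
  psum N (fun k => U (e k)) <= sobolev_norm s U ^+ 2.
Proof.
move=> hU fU; rewrite /sobolev_norm sqr_sqrtr ?fine_ge0 ?sobolev_sqnorm_ge0//.
move: N; apply/sqnorm_le => //; rewrite fineK// ge0_fin_numE ?sobolev_sqnorm_ge0//.
Qed.

Lemma sub_finite (u v : sobolev0 s) : (sobolev_sqnorm s (u \- v)%R < +oo)%E.
Proof.
have hu := distribution_homogeneous u; have hv := distribution_homogeneous v.
have B N : psum N (fun k => (u \- v) (e k)) <= 2 * sobolev_norm s u ^+ 2 + 2 * sobolev_norm s v ^+ 2.
  apply: (@le_trans _ _ (2 * psum N (fun k => u (e k)) + 2 * psum N (fun k => v (e k)))).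
    rewrite /psum !mulr_sumr -big_split; apply: ler_sum => j _ /=.
    rewrite mulrCA [2 * (_ * _)]mulrCA -mulrDr; apply: ler_wpM2l; first exact: ltW (wgt_gt0 _).
    have sq (x y : R) : (x - y) ^+ 2 <= 2 * x ^+ 2 + 2 * y ^+ 2 by have := sqr_ge0 (x + y); lra.
    by have := sq (u (e j.*2)) (v (e j.*2)); have := sq (u (e j.*2.+1)) (v (e j.*2.+1)); lra.
  by apply: lerD; rewrite ler_wpM2l// psum_le_norm// sobolev0_finite.
by apply: le_lt_trans (ltry _); apply/sqnorm_le; [exact: sub_homogeneous|exact: B].
Qed.

Lemma coord_le_norm (u v : sobolev0 s) k : `|u (e k) - v (e k)| <= Num.sqrt (wgt k./2)^-1 * sobolev_norm s (u \- v).
Proof.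
have n0 : 0 <= sobolev_norm s (u \- v) by exact: sqrtr_ge0.
apply: normr_le_sqr; first by rewrite mulr_ge0 ?sqrtr_ge0.
have w0 := wgt_gt0 k./2.
rewrite exprMn sqr_sqrtr ?invr_ge0 ?(ltW w0)// mulrC ler_pdivlMr//.
apply: le_trans (psum_le_norm k./2.+1 (sub_homogeneous u v) (sub_finite u v)).
rewrite /psum big_ord_recr /=; apply: ler_wpDl; first by apply: sumr_ge0 => j _; exact: (psum_term_ge0 j (fun i => (u \- v) (e i))).
rewrite mulrC; apply: ler_wpM2l; first exact: ltW.
have : (odd k + k./2.*2 = k)%N by exact: odd_double_half.
by case: (odd k) => /=; move: k./2 => j <-; rewrite ?add1n ?add0n ?lerDl ?lerDr ?sqr_ge0.
Qed.

Lemma ball_norm (u v : sobolev0 s) (r : R) : ball u r v = (sobolev_norm s (u \- v) < r).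
Proof. by []. Qed.

Lemma cont_coord k : continuous (fun u : sobolev0 s => u (e k)).
Proof.
move=> u; apply/(@cvgrPdist_lt R _ _ (nbhs u) (nbhs_filter u)) => r r0; rewrite -nbhs_ballE.
set C := Num.sqrt (wgt k./2)^-1.
have C0 : 0 < C by rewrite sqrtr_gt0 invr_gt0 wgt_gt0.
exists (r / C) => /=; first exact: divr_gt0.
move=> v; rewrite ball_norm => h; apply: le_lt_trans (coord_le_norm u v k) _.
by rewrite mulrC -ltr_pdivlMr.
Qed.

(** Beyond N, the tail of the norm of u bounds the difference whatever v does;
   the N first frequencies are handled by del.  Smoothing and rational
   truncation are both approximations of this kind. *)
Lemma relative_approx (u : sobolev0 s) (r : R) : 0 < r -> exists N del, 0 < del /\
  forall v : sobolev0 s, (forall k, `|u (e k) - v (e k)| <= `|u (e k)|) ->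
   (forall k, (k < N.*2)%N -> `|u (e k) - v (e k)| <= del * `|u (e k)|) -> ball u r v.
Proof.
move=> r0; have hu := distribution_homogeneous u.
pose A := sobolev_norm s u ^+ 2; pose z k := u (e k).
have zA N : psum N z <= A by exact: psum_le_norm (sobolev0_finite u).
have rr : 0 < (r / 2) ^+ 2 by rewrite exprn_gt0// divr_gt0.
have [N hN] : exists N, A - (r / 2) ^+ 2 / 2 <= psum N z.
  apply: contrapT => /forallNP H.
  have [A0|A0] := ltP (A - (r / 2) ^+ 2 / 2) 0.
    by apply: (H 0%N); rewrite /psum big_ord0 ltW.
  have : sobolev_norm s u <= Num.sqrt (A - (r / 2) ^+ 2 / 2).
    apply: sobolev_norm_le; [exact: hu|exact: sqrtr_ge0|].
    by move=> N; rewrite sqr_sqrtr//; have /negP := H N; rewrite -ltNge => /ltW.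
  move=> h; have : A <= Num.sqrt (A - (r / 2) ^+ 2 / 2) ^+ 2 by apply: lerXn2r; rewrite ?nnegrE ?sqrtr_ge0.
  rewrite sqr_sqrtr//; by move: rr; set y := (r / 2) ^+ 2; clearbody y; lra.
have A0 : 0 <= A by exact: sqr_ge0.
pose del := Num.sqrt ((r / 2) ^+ 2 / (2 * (A + 1))).
have q0 : 0 < (r / 2) ^+ 2 / (2 * (A + 1)) by rewrite divr_gt0// mulr_gt0//; lra.
have del2 : del ^+ 2 * A <= (r / 2) ^+ 2 / 2.
  rewrite sqr_sqrtr ?(ltW q0)//; move: rr; set y := (r / 2) ^+ 2; clearbody y => y0.
  rewrite (_ : y / (2 * (A + 1)) * A = (y / 2) * (A / (A + 1))); last by field; lra.
  by rewrite ler_piMr ?divr_ge0 ?(ltW y0)// ler_pdivrMr ?mul1r; lra.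
exists N, del; split; first by rewrite sqrtr_gt0.
move=> v h1 h2; rewrite ball_norm; apply: (@le_lt_trans _ _ (r / 2)); last by lra.
apply: sobolev_norm_le; [exact: sub_homogeneous|by rewrite divr_ge0// ltW|move=> N1].
pose N' := maxn N1 N.
apply: le_trans (psum_mono _ (leq_maxl N1 N)) _; rewrite -/N'.
have sq1 k : (u (e k) - v (e k)) ^+ 2 <= z k ^+ 2.
  by rewrite -(real_normK (num_real (_ - _))) -(real_normK (num_real (z k))); apply: lerXn2r; rewrite ?nnegrE.
have sq2 k : (k < N.*2)%N -> (u (e k) - v (e k)) ^+ 2 <= del ^+ 2 * z k ^+ 2.
  move=> kN; rewrite -(real_normK (num_real (_ - _))) -(real_normK (num_real (z k))) -exprMn.
  by apply: lerXn2r; rewrite ?nnegrE ?mulr_ge0 ?sqrtr_ge0//; exact: h2.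
have split_ x : psum N' x = psum N x + \sum_(N <= j < N') wgt j * (x j.*2 ^+ 2 + x j.*2.+1 ^+ 2).
  rewrite /psum -!(big_mkord xpredT (fun j => wgt j * (x j.*2 ^+ 2 + x j.*2.+1 ^+ 2))).
  by rewrite (big_cat_nat (leq0n N) (leq_maxr N1 N)).
have P1 : psum N (fun k => (u \- v) (e k)) <= del ^+ 2 * psum N z.
  rewrite /psum mulr_sumr; apply: ler_sum => j _; rewrite mulrCA; apply: ler_wpM2l; first exact: ltW (wgt_gt0 _).
  by rewrite mulrDr; apply: lerD; apply: sq2; have := ltn_ord j; clear; lia.
have P2 : \sum_(N <= j < N') wgt j * ((u \- v) (e j.*2) ^+ 2 + (u \- v) (e j.*2.+1) ^+ 2) <=
    \sum_(N <= j < N') wgt j * (z j.*2 ^+ 2 + z j.*2.+1 ^+ 2).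
  apply: ler_sum => j _; apply: ler_wpM2l; first exact: ltW (wgt_gt0 _).
  by apply: lerD; exact: sq1.
have P3 : psum N' z <= A by [].
have P4 : del ^+ 2 * psum N z <= del ^+ 2 * A by rewrite ler_wpM2l// sqr_ge0.
rewrite split_; rewrite split_ in P3; move: del2 hN P1 P2 P3 P4.
set y := (r / 2) ^+ 2; clearbody y; lra.
Qed.

Lemma norm_mono (u v u' v' : sobolev0 s) : (forall k, `|u (e k) - v (e k)| <= `|u' (e k) - v' (e k)|) ->
  sobolev_norm s (u \- v) <= sobolev_norm s (u' \- v').
Proof.
move=> h; apply: sobolev_norm_le; [exact: sub_homogeneous|exact: sqrtr_ge0|move=> N].
apply: le_trans (psum_le_norm N (sub_homogeneous u' v') (sub_finite u' v')).
have sq k : (u (e k) - v (e k)) ^+ 2 <= (u' (e k) - v' (e k)) ^+ 2.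
  by rewrite -(real_normK (num_real (_ - _))) -[leRHS](real_normK (num_real _)); apply: lerXn2r; rewrite ?nnegrE.
by apply: ler_sum => j _; apply: ler_wpM2l; [exact: ltW (wgt_gt0 _)|apply: lerD; exact: sq].
Qed.

Lemma smooth_vf M z : smooth (vf M z).
Proof.
move=> n x; have -> : derive1n n (vf M z) = vf M (iter n (@Dx R) z).
  elim: n => [//|n IH]; rewrite derive1nS IH iterS; apply/funext => y.
  by rewrite derive1E; have [_ ->] := dr_vf M (iter n (@Dx R) z) y.
by have [] := dr_vf M (iter n (@Dx R) z) x.
Qed.

Definition tvf M z : test_function R := TestFunction (@smooth_vf M z) (@vf_periodic R M z).

Lemma pairing_tvf (u : distribution R) M z : u (tvf M z) = \sum_(k < M.*2) z k * u (e k).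
Proof.
pose tr j k := if (k < j)%N then z k else 0.
have key j : (j <= M.*2)%N -> u (tvf M (tr j)) = \sum_(k < j) z k * u (e k).
  elim: j => [_|j IH jM].
    rewrite big_ord0 (distribution_homogeneous u (a := 0) (f := tvf M (tr 0%N))) ?mul0r// => x /=.
    by rewrite mul0r /vf big1// => k _; rewrite mul0r.
  rewrite big_ord_recr /= -IH ?(ltnW jM)// addrC; apply: pairing_linear => x /=.
  rewrite /vf (bigD1 (Ordinal jM))//= [in RHS](bigD1 (Ordinal jM))//= /tr ltnSn ltnn mul0r add0r.
  congr (_ + _); apply: eq_bigr => k; rewrite -val_eqE /= => kj.
  by rewrite ltnS leq_eqVlt (negPf kj).
rewrite -key//; rewrite -[RHS]mul1r; apply: distribution_homogeneous => x /=.
by rewrite mul1r; apply: eq_vf => k kM; rewrite /tr kM.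
Qed.

Lemma coef_vf_out M z k : (M.*2 <= k)%N -> coef (vf M z) k = 0.
Proof.
move=> Mk; rewrite /coef; under iT_eq do rewrite mulrC.
rewrite iT_vfM; last exact: cont_emode.
rewrite big1// => j _; rewrite {1}/coef iT_emodeM (_ : (k == j) = false) ?mul0r//.
by apply/negbTE; rewrite neq_ltn (leq_trans (ltn_ord j) Mk) orbT.
Qed.

Lemma test_cont (f : test_function R) : continuous f.
Proof.
move=> x; apply: differentiable_continuous; apply/derivable1_diffP.
by have := @test_smooth R f 0%N x.
Qed.

Lemma emb_exists M z : exists w : sobolev0 s, represents (vf M z) w.
Proof.
have cv := @cont_vf R M z.
have lin_ (a : R) (f g h : test_function R) : (forall x, h x = a * f x + g x) ->
    integralT (fun x => vf M z x * h x) = a * integralT (fun x => vf M z x * f x) + integralT (fun x => vf M z x * g x).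
  move=> hh; have cf := @test_cont f; have cg := @test_cont g.
  rewrite (@iT_eq _ _ (fun x => a * (vf M z x * f x) + vf M z x * g x)); last by move=> x; rewrite hh; ring.
  by rewrite iTD ?iTZ//; ct.
have ct_ : exists (N : nat) (C : R), forall (f : test_function R) (B : R),
    (forall k x, (k <= N)%N -> `|derive1n k f x| <= B) -> `|integralT (fun x => vf M z x * f x)| <= C * B.
  exists 0%N, (integralT (fun x => `|vf M z x|)) => f B hB; have cf := @test_cont f.
  rewrite mulrC -iTZ; last exact: cont_abs.
  apply: iT_abs_le; [by ct|by apply: contZ; exact: cont_abs|move=> x].
  by rewrite normrM mulrC ler_wpM2r//; exact: (hB 0%N x).
pose u := Distribution lin_ ct_.
have m0 : u (cos_mode R 0) = 0.
  rewrite /= (@iT_eq _ _ (vf M z)) ?iT_vf// => x.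
  by rewrite /trig mulr0 mul0r cos0 mul1r mul0r addr0 mulr1.
have fin : (sobolev_sqnorm s u < +oo)%E.
  apply: le_lt_trans (ltry (psum M (fun k => u (e k)))).
  apply/sqnorm_le; first exact: distribution_homogeneous.
  move=> N; apply: le_trans (psum_mono _ (leq_maxl N M)) _.
  rewrite /psum -!(big_mkord xpredT (fun j => wgt j * (u (e j.*2) ^+ 2 + u (e j.*2.+1) ^+ 2))).
  rewrite (big_cat_nat (leq0n M) (leq_maxr N M))//= -[leRHS]addr0 lerD2l big_nat big1// => j /andP[Mj _].
  have z1 : integralT (fun x => vf M z x * e j.*2 x) = 0 by apply: (@coef_vf_out M z); rewrite leq_double.
  have z2 : integralT (fun x => vf M z x * e j.*2.+1 x) = 0.
    by apply: (@coef_vf_out M z); rewrite ltnW// ltnS leq_double.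
  by rewrite z1 z2 !expr0n /= addr0 mulr0.
by exists (@Sobolev0 R s u m0 fin).
Qed.

Definition emb M z : sobolev0 s := sval (cid (emb_exists M z)).

Lemma emb_represents M z : represents (vf M z) (emb M z).
Proof. by rewrite /emb; case: cid. Qed.

Lemma emb_coord M z k : emb M z (e k) = if (k < M.*2)%N then z k else 0.
Proof.
rewrite emb_represents -/(coef (vf M z) k); case: ltnP => kM; first exact: coef_vf.
exact: coef_vf_out.
Qed.

End coordinates.

(** * White noise in coordinates *)

Section borel_structure.
Variables (R : realType) (s : R).
Local Notation e := (emode R).

Definition coordseq (u : sobolev0 s) (k : nat) : R := u (e k).

Lemma cont_meas_real (f : sobolev0 s -> R) : continuous f -> measurable_fun setT (f : borel_sobolev0 s -> R).
Proof.
move=> cf; apply: (measurability _ (RGenOInfty.measurableE R)) => _ [_ [x ->] <-].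
by rewrite setTI; apply: sub_sigma_algebra; apply: open_comp.
Qed.

Lemma cont_meas_self (f : sobolev0 s -> sobolev0 s) : continuous f ->
  measurable_fun setT (f : borel_sobolev0 s -> borel_sobolev0 s).
Proof.
move=> cf; apply: (@measurability _ _ (borel_sobolev0 s) (borel_sobolev0 s) setT f (@open (sobolev0 s)) erefl) => // _ [U oU <-].
by rewrite setTI; apply: sub_sigma_algebra; apply: open_comp => // u _; exact: cf.
Qed.

Let center (r : seq rat) : sobolev0 s := emb s (size r) (fun k => ratr (nth 0 r k)).
Let cell (i : seq rat * nat) : set (seqT R) :=
  [set x : nat -> R | forall N, psum s N (fun k => x k - center i.1 (e k)) <= i.2.+1%:R^-1 ^+ 2].

Let cell_meas i : measurable (cell i).
Proof.
rewrite (_ : cell i = \bigcap_N [set x : seqT R | psum s N (fun k => x k - center i.1 (e k)) <= i.2.+1%:R^-1 ^+ 2]); last first.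
  by apply/seteqP; split => x h; [move=> N _; exact: h|move=> N; exact: h].
apply: bigcapT_measurable => N.
have mh : measurable_fun setT (fun x : seqT R => psum s N (fun k => x k - center i.1 (e k))).
  apply: measurable_sum => j; apply: measurable_funM; first exact: measurable_cst.
  apply: measurable_funD; apply: measurable_funX; apply: measurable_funB; try exact: measurable_cst; exact: coord_meas.
have := mh measurableT _ (measurable_itv `]-oo, i.2.+1%:R^-1 ^+ 2]); rewrite setTI.
by congr measurable; apply/seteqP; split => x; rewrite /= in_itv.
Qed.

Let rat_approx (x del : R) : 0 < del -> exists q : rat, `|x - ratr q| <= del * `|x|.
Proof.
move=> d0; have [->|x0] := eqVneq x 0.
  by exists 0; rewrite rmorph0 subrr normr0 mulr0.
have h : x < x + del * `|x| by rewrite ltrDl mulr_gt0// normr_gt0.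
have [q] := rat_in_itvoo h; rewrite in_itv /= => /andP[q1 q2].
by exists q; rewrite distrC ger0_norm; lra.
Qed.

(** An open set is a countable union of closed balls with rational data, and
   belonging to a closed ball is a condition on the partial sums psum. *)
Lemma borel_coord (A : set (borel_sobolev0 s)) : measurable A ->
  exists2 E : set (seqT R), measurable E & A = coordseq @^-1` E.
Proof.
have : <<s @open (sobolev0 s) >> `<=` preimage_set_system setT coordseq (@measurable _ (seqT R)).
  apply: smallest_sub; first by apply: sigma_algebra_preimage; exact: sigma_algebra_measurable.
  move=> U oU; pose I (i : seq rat * nat) := forall u, cell i (coordseq u) -> U u.
  pose E := \bigcup_(i : seq rat * nat) (if `[< I i >] then cell i else set0).
  exists E.
    apply: countable_bigcupT_measurable; first exact: countableP.
    by move=> i; case: asboolP => _.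
  rewrite setTI; apply/seteqP; split => u /=.
    by move=> [i _]; case: asboolP => // Ii; exact: Ii.
  move=> Uu; have : nbhs u U by exact: open_nbhs_nbhs.
  rewrite -nbhs_ballE => -[r /= r0 rU].
  have [m hm] : exists m : nat, m.+1%:R^-1 < r / 2.
    have r20 : 0 < r / 2 by rewrite divr_gt0.
    have [m _ hm] := near_infty_natSinv_lt (PosNum r20).
    by exists m; exact: (hm m (leqnn m)).
  have q0 : 0 < m.+1%:R^-1 :> R by rewrite invr_gt0 ltr0n.
  have [N [del [d0 H]]] := relative_approx u q0.
  pose dl := Num.min 1 del; have dl0 : 0 < dl by rewrite lt_min ltr01 d0.
  have /choice[rho hrho] : forall k, exists q : rat, `|u (e k) - ratr q| <= dl * `|u (e k)|.
    by move=> k; exact: rat_approx.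
  pose rs := mkseq rho N.*2.
  (* center has twice as many coordinates as the list is long; the missing ones
     are 0, the default value of nth. *)
  have cE k : center rs (e k) = if (k < N.*2)%N then ratr (rho k) else 0.
    rewrite /center emb_coord size_mkseq; case: ltnP => kN; last first.
      by rewrite ifF//; apply/negbTE; rewrite -leqNgt; apply: leq_trans kN; rewrite -[leqRHS]addnn leq_addr.
    case: ltnP => kM; first by rewrite nth_mkseq.
    by rewrite nth_default ?rmorph0// size_mkseq.
  have hb : ball u m.+1%:R^-1 (center rs).
    apply: H => k; rewrite cE.
      case: ifP => _; last by rewrite subr0.
      by apply: le_trans (hrho k) _; rewrite ler_piMl// /dl ge_min lexx.
    move=> kN; rewrite kN; apply: le_trans (hrho k) _; rewrite ler_wpM2r// /dl ge_min lexx orbT//.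
  have n1 : sobolev_norm s (u \- center rs) < m.+1%:R^-1 by exact: hb.
  exists (rs, m) => //; case: asboolP => [_ N' /=|].
    apply: le_trans (psum_le_norm N' (sub_homogeneous u (center rs)) (sub_finite u (center rs))) _.
    by apply: lerXn2r; rewrite ?nnegrE ?sqrtr_ge0// ltW.
  case=> u' hu'; apply: rU => /=.
  have n2 : sobolev_norm s (u' \- center rs) <= m.+1%:R^-1.
    apply: sobolev_norm_le; [exact: sub_homogeneous|exact: ltW|exact: hu'].
  have n3 : sobolev_norm s (center rs \- u') <= sobolev_norm s (u' \- center rs).
    by apply: norm_mono => k; rewrite distrC.
  have b2 : ball (center rs) (r / 2) u' by rewrite ball_norm; apply: le_lt_trans n3 (le_lt_trans n2 hm).
  have b1 : ball u (r / 2) (center rs) by rewrite ball_norm; exact: lt_trans n1 hm.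
  have := ball_triangle b1 b2; by rewrite -splitr.
move=> sub mA; have [E mE EA] := sub A mA.
by exists E => //; rewrite -EA setTI.
Qed.

End borel_structure.

Section white_noise_coordinates.
Variables (R : realType) (s : R) (Q : probability (borel_sobolev0 s) R) (hQ : is_white_noise Q).
Local Notation e := (emode R).
Local Notation Int f := (\int[Q]_(w in setT) f w).

Definition gcoord (k : nat) (u : borel_sobolev0 s) : R := (u : sobolev0 s) (e k).

Lemma gcoord_meas k : measurable_fun setT (gcoord k).
Proof. apply: cont_meas_real; exact: cont_coord. Qed.

Let linE n xi (u : borel_sobolev0 s) : lin n xi (gcoord ^~ u) =
  (u : sobolev0 s) (tvf n (fun k => if (k < n)%N then xi k else 0)).
Proof.
rewrite pairing_tvf (@lin_widen R n n.*2)//.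
by rewrite -addnn leq_addr.
Qed.

Let sqE n xi : integralT (fun x => tvf n (fun k => if (k < n)%N then xi k else 0 : R) x ^+ 2) = sq n xi.
Proof.
rewrite iT_vf_sqr; have := @lin_widen R n n.*2 xi xi (_ : (n <= n.*2)%N).
rewrite /lin /sq; under eq_bigr do rewrite -expr2.
move=> ->; last by rewrite -addnn leq_addr.
by apply: eq_bigr => k _; case: ifP => _; rewrite expr2 ?mul0r.
Qed.

Lemma gcoord_cos n xi : Int (fun w => cos (lin n xi (gcoord ^~ w))) = expR (- (2^-1 * sq n xi)).
Proof.
have [h _] := hQ (f := tvf n (fun k => if (k < n)%N then xi k else 0)) (iT_vf n _).
rewrite /Rintegral; under eq_integral do rewrite linE.
by rewrite h /= sqE.
Qed.

Lemma gcoord_sin n xi : Int (fun w => sin (lin n xi (gcoord ^~ w))) = 0.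
Proof.
have [_ h] := hQ (f := tvf n (fun k => if (k < n)%N then xi k else 0)) (iT_vf n _).
by rewrite /Rintegral; under eq_integral do rewrite linE; rewrite h.
Qed.

End white_noise_coordinates.

(** * Invariance of white noise under KdV *)

(** G is chosen for the first term, then th for the second, and k last since the
   third term involves both. *)
Lemma choose_parameters (R : realType) (A B C D del : R) (k1 : nat) : 0 < del -> exists G th k,
  [/\ 0 < G, 0 < th, (k1 <= k)%N, (0 < k)%N &
   2 / G * A + th * B + C * expR G / th * (D / k%:R) <= del].
Proof.
move=> d0; pose G := 6 * (`|A| + 1) / del; pose th := del / (3 * (`|B| + 1)).
have A1 : 0 < `|A| + 1 by rewrite ltr_wpDl.
have B1 : 0 < `|B| + 1 by rewrite ltr_wpDl.
have G0 : 0 < G by rewrite divr_gt0// mulr_gt0.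
have th0 : 0 < th by rewrite divr_gt0// mulr_gt0.
pose E := 3 * `|C * expR G / th * D| / del.
have E0 : 0 <= E by rewrite divr_ge0 ?(ltW d0)// mulr_ge0.
pose k := maxn k1 (Num.bound E).+1.
have Ek : E <= k%:R.
  apply: le_trans (ltW (archi_boundP E0)) _; rewrite ler_nat /k; clear; lia.
have k0 : (0 < k)%N by rewrite /k; clear; lia.
exists G, th, k; split => //; first by rewrite /k leq_maxl.
have kR : 0 < k%:R :> R by rewrite ltr0n.
have e1 : 2 / G * A <= del / 3.
  apply: (@le_trans _ _ (2 / G * (`|A| + 1))).
    by rewrite ler_wpM2l ?divr_ge0 ?(ltW G0)//; have := ler_norm A; lra.
  by apply: eq_ler; rewrite /G; field; rewrite !gt_eqF.
have e2 : th * B <= del / 3.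
  apply: (@le_trans _ _ (th * (`|B| + 1))).
    by rewrite ler_wpM2l ?(ltW th0)//; have := ler_norm B; lra.
  by apply: eq_ler; rewrite /th; field; rewrite !gt_eqF.
have e3 : C * expR G / th * (D / k%:R) <= del / 3.
  rewrite mulrA ler_pdivrMr//; apply: le_trans (ler_norm _) _.
  have : E * (del / 3) <= k%:R * (del / 3) by rewrite ler_wpM2r// divr_ge0// ltW.
  rewrite (_ : E * (del / 3) = `|C * expR G / th * D|) 1?[_ * k%:R]mulrC//.
  by rewrite /E; field; rewrite gt_eqF.
lra.
Qed.

Section invariance.
Variables (R : realType) (s : R) (Q : probability (borel_sobolev0 s) R) (hQ : is_white_noise Q).
Variables (S : R -> sobolev0 s -> sobolev0 s) (hS : is_kdv_flow S).
Local Notation e := (emode R).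
Local Notation Int f := (\int[Q]_(w in setT) f w).
Local Notation ig f := (Q.-integrable setT (EFin \o f)).
Local Notation g := (@gcoord R s).

Let mT : measurable (setT : set (borel_sobolev0 s)). Proof. exact: measurableT. Qed.
Let PT : Q setT = 1%E. Proof. exact: probability_setT. Qed.
Let mg k : measurable_fun setT (g k). Proof. exact: gcoord_meas. Qed.
Let gcos := gcoord_cos hQ.
Let gsin := gcoord_sin hQ.

(** Coupling of white noise with the regularized Gaussian vector on one
   probability space: the regularization is removed by convergence in H^s
   instead of weak convergence. *)
Definition cutoff (eps : R) (M : nat) (u : sobolev0 s) : sobolev0 s := emb s M (smoothed eps g u).

Lemma lam_bounds (eps : R) k : 0 < eps -> 0 < lam eps k <= 1.
Proof.
move=> e0; have l0 := lam_gt0 e0 k; rewrite l0 /=.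
rewrite -(ler_pXn2r (_ : (0 < 2)%N)) ?nnegrE ?(ltW l0)// expr1n; exact: lam2_le1.
Qed.

Lemma cont_cutoff (eps : R) M : 0 < eps -> continuous (cutoff eps M).
Proof.
move=> e0 u A; rewrite -!nbhs_ballE => -[r /= r0 rA]; exists r => //= v.
rewrite ball_norm => h; apply: rA; rewrite ball_norm; apply: le_lt_trans h.
apply: norm_mono => k; rewrite !emb_coord; case: ifP => _; last by rewrite subrr normr0.
rewrite /smoothed -mulrBr normrM ler_piMl//; have /andP[l0 l1] := lam_bounds k e0.
by rewrite ger0_norm// ltW.
Qed.

Let f_cont (a b : R) : continuous (fun y : R => a * cos y + b * sin y).
Proof.
have ccos : continuous (@cos R) by apply: dr_continuous => x; exact: is_derive_cos.
have csin : continuous (@sin R) by apply: dr_continuous => x; exact: is_derive_sin.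
by apply: contD; apply: contZ.
Qed.

Let cont_lin m xi : continuous (fun u : sobolev0 s => lin m xi (g ^~ u)).
Proof.
elim: m => [|m IH] u.
  rewrite (_ : (fun u => _) = fun=> 0); last by apply/funext => v; rewrite /lin big_ord0.
  exact: (@cvg_cst _ _ _ (nbhs u) (nbhs_filter u)).
rewrite (_ : (fun u => _) = fun v : sobolev0 s => lin m xi (g ^~ v) + xi m * v (e m)); last first.
  by apply/funext => v; rewrite /lin big_ord_recr.
exact: (@cvgD _ _ _ (nbhs u) (nbhs_filter u) _ _ _ _ (IH u) (@cvgMr _ _ (nbhs u) (nbhs_filter u) _ _ _ (@cont_coord R s m u))).
Qed.

Let St_cont t : continuous (S t). Proof. by case: hS. Qed.

Section level.
Variables (t : R) (m : nat) (xi : nat -> R) (a b : R) (n : R) (L k : nat).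
Hypotheses (t0 : 0 < t) (ab : `|a| + `|b| <= 1) (n128 : 128 <= n).
Hypotheses (nL : n ^+ 4 <= L%:R <= 2 * n ^+ 4) (k0 : (0 < k)%N) (mk : (m <= (3 * k ^ 2).*2)%N).
Local Notation M := (3 * k ^ 2)%N.
Local Notation eps := (n ^- 8).
Local Notation K := (n ^+ 6).
Local Notation V := (expR 1 * (2 * expR 1) : R).
Local Notation f y := (a * cos y + b * sin y).

Let n64 : 64 <= n. Proof. by move: n128; lra. Qed.
Let np : 0 < n. Proof. by move: n128; lra. Qed.
Let eps0 : 0 < eps. Proof. by rewrite invr_gt0 exprn_gt0. Qed.
Let K1 : 1 <= K. Proof. by apply: exprn_ege1; move: n128; lra. Qed.
Let D w := gibbs M eps K (smoothed eps g w).

(** Insert the Gibbs density on both sides, at the cost given by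
   density_near_one, and apply flow_vs_chain. *)
Lemma level_estimate (G th : R) : 0 < G -> 0 < th ->
  `|Int (fun u => f (lin m xi (g ^~ (S t (cutoff eps M u))))) - Int (fun u => f (lin m xi (g ^~ (cutoff eps M u))))| <=
  2 * (128 / n * V + 16 / n ^+ 2) + (2 / G * (t * Crate eps K V) + th * Cw V +
   2 * sq m xi * expR G / th * ((64 * K ^+ 2 * Cw V + t * Cdef eps K V) / k%:R)).
Proof.
move=> G0 th0.
have [iD2 hD2] := density_square M n64 mg gcos gsin nL n128.
have [iD1 hD1] := density_near_one M n64 mg gcos gsin nL n128.
have iD := ig_D M eps K1 Q mg.
pose Z u := lin m xi (g ^~ (S t (cutoff eps M u))).
have mZ : measurable_fun setT (Z : borel_sobolev0 s -> R).
  apply: cont_meas_real => u; apply: (@cvg_comp _ _ _ (cutoff eps M) (fun v => lin m xi (g ^~ (S t v))) _ (nbhs (cutoff eps M u))).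
    exact: cont_cutoff.
  apply: (@cvg_comp _ _ _ (S t) (fun v => lin m xi (g ^~ v)) _ (nbhs (S t (cutoff eps M u)))); first exact: St_cont.
  exact: cont_lin.
have hZ w : exists u, [/\ kdv_solution u, u 0 = vf M (smoothed eps g w) & Z w = lin m xi (coef (u t))].
  case: hS => _ _ _ _ h; have [u [ku u0 ut]] := h (tvf M (smoothed eps g w)) (cutoff eps M w) (emb_represents s M _).
  exists u; split => //; apply: eq_bigr => i _; congr (_ * _).
  by rewrite /gcoord (ut t (e i)).
have Y_E w : lin m xi (g ^~ (cutoff eps M w)) = lin m xi (smoothed eps g w).
  by apply: eq_bigr => i _; rewrite /gcoord /cutoff emb_coord (leq_trans (ltn_ord i) mk).
have key := flow_vs_chain eps0 K1 mg gcos gsin k0 iD2 hD2 t0 mk ab mZ hZ G0 th0.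
have mf (Y : borel_sobolev0 s -> R) : measurable_fun setT Y -> measurable_fun setT (fun u => f (Y u)).
  move=> mY; apply: (measurableT_comp (f := fun y : R => f y) _ mY).
  exact: (continuous_measurable_fun (@f_cont a b)).
have dev (Y : borel_sobolev0 s -> R) : measurable_fun setT Y ->
    `|Int (fun u => f (Y u)) - Int (fun u => f (Y u) * D u)| <= 128 / n * V + 16 / n ^+ 2.
  move=> mY; have i1 : ig (fun u => f (Y u)).
    by apply: (ig_bdd mT PT (C := 1)); [exact: mf|move=> w _; exact: sinusoid_le1].
  have i2 : ig (fun u => f (Y u) * D u).
    by apply: (ig_on_ball K1 Q mg (C := 1)); [exact: mf|move=> w _; exact: sinusoid_le1].
  rewrite -(IntB mT i1 i2); apply: le_trans hD1.
  apply: (Int_abs_le mT (ig_meas (igB mT i1 i2)) iD1) => w _.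
  rewrite (_ : _ - _ = f (Y w) * - (D w - 1)); last by ring.
  by rewrite normrM normrN ler_piMl// sinusoid_le1.
have mY : measurable_fun setT (fun w => lin m xi (smoothed eps g w)).
  by apply: (lin_meas (Z := fun k w => smoothed eps g w k)) => i; exact: smoothed_meas.
have h1 := dev Z mZ; have h2 := dev _ mY.
under [X in _ - X]eq_Rintegral do rewrite Y_E.
have -> : (64 * K ^+ 2 * Cw V + t * Cdef eps K V) / k%:R =
   64 * K ^+ 2 * Cw V / k%:R + t * Cdef eps K V / k%:R by ring.
rewrite [X in `|X - _|](_ : _ = Int (fun u => f (Z u)))//; set I1 := Int (fun u => f (Z u)) in h1 *.
set I2 := Int (fun u => f (lin m xi (smoothed eps g u))) in h2 *.
move: h1 h2 key; rewrite /D.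
set J1 := Int (fun u => f (Z u) * _); set J2 := Int (fun u => f (lin m xi (smoothed eps g u)) * _).
move=> h1 h2 key.
have : `|I1 - I2| <= `|I1 - J1| + `|J1 - J2| + `|I2 - J2|.
  rewrite (_ : I1 - I2 = (I1 - J1) + (J1 - J2) - (I2 - J2)); last by ring.
  by apply: le_trans (ler_normB _ _) _; rewrite lerD2r ler_normD.
lra.
Qed.

End level.

(** The factors lam are at most 1, and tend to 1 at each fixed frequency, so that
   relative_approx applies. *)
Lemma cutoff_cvg (k : nat -> nat) (u : sobolev0 s) : (forall j, (j < k j)%N) ->
  cutoff ((j + 128)%:R ^- 8) (3 * k j ^ 2) u @[j --> \oo] --> u.
Proof.
move=> hk A; rewrite -nbhs_ballE => -[r /= r0 rA].
have [N [del [d0 H]]] := relative_approx u r0.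
pose F := freq R N.*2; have F0 : 0 < F by exact: freq_gt0.
have dF : 0 < del / F ^+ 2 by rewrite divr_gt0// exprn_gt0.
have [j0 _ hj0] := near_infty_natSinv_lt (PosNum dF).
exists (maxn j0 N) => // j /= jN; apply: rA; apply: H => i.
all: set eps := (j + 128)%:R ^- 8 : R.
all: have n1 : 1 <= (j + 128)%:R :> R by rewrite ler1n addn_gt0 orbT.
all: have eps0 : 0 < eps by rewrite invr_gt0 exprn_gt0// (lt_le_trans ltr01).
all: have /andP[l0 l1] := lam_bounds i eps0.
all: rewrite /cutoff emb_coord.
  case: ifP => _; last by rewrite subr0.
  rewrite /smoothed /gcoord (_ : _ - _ = (1 - lam eps i) * u (e i)); last by ring.
  rewrite normrM ler_piMl// ger0_norm ?subr_ge0//; lra.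
move=> iN; have Nk : (N <= 3 * k j ^ 2)%N.
  have := hk j; have : (N <= j)%N by apply: leq_trans jN; exact: leq_maxr.
  move: (k j) => q; clear; nia.
rewrite (leq_trans iN) ?leq_double// /smoothed /gcoord (_ : _ - _ = (1 - lam eps i) * u (e i)); last by ring.
rewrite normrM ger0_norm ?subr_ge0//; apply: ler_wpM2r => //.
have fi : freq R i <= F.
  rewrite /F /freq doubleK ler_wpM2l ?mulr_ge0 ?pi_ge0// ler_nat.
  by move: iN; rewrite ltn_half2 => /ltnW.
have h1 : 1 - lam eps i <= eps * freq R i ^+ 2.
  have b0 : 0 <= eps * freq R i ^+ 2 by apply: mulr_ge0 (sqr_ge0 _); exact: ltW.
  have l2 : lam eps i * lam eps i <= lam eps i by rewrite ler_piMr// ltW.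
  have : lam eps i ^+ 2 * (1 + eps * freq R i ^+ 2) = 1.
    by rewrite -lam_sqr// divff// expf_neq0// gt_eqF.
  have l21 : lam eps i ^+ 2 <= 1 := lam2_le1 eps0 i.
  have := ler_wpM2r b0 l21; rewrite expr2 in l21 *; lra.
have h2 : eps * freq R i ^+ 2 <= eps * F ^+ 2.
  by rewrite ler_wpM2l ?(ltW eps0)//; apply: lerXn2r; rewrite ?nnegrE ?(ltW F0)// ltW// freq_gt0.
have h3 : eps * F ^+ 2 <= del.
  rewrite -ler_pdivlMr ?exprn_gt0//.
  have jj : (j0 <= j)%N by apply: leq_trans jN; exact: leq_maxl.
  apply: le_trans (ltW (hj0 j jj)); rewrite lef_pV2 ?posrE ?exprn_gt0 ?(lt_le_trans ltr01 n1) ?ltr0n//.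
  apply: (@le_trans _ _ (j + 128)%:R); first by rewrite ler_nat; clear; lia.
  by rewrite exprS ler_peMr ?(le_trans ler01 n1)// exprn_ege1.
lra.
Qed.

(** The discrepancy at level j is made small by the choice of k, and dominated
   convergence passes to the limit since S t is continuous. *)
Lemma trig_invariant t m xi (a b : R) : 0 < t -> `|a| + `|b| <= 1 ->
  Int (fun u => a * cos (lin m xi (g ^~ (S t u))) + b * sin (lin m xi (g ^~ (S t u)))) =
  Int (fun u => a * cos (lin m xi (g ^~ u)) + b * sin (lin m xi (g ^~ u))).
Proof.
move=> t0 ab; pose V := expR 1 * (2 * expR 1) : R.
pose n j := (j + 128)%:R : R.
have n128 j : 128 <= n j by rewrite /n -[128]/(128%:R) ler_nat leq_addl.
have nL j : n j ^+ 4 <= ((j + 128) ^ 4)%N%:R <= 2 * n j ^+ 4.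
  rewrite natrX lexx /=; have : 0 <= n j ^+ 4 by apply: exprn_ge0; rewrite ler0n.
  by rewrite /n; set y := _ ^+ 4; lra.
pose F v := a * cos (lin m xi (g ^~ v)) + b * sin (lin m xi (g ^~ v)).
pose eps j := n j ^- 8.
have /choice[k hk] : forall j, exists k, [/\ (j < k)%N, (m <= (3 * k ^ 2).*2)%N &
    `|Int (fun u => F (S t (cutoff (eps j) (3 * k ^ 2) u))) - Int (fun u => F (cutoff (eps j) (3 * k ^ 2) u))| <=
    2 * (128 / n j * V + 16 / n j ^+ 2) + j.+1%:R^-1].
  move=> j; have j0 : 0 < j.+1%:R^-1 :> R by rewrite invr_gt0 ltr0n.
  have [G [th [k [G0 th0 k1 k0 H]]]] := choose_parameters (t * Crate (eps j) (n j ^+ 6) V) (Cw V)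
    (2 * sq m xi) (64 * (n j ^+ 6) ^+ 2 * Cw V + t * Cdef (eps j) (n j ^+ 6) V) (maxn j.+1 m) j0.
  have jk : (j < k)%N by apply: leq_trans k1; exact: leq_maxl.
  have mk : (m <= (3 * k ^ 2).*2)%N.
    have : (m <= k)%N by apply: leq_trans k1; exact: leq_maxr.
    move: k0; clear; nia.
  exists k; split => //.
  apply: le_trans (level_estimate xi t0 ab (n128 j) (nL j) k0 mk G0 th0) _.
  by rewrite lerD2l.
pose w j := cutoff (eps j) (3 * k j ^ 2).
have eps0 j : 0 < eps j by rewrite invr_gt0 exprn_gt0// (lt_le_trans _ (n128 j)).
have wc u : w j u @[j --> \oo] --> u by apply: cutoff_cvg => j; have [] := hk j.
have cF : continuous F.
  move=> v; apply: (@cvg_comp _ _ _ (fun v => lin m xi (g ^~ v)) (fun y => a * cos y + b * sin y) _ (nbhs (lin m xi (g ^~ v)))).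
    exact: cont_lin.
  exact: f_cont.
have F1 v : `|F v| <= 1 by exact: sinusoid_le1.
have lim (Phi : sobolev0 s -> R) : continuous Phi -> (forall v, `|Phi v| <= 1) ->
    Int (fun u => Phi (w j u)) @[j --> \oo] --> Int Phi.
  move=> cP P1; have [] // := Int_dct mT (F := fun j u => Phi (w j u)) (f := Phi) (g := fun=> 1) _ (ig_cst mT PT 1) _ _.
  - move=> j; apply: cont_meas_real => u.
    apply: (@cvg_comp _ _ _ (w j) Phi _ (nbhs (w j u))); last exact: cP.
    by apply: cont_cutoff.
  - by move=> u _; apply: (@cvg_comp _ _ _ (w ^~ u) Phi _ (nbhs u)); [exact: wc|exact: cP].
have L1 := lim (fun v => F (S t v)) _ _; have L2 := lim F cF F1.
have {}L1 : Int (fun u => F (S t (w j u))) @[j --> \oo] --> Int (fun u => F (S t u)).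
  apply: L1 => v; last exact: F1.
  by apply: (@cvg_comp _ _ _ (S t) F _ (nbhs (S t v))); [exact: St_cont|exact: cF].
have L3 := cvgB L1 L2.
have L0 : (fun j => Int (fun u => F (S t (w j u))) - Int (fun u => F (w j u))) @ \oo --> (0 : R).
  apply: (@cvg_rate R _ _ (2 * (128 * V + 16) + 1)) => j; rewrite subr0; have [_ _ h] := hk j.
  apply: le_trans h _.
  have n1 : j.+1%:R <= n j by rewrite /n ler_nat; clear; lia.
  have j0 : 0 < j.+1%:R :> R by rewrite ltr0n.
  have nj : (n j)^-1 <= j.+1%:R^-1 by rewrite lef_pV2 ?posrE// (lt_le_trans j0).
  have nj0 : 0 < (n j)^-1 by rewrite invr_gt0 (lt_le_trans j0).
  have nj1 : (n j)^-1 <= 1 by rewrite invf_le1 ?(lt_le_trans j0)// (le_trans _ n1)// ler1n.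
  have V0 : 0 <= V by rewrite /V !mulr_ge0 ?expR_ge0.
  have nj2 : (n j) ^- 2 <= j.+1%:R^-1.
    by rewrite -exprVn expr2; apply: le_trans nj; rewrite ler_piMr// ltW.
  have p := ler_wpM2r V0 (ler_wpM2l (ler0n R 128) nj).
  by move: p nj2; move: (n j)^-1 (n j ^- 2) j.+1%:R^-1 => x y z; lra.
have e0 := @cvg_unique _ (@Rhausdorff R) _ _ _ _ (L3 _) L0.
by apply/eqP; rewrite -subr_eq0; apply/eqP; exact: e0.
Qed.

Let inv_pos t (A : set (borel_sobolev0 s)) : 0 < t -> measurable A -> Q (S t @^-1` A) = Q A.
Proof.
move=> t0 mA; have [E mE ->] := borel_coord mA.
have mX k : measurable_fun setT (fun u : borel_sobolev0 s => g k (S t u)).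
  exact: (measurableT_comp (mg k) (cont_meas_self (@St_cont t))).
have one : `|1 : R| + `|0 : R| <= 1 by rewrite normr0 normr1 addr0.
have one' : `|0 : R| + `|1 : R| <= 1 by rewrite normr0 normr1 add0r.
apply: (law_event mX mg _ _ mE) => n xi.
  have := trig_invariant n xi t0 one.
  under eq_Rintegral do rewrite mul1r mul0r addr0.
  by under [X in _ = X -> _]eq_Rintegral do rewrite mul1r mul0r addr0.
have := trig_invariant n xi t0 one'.
under eq_Rintegral do rewrite mul1r mul0r add0r.
by under [X in _ = X -> _]eq_Rintegral do rewrite mul1r mul0r add0r.
Qed.

Lemma flow_invariant t (A : set (borel_sobolev0 s)) : measurable A -> Q (S t @^-1` A) = Q A.
Proof.
move=> mA; have [S0 SD _ _ _] := hS; have [t0|t0|->] := ltgtP t 0; [|exact: inv_pos|].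
  have mB : measurable (S t @^-1` A : set (borel_sobolev0 s)).
    by rewrite -[X in measurable X]setTI; exact: (cont_meas_self (@St_cont t)).
  have nt : 0 < - t by rewrite oppr_gt0.
  rewrite -(inv_pos nt mB); congr (Q _); apply/seteqP.
  by split => u; rewrite /= -SD subrr S0.
by congr (Q _); apply/seteqP; split => u; rewrite /= S0.
Qed.

End invariance.

Theorem theorem1p4 (R : realType) (s : R) (hs1 : -1 <= s) (hs2 : s < - 2^-1)
    (Q : probability (borel_sobolev0 s) R) (hQ : is_white_noise Q)
    (S : R -> sobolev0 s -> sobolev0 s) (hS : is_kdv_flow S) (t : R) :
  forall A : set (borel_sobolev0 s), measurable A ->
    pushforward Q (S t : borel_sobolev0 s -> borel_sobolev0 s) A = Q A.
Proof. by move=> A mA; exact: (flow_invariant hQ hS t mA). Qed.
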